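(* Let $M\in[1,\infty[$, $h\in\mathbb Z$, $k\in\mathbb Z_+$ with $(h,k)=1$. Let $\delta\in\,]0,1/2[$ and assume $k\ll M^{1/2-\delta}$. Then \[\sum_{n\leqslant M}t(n)\,e\!\left(\frac{nh}k\right)\ll_\delta k^{2/3}\,M^{1/3+\vartheta/3+\varepsilon}.\] When $M^{3/(5+6\vartheta)-1/2+\vartheta}\ll k\ll M^{5/18+\vartheta/3}$, we have \[\sum_{n\leqslant M}t(n)\,e\!\left(\frac{nh}k\right)\ll k^{(1-6\vartheta)/(4-6\vartheta)}\,M^{3/(8-12\vartheta)+\varepsilon}.\] For $M^{5/18+\vartheta/3}\ll k\ll M^{1/2-\varepsilon}$, we have \[\sum_{n\leqslant M}t(n)\,e\!\left(\frac{nh}k\right)\ll k^{2/3}\,M^{7/27+\vartheta/9+\varepsilon}.\]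
   Context: Let $\psi$ be a fixed Maass cusp form for the full modular group $\mathrm{SL}_2(\mathbb Z)$, with eigenvalue $1/4+\kappa^2$ of the hyperbolic Laplacian and Fourier expansion $\psi(x+yi)=y^{1/2}\sum_{n\neq0}t(n)K_{i\kappa}(2\pi|n|y)e(nx)$; $\psi$ is assumed even or odd. Here $e(x)=e^{2\pi ix}$. The number $\vartheta\in[0,\infty[$ is a fixed exponent such that $t(n)\ll n^{\vartheta+\varepsilon}$ for every $\varepsilon>0$. $\varepsilon$ denotes an arbitrarily small fixed positive number; implicit constants may depend on $\psi$, $\vartheta$ and $\varepsilon$. *)

(* Defs.v *)
(* Stdlib's real numbers with Coquelicot. *)
From Stdlib Require Import Reals ZArith.
From Coquelicot Require Import Coquelicot.
Open Scope R_scope.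

(* A function on the upper half-plane is a total function [C -> C] of which
   only the values at points [(x, y) = x + y i] with [0 < y] matter. *)

Definition re_part (psi : C -> C) (x y : R) : R := Re (psi (x, y)).
Definition im_part (psi : C -> C) (x y : R) : R := Im (psi (x, y)).

Definition hyp_laplacian (f : R -> R -> R) (x y : R) : R :=
  - y ^ 2 * (Derive_n (fun u => f u y) 2 x + Derive_n (fun v => f x v) 2 y).

Definition smooth_on_H (f : R -> R -> R) : Prop :=
  forall (n : nat) (x y : R), 0 < y -> ex_diff_n f n x y.

(* [kappa] is real: every nonzero cusp form for the full modular group has
   eigenvalue greater than 1/4. *)
Record maass_cusp_form (kappa : R) (psi : C -> C) : Prop := {
  mcf_smooth : smooth_on_H (re_part psi) /\ smooth_on_H (im_part psi);
  mcf_nonzero : exists z : C, 0 < Im z /\ psi z <> RtoC 0;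
  mcf_modular : forall (a b c d : Z) (z : C),
    (a * d - b * c = 1)%Z -> 0 < Im z ->
    psi ((RtoC (IZR a) * z + RtoC (IZR b)) /
         (RtoC (IZR c) * z + RtoC (IZR d)))%C = psi z;
  mcf_eigen : forall x y : R, 0 < y ->
    hyp_laplacian (re_part psi) x y = (1 / 4 + kappa ^ 2) * re_part psi x y /\
    hyp_laplacian (im_part psi) x y = (1 / 4 + kappa ^ 2) * im_part psi x y;
  mcf_moderate_growth : exists (N : nat) (B : R), forall x y : R, 1 <= y ->
    Cmod (psi (x, y)) <= B * y ^ N;
  mcf_cuspidal : forall y : R, 0 < y ->
    is_RInt (V := C_R_NormedModule) (fun x => psi (x, y)) 0 1 (RtoC 0)
}.

Definition even_form (psi : C -> C) : Prop :=
  forall x y : R, 0 < y -> psi (- x, y) = psi (x, y).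
Definition odd_form (psi : C -> C) : Prop :=
  forall x y : R, 0 < y -> psi (- x, y) = (- psi (x, y))%C.

(* K_{i kappa}(y) for y > 0, from
   K_nu(y) = int_0^oo exp (- y cosh u) cosh (nu u) du  at  nu = i kappa. *)
Definition besselK_i (kappa y : R) : R :=
  RInt_gen (fun u : R => exp (- y * cosh u) * cos (kappa * u))
    (at_point 0) (Rbar_locally p_infty).

(* e(x) = exp (2 pi i x) *)
Definition e (x : R) : C := (cos (2 * PI * x), sin (2 * PI * x)).

(* l = sum of a(n) over the nonzero integers n, the positive and the negative
   part converging separately. *)
Definition is_sum_nonzero (a : Z -> C) (l : C) : Prop :=
  exists lp ln : C,
    is_series (V := C_R_NormedModule) (fun j => a (Z.of_nat (S j))) lp /\
    is_series (V := C_R_NormedModule) (fun j => a (- Z.of_nat (S j))%Z) ln /\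
    l = (lp + ln)%C.

Definition fourier_expansion (kappa : R) (psi : C -> C) (t : Z -> C) : Prop :=
  forall x y : R, 0 < y ->
    is_sum_nonzero
      (fun n => RtoC (sqrt y) * t n
                * RtoC (besselK_i kappa (2 * PI * Rabs (IZR n) * y))
                * e (IZR n * x))%C
      (psi (x, y)).

(* t(n) << n^(theta + eps), n >= 1, for every eps > 0 *)
Definition coeff_exponent (t : Z -> C) (theta : R) : Prop :=
  forall eps : R, 0 < eps -> exists B : R, forall n : Z, (1 <= n)%Z ->
    Cmod (t n) <= B * Rpower (IZR n) (theta + eps).

(* The sum of t(n) e(n h / k) over the integers 1 <= n <= M;
   [Int_part] is the floor function. *)
Definition twisted_sum (t : Z -> C) (M : R) (h k : Z) : C :=
  sum_n_m (G := C_AbelianMonoid)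
    (fun n : nat => t (Z.of_nat n) * e (INR n * IZR h / IZR k))%C
    1 (Z.to_nat (Int_part M)).

(* Main.v *)
(* Fourier inversion writes a block [sqrt y * sum t(n) K(2 pi n y) e(n h/k)], n in (N/2, N] and
   y = c/N, as the integral of psi(x + iy) against a Dirichlet kernel centred at h/k; the weights
   are then removed by partial summation. So one needs bounds for the integrals of
   psi(h/k + u + iy) e(mu u) over arcs. The modular map sending h/k to infinity, the Fourier
   expansion and van der Corput's second derivative test give k U^(3/2) on u ~ U. For U <= 1/k^2 the
   image arc is cut into Farey arcs, each moved by its own modular map, and Cauchy-Schwarz with
   Bessel's inequality reduces the square of the integral to correlations of pairs of arcs, which are
   small by van der Corput again; this gives U k^(1/4) y^(1/8). Summing over all Farey arcs of the
   circle yields [theorem_W]: the sum is << k^(1/4) M^(3/8), which contains the last two bounds.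
   For the first one [theorem_V] averages the block over H = k^(2/3) N^(1/3 - 2 theta/3) shifts, which
   squares the decay of the kernel, and uses only the first arc bound. *)

Require Import Defs.
From Stdlib Require Import Reals ZArith Lra Lia Psatz List Classical Znumtheory FinFun.
From Coquelicot Require Import Coquelicot.
Open Scope R_scope.

(** In terms of X = 1/(k^2 U) the bound k U^(3/2) is U / sqrt X, which saves nothing for U near
    1/k^2. The target U k^(1/4) y^(1/8) is U / (s sqrt X) with s^8 = 1/(k^2 y X^4); this fixes s,
    and the Farey order is about s. The obstacle is that n enters the phases of the moved arcs
    nonlinearly. With the real part t of the image point as variable the phase is n t plus a term
    free of n, so the integrals become Fourier coefficients of one function on the circle. The size
    of a correlation is governed by the integer [cc], which separates two image cusps, and pairs
    with a given [cc] are counted by congruences. The weights have size N^(-1/2) when y is near 1/N,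
    so y^(1/8) turns into N^(3/8). For theta = 0 this is the second bound itself; otherwise powers
    of k are traded for powers of M. In the first bound, the plain kernel 1/u against k u^(3/2) is
    dominated by arcs of length about 1 and gains nothing in N; hence the averaging, whose H
    balances k / sqrt H against H N^(theta - 1/2). *)

Definition is_cint (f : R -> C) (a b : R) (l : C) : Prop :=
  is_RInt (fun x => fst (f x)) a b (fst l) /\
  is_RInt (fun x => snd (f x)) a b (snd l).

Definition cint (f : R -> C) (a b : R) : C :=
  (RInt (fun x => fst (f x)) a b, RInt (fun x => snd (f x)) a b).

Definition ccont (f : R -> C) (x : R) : Prop :=
  continuous (fun t => fst (f t)) x /\ continuous (fun t => snd (f t)) x.

Definition is_cderive (f : R -> C) (x : R) (l : C) : Prop :=
  is_derive (fun t => fst (f t)) x (fst l) /\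
  is_derive (fun t => snd (f t)) x (snd l).

Lemma ccont_plus f g x : ccont f x -> ccont g x -> ccont (fun t => (f t + g t)%C) x.
Proof.
 intros [H1 H2] [H3 H4]; split; simpl; [apply (continuous_plus (fun t => fst (f t)) (fun t => fst (g t))) |apply (continuous_plus (fun t => snd (f t)) (fun t => snd (g t)))]; assumption.
Qed.

Lemma ccont_mult f g x : ccont f x -> ccont g x -> ccont (fun t => (f t * g t)%C) x.
Proof.
 intros [H1 H2] [H3 H4]; split; simpl.
 - apply (continuous_minus (fun t => fst (f t) * fst (g t)) (fun t => snd (f t) * snd (g t))); [apply (continuous_mult (fun t => fst (f t)) (fun t => fst (g t))) |apply (continuous_mult (fun t => snd (f t)) (fun t => snd (g t)))]; assumption.
 - apply (continuous_plus (fun t => fst (f t) * snd (g t)) (fun t => snd (f t) * fst (g t))); [apply (continuous_mult (fun t => fst (f t)) (fun t => snd (g t))) |apply (continuous_mult (fun t => snd (f t)) (fun t => fst (g t)))]; assumption.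
Qed.

Lemma ccont_const c x : ccont (fun _ => c) x.
Proof. split; apply continuous_const. Qed.

Lemma ccont_conj f x : ccont f x -> ccont (fun t => Cconj (f t)) x.
Proof. intros [H1 H2]; split; simpl; [assumption|]. apply (continuous_opp (fun t => snd (f t))); assumption. Qed.

Lemma ccont_R f x : continuous f x -> ccont (fun t => RtoC (f t)) x.
Proof. intros H; split; simpl; [exact H|apply continuous_const]. Qed.

Lemma ccont_e f x : continuous f x -> ccont (fun t => e (f t)) x.
Proof.
 intros H; split; unfold e; simpl.
 - apply (continuous_comp (fun t => 2 * PI * f t) cos).
  + apply (continuous_mult (fun _ => 2 * PI) f); [apply continuous_const|assumption].
  + apply continuous_cos.
 - apply (continuous_comp (fun t => 2 * PI * f t) sin).
  + apply (continuous_mult (fun _ => 2 * PI) f); [apply continuous_const|assumption].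
  + apply continuous_sin.
Qed.

Lemma ccont_comp (f : R -> C) (g : R -> R) x :
  continuous g x -> ccont f (g x) -> ccont (fun t => f (g t)) x.
Proof.
 intros H [H1 H2]; split; [apply (continuous_comp g (fun t => fst (f t))) |apply (continuous_comp g (fun t => snd (f t)))]; assumption.
Qed.

Lemma ccont_ext f g x : (forall t, f t = g t) -> ccont f x -> ccont g x.
Proof.
 intros E [H1 H2]; split; [apply continuous_ext with (2 := H1)|apply continuous_ext with (2 := H2)]; intros; rewrite E; reflexivity.
Qed.

Lemma is_cderive_ccont f x l : is_cderive f x l -> ccont f x.
Proof.
 intros [H1 H2]; split; [apply (ex_derive_continuous (fun t => fst (f t))); exists (fst l) |apply (ex_derive_continuous (fun t => snd (f t))); exists (snd l)]; assumption.
Qed.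

(** * Real powers, and tactics for side conditions *)

Lemma Rpower_pos x a : 0 < Rpower x a.
Proof. apply exp_pos. Qed.

Lemma Rpower_base_le x y a : 0 < x -> x <= y -> 0 <= a -> Rpower x a <= Rpower y a.
Proof. intros; apply Rle_Rpower_l; lra. Qed.

Lemma Rpower_1_base a : Rpower 1 a = 1.
Proof. unfold Rpower. rewrite ln_1, Rmult_0_r, exp_0. reflexivity. Qed.

Lemma Rpower_ge_1 x a : 1 <= x -> 0 <= a -> 1 <= Rpower x a.
Proof. intros Hx Ha. apply Rle_trans with (Rpower 1 a); [rewrite Rpower_1_base; lra|apply Rpower_base_le; lra]. Qed.

Lemma derive_cont (f : R -> R) x l : is_derive f x l -> continuous f x.
Proof. intros H. apply (ex_derive_continuous f). exists l; exact H. Qed.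

(* [side] closes positivity, monotonicity and continuity side conditions; the notations below it call it. *)
Ltac pos := first [assumption | lazymatch goal with
  | |- 0 < _ * _ => apply Rmult_lt_0_compat; pos
  | |- 0 <= _ ^ 2 => apply pow2_ge_0
  | |- 0 <= _ * _ => apply Rmult_le_pos; pos
  | |- 0 < _ / _ => apply Rdiv_lt_0_compat; pos
  | |- 0 <= _ / _ => apply Rdiv_le_0_compat; pos
  | |- 0 < / _ => apply Rinv_0_lt_compat; pos
  | |- 0 <= / _ => left; apply Rinv_0_lt_compat; pos
  | |- 0 < Rpower _ _ => apply Rpower_pos
  | |- 0 <= Rpower _ _ => left; apply Rpower_pos
  | |- 0 < sqrt _ => apply sqrt_lt_R0; pos
  | |- 0 <= sqrt _ => apply sqrt_pos
  | |- 0 <= Cmod _ => apply Cmod_ge_0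
  | |- 0 <= Rabs _ => apply Rabs_pos
  | |- 0 < exp _ => apply exp_pos
  | |- 0 < _ ^ _ => apply pow_lt; pos
  | |- 0 <= _ ^ _ => apply pow_le; pos
  | |- 0 <= INR _ => apply pos_INR
  | |- 0 < _ + _ => first [apply Rplus_lt_0_compat; pos | apply Rplus_lt_le_0_compat; pos | apply Rplus_le_lt_0_compat; pos]
  | |- 0 <= _ + _ => apply Rplus_le_le_0_compat; pos
  | |- 0 < PI => apply PI_RGT_0
  | |- 0 <= PI => left; apply PI_RGT_0
  | |- IZR _ < IZR _ => apply IZR_lt; lia
  | |- IZR _ <= IZR _ => apply IZR_le; lia
  | |- _ <> 0 => apply Rgt_not_eq; pos
  | |- _ > 0 => apply Rlt_gt; pos
  end | lra].

Ltac mono := first [assumption | lra | lazymatch goal with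
  | |- ?x <= ?x => apply Rle_refl
  | |- ?a * ?b <= ?a * ?c => apply Rmult_le_compat_l; [pos | mono]
  | |- ?a * ?b <= ?c * ?b => apply Rmult_le_compat_r; [pos | mono]
  | |- _ * _ <= _ * _ => apply Rmult_le_compat; [pos | pos | mono | mono]
  | |- _ + _ <= _ + _ => apply Rplus_le_compat; mono
  | |- / _ <= / _ => apply Rinv_le_contravar; [pos | mono]
  | |- sqrt _ <= sqrt _ => apply sqrt_le_1_alt; mono
  | |- Rpower ?x _ <= Rpower ?x _ => apply Rle_Rpower; lra
  | |- Rpower _ ?a <= Rpower _ ?a => apply Rpower_base_le; [pos | mono | lra]
  | |- _ ^ ?n <= _ ^ ?n => apply pow_incr; split; mono
  | |- 1 <= _ ^ _ => apply pow_R1_Rle; mono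
  | |- 1 <= _ * _ => apply (Rle_trans _ (1 * 1)); [lra | apply Rmult_le_compat; mono]
  | |- Rabs _ <= _ => apply Rabs_le; split; mono
  | |- 1 <= Rpower _ _ => apply Rpower_ge_1; lra
  | |- IZR _ <= IZR _ => apply IZR_le; lia
  | |- INR _ <= INR _ => apply le_INR; lia
  | |- _ / _ <= _ => apply Rle_div_l; [pos | mono]
  | |- _ <= _ / _ => apply Rle_div_r; [pos | mono]
  | |- 0 <= _ => pos
  end].

Ltac cont := first [assumption | lazymatch goal with
  | |- continuous (fun _ => ?c) _ => apply continuous_const
  | |- continuous (fun x => x) _ => apply continuous_id
  | |- continuous (fun x => @?f x * @?g x) _ => apply (continuous_mult f g); cont
  | |- continuous (fun x => @?f x + @?g x) _ => apply (continuous_plus f g); cont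
  | |- continuous (fun x => @?f x - @?g x) _ => apply (continuous_minus f g); cont
  | |- continuous (fun x => - @?f x) _ => apply (continuous_opp f); cont
  | |- continuous (fun x => @?f x / @?g x) _ => apply (continuous_mult f (fun x => / g x)); cont
  | |- continuous (fun x => / @?f x) _ => apply (continuous_comp f Rinv); [cont | apply continuous_Rinv; pos]
  | |- continuous (fun x => @?f x ^ _) _ => apply (ex_derive_continuous (fun x => f x ^ _)); auto_derive; side
  | |- continuous (fun x => cos (@?f x)) _ => apply (continuous_comp f cos); [cont | apply continuous_cos]
  | |- continuous (fun x => sin (@?f x)) _ => apply (continuous_comp f sin); [cont | apply continuous_sin]
  | |- continuous (fun x => sqrt (@?f x)) _ => apply (continuous_comp f sqrt); [cont | apply continuous_sqrt]
  | |- ccont (fun _ => ?c) _ => apply ccont_const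
  | |- ccont (fun x => Cmult (@?f x) (@?g x)) _ => apply (ccont_mult f g); cont
  | |- ccont (fun x => Cplus (@?f x) (@?g x)) _ => apply (ccont_plus f g); cont
  | |- ccont (fun x => RtoC (@?f x)) _ => apply (ccont_R f); cont
  | |- ccont (fun x => e (@?f x)) _ => apply (ccont_e f); cont
  | _ => solve [auto]
  end | solve [apply ex_derive_continuous; auto_derive; side] | solve [eauto]]
with side := first [assumption | lra | lia | lazymatch goal with
  | |- continuous _ _ => cont
  | |- ccont _ _ => cont
  | |- True => exact I
  | |- _ /\ _ => split; side
  | |- sqrt _ * sqrt _ = _ => apply sqrt_sqrt; side
  | |- _ = _ => first [reflexivity | ring | field; side]
  | |- IZR _ < IZR _ => apply IZR_lt; lia
  | |- INR _ < INR _ => apply lt_INR; lia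
  | |- 0 < INR _ => apply lt_0_INR; lia
  | |- _ <= _ => first [mono | solve [right; ring] | solve [right; field; side]]
  | |- _ => pos
  end | nra | solve [progress intros; side] | solve [eauto 3]
  | match goal with x := _ |- context [?y] => constr_eq x y; unfold x; side end].

Tactic Notation "have" ident(H) ":" lconstr(P) := assert (H : P) by side.
Tactic Notation "have" ":" lconstr(P) := assert P by side.
Tactic Notation "note" constr(x) := pose proof x.
Tactic Notation "note" constr(x) "as" simple_intropattern(p) := pose proof x as p.
Tactic Notation "via" constr(x) := apply Rle_trans with x.
Tactic Notation "upto" uconstr(x) := eapply Rle_trans; [apply x |].
Ltac mul_l := apply Rmult_le_compat_l; [side |].
Ltac mul_r := apply Rmult_le_compat_r; [side |].
Tactic Notation "cancel_r" constr(x) := apply Rmult_le_reg_r with x; [side |].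
Ltac div_cancel := unfold Rdiv; rewrite Rmult_assoc, Rinv_l by side.
Ltac minmax := rewrite Rmin_left, Rmax_right by side.
Notation "'!!'" := ltac:(side) (only parsing).
Ltac derive_eq K :=
  lazymatch goal with |- is_derive _ _ ?v => lazymatch type of K with is_derive _ _ ?u => replace v with u end end.

(** * Complex-valued integrals *)

Lemma cint_spec f a b :
  (forall x, Rmin a b <= x <= Rmax a b -> ccont f x) -> is_cint f a b (cint f a b).
Proof.
 intros H; split; [apply (RInt_correct (fun x => fst (f x)))|apply (RInt_correct (fun x => snd (f x)))]; apply ex_RInt_continuous; intros; apply H; assumption.
Qed.

Lemma cint_ok f a b : a <= b ->
  (forall x, a <= x <= b -> ccont f x) -> is_cint f a b (cint f a b).
Proof. intros Hab H; apply cint_spec; minmax; assumption. Qed.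

Lemma cint_eq f a b l : is_cint f a b l -> cint f a b = l.
Proof.
 intros [H1 H2]; unfold cint. rewrite (is_RInt_unique _ _ _ _ H1), (is_RInt_unique _ _ _ _ H2). destruct l; reflexivity.
Qed.

Lemma is_cint_ext f g a b l :
  (forall x, Rmin a b < x < Rmax a b -> f x = g x) -> is_cint f a b l -> is_cint g a b l.
Proof.
 intros E [H1 H2]; split; [apply is_RInt_ext with (2 := H1)|apply is_RInt_ext with (2 := H2)]; intros; rewrite E; trivial.
Qed.

Lemma is_cint_ext_le f g a b l : a <= b ->
  (forall x, a < x < b -> f x = g x) -> is_cint f a b l -> is_cint g a b l.
Proof. intros Hab H; apply is_cint_ext; minmax; assumption. Qed.

Lemma is_cint_plus f g a b lf lg :
  is_cint f a b lf -> is_cint g a b lg -> is_cint (fun x => (f x + g x)%C) a b (lf + lg)%C.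
Proof.
 intros [H1 H2] [H3 H4]; split; simpl; [apply (is_RInt_plus (fun x => fst (f x)) (fun x => fst (g x))) |apply (is_RInt_plus (fun x => snd (f x)) (fun x => snd (g x)))]; assumption.
Qed.

Lemma is_cint_scal f a b l c : is_cint f a b l -> is_cint (fun x => (c * f x)%C) a b (c * l)%C.
Proof.
 intros [H1 H2]; split; simpl.
 - apply (is_RInt_minus (fun x => fst c * fst (f x)) (fun x => snd c * snd (f x))); [apply (is_RInt_scal (fun x => fst (f x)) a b (fst c)) |apply (is_RInt_scal (fun x => snd (f x)) a b (snd c))]; assumption.
 - apply (is_RInt_plus (fun x => fst c * snd (f x)) (fun x => snd c * fst (f x))); [apply (is_RInt_scal (fun x => snd (f x)) a b (fst c)) |apply (is_RInt_scal (fun x => fst (f x)) a b (snd c))]; assumption.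
Qed.

Lemma is_cint_minus f g a b lf lg :
  is_cint f a b lf -> is_cint g a b lg -> is_cint (fun x => (f x - g x)%C) a b (lf - lg)%C.
Proof.
 intros [H1 H2] [H3 H4]; split; simpl; [apply (is_RInt_minus (fun x => fst (f x)) (fun x => fst (g x))) |apply (is_RInt_minus (fun x => snd (f x)) (fun x => snd (g x)))]; assumption.
Qed.

Lemma is_cint_conj f a b l : is_cint f a b l -> is_cint (fun x => Cconj (f x)) a b (Cconj l).
Proof. intros [H1 H2]; split; simpl; [side|]. apply (is_RInt_opp (fun x => snd (f x))); assumption. Qed.

Lemma is_cint_Chasles f a b c l1 l2 :
  is_cint f a b l1 -> is_cint f b c l2 -> is_cint f a c (l1 + l2)%C.
Proof.
 intros [H1 H2] [H3 H4]; split; simpl; [apply (is_RInt_Chasles (fun x => fst (f x)) a b c) |apply (is_RInt_Chasles (fun x => snd (f x)) a b c)]; assumption.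
Qed.

Lemma is_cint_point f a : is_cint f a a (RtoC 0).
Proof.
 split; simpl; [apply (is_RInt_point (V := R_NormedModule) (fun x => fst (f x)) a) |apply (is_RInt_point (V := R_NormedModule) (fun x => snd (f x)) a)].
Qed.

Lemma is_cint_0 a b : is_cint (fun _ => RtoC 0) a b (RtoC 0).
Proof.
 assert (K : is_RInt (fun _ : R => 0) a b 0).
 { note (is_RInt_const (V := R_NormedModule) a b 0) as K.
  replace (scal (b - a) (0 : R_NormedModule)) with (0 : R) in K by (unfold scal; simpl; unfold mult; simpl; ring). side. }
 split; exact K.
Qed.

(** |l|^2 is the integral of the real inner product of l with f, which is at most |l| g pointwise by
    Cauchy-Schwarz in the plane; dividing by |l| finishes. No argument of l has to be chosen. *)
Lemma is_cint_bound f g a b l lg : a <= b ->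
  (forall x, a < x < b -> Cmod (f x) <= g x) ->
  is_cint f a b l -> is_RInt g a b lg -> Cmod l <= lg.
Proof.
 intros Hab Hf [H1 H2] Hg. assert (Hc : (Cmod l) ^ 2 <= Cmod l * lg).
 { rewrite Cmod2_alt.
  assert (K1 : is_RInt (fun x => fst l * fst (f x) + snd l * snd (f x)) a b (fst l * fst l + snd l * snd l)).
  { apply (is_RInt_plus (fun x => fst l * fst (f x)) (fun x => snd l * snd (f x))); [apply (is_RInt_scal (fun x => fst (f x)) a b (fst l)) |apply (is_RInt_scal (fun x => snd (f x)) a b (snd l))]; assumption. }
  assert (K2 : is_RInt (fun x => Cmod l * g x) a b (Cmod l * lg)) by (apply (is_RInt_scal g a b (Cmod l)); assumption).
  unfold Re, Im. replace (fst l ^ 2 + snd l ^ 2) with (fst l * fst l + snd l * snd l) by ring.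
  apply (is_RInt_le _ _ _ _ _ _ Hab K1 K2). intros x Hx. specialize (Hf x Hx). via (Cmod l * Cmod (f x)). 2: { side. }
  unfold Cmod. rewrite <- sqrt_mult by nra. apply Rsqr_incr_0_var; [|side]. rewrite Rsqr_sqrt by nra. unfold Rsqr.
  note (pow2_ge_0 (fst l * snd (f x) - snd l * fst (f x))). nra. }
 destruct (Req_dec (Cmod l) 0) as [E|E].
 - rewrite E. assert (K0 : is_RInt (fun _ => 0) a b 0). { note (is_cint_0 a b) as [K _]. side. }
  apply (is_RInt_le _ _ _ _ _ _ Hab K0 Hg). intros x Hx. apply Rle_trans with (2 := Hf x Hx). side.
 - note (Cmod_ge_0 l). nra.
Qed.

Lemma cint_bound f a b l M : a <= b ->
  (forall x, a < x < b -> Cmod (f x) <= M) -> is_cint f a b l -> Cmod l <= (b - a) * M.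
Proof.
 intros Hab Hf H. apply (is_cint_bound f (fun _ => M) a b l ((b - a) * M) Hab Hf H).
 apply (is_RInt_const (V := R_NormedModule)).
Qed.

Lemma is_cint_derive f df a b :
  (forall x, Rmin a b <= x <= Rmax a b -> is_cderive f x (df x)) ->
  (forall x, Rmin a b <= x <= Rmax a b -> ccont df x) ->
  is_cint df a b (f b - f a)%C.
Proof.
 intros H1 H2; split; simpl; [apply (is_RInt_derive (fun x => fst (f x)) (fun x => fst (df x))) |apply (is_RInt_derive (fun x => snd (f x)) (fun x => snd (df x)))]; intros; try (apply H1; assumption); apply H2; assumption.
Qed.

Lemma is_cint_comp f (g dg : R -> R) a b :
  (forall x, Rmin a b <= x <= Rmax a b -> ccont f (g x)) ->
  (forall x, Rmin a b <= x <= Rmax a b -> is_derive g x (dg x) /\ continuous dg x) ->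
  is_cint (fun y => (RtoC (dg y) * f (g y))%C) a b (cint f (g a) (g b)).
Proof.
 intros H1 H2. assert (K1 := is_RInt_comp (fun x => fst (f x)) g dg a b (fun x Hx => proj1 (H1 x Hx)) H2).
 assert (K2 := is_RInt_comp (fun x => snd (f x)) g dg a b (fun x Hx => proj2 (H1 x Hx)) H2). split; simpl.
 - eapply is_RInt_ext; [|exact K1]. intros; simpl. unfold scal; simpl; unfold mult; simpl. ring.
 - eapply is_RInt_ext; [|exact K2]. intros; simpl. unfold scal; simpl; unfold mult; simpl. ring.
Qed.

Lemma is_cderive_mult f g x df dg :
  is_cderive f x df -> is_cderive g x dg ->
  is_cderive (fun t => (f t * g t)%C) x (df * g x + f x * dg)%C.
Proof.
 intros [H1 H2] [H3 H4]. note (is_derive_mult _ _ _ _ _ H1 H3 Rmult_comm) as A1.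
 note (is_derive_mult _ _ _ _ _ H2 H4 Rmult_comm) as A2. note (is_derive_mult _ _ _ _ _ H1 H4 Rmult_comm) as A3.
 note (is_derive_mult _ _ _ _ _ H2 H3 Rmult_comm) as A4. unfold plus, mult in *; simpl in *. split; simpl.
 - note (is_derive_minus _ _ _ _ _ A1 A2) as B. unfold minus, plus, opp in B; simpl in B.
  match goal with |- is_derive _ _ ?v => match type of B with is_derive _ _ ?w => replace v with w by ring end end.
  side.
 - note (is_derive_plus _ _ _ _ _ A3 A4) as B. unfold plus in B; simpl in B.
  match goal with |- is_derive _ _ ?v => match type of B with is_derive _ _ ?w => replace v with w by ring end end.
  side.
Qed.

Lemma is_cderive_R f x df : is_derive f x df -> is_cderive (fun t => RtoC (f t)) x (RtoC df).
Proof. intros H; split; simpl; [side|]. apply is_derive_Reals. apply derivable_pt_lim_const. Qed.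

Lemma is_cderive_e f x df : is_derive f x df ->
  is_cderive (fun t => e (f t)) x (RtoC (2 * PI * df) * Ci * e (f x))%C.
Proof.
 intros H. assert (Hx : ex_derive f x) by (exists df; exact H).
 split; unfold e; simpl; auto_derive; trivial; rewrite (is_derive_unique (fun t : R => f t) x df H); ring.
Qed.

Lemma is_cint_parts f g df dg a b :
  (forall x, Rmin a b <= x <= Rmax a b -> is_cderive f x (df x)) ->
  (forall x, Rmin a b <= x <= Rmax a b -> is_cderive g x (dg x)) ->
  (forall x, Rmin a b <= x <= Rmax a b -> ccont df x) ->
  (forall x, Rmin a b <= x <= Rmax a b -> ccont dg x) ->
  is_cint (fun x => (f x * dg x)%C) a b
    (f b * g b - f a * g a - cint (fun x => (df x * g x)%C) a b)%C.
Proof.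
 intros H1 H2 H3 H4. assert (K : is_cint (fun x => (df x * g x + f x * dg x)%C) a b (f b * g b - f a * g a)%C).
 { apply (is_cint_derive (fun x => (f x * g x)%C)).
  - intros; apply is_cderive_mult; auto.
  - intros; apply ccont_plus; apply ccont_mult; auto; eapply is_cderive_ccont; auto. }
 assert (K2 : is_cint (fun x => (df x * g x)%C) a b (cint (fun x => (df x * g x)%C) a b)).
 { apply cint_spec. intros; apply ccont_mult; auto; eapply is_cderive_ccont; auto. }
 eapply is_cint_ext; [|exact (is_cint_minus _ _ _ _ _ _ K K2)]. intros; simpl. ring.
Qed.

Lemma Cmod_e x : Cmod (e x) = 1.
Proof.
 unfold e, Cmod; simpl. rewrite !Rmult_1_r.
 replace (cos (2 * PI * x) * cos (2 * PI * x) + sin (2 * PI * x) * sin (2 * PI * x)) with 1.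
 - apply sqrt_1.
 - note (sin2_cos2 (2 * PI * x)). unfold Rsqr in H. lra.
Qed.

Lemma e_plus x y : e (x + y) = (e x * e y)%C.
Proof. unfold e, Cmult; simpl. rewrite Rmult_plus_distr_l, cos_plus, sin_plus. f_equal; ring. Qed.

Lemma e_conj x : Cconj (e x) = e (- x).
Proof.
 unfold e, Cconj; simpl. replace (2 * PI * - x) with (- (2 * PI * x)) by ring. rewrite cos_neg, sin_neg. side.
Qed.

Lemma e_0 : e 0 = RtoC 1.
Proof. unfold e. rewrite Rmult_0_r, cos_0, sin_0. side. Qed.

Lemma e_Z n : e (IZR n) = RtoC 1.
Proof.
 assert (P : forall m : nat, e (INR m) = RtoC 1).
 { induction m.
  - apply e_0.
  - rewrite S_INR, e_plus, IHm. unfold e. rewrite Rmult_1_r, cos_2PI, sin_2PI. unfold Cmult, RtoC; simpl. f_equal; ring. }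
 destruct (Z_le_gt_dec 0 n) as [H|H].
 - rewrite <- (Z2Nat.id n) by assumption. rewrite <- INR_IZR_INZ. side.
 - replace (IZR n) with (- IZR (- n)) by (rewrite opp_IZR; ring). rewrite <- e_conj. rewrite <- (Z2Nat.id (- n)) by lia.
  rewrite <- INR_IZR_INZ, P. unfold Cconj, RtoC; simpl; f_equal; ring.
Qed.

Lemma e_add_Z x n : e (x + IZR n) = e x.
Proof. rewrite e_plus, e_Z. ring. Qed.

(** * Van der Corput's estimates *)

Lemma Rabs_sign s x : s = 1 \/ s = -1 -> 0 <= s * x -> Rabs x = s * x.
Proof.
 intros [E|E] H; subst s.
 - rewrite Rabs_pos_eq; lra.
 - rewrite Rabs_left1; lra.
Qed.

Lemma Cmod_R x : Cmod (RtoC x) = Rabs x.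
Proof. apply Cmod_R. Qed.

(** First derivative test. The derivative of the phase is factored as [rho] times [kap] and the
    amplitude as [rho] times [sig], so that only [sig] and [kap] have to be monotone; [s1] and [s2]
    record the directions, [s3] the sign of [kap]. The quotient sig / kap is integrated by parts
    against rho kap e(Phi). Boundary terms and variation together give 4 S / (2 pi d), and 2 pi >=
    4. *)
Lemma vdc_first (Phi rho sig dsig kap dkap : R -> R) a b S d s1 s2 s3 :
  a <= b -> 0 < d -> 0 <= S ->
  s1 = 1 \/ s1 = -1 -> s2 = 1 \/ s2 = -1 -> s3 = 1 \/ s3 = -1 ->
  (forall t, a <= t <= b -> is_derive Phi t (rho t * kap t)) ->
  (forall t, a <= t <= b -> is_derive sig t (dsig t)) ->
  (forall t, a <= t <= b -> is_derive kap t (dkap t)) ->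
  (forall t, a <= t <= b -> continuous rho t) ->
  (forall t, a <= t <= b -> continuous dsig t) ->
  (forall t, a <= t <= b -> continuous dkap t) ->
  (forall t, a <= t <= b -> 0 <= sig t <= S) ->
  (forall t, a <= t <= b -> 0 <= s1 * dsig t) ->
  (forall t, a <= t <= b -> 0 <= s2 * dkap t) ->
  (forall t, a <= t <= b -> d <= s3 * kap t) ->
  Cmod (cint (fun t => (RtoC (rho t * sig t) * e (Phi t))%C) a b) <= S / d.
Proof.
 intros Hab Hd HS E1 E2 E3 HP Hs Hk Cr Cs Ck Bs M1 M2 M3. assert (Hpi := PI_RGT_0).
 assert (Hk0 : forall t, a <= t <= b -> kap t <> 0). { intros t Ht Z. specialize (M3 t Ht). side. }
 assert (Ek : forall t, a <= t <= b -> d <= Rabs (kap t)).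
 { intros t Ht. rewrite (Rabs_sign s3); auto. specialize (M3 t Ht). lra. } set (w := fun t => sig t / kap t).
 set (dw := fun t => dsig t / kap t - sig t * dkap t / (kap t) ^ 2). set (c0 := (RtoC (/ (2 * PI)) * - Ci)%C).
 assert (CPhi : forall t, a <= t <= b -> continuous Phi t).
 { intros t Ht. apply (ex_derive_continuous Phi). eexists; apply HP; assumption. }
 assert (Ckap : forall t, a <= t <= b -> continuous kap t).
 { intros t Ht. apply (ex_derive_continuous kap). eexists; apply Hk; assumption. }
 assert (Csig : forall t, a <= t <= b -> continuous sig t).
 { intros t Ht. apply (ex_derive_continuous sig). eexists; apply Hs; assumption. }
 assert (Cik : forall t, a <= t <= b -> continuous (fun t => / kap t) t).
 { intros t Ht. apply continuous_comp; [side|]. apply continuous_Rinv. side. }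
 assert (Dw : forall t, a <= t <= b -> is_derive w t (dw t)).
 { intros t Ht. note (is_derive_div sig kap t _ _ (Hs t Ht) (Hk t Ht) (Hk0 t Ht)) as D. derive_eq D.
  - side.
  - side. }
 assert (Cdw : forall t, a <= t <= b -> continuous dw t).
 { intros t Ht. apply (continuous_minus (fun t => dsig t / kap t) (fun t => sig t * dkap t / kap t ^ 2)).
  - side.
  - apply (continuous_mult (fun t => sig t * dkap t) (fun t => / kap t ^ 2)).
   + side.
   + apply continuous_ext_loc with (fun t => / kap t * / kap t).
    * apply filter_forall. intros z. simpl. destruct (Req_dec (kap z) 0) as [E|E].
     { rewrite E. rewrite Rmult_0_l, Rinv_0. ring. } side.
    * side. }
 set (g := fun t => (c0 * e (Phi t))%C). set (dg := fun t => (RtoC (rho t * kap t) * e (Phi t))%C).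
 assert (Dg : forall t, a <= t <= b -> is_cderive g t (dg t)).
 { intros t Ht. unfold g, dg. assert (D0 : is_cderive (fun _ => c0) t (RtoC 0)).
  { split; simpl; apply is_derive_Reals; apply derivable_pt_lim_const. }
  note (is_cderive_mult (fun _ => c0) (fun t => e (Phi t)) t (RtoC 0) _ D0 (is_cderive_e Phi t _ (HP t Ht))) as D1.
  match goal with |- is_cderive _ _ ?v => match type of D1 with is_cderive _ _ ?u => replace v with u end end.
  - side.
  - unfold c0, Ci, Cmult, Cplus, Copp, RtoC; destruct (e (Phi t)) as [x y]; simpl. f_equal; field; lra. }
 have Cdg : forall t, a <= t <= b -> ccont dg t. assert (Rm : forall t, Rmin a b <= t <= Rmax a b -> a <= t <= b).
 { intros t. minmax. side. }
 assert (K : is_cint (fun x => (RtoC (w x) * dg x)%C) a b (RtoC (w b) * g b - RtoC (w a) * g a - cint (fun x => (RtoC (dw x) * g x)%C) a b)%C).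
 { apply (is_cint_parts (fun t => RtoC (w t)) g (fun t => RtoC (dw t)) dg).
  - intros; apply is_cderive_R; auto.
  - auto.
  - side.
  - auto. }
 rewrite (cint_eq _ _ _ (RtoC (w b) * g b - RtoC (w a) * g a - cint (fun x => (RtoC (dw x) * g x)%C) a b)%C).
 2: { eapply is_cint_ext_le; [side| |exact K]. intros x Hx. unfold dg, w. rewrite Cmult_assoc. f_equal.
  rewrite <- RtoC_mult. f_equal. field. apply Hk0. lra. }
 assert (Mg : forall t, Cmod (g t) = / (2 * PI)).
 { intros t. unfold g, c0. rewrite !Cmod_mult, Cmod_e, Cmod_opp, Cmod_Ci, Cmod_R. rewrite Rabs_pos_eq; [ring|]. side. }
 assert (Bw : forall t, a <= t <= b -> Rabs (w t) <= S / d).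
 { intros t Ht. unfold w, Rdiv. rewrite Rabs_mult, Rabs_inv. specialize (Bs t Ht). specialize (Ek t Ht). side. }
 (* [dG] majorizes |dw| because sig <= S and |kap| >= d; each of the two monotone terms of [G]
    increases by at most S / d, which bounds the variation of sig / kap. *)
 have HSd : 0 <= S / d. set (G := fun t => s1 * sig t / d - s2 * S / kap t).
 set (dG := fun t => s1 * dsig t / d + s2 * S * dkap t / (kap t) ^ 2).
 assert (DG : forall t, a <= t <= b -> is_derive G t (dG t)).
 { intros t Ht. unfold G, dG. assert (X1 : ex_derive sig t) by (eexists; apply Hs; assumption).
  assert (X2 : ex_derive kap t) by (eexists; apply Hk; assumption). auto_derive; [side|].
  rewrite (is_derive_unique (fun t : R => sig t) t _ (Hs t Ht)).
  rewrite (is_derive_unique (fun t : R => kap t) t _ (Hk t Ht)). side. }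
 assert (CdG : forall t, a <= t <= b -> continuous dG t).
 { intros t Ht. apply (continuous_plus (fun t => s1 * dsig t / d) (fun t => s2 * S * dkap t / kap t ^ 2)).
  - side.
  - apply (continuous_mult (fun t => s2 * S * dkap t) (fun t => / kap t ^ 2)).
   + side.
   + apply continuous_ext_loc with (fun t => / kap t * / kap t).
    * apply filter_forall. intros z. simpl. destruct (Req_dec (kap z) 0) as [E|E].
     { rewrite E. rewrite Rmult_0_l, Rinv_0. ring. } side.
    * side. }
 assert (IG : is_RInt dG a b (G b - G a)). { apply (is_RInt_derive G dG); intros; side; auto. }
 assert (Bi : Cmod (cint (fun x => (RtoC (dw x) * g x)%C) a b) <= / (2 * PI) * (G b - G a)).
 { apply (is_cint_bound (fun x => (RtoC (dw x) * g x)%C) (fun t => / (2 * PI) * dG t) a b); trivial.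
  - intros x Hx. have Hx' : a <= x <= b. rewrite Cmod_mult, Mg, Cmod_R, Rmult_comm. apply Rmult_le_compat_l. { side. }
   upto Rabs_triang. assert (Hkk : 0 < kap x ^ 2). { note (Hk0 x Hx'). side. } apply Rplus_le_compat.
   + unfold Rdiv. rewrite Rabs_mult, Rabs_inv, (Rabs_sign s1) by auto. apply Rmult_le_compat_l; auto.
    apply Rinv_le_contravar; auto.
   + rewrite Rabs_Ropp. unfold Rdiv. rewrite Rabs_mult, (Rabs_pos_eq (/ kap x ^ 2)) by side. mul_r.
    rewrite Rabs_mult, (Rabs_sign s2 (dkap x)) by auto. note (Bs x Hx'). rewrite Rabs_pos_eq by lra. note (M2 x Hx').
    nra.
  - apply cint_ok; auto. side.
  - apply (is_RInt_scal dG a b (/ (2 * PI))). side. }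
 assert (BG : G b - G a <= 2 * (S / d)).
 { unfold G. assert (s1 * sig b / d - s1 * sig a / d <= S / d).
  { replace (s1 * sig b / d - s1 * sig a / d) with (s1 * (sig b - sig a) / d) by side. mul_r. note (Bs a !!).
   note (Bs b !!). side. }
  assert (Ik : forall t, a <= t <= b -> 0 <= s3 * / kap t <= / d).
  { intros t Ht. specialize (M3 t Ht). replace (s3 * / kap t) with (/ (s3 * kap t)).
   2: { rewrite Rinv_mult. f_equal. destruct E3 as [E|E]; rewrite E; field. } side. }
  assert (- (s2 * S / kap b) + s2 * S / kap a <= S / d).
  { replace (- (s2 * S / kap b) + s2 * S / kap a) with (S * (s2 * (/ kap a - / kap b))) by side. mul_l. note (Ik a !!).
   note (Ik b !!). side. }
  lra. }
 upto Cmod_triangle. rewrite Cmod_opp. unfold Cminus at 1.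
 assert (B1 : Cmod (RtoC (w b) * g b + - (RtoC (w a) * g a))%C <= / (2 * PI) * (2 * (S / d))).
 { upto Cmod_triangle. rewrite Cmod_opp, !Cmod_mult, !Mg, !Cmod_R. note (Bw a !!). note (Bw b !!).
  have : 0 < / (2 * PI). nra. }
 assert (P2 : / (2 * PI) <= / 4). { apply Rinv_le_contravar; [lra|]. note PI2_1. side. }
 have P3 : / (2 * PI) * (G b - G a) <= / (2 * PI) * (2 * (S / d)). side.
Qed.

(** Since f grows at speed at least l, the set |f| < d lies within d / l of the zero of f, or of an
    end of [a, b] if f keeps its sign. The alternatives c1 = a and c2 = b stand for an outer
    interval that has shrunk to a point, where nothing is claimed about f. *)
Lemma increasing_split (f df : R -> R) a b l d :
  a <= b -> 0 < l -> 0 < d ->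
  (forall t, a <= t <= b -> is_derive f t (df t)) ->
  (forall t, a <= t <= b -> l <= df t) ->
  exists c1 c2, a <= c1 /\ c1 <= c2 /\ c2 <= b /\ c2 - c1 <= 2 * d / l /\
    (forall t, a <= t <= c1 -> c1 = a \/ f t <= - d) /\
    (forall t, c2 <= t <= b -> c2 = b \/ d <= f t).
Proof.
 intros Hab Hl Hd D L. assert (G : forall x y, a <= x -> x <= y -> y <= b -> l * (y - x) <= f y - f x).
 { intros x y Hx Hxy Hy. destruct (MVT_gen f x y df) as [c [Hc E]].
  - intros z. minmax. intros Hz. apply D; lra.
  - intros z. minmax. intros Hz. apply derivable_continuous_pt. exists (df z). apply is_derive_Reals. apply D; lra.
  - rewrite Rmin_left, Rmax_right in Hc by assumption. rewrite E. mul_r. apply L; lra. }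
 have Hq : 0 < d / l. have Eq : l * (d / l) = d. have Eq2 : 2 * d / l = 2 * (d / l).
 assert (Z : (0 <= f a) \/ (f b <= 0) \/ exists z, a <= z <= b /\ f z = 0).
 { destruct (Rle_dec 0 (f a)) as [H|H]; [side|right]. destruct (Rle_dec (f b) 0) as [H'|H']; [side|right].
  assert (a < b). { destruct Hab as [Hab|Hab]; [side|]. subst. lra. }
  destruct (Ranalysis5.IVT_interv f a b) as [z [Hz E]]; try lra.
  - intros z Hz. apply derivable_continuous_pt. exists (df z). apply is_derive_Reals. side.
  - side. }
 assert (Up : forall z, a <= z <= b -> 0 <= f z -> forall t, Rmin b (z + d / l) <= t <= b -> Rmin b (z + d / l) = b \/ d <= f t).
 { intros z Hz Hfz t Ht. unfold Rmin in *. destruct (Rle_dec b (z + d / l)) as [H|H]; [side|right].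
  note (G z t !! !! !!). side. }
 assert (Dn : forall z, a <= z <= b -> f z <= 0 -> forall t, a <= t <= Rmax a (z - d / l) -> Rmax a (z - d / l) = a \/ f t <= - d).
 { intros z Hz Hfz t Ht. unfold Rmax in *. destruct (Rle_dec a (z - d / l)) as [H|H]; [right|side].
  note (G t z !! !! !!). side. }
 destruct Z as [Z|[Z|[z [Hz Z]]]].
 - exists a, (Rmin b (a + d / l)). repeat split; try lra.
  + unfold Rmin; destruct (Rle_dec b (a + d / l)); lra.
  + apply Rmin_l.
  + note (Rmin_r b (a + d / l)). lra.
  + side.
  + apply Up; lra.
 - exists (Rmax a (b - d / l)), b. repeat split; try lra.
  + apply Rmax_l.
  + unfold Rmax; destruct (Rle_dec a (b - d / l)); lra.
  + note (Rmax_r a (b - d / l)). lra.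
  + apply Dn; lra.
  + side.
 - exists (Rmax a (z - d / l)), (Rmin b (z + d / l)). repeat split.
  + apply Rmax_l.
  + unfold Rmax, Rmin; destruct (Rle_dec a (z - d / l)), (Rle_dec b (z + d / l)); lra.
  + apply Rmin_l.
  + note (Rmax_r a (z - d / l)). note (Rmin_r b (z + d / l)). lra.
  + apply Dn; lra.
  + apply Up; lra.
Qed.

(** Second derivative test. [kap] moves at speed at least l, so |kap| >= d outside an interval of
    length 2 d / l. Inside, the trivial bound is 2 d P S / l; outside, [vdc_first] gives S / d
    twice. The choice d^2 = l / P makes both contributions equal. *)
Lemma vdc_second (Phi rho sig dsig kap dkap : R -> R) a b S P l s1 s2 :
  a <= b -> 0 < l -> 0 < P -> 0 <= S ->
  s1 = 1 \/ s1 = -1 -> s2 = 1 \/ s2 = -1 ->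
  (forall t, a <= t <= b -> is_derive Phi t (rho t * kap t)) ->
  (forall t, a <= t <= b -> is_derive sig t (dsig t)) ->
  (forall t, a <= t <= b -> is_derive kap t (dkap t)) ->
  (forall t, a <= t <= b -> continuous rho t) ->
  (forall t, a <= t <= b -> continuous dsig t) ->
  (forall t, a <= t <= b -> continuous dkap t) ->
  (forall t, a <= t <= b -> 0 <= sig t <= S) ->
  (forall t, a <= t <= b -> Rabs (rho t) <= P) ->
  (forall t, a <= t <= b -> 0 <= s1 * dsig t) ->
  (forall t, a <= t <= b -> l <= s2 * dkap t) ->
  Cmod (cint (fun t => (RtoC (rho t * sig t) * e (Phi t))%C) a b) <= 4 * S * sqrt (P / l).
Proof.
 intros Hab Hl HP HS E1 E2 DP Ds Dk Cr Cs Ck Bs Br M1 M2. set (d := sqrt (l / P)). have Hd : 0 < d.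
 have Edd : d * d = l / P. assert (Ed : sqrt (P / l) = / d). { unfold d. rewrite <- sqrt_inv. f_equal. side. }
 destruct (increasing_split (fun t => s2 * kap t) (fun t => s2 * dkap t) a b l d) as (c1 & c2 & A1 & A2 & A3 & A4 & A5 & A6); trivial.
 { intros t Ht. apply is_derive_scal. side. } set (f := fun t => (RtoC (rho t * sig t) * e (Phi t))%C).
 assert (Cf : forall t, a <= t <= b -> ccont f t).
 { intros t Ht. apply ccont_mult.
  - apply ccont_R. apply (continuous_mult rho sig); auto. apply (ex_derive_continuous sig).
   eexists; apply Ds; assumption.
  - apply ccont_e. apply (ex_derive_continuous Phi). eexists; apply DP; assumption. }
 assert (I : forall x y, a <= x -> x <= y -> y <= b -> is_cint f x y (cint f x y)).
 { intros. apply cint_ok; trivial. intros; apply Cf; lra. }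
 rewrite (cint_eq f a b (cint f a c1 + cint f c1 c2 + cint f c2 b)%C).
 2: { apply is_cint_Chasles with c2; [apply is_cint_Chasles with c1|]; apply I; lra. } have HSd : 0 <= S / d.
 assert (B0 : forall x, Cmod (cint f x x) <= S / d).
 { intros x. rewrite (cint_eq f x x 0 (is_cint_point f x)), Cmod_0. side. }
 assert (B1 : Cmod (cint f a c1) <= S / d).
 { destruct (Req_dec c1 a) as [E|E]; [rewrite E; apply B0|].
  apply (vdc_first Phi rho sig dsig kap dkap a c1 S d s1 s2 (- s2)); trivial; try (intros t Ht; (apply DP || apply Ds || apply Dk || apply Cr || apply Cs || apply Ck || apply Bs || apply M1); lra).
  - side.
  - intros t Ht. note (M2 t !!). lra.
  - intros t Ht. destruct (A5 t Ht); side. }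
 assert (B3 : Cmod (cint f c2 b) <= S / d).
 { destruct (Req_dec c2 b) as [E|E]; [rewrite E; apply B0|].
  apply (vdc_first Phi rho sig dsig kap dkap c2 b S d s1 s2 s2); trivial; try (intros t Ht; (apply DP || apply Ds || apply Dk || apply Cr || apply Cs || apply Ck || apply Bs || apply M1); lra).
  - intros t Ht. note (M2 t !!). lra.
  - intros t Ht. destruct (A6 t Ht); side. }
 assert (B2 : Cmod (cint f c1 c2) <= 2 * (S / d)).
 { via ((c2 - c1) * (P * S)).
  - eapply cint_bound; trivial; [|side]. intros t Ht. unfold f.
   rewrite Cmod_mult, Cmod_e, Cmod_R, Rmult_1_r, Rabs_mult. note (Bs t !!). apply Rmult_le_compat; try apply Rabs_pos.
   + apply Br; lra.
   + side.
  - via (2 * d / l * (P * S)).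
   + side.
   + right. replace l with (P * (d * d)) by (rewrite Edd; field; lra). side. }
 upto Cmod_triangle. note (Cmod_triangle (cint f a c1) (cint f c1 c2)). side.
Qed.

(** * Finite sums and Bessel's inequality *)

Definition Rsum {A} (f : A -> R) (l : list A) : R := fold_right (fun a s => f a + s) 0 l.
Definition Csum {A} (f : A -> C) (l : list A) : C := fold_right (fun a s => (f a + s)%C) (RtoC 0) l.

Lemma Rsum_ext {A} (f g : A -> R) l : (forall a, In a l -> f a = g a) -> Rsum f l = Rsum g l.
Proof. induction l; simpl; intros H; [side|]. rewrite H, IHl; auto. Qed.

Lemma Rsum_le {A} (f g : A -> R) l : (forall a, In a l -> f a <= g a) -> Rsum f l <= Rsum g l.
Proof. induction l; simpl; intros H; [lra|]. apply Rplus_le_compat; auto. Qed.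

Lemma Rsum_0 {A} (l : list A) : Rsum (fun _ => 0) l = 0.
Proof. induction l; simpl; [side|]. side. Qed.

Lemma Rsum_nonneg {A} (f : A -> R) l : (forall a, In a l -> 0 <= f a) -> 0 <= Rsum f l.
Proof. intros H. rewrite <- (Rsum_0 l). apply Rsum_le; assumption. Qed.

Lemma Rsum_plus {A} (f g : A -> R) l : Rsum (fun a => f a + g a) l = Rsum f l + Rsum g l.
Proof. induction l; simpl; [ring|]. side. Qed.

Lemma Rsum_scal {A} c (f : A -> R) l : Rsum (fun a => c * f a) l = c * Rsum f l.
Proof. induction l; simpl; [ring|]. side. Qed.

Lemma Rsum_scal_r {A} c (f : A -> R) l : Rsum (fun a => f a * c) l = Rsum f l * c.
Proof. induction l; simpl; [ring|]. side. Qed.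

Lemma Rsum_const {A} c (l : list A) : Rsum (fun _ => c) l = INR (length l) * c.
Proof. induction l; [simpl; ring|]. simpl length. rewrite S_INR. simpl. side. Qed.

Lemma Rsum_app {A} (f : A -> R) l l' : Rsum f (l ++ l') = Rsum f l + Rsum f l'.
Proof. induction l; simpl; [ring|]. side. Qed.

Lemma Rsum_map {A B} (f : B -> R) (g : A -> B) l : Rsum f (map g l) = Rsum (fun a => f (g a)) l.
Proof. induction l; simpl; [side|]. side. Qed.

Lemma Rsum_flat_map {A B} (f : B -> R) (g : A -> list B) l :
  Rsum f (flat_map g l) = Rsum (fun a => Rsum f (g a)) l.
Proof. induction l; simpl; [side|]. rewrite Rsum_app, IHl; reflexivity. Qed.

Lemma Rsum_incl {A} (f : A -> R) l l' : NoDup l -> incl l l' ->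
  (forall a, In a l' -> 0 <= f a) -> Rsum f l <= Rsum f l'.
Proof.
 revert l'. induction l as [|a l IH]; intros l' N I P; simpl.
 - apply Rsum_nonneg; assumption.
 - assert (Ia : In a l') by (apply I; left; trivial). destruct (in_split _ _ Ia) as (l1 & l2 & E). subst l'.
  inversion N; subst. rewrite Rsum_app. simpl. assert (Rsum f l <= Rsum f (l1 ++ l2)).
  { apply IH; auto.
   - intros x Hx. assert (In x (l1 ++ a :: l2)) by (apply I; right; trivial). apply in_app_iff in H. apply in_app_iff.
    destruct H as [H|[H|H]]; auto. subst x. contradiction.
   - intros x Hx. apply P. apply in_app_iff in Hx. apply in_app_iff. simpl. tauto. }
  rewrite Rsum_app in H. lra.
Qed.

(** The counting device of the proof: terms are labelled injectively by keys and the sum is enlarged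
    to a box of keys. Arcs are counted this way in [varc_count], pairs of arcs in [core_sum]. *)
Lemma Rsum_inj {A B} (F : A -> R) (f : B -> R) (phi : A -> B) l l' : NoDup l ->
  (forall a b, In a l -> In b l -> phi a = phi b -> a = b) ->
  (forall a, In a l -> In (phi a) l') ->
  (forall a, In a l -> F a <= f (phi a)) ->
  (forall b, In b l' -> 0 <= f b) ->
  Rsum F l <= Rsum f l'.
Proof.
 intros N Inj Im Le P. via (Rsum f (map phi l)).
 - rewrite Rsum_map. apply Rsum_le; assumption.
 - apply Rsum_incl; trivial.
  + clear Im Le P. induction l as [|a l IH]; simpl; [constructor|]. inversion N; subst. constructor.
   * intros H. apply in_map_iff in H. destruct H as [b [E Hb]]. apply H1. rewrite <- (Inj b a); simpl; auto.
   * apply IH; trivial. intros; apply Inj; simpl; auto.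
  + intros b Hb. apply in_map_iff in Hb. destruct Hb as [a [E Ha]]. subst b. auto.
Qed.

Lemma Rsum_filter_le {A} (f : A -> R) (p : A -> bool) l :
  (forall a, In a l -> 0 <= f a) -> Rsum f (filter p l) <= Rsum f l.
Proof.
 induction l as [|a l IH]; simpl; intros H; [lra|]. assert (0 <= f a) by auto.
 assert (Rsum f (filter p l) <= Rsum f l) by auto. destruct (p a); simpl; lra.
Qed.

Lemma Csum_ext {A} (f g : A -> C) l : (forall a, In a l -> f a = g a) -> Csum f l = Csum g l.
Proof. induction l; simpl; intros H; [side|]. rewrite H, IHl; auto. Qed.

Lemma Csum_0 {A} (l : list A) : Csum (fun _ => RtoC 0) l = RtoC 0.
Proof. induction l; simpl; [side|]. rewrite IHl; ring. Qed.

Lemma Csum_plus {A} (f g : A -> C) l : Csum (fun a => (f a + g a)%C) l = (Csum f l + Csum g l)%C.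
Proof. induction l; simpl; [ring|]. rewrite IHl; ring. Qed.

Lemma Csum_scal {A} c (f : A -> C) l : Csum (fun a => (c * f a)%C) l = (c * Csum f l)%C.
Proof. induction l; simpl; [ring|]. rewrite IHl; ring. Qed.

Lemma Csum_app {A} (f : A -> C) l l' : Csum f (l ++ l') = (Csum f l + Csum f l')%C.
Proof. induction l; simpl; [ring|]. rewrite IHl; ring. Qed.

Lemma Csum_map {A B} (f : B -> C) (g : A -> B) l : Csum f (map g l) = Csum (fun a => f (g a)) l.
Proof. induction l; simpl; [side|]. rewrite IHl; reflexivity. Qed.

Lemma Csum_flat_map {A B} (f : B -> C) (g : A -> list B) l :
  Csum f (flat_map g l) = Csum (fun a => Csum f (g a)) l.
Proof. induction l; simpl; [side|]. rewrite Csum_app, IHl; reflexivity. Qed.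

Lemma Csum_exchange {A B} (f : A -> B -> C) l l' :
  Csum (fun a => Csum (fun b => f a b) l') l = Csum (fun b => Csum (fun a => f a b) l) l'.
Proof.
 induction l; simpl.
 - symmetry; apply Csum_0.
 - rewrite IHl, Csum_plus. side.
Qed.

Lemma Csum_conj {A} (f : A -> C) l : Cconj (Csum f l) = Csum (fun a => Cconj (f a)) l.
Proof.
 induction l; simpl.
 - unfold Cconj, RtoC; simpl; f_equal; ring.
 - rewrite <- IHl. unfold Cconj, Cplus; simpl; f_equal; ring.
Qed.

Lemma Cmod_Csum {A} (f : A -> C) l : Cmod (Csum f l) <= Rsum (fun a => Cmod (f a)) l.
Proof. induction l; simpl; [rewrite Cmod_0; lra|]. upto Cmod_triangle. lra. Qed.

Lemma Csum_R {A} (f : A -> R) l : Csum (fun a => RtoC (f a)) l = RtoC (Rsum f l).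
Proof. induction l; simpl; [side|]. rewrite IHl, <- RtoC_plus. side. Qed.

Lemma Rsum_CS {A} (f g : A -> R) l :
  Rsum (fun a => f a * g a) l ^ 2 <= Rsum (fun a => f a ^ 2) l * Rsum (fun a => g a ^ 2) l.
Proof.
 induction l as [|a l IH]; simpl; [lra|]. set (x := Rsum (fun a => f a * g a) l) in *.
 set (F := Rsum (fun a => f a ^ 2) l) in *. set (G := Rsum (fun a => g a ^ 2) l) in *.
 change (Rsum (fun a => f a * (f a * 1)) l) with F. change (Rsum (fun a => g a * (g a * 1)) l) with G.
 assert (HF : 0 <= F) by (apply Rsum_nonneg; intros; apply pow2_ge_0).
 assert (HG : 0 <= G) by (apply Rsum_nonneg; intros; apply pow2_ge_0).
 assert (K : 2 * x * (f a * g a) <= f a ^ 2 * G + g a ^ 2 * F).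
 { via (2 * (sqrt F * sqrt G) * Rabs (f a * g a)).
  - via (Rabs (2 * x * (f a * g a))); [apply Rle_abs|]. rewrite !Rabs_mult, (Rabs_pos_eq 2) by lra. mul_r. mul_l.
   rewrite <- sqrt_mult by assumption. rewrite <- sqrt_Rsqr_abs. apply sqrt_le_1_alt. unfold Rsqr. lra.
  - rewrite Rabs_mult. set (p := sqrt F). set (q := sqrt G).
   assert (Ep : F = p ^ 2) by (unfold p; rewrite pow2_sqrt; trivial).
   assert (Eq : G = q ^ 2) by (unfold q; rewrite pow2_sqrt; trivial). rewrite <- pow2_abs, <- (pow2_abs (g a)).
   note (pow2_ge_0 (Rabs (f a) * q - Rabs (g a) * p)). nra. }
 nra.
Qed.

Lemma Csum_CS {A} (f g : A -> C) l :
  Cmod (Csum (fun a => (f a * g a)%C) l) ^ 2 <=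
  Rsum (fun a => Cmod (f a) ^ 2) l * Rsum (fun a => Cmod (g a) ^ 2) l.
Proof.
 eapply Rle_trans; [|apply Rsum_CS]. apply pow_incr. split; [side|]. upto Cmod_Csum. right.
 apply Rsum_ext; intros; apply Cmod_mult.
Qed.

Lemma is_cint_Csum {A} (f : A -> R -> C) (v : A -> C) a b l :
  (forall i, In i l -> is_cint (f i) a b (v i)) ->
  is_cint (fun t => Csum (fun i => f i t) l) a b (Csum v l).
Proof.
 induction l; simpl; intros H.
 - apply is_cint_0.
 - apply is_cint_plus; auto.
Qed.

Lemma ccont_Csum {A} (f : A -> R -> C) x l :
  (forall i, In i l -> ccont (f i) x) -> ccont (fun t => Csum (fun i => f i t) l) x.
Proof. induction l; simpl; intros H; [side|]. side. Qed.

Definition ind (a b t : R) : R := if Rle_dec a t then if Rle_dec t b then 1 else 0 else 0.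

Lemma ind_mult a b c d t : ind a b t * ind c d t = ind (Rmax a c) (Rmin b d) t.
Proof.
 unfold ind.
 destruct (Rle_dec (Rmax a c) t) as [H|H]; destruct (Rle_dec t (Rmin b d)) as [H'|H']; destruct (Rle_dec a t), (Rle_dec t b), (Rle_dec c t), (Rle_dec t d); try ring; exfalso; unfold Rmax, Rmin in *; destruct (Rle_dec a c); destruct (Rle_dec b d); lra.
Qed.

Lemma is_cint_ind g a b l : 0 <= a -> a <= b -> b <= 1 -> is_cint g a b l ->
  is_cint (fun t => (RtoC (ind a b t) * g t)%C) 0 1 l.
Proof.
 intros H0 Hab H1 H. replace l with (0 + l + 0)%C by ring.
 apply is_cint_Chasles with b; [apply is_cint_Chasles with a|].
 - eapply is_cint_ext_le; [side| |apply is_cint_0]. intros x Hx. unfold ind. destruct (Rle_dec a x); [lra|ring].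
 - eapply is_cint_ext_le; [side| |exact H]. intros x Hx. unfold ind. destruct (Rle_dec a x); [|lra].
  destruct (Rle_dec x b); [ring|lra].
 - eapply is_cint_ext_le; [side| |apply is_cint_0]. intros x Hx. unfold ind. destruct (Rle_dec a x); [|ring].
  destruct (Rle_dec x b); [lra|ring].
Qed.

Lemma is_cint_e_Z n : n <> 0%Z -> is_cint (fun t => e (IZR n * t)) 0 1 0.
Proof.
 intros Hn. assert (Hp := PI_RGT_0). assert (Hz : IZR n <> 0) by (apply IZR_neq; assumption).
 set (c0 := (RtoC (/ (2 * PI * IZR n)) * - Ci)%C).
 assert (D : forall x, is_cderive (fun t => (c0 * e (IZR n * t))%C) x (e (IZR n * x))).
 { intros x. assert (D0 : is_cderive (fun _ => c0) x (RtoC 0)).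
  { split; simpl; apply is_derive_Reals; apply derivable_pt_lim_const. }
  assert (D1 : is_derive (fun t => IZR n * t) x (IZR n)) by (auto_derive; [side|ring]).
  note (is_cderive_mult _ _ _ _ _ D0 (is_cderive_e _ _ _ D1)) as D2.
  match goal with |- is_cderive _ _ ?v => match type of D2 with is_cderive _ _ ?u => replace v with u end end.
  - side.
  - unfold c0, Ci, Cmult, Cplus, Copp, RtoC; destruct (e (IZR n * x)) as [p q]; simpl. f_equal; field; lra. }
 assert (K : is_cint (fun t => e (IZR n * t)) 0 1 (c0 * e (IZR n * 1) - c0 * e (IZR n * 0))%C).
 { apply (is_cint_derive (fun t => (c0 * e (IZR n * t))%C)); intros; [side|]. side. }
 replace (c0 * e (IZR n * 1) - c0 * e (IZR n * 0))%C with (RtoC 0) in K; [side|].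
 rewrite Rmult_1_r, e_Z, Rmult_0_r, e_0. ring.
Qed.

Lemma is_cint_e_0 : is_cint (fun t => e (IZR 0 * t)) 0 1 1.
Proof.
 eapply (is_cint_ext_le (fun _ => RtoC 1)); [lra| |].
 - intros x _. rewrite Rmult_0_l, e_0. side.
 - split; simpl.
  + note (is_RInt_const (V := R_NormedModule) 0 1 1) as K.
   replace (scal (1 - 0) (1 : R_NormedModule)) with (1 : R) in K by (unfold scal; simpl; unfold mult; simpl; ring).
   side.
  + note (is_cint_0 0 1) as [K _]. side.
Qed.

Section Bessel.
Context {A : Type} (lo hi : A -> R) (f : A -> R -> C) (l : list A) (zs : list Z).

(** The inner product over [0, 1] of [f a] and [f b], each set to zero outside its own interval. *)
Definition overlap (a b : A) : C :=
  if Rle_dec (Rmax (lo a) (lo b)) (Rmin (hi a) (hi b))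
  then cint (fun t => (f a t * Cconj (f b t))%C) (Rmax (lo a) (lo b)) (Rmin (hi a) (hi b))
  else RtoC 0.

Definition coef (n : Z) : C := Csum (fun a => cint (fun t => (f a t * e (IZR n * t))%C) (lo a) (hi a)) l.

Hypotheses (Hl : forall a, In a l -> 0 <= lo a /\ lo a <= hi a /\ hi a <= 1)
 (Hf : forall a, In a l -> forall t, lo a <= t <= hi a -> ccont (f a) t) (Hz : NoDup zs).

(** Let G be the sum of the cut-off functions and P its projection on the exponentials e(- n t), n
    in [zs]. Then <G, G> is the double sum of overlaps, while <G, P> and <P, P> both equal the sum
    of |coef n|^2; the claim is the positivity of the integral of |G - P|^2. *)
Lemma bessel_inequality :
  Rsum (fun n => Cmod (coef n) ^ 2) zs <= Rsum (fun a => Rsum (fun b => Cmod (overlap a b)) l) l.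
Proof.
 set (G := fun t => Csum (fun a => (RtoC (ind (lo a) (hi a) t) * f a t)%C) l).
 set (P := fun t => Csum (fun n => (coef n * e (- (IZR n * t)))%C) zs).
 assert (IGG : is_cint (fun t => (G t * Cconj (G t))%C) 0 1 (Csum (fun a => Csum (fun b => overlap a b) l) l)).
 { eapply is_cint_ext.
  2: {
   apply (is_cint_Csum (fun a t => Csum (fun b => (RtoC (ind (Rmax (lo a) (lo b)) (Rmin (hi a) (hi b)) t) * (f a t * Cconj (f b t)))%C) l)).
   intros a Ha. apply is_cint_Csum. intros b Hb. unfold overlap. note (Hl a Ha).
   destruct (Rle_dec (Rmax (lo a) (lo b)) (Rmin (hi a) (hi b))) as [D|D].
   - apply is_cint_ind; trivial.
    + apply Rle_trans with (2 := Rmax_l _ _). lra.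
    + apply Rle_trans with (1 := Rmin_l _ _). lra.
    + apply cint_ok; trivial. intros x Hx. note (Rmax_l (lo a) (lo b)). note (Rmax_r (lo a) (lo b)).
     note (Rmin_l (hi a) (hi b)). note (Rmin_r (hi a) (hi b)). apply ccont_mult; [apply Hf; trivial; lra|].
     apply ccont_conj. apply Hf; trivial; lra.
   - eapply is_cint_ext; [|apply is_cint_0]. intros x _. unfold ind. destruct (Rle_dec (Rmax (lo a) (lo b)) x); [|ring].
    destruct (Rle_dec x (Rmin (hi a) (hi b))); [lra|ring]. }
  intros t _. unfold G. rewrite Csum_conj. rewrite Cmult_comm, <- Csum_scal. apply Csum_ext; intros a Ha.
  rewrite Cmult_comm, <- Csum_scal. apply Csum_ext; intros b Hb. rewrite <- ind_mult, RtoC_mult.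
  unfold Cconj, Cmult, RtoC; simpl. f_equal; ring. }
 assert (IGn : forall n : Z, is_cint (fun t => (G t * e (IZR n * t))%C) 0 1 (coef n)).
 { intros n. eapply is_cint_ext.
  2: { apply (is_cint_Csum (fun a t => (RtoC (ind (lo a) (hi a) t) * (f a t * e (IZR n * t)))%C)). intros a Ha.
   note (Hl a Ha). apply is_cint_ind; try lra. apply cint_ok; [lra|]. side. }
  intros t _. unfold G. rewrite Cmult_comm, <- Csum_scal. apply Csum_ext; intros; ring. }
 set (Q := Rsum (fun n => Cmod (coef n) ^ 2) zs). assert (EQ : Csum (fun n => (Cconj (coef n) * coef n)%C) zs = RtoC Q).
 { unfold Q. rewrite <- Csum_R. apply Csum_ext; intros n _. rewrite Cmod2_conj. ring. }
 assert (IGP : is_cint (fun t => (G t * Cconj (P t))%C) 0 1 (RtoC Q)).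
 { rewrite <- EQ. eapply is_cint_ext. 2: { apply is_cint_Csum. intros n Hn. apply is_cint_scal. side. }
  - intros t _. unfold P. rewrite Csum_conj, <- Csum_scal. apply Csum_ext; intros n _.
   rewrite Cmult_conj, e_conj, Ropp_involutive. ring. }
 assert (IPP : is_cint (fun t => (P t * Cconj (P t))%C) 0 1 (RtoC Q)).
 { rewrite <- EQ.
  assert (S1 : forall n zs', NoDup zs' -> In n zs' -> Csum (fun m => if Z.eq_dec m n then coef m else RtoC 0) zs' = coef n).
  { intros n. induction zs' as [|m zs' IH]; intros N I; [destruct I|]. inversion N; subst. simpl.
   destruct (Z.eq_dec m n) as [E|E].
   - subst m. rewrite (Csum_ext _ (fun _ => RtoC 0)), Csum_0; [ring|]. intros m Hm.
    destruct (Z.eq_dec m n); [subst; contradiction|side].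
   - destruct I as [I|I]; [side|]. rewrite IH; trivial. ring. }
  assert (IPn : forall n, In n zs -> is_cint (fun t => (P t * e (IZR n * t))%C) 0 1 (coef n)).
  { intros n Hn. rewrite <- (S1 n zs Hz Hn). eapply is_cint_ext.
   2: { apply (is_cint_Csum (fun m t => (coef m * e (IZR (n - m) * t))%C)). intros m Hm.
    destruct (Z.eq_dec m n) as [E|E].
    - subst m. rewrite Z.sub_diag. note (is_cint_scal _ _ _ _ (coef n) is_cint_e_0) as K.
     replace (coef n * 1)%C with (coef n) in K by ring. side.
    - note (is_cint_scal _ _ _ _ (coef m) (is_cint_e_Z (n - m) !!)) as K.
     replace (coef m * 0)%C with (RtoC 0) in K by ring. side. }
   intros t _. unfold P. rewrite Cmult_comm, <- Csum_scal. apply Csum_ext; intros m _. rewrite minus_IZR.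
   replace ((IZR n - IZR m) * t) with (IZR n * t + - (IZR m * t)) by ring. rewrite e_plus. ring. }
  eapply is_cint_ext.
  2: {
   apply (is_cint_Csum (fun n t => (Cconj (coef n) * (P t * e (IZR n * t)))%C) (fun n => (Cconj (coef n) * coef n)%C)).
   intros n Hn. apply is_cint_scal. side. }
  - intros t _. unfold P at 3. rewrite Csum_conj, <- Csum_scal. apply Csum_ext; intros n _.
   rewrite Cmult_conj, e_conj, Ropp_involutive. ring. }
 note (is_cint_plus _ _ _ _ _ _ (is_cint_minus _ _ _ _ _ _ IGG IGP) (is_cint_minus _ _ _ _ _ _ IPP (is_cint_conj _ _ _ _ IGP))) as K.
 assert (K' : 0 <= fst (Csum (fun a => Csum (fun b => overlap a b) l) l - RtoC Q + (RtoC Q - Cconj (RtoC Q)))%C).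
 { destruct K as [K _]. assert (K0 : is_RInt (fun _ => 0) 0 1 0) by (note (is_cint_0 0 1) as [K0 _]; exact K0).
  apply (is_RInt_le _ _ _ _ _ _ Rle_0_1 K0 K). intros t _. simpl. note (pow2_ge_0 (fst (G t) - fst (P t))).
  note (pow2_ge_0 (snd (G t) - snd (P t))). side. }
 simpl in K'. fold Q.
 assert (B : fst (Csum (fun a => Csum (fun b => overlap a b) l) l) <= Rsum (fun a => Rsum (fun b => Cmod (overlap a b)) l) l).
 { via (Cmod (Csum (fun a => Csum (fun b => overlap a b) l) l)).
  - apply Rle_trans with (1 := Rle_abs _). eapply Rle_trans; [apply Rmax_l|apply Rmax_Cmod].
  - upto Cmod_Csum. apply Rsum_le; intros a _. apply Cmod_Csum. }
 lra.
Qed.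
End Bessel.

(** * The Bessel function *)

Definition improper (f : R -> R) : R := RInt_gen f (at_point 0) (Rbar_locally p_infty).

Lemma is_RInt_exp_decay C a b c : 0 < a ->
  is_RInt (fun u => C * exp (- a * u)) b c (C / a * exp (- a * b) - C / a * exp (- a * c)).
Proof.
 intros Ha. note (is_RInt_derive (fun u => - (C / a) * exp (- a * u)) (fun u => C * exp (- a * u)) b c) as K.
 assert (K' : is_RInt (fun u => C * exp (- a * u)) b c (minus (- (C / a) * exp (- a * c)) (- (C / a) * exp (- a * b)))).
 { apply K.
  - intros x _. auto_derive; [side|]. side.
  - intros x _. apply (ex_derive_continuous (fun u => C * exp (- a * u))). auto_derive. side. }
 unfold minus, plus, opp in K'; simpl in K'.
 match goal with |- is_RInt _ _ _ ?v => match type of K' with is_RInt _ _ _ ?u => replace v with u by ring end end.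
 side.
Qed.

(** Tails beyond b are at most C' e^(- a b) / a, so the partial integrals converge. The tail
    estimate admits its own constant [C'], which may be far smaller than [C]: [KB_lower] needs a
    tail that is exponentially small in v. *)
Lemma improper_spec f C a : 0 < a ->
  (forall u, continuous f u) -> (forall u, 0 <= u -> Rabs (f u) <= C * exp (- a * u)) ->
  is_RInt_gen f (at_point 0) (Rbar_locally p_infty) (improper f) /\
  (forall b C', 0 <= b -> (forall u, b <= u -> Rabs (f u) <= C' * exp (- a * u)) ->
     Rabs (improper f - RInt f 0 b) <= C' / a * exp (- a * b)).
Proof.
 intros Ha Cf Df. assert (Ex : forall x y, is_RInt f x y (RInt f x y)).
 { intros. apply (RInt_correct f). apply ex_RInt_continuous. side. }
 assert (Ch : forall x y z, RInt f x z = RInt f x y + RInt f y z).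
 { intros. apply is_RInt_unique. apply (is_RInt_Chasles f x y z); apply Ex. }
 assert (Tl : forall b c C', 0 <= b -> b <= c -> (forall u, b <= u -> Rabs (f u) <= C' * exp (- a * u)) -> Rabs (RInt f b c) <= C' / a * exp (- a * b)).
 { intros b c C' Hb Hbc D. assert (HC : 0 <= C').
  { note (D b (Rle_refl _)). note (Rabs_pos (f b)). note (exp_pos (- a * b)). nra. }
  via (C' / a * exp (- a * b) - C' / a * exp (- a * c)).
  - apply (norm_RInt_le f (fun u => C' * exp (- a * u)) b c); trivial.
   + intros x Hx. apply D; lra.
   + apply is_RInt_exp_decay; assumption.
  - note (exp_pos (- a * c)). have : 0 <= C' / a. nra. }
 assert (HC : 0 <= C). { note (Df 0 (Rle_refl _)). note (Rabs_pos (f 0)). note (exp_pos (- a * 0)). nra. }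
 assert (Small : forall K eps, 0 <= K -> 0 < eps -> exists B, 0 <= B /\ forall b, B <= b -> K / a * exp (- a * b) < eps).
 { intros K eps HK He. exists (K / (a * a * eps)). split.
  - side.
  - intros b Hb. replace (- a * b) with (- (a * b)) by ring. rewrite exp_Ropp. note (exp_ineq1_le (a * b)).
   assert (Hp : 0 < exp (a * b)) by apply exp_pos. apply Rmult_lt_reg_r with (exp (a * b)); [side|].
   rewrite Rmult_assoc, Rinv_l, Rmult_1_r by lra. assert (K / a <= eps * (a * b)).
   { replace (K / a) with (eps * (a * (K / (a * a * eps)))) by side. side. } nra. }
 assert (Cv : exists l, forall eps, 0 < eps -> exists B, forall b, B <= b -> Rabs (RInt f 0 b - l) < eps).
 { assert (CC : Cauchy_crit (fun n => RInt f 0 (INR n))).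
  { intros eps He. destruct (Small C eps HC He) as (B & HB0 & HB). destruct (nfloor_ex B HB0) as [n0 [Hn0 Hn1]].
   exists (S n0).
   assert (W : forall n m, (n >= S n0)%nat -> (n <= m)%nat -> Rabs (RInt f 0 (INR m) - RInt f 0 (INR n)) < eps).
   { intros n m Hn Hm. rewrite (Ch 0 (INR n) (INR m)). rewrite Rplus_minus_l. assert (B <= INR n).
    { via (INR (S n0)); [rewrite S_INR; lra|side]. } eapply Rle_lt_trans; [|apply (HB (INR n)); assumption].
    apply Tl; [side|side|]. intros u Hu. apply Df. side. }
   intros n m Hn Hm. unfold Rdist. destruct (Nat.le_ge_cases n m).
   - rewrite Rabs_minus_sym. side.
   - side. }
  destruct (Rcomplete.R_complete _ CC) as [l Hl]. exists l. intros eps He.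
  destruct (Small C (eps / 2) HC !!) as (B & HB0 & HB). destruct (Hl (eps / 2) !!) as [N HN]. exists (Rmax B 0).
  intros b Hb. note (Rmax_l B 0). destruct (nfloor_ex b !!) as [n0 [Hn0 Hn1]]. set (n := Nat.max N (S n0)).
  assert (Hbn : b <= INR n). { via (INR (S n0)); [rewrite S_INR; lra|side]. } specialize (HN n ltac:(unfold n; lia)).
  unfold Rdist in HN. rewrite (Ch 0 b (INR n)) in HN. assert (T : Rabs (RInt f b (INR n)) < eps / 2).
  { eapply Rle_lt_trans; [|apply (HB b); lra]. apply Tl; [lra|side|]. intros; apply Df; lra. }
  replace (RInt f 0 b - l) with ((RInt f 0 b + RInt f b (INR n) - l - RInt f b (INR n)) : R) by side.
  eapply Rle_lt_trans; [apply Rabs_triang|]. rewrite Rabs_Ropp. lra. }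
 destruct Cv as [l Hl]. assert (G : is_RInt_gen f (at_point 0) (Rbar_locally p_infty) l).
 { intros P [eps HP]. destruct (Hl eps (cond_pos eps)) as [B HB]. exists (fun x => x = 0) (fun y => B < y).
  - reflexivity.
  - exists B. side.
  - intros x y Hx Hy. subst x. exists (RInt f 0 y). split; [side|]. apply HP. apply HB. lra. }
 assert (E : improper f = l) by (apply is_RInt_gen_unique; exact G). rewrite E. split; [side|]. intros b C' Hb D.
 apply Rnot_lt_le. intros Hlt. set (d := Rabs (l - RInt f 0 b) - C' / a * exp (- a * b)).
 destruct (Hl d ltac:(unfold d; lra)) as [B HB]. specialize (HB (Rmax B b) (Rmax_l _ _)). note (Rmax_r B b) as Hm.
 rewrite (Ch 0 b (Rmax B b)) in HB. note (Tl b (Rmax B b) C' Hb Hm D) as HT.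
 assert (Rabs (l - RInt f 0 b) <= Rabs (RInt f 0 b + RInt f b (Rmax B b) - l) + Rabs (RInt f b (Rmax B b))).
 { replace (l - RInt f 0 b) with (- (RInt f 0 b + RInt f b (Rmax B b) - l) + RInt f b (Rmax B b)) by ring.
  upto Rabs_triang. rewrite Rabs_Ropp. lra. }
 unfold d in HB. lra.
Qed.

Lemma improper_bound f C a : 0 < a ->
  (forall u, continuous f u) -> (forall u, 0 <= u -> Rabs (f u) <= C * exp (- a * u)) ->
  Rabs (improper f) <= C / a.
Proof.
 intros Ha Cf Df. destruct (improper_spec f C a Ha Cf Df) as [_ K]. specialize (K 0 C (Rle_refl _) Df).
 rewrite (is_RInt_unique f 0 0 zero (is_RInt_point f 0)) in K. rewrite Rminus_0_r, Rmult_0_r, exp_0, Rmult_1_r in K.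
 side.
Qed.

(** The inequality ln z <= z - 1 at z = x / a reads a ln (x / a) <= x - a <= x. *)
Lemma exp_neg_le_Rpower x a : 0 < x -> 0 < a -> exp (- x) <= Rpower a a * Rpower x (- a).
Proof.
 intros Hx Ha. replace (Rpower a a * Rpower x (- a)) with (exp (- (a * ln (x / a)))).
 - apply exp_le_inv || idtac. destruct (Rle_lt_dec (- x) (- (a * ln (x / a)))) as [H|H].
  + destruct H as [H|H]; [left; apply exp_increasing; assumption|right; f_equal; assumption].
  + exfalso. have Hxa : 0 < x / a. note (exp_ineq1_le (ln (x / a))) as K. rewrite exp_ln in K by assumption.
   have : a * ln (x / a) <= a * (x / a - 1). replace (a * (x / a - 1)) with (x - a) in H0 by side. lra.
 - unfold Rpower. rewrite <- exp_plus. f_equal. rewrite ln_div by assumption. ring.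
Qed.

Lemma cosh_ge_exp u : exp u / 2 <= cosh u.
Proof. unfold cosh. note (exp_pos (- u)). lra. Qed.

Lemma cosh_ge_1 u : 1 <= cosh u.
Proof.
 unfold cosh. rewrite exp_Ropp. note (exp_pos u). assert (2 <= exp u + / exp u); [|lra]. cancel_r (exp u).
 rewrite Rmult_plus_distr_r, Rinv_l by lra. note (pow2_ge_0 (exp u - 1)). nra.
Qed.

Section BesselK.
Variable kappa : R.

(** [KB 0] is the Bessel function; each derivative in v brings down a factor - cosh u, hence the
    index j. *)
Definition bk (j : nat) (v u : R) : R := cosh u ^ j * exp (- v * cosh u) * cos (kappa * u).
Definition KB (j : nat) (v : R) : R := improper (bk j v).

Lemma bk_continuous j v u : continuous (bk j v) u.
Proof. apply (ex_derive_continuous (bk j v)). unfold bk, cosh. auto_derive. side. Qed.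

Lemma besselK_KB v : besselK_i kappa v = KB 0 v.
Proof.
 unfold besselK_i, KB, improper, RInt_gen. f_equal. apply FunctionalExtensionality.functional_extensionality; intros l.
 assert (E : (fun u : R => exp (- v * cosh u) * cos (kappa * u)) = bk 0 v).
 { apply FunctionalExtensionality.functional_extensionality; intros u. unfold bk. side. } rewrite E. side.
Qed.

(* [x ^ j exp (- x)] is at most a constant times [x ^ (- a)] at [x = v cosh u]. *)
Lemma bk_bound j v a : 0 < v -> 0 < a -> forall u, 0 <= u ->
  Rabs (bk j v u) <= Rpower (a + INR j) (a + INR j) * Rpower 2 a * Rpower v (- (a + INR j)) * exp (- a * u).
Proof.
 intros Hv Ha u Hu. unfold bk. note (cosh_ge_1 u) as H1. note (cosh_ge_exp u) as H2. rewrite !Rabs_mult.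
 rewrite Rabs_pos_eq by side. rewrite Rabs_pos_eq by (left; apply exp_pos).
 assert (Hc : Rabs (cos (kappa * u)) <= 1) by (apply Rabs_le; apply COS_bound). assert (Hj := pos_INR j).
 have Hx : 0 < v * cosh u. note (exp_neg_le_Rpower (v * cosh u) (a + INR j) Hx !!) as K.
 replace (- (v * cosh u)) with (- v * cosh u) in K by ring. via (cosh u ^ j * exp (- v * cosh u)).
 { rewrite <- (Rmult_1_r (cosh u ^ j * exp (- v * cosh u))) at 2. apply Rmult_le_compat_l; [|side].
  apply Rmult_le_pos; [side|left; apply exp_pos]. }
 via (cosh u ^ j * (Rpower (a + INR j) (a + INR j) * Rpower (v * cosh u) (- (a + INR j)))). { side. }
 rewrite <- Rpower_mult_distr by lra. rewrite <- Rpower_pow by lra.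
 replace (Rpower (cosh u) (INR j) * (Rpower (a + INR j) (a + INR j) * (Rpower v (- (a + INR j)) * Rpower (cosh u) (- (a + INR j))))) with (Rpower (a + INR j) (a + INR j) * Rpower v (- (a + INR j)) * (Rpower (cosh u) (INR j) * Rpower (cosh u) (- (a + INR j)))) by ring.
 rewrite <- Rpower_plus. replace (INR j + - (a + INR j)) with (- a) by ring.
 assert (K2 : Rpower (cosh u) (- a) <= Rpower 2 a * exp (- a * u)).
 { unfold Rpower. rewrite <- exp_plus. assert (L : u - ln 2 <= ln (cosh u)).
  { via (ln (exp u / 2)).
   - rewrite ln_div by side. rewrite ln_exp. lra.
   - destruct H2 as [H2|H2]; [left; apply ln_increasing; [|side]|right; f_equal; assumption]. side. }
  have L2 : - a * ln (cosh u) <= a * ln 2 + - a * u.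
  destruct L2 as [L2|L2]; [left; apply exp_increasing; assumption|right; f_equal; assumption]. }
 have : 0 < Rpower (a + INR j) (a + INR j) * Rpower v (- (a + INR j)). nra.
Qed.

(** The exponent [a] stays free: convergence of the sums over n needs it only just above 1/2, while
    decay in the cusp needs it as large as one likes. *)
Lemma KB_bound j v a : 0 < v -> 0 < a ->
  Rabs (KB j v) <= Rpower (a + INR j) (a + INR j) * Rpower 2 a / a * Rpower v (- (a + INR j)).
Proof.
 intros Hv Ha. note (improper_bound (bk j v) _ a Ha (bk_continuous j v) (bk_bound j v a Hv Ha)) as K. upto K. side.
Qed.

Lemma exp_taylor_bound z : Rabs (exp z - 1 - z) <= z ^ 2 * exp (Rabs z).
Proof.
 note (exp_ineq1_le z). note (exp_ineq1_le (- z)). rewrite Rabs_pos_eq by lra.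
 assert (E : exp z * exp (- z) = 1) by (rewrite <- exp_plus, Rplus_opp_r; apply exp_0). have A : exp z - 1 <= z * exp z.
 destruct (Rle_dec 0 z) as [Hz|Hz].
 - rewrite Rabs_pos_eq by assumption. nra.
 - rewrite Rabs_left1 by lra. side.
Qed.

(** Differentiation under the integral sign. The second-order remainder of the exponential is at
    most h^2 cosh^2 u e^(|h| cosh u), and |h| <= v / 2 leaves half of the decay; so the remainder is
    controlled like [bk (j + 2) (v / 2)]. *)
Lemma KB_derive j v : 0 < v -> is_derive (KB j) v (- KB (S j) v).
Proof.
 intros Hv. set (a := 1).
 set (Cc := Rpower (a + INR (j + 2)) (a + INR (j + 2)) * Rpower 2 a * Rpower (v / 2) (- (a + INR (j + 2)))).
 assert (Main : forall h, Rabs h <= v / 2 -> Rabs (KB j (v + h) - KB j v + h * KB (S j) v) <= h ^ 2 * Cc).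
 { intros h Hh. assert (Hvh : 0 < v + h). { apply Rabs_le_between in Hh. lra. }
  set (f := fun u => bk j (v + h) u - bk j v u + h * bk (S j) v u).
  assert (Ef : improper f = KB j (v + h) - KB j v + h * KB (S j) v).
  { apply is_RInt_gen_unique.
   destruct (improper_spec (bk j (v + h)) _ 1 Rlt_0_1 (bk_continuous _ _) (bk_bound _ _ 1 Hvh Rlt_0_1)) as [K1 _].
   destruct (improper_spec (bk j v) _ 1 Rlt_0_1 (bk_continuous _ _) (bk_bound _ _ 1 Hv Rlt_0_1)) as [K2 _].
   destruct (improper_spec (bk (S j) v) _ 1 Rlt_0_1 (bk_continuous _ _) (bk_bound _ _ 1 Hv Rlt_0_1)) as [K3 _].
   apply (is_RInt_gen_plus (fun u => bk j (v + h) u - bk j v u) (fun u => h * bk (S j) v u)).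
   - apply (is_RInt_gen_minus (bk j (v + h)) (bk j v)); assumption.
   - apply (is_RInt_gen_scal (bk (S j) v) h). side. }
  rewrite <- Ef. replace (h ^ 2 * Cc) with (h ^ 2 * Cc / a) by side. apply improper_bound; [side| |].
  - intros u. apply (ex_derive_continuous f). unfold f, bk, cosh. auto_derive. side.
  - intros u Hu. unfold f. note (bk_bound (j + 2) (v / 2) a !! ltac:(unfold a; lra) u Hu) as B.
   via (h ^ 2 * (cosh u ^ (j + 2) * exp (- (v / 2) * cosh u) * Rabs (cos (kappa * u)))).
   + unfold bk. set (c := cosh u). assert (Hc : 1 <= c) by apply cosh_ge_1.
    replace (- (v + h) * c) with (- v * c + - h * c) by ring. rewrite exp_plus.
    replace (c ^ j * (exp (- v * c) * exp (- h * c)) * cos (kappa * u) - c ^ j * exp (- v * c) * cos (kappa * u) + h * (c ^ S j * exp (- v * c) * cos (kappa * u))) with (c ^ j * exp (- v * c) * (exp (- h * c) - 1 - (- h * c)) * cos (kappa * u)) by (simpl; ring).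
    rewrite !Rabs_mult. rewrite Rabs_pos_eq by side. rewrite Rabs_pos_eq by (left; apply exp_pos).
    replace (h ^ 2 * (c ^ (j + 2) * exp (- (v / 2) * c) * Rabs (cos (kappa * u)))) with (c ^ j * (h ^ 2 * c ^ 2 * exp (- (v / 2) * c)) * Rabs (cos (kappa * u))) by (rewrite pow_add; ring).
    mul_r. rewrite Rmult_assoc. mul_l. via (exp (- v * c) * ((- h * c) ^ 2 * exp (Rabs (- h * c)))).
    * apply Rmult_le_compat_l; [left; apply exp_pos|]. apply exp_taylor_bound.
    * replace (exp (- v * c) * ((- h * c) ^ 2 * exp (Rabs (- h * c)))) with (h ^ 2 * c ^ 2 * (exp (- v * c) * exp (Rabs (- h * c)))) by ring.
     mul_l. rewrite <- exp_plus. rewrite Rabs_mult, Rabs_Ropp, (Rabs_pos_eq c) by lra.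
     have L : - v * c + Rabs h * c <= - (v / 2) * c.
     destruct L as [L|L]; [left; apply exp_increasing; assumption|right; f_equal; assumption].
   + via (h ^ 2 * (Cc * exp (- a * u))); [|side]. mul_l. unfold bk in B. rewrite !Rabs_mult in B. note (cosh_ge_1 u).
    rewrite Rabs_pos_eq in B by side. rewrite Rabs_pos_eq in B by (left; apply exp_pos). side. }
 apply is_derive_Reals. intros eps He. assert (Hd : 0 < Rmin (v / 2) (eps / (Cc + 1))).
 { apply Rmin_pos; [lra|]. side. } exists (mkposreal _ Hd). intros h Hh0 Hh. simpl in Hh.
 note (Rmin_l (v / 2) (eps / (Cc + 1))). note (Rmin_r (v / 2) (eps / (Cc + 1))). note (Main h !!) as M.
 replace ((KB j (v + h) - KB j v) / h - - KB (S j) v) with ((KB j (v + h) - KB j v + h * KB (S j) v) / h) by side.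
 unfold Rdiv. rewrite Rabs_mult, Rabs_inv. assert (Hah : 0 < Rabs h) by (apply Rabs_pos_lt; assumption).
 apply Rle_lt_trans with (Rabs h * Cc).
 - cancel_r (Rabs h). rewrite Rmult_assoc, Rinv_l, Rmult_1_r by lra. rewrite <- pow2_abs in M. lra.
 - have E : eps / (Cc + 1) * (Cc + 1) = eps. side.
Qed.

End BesselK.

Lemma exp_le_mono x y : x <= y -> exp x <= exp y.
Proof. intros [H|H]; [left; apply exp_increasing; assumption|right; f_equal; assumption]. Qed.

Lemma exp_cosh_decay v : 0 < v -> exists B, 0 < B /\ forall u, 0 <= u -> exp (- v * cosh u) <= B * exp (- (1) * u).
Proof.
 intros Hv. eexists. split; [|intros u Hu; note (bk_bound 0 0 v 1 Hv Rlt_0_1 u Hu) as K].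
 2: { unfold bk in K. rewrite Rmult_0_l, cos_0, Rmult_1_r in K. rewrite Rmult_1_l in K.
  rewrite Rabs_pos_eq in K by (left; apply exp_pos). exact K. }
 side.
Qed.

Lemma KB_exp_upper kappa : exists B, 0 < B /\ forall v, 1 <= v -> Rabs (KB kappa 0 v) <= B * exp (- v / 2).
Proof.
 destruct (exp_cosh_decay (1 / 2) !!) as (B & HB & D). exists B. split; [side|]. intros v Hv.
 replace (B * exp (- v / 2)) with (B * exp (- v / 2) / 1) by field. apply improper_bound; [lra|apply bk_continuous|].
 intros u Hu. unfold bk. rewrite pow_O, Rmult_1_l, Rabs_mult. via (exp (- v * cosh u)).
 - rewrite Rabs_pos_eq by (left; apply exp_pos). rewrite <- (Rmult_1_r (exp (- v * cosh u))) at 2.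
  apply Rmult_le_compat_l; [left; apply exp_pos|]. apply Rabs_le. apply COS_bound.
 - via (exp (- v / 2) * exp (- (1 / 2) * cosh u)).
  + rewrite <- exp_plus. apply exp_le_mono. note (cosh_ge_1 u). nra.
  + specialize (D u Hu).
   replace (B * exp (- v / 2) * exp (- (1) * u)) with (exp (- v / 2) * (B * exp (- (1) * u))) by ring.
   apply Rmult_le_compat_l; [left; apply exp_pos|side].
Qed.

Lemma cosh_mono x y : 0 <= x -> x <= y -> cosh x <= cosh y.
Proof.
 intros Hx Hxy. unfold cosh. rewrite !exp_Ropp. assert (H1 : 1 <= exp x) by (note (exp_ineq1_le x); lra).
 assert (H2 : exp x <= exp y) by (apply exp_le_mono; assumption). assert (exp x + / exp x <= exp y + / exp y); [|lra].
 have E : exp y + / exp y - (exp x + / exp x) = (exp y - exp x) * (1 - / exp x * / exp y). assert (/ exp x <= 1).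
 { rewrite <- Rinv_1. side. } have : 0 < / exp y. have : / exp x * / exp y <= 1. side.
Qed.

Lemma cosh_lt x y : 0 <= x -> x < y -> cosh x < cosh y.
Proof.
 intros Hx Hxy. unfold cosh. rewrite !exp_Ropp. assert (H1 : 1 <= exp x) by (note (exp_ineq1_le x); lra).
 assert (H2 : exp x < exp y) by (apply exp_increasing; assumption). assert (exp x + / exp x < exp y + / exp y); [|lra].
 have E : exp y + / exp y - (exp x + / exp x) = (exp y - exp x) * (1 - / exp x * / exp y). assert (/ exp x <= 1).
 { rewrite <- Rinv_1. side. } have : 0 < / exp y. have : / exp x * / exp y < 1. side.
Qed.

Lemma cosh_half_le_2 : cosh (1 / 2) <= 2.
Proof.
 unfold cosh. note exp_le_3. assert (exp (1 / 2) <= exp 1) by (apply exp_le_mono; lra).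
 assert (exp (- (1 / 2)) <= exp 0) by (apply exp_le_mono; lra). rewrite exp_0 in *. lra.
Qed.

Lemma cos_ge_half x : Rabs x <= 1 -> 1 / 2 <= cos x.
Proof.
 intros H. replace x with (2 * (x / 2)) by field. rewrite cos_2a_sin. assert (Hs : Rabs (sin (x / 2)) <= Rabs (x / 2)).
 { destruct (Rle_dec 0 (x / 2)) as [P|P].
  - rewrite (Rabs_pos_eq (x / 2)) by assumption. apply Rabs_le. rewrite Rabs_pos_eq in H by lra. split.
   + assert (0 <= sin (x / 2)); [|lra]. apply sin_ge_0; [lra|]. note PI2_1. side.
   + destruct (Req_dec (x / 2) 0) as [E|E]; [rewrite E, sin_0; lra|]. left; apply sin_lt_x; lra.
  - rewrite <- Rabs_Ropp, <- sin_neg, <- (Rabs_Ropp (x / 2)). rewrite Rabs_left1 in H by lra.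
   rewrite (Rabs_pos_eq (- (x / 2))) by lra. apply Rabs_le. split.
   + assert (0 <= sin (- (x / 2))); [|lra]. apply sin_ge_0; [lra|]. note PI2_1. side.
   + left; apply sin_lt_x; lra. }
 assert (Hx : Rabs (x / 2) <= 1 / 2). { unfold Rdiv. rewrite Rabs_mult, (Rabs_pos_eq (/ 2)) by lra. lra. }
 note (Rabs_pos (sin (x / 2))). assert (sin (x / 2) * sin (x / 2) <= 1 / 4).
 { replace (sin (x / 2) * sin (x / 2)) with (Rabs (sin (x / 2)) ^ 2) by (rewrite pow2_abs; ring). nra. } lra.
Qed.

(** The function may oscillate for small v, so the bound starts at some [v0]. For large v the
    integral is concentrated near u = 0: on [0, s0] the cosine is at least 1/2, the first half of
    that interval contributes s0/4 e^(- v c1), and the tail is O(e^(- v c0)) with c0 > c1. Finally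
    c1 <= 2. *)
Lemma KB_lower kappa : exists v0 c, 1 <= v0 /\ 0 < c /\ forall v, v0 <= v -> c * exp (- 2 * v) <= KB kappa 0 v.
Proof.
 destruct (exp_cosh_decay 1 !!) as (B & HB & D). set (s0 := / (1 + Rabs kappa)). note (Rabs_pos kappa) as Hk.
 have Hs : 0 < s0. assert (Hs1 : s0 <= 1). { rewrite <- Rinv_1. side. }
 assert (Hcos : forall u, 0 <= u <= s0 -> 1 / 2 <= cos (kappa * u)).
 { intros u Hu. apply cos_ge_half. rewrite Rabs_mult, (Rabs_pos_eq u) by lra. have : s0 * (1 + Rabs kappa) = 1. nra. }
 set (c1 := cosh (s0 / 2)). set (c0 := cosh s0). assert (Hc : c1 < c0) by (apply cosh_lt; lra). assert (Hc1 : c1 <= 2).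
 { apply Rle_trans with (2 := cosh_half_le_2). apply cosh_mono; lra. } set (B' := B * exp c0). have HB' : 0 < B'.
 (* From here on v (c0 - c1) >= 8 B' / s0, and e^z >= z makes the tail at most half of the
    contribution near 0. *)
 set (v0 := Rmax 1 (8 * B' / (s0 * (c0 - c1)))). exists v0, (s0 / 8). split; [apply Rmax_l|]. split; [lra|].
 intros v Hv. assert (Hv1 : 1 <= v) by (apply Rle_trans with (2 := Hv); apply Rmax_l).
 assert (Hv2 : 8 * B' / (s0 * (c0 - c1)) <= v) by (apply Rle_trans with (2 := Hv); apply Rmax_r).
 destruct (improper_spec (bk kappa 0 v) _ 1 Rlt_0_1 (bk_continuous _ _ _) (bk_bound kappa 0 v 1 !! Rlt_0_1)) as [_ T].
 specialize (T s0 (B' * exp (- v * c0)) !!).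
 assert (T1 : forall u, s0 <= u -> Rabs (bk kappa 0 v u) <= B' * exp (- v * c0) * exp (- (1) * u)).
 { intros u Hu. unfold bk. rewrite pow_O, Rmult_1_l, Rabs_mult. via (exp (- v * cosh u)).
  - rewrite Rabs_pos_eq by (left; apply exp_pos). rewrite <- (Rmult_1_r (exp (- v * cosh u))) at 2.
   apply Rmult_le_compat_l; [left; apply exp_pos|]. apply Rabs_le. apply COS_bound.
  - specialize (D u !!). assert (c0 <= cosh u) by (apply cosh_mono; lra).
   via (exp (- (v - 1) * c0) * exp (- (1) * cosh u)).
   + rewrite <- exp_plus. apply exp_le_mono. nra.
   + unfold B'. replace (exp (- (v - 1) * c0)) with (exp c0 * exp (- v * c0)) by (rewrite <- exp_plus; f_equal; ring).
    have : 0 < exp c0 * exp (- v * c0). nra. }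
 specialize (T T1). fold (KB kappa 0 v) in T. assert (I : s0 / 4 * exp (- v * c1) <= RInt (bk kappa 0 v) 0 s0).
 { assert (Ex : forall x y, ex_RInt (bk kappa 0 v) x y).
  { intros. apply (ex_RInt_continuous (bk kappa 0 v)). intros; apply bk_continuous. }
  rewrite <- (RInt_Chasles (bk kappa 0 v) 0 (s0 / 2) s0) by apply Ex.
  assert (A1 : s0 / 4 * exp (- v * c1) <= RInt (bk kappa 0 v) 0 (s0 / 2)).
  { note (is_RInt_const (V := R_NormedModule) 0 (s0 / 2) (exp (- v * c1) / 2)) as K.
   note (is_RInt_le _ _ _ _ _ _ (!! : 0 <= s0 / 2) K (RInt_correct _ _ _ (Ex 0 (s0 / 2)))) as L.
   replace (s0 / 4 * exp (- v * c1)) with ((s0 / 2 - 0) * (exp (- v * c1) / 2)) by field. apply L. intros x Hx.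
   unfold bk. note (Hcos x !!). assert (exp (- v * c1) <= exp (- v * cosh x)).
   { apply exp_le_mono. assert (cosh x <= c1) by (apply cosh_mono; lra). nra. } note (exp_pos (- v * c1)). nra. }
  assert (A2 : 0 <= RInt (bk kappa 0 v) (s0 / 2) s0).
  { apply RInt_ge_0; [lra|side|]. intros x Hx. unfold bk. note (Hcos x !!). note (exp_pos (- v * cosh x)). nra. }
  unfold plus; simpl. lra. }
 assert (Small : B' * exp (- v * c0) <= s0 / 8 * exp (- v * c1)).
 { replace (exp (- v * c0)) with (exp (- v * c1) * / exp (v * (c0 - c1))).
  2: { rewrite <- exp_Ropp, <- exp_plus. f_equal. ring. } assert (B' * / exp (v * (c0 - c1)) <= s0 / 8).
  { note (exp_pos (v * (c0 - c1))). note (exp_ineq1_le (v * (c0 - c1))). cancel_r (exp (v * (c0 - c1))).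
   rewrite Rmult_assoc, Rinv_l, Rmult_1_r by lra. have : 8 * B' / (s0 * (c0 - c1)) * (s0 * (c0 - c1)) = 8 * B'.
   have : 0 < s0 * (c0 - c1). side. }
  note (exp_pos (- v * c1)). nra. }
 assert (E1 : exp (- (1) * s0) <= 1). { via (exp 0); [apply exp_le_mono; lra|rewrite exp_0; lra]. }
 assert (E2 : exp (- 2 * v) <= exp (- v * c1)) by (apply exp_le_mono; nra). note (exp_pos (- v * c0)).
 assert (B' * exp (- v * c0) / 1 * exp (- (1) * s0) <= B' * exp (- v * c0)).
 { unfold Rdiv. rewrite Rinv_1, Rmult_1_r. rewrite <- (Rmult_1_r (B' * exp (- v * c0))) at 2. side. }
 apply Rabs_le_between in T. side.
Qed.

(** * Farey arcs *)

(** Mediants are inserted between Farey neighbours until q + q' > K. The mediant then cuts the last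
    interval into half arcs of lengths 1/(q (q + q')) and 1/(q' (q + q')), and K < q + q' <= 2 K.
    Stated as an induction principle for interval properties, it yields the list of arcs,
    Dirichlet's approximation and the summation of kernel estimates over the circle. *)
Lemma stern_brocot (Pr : R -> R -> Prop) (K : Z) :
  (forall a b c, a <= b -> b <= c -> Pr a b -> Pr b c -> Pr a c) ->
  (forall p q l, (1 <= q <= K)%Z -> Z.gcd p q = 1%Z ->
     / (2 * IZR q * IZR K) <= l -> l <= / (IZR q * IZR K) -> Pr (IZR p / IZR q) (IZR p / IZR q + l)) ->
  (forall p q l, (1 <= q <= K)%Z -> Z.gcd p q = 1%Z ->
     / (2 * IZR q * IZR K) <= l -> l <= / (IZR q * IZR K) -> Pr (IZR p / IZR q - l) (IZR p / IZR q)) ->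
  (1 <= K)%Z -> forall m1 m2 : Z, (m1 < m2)%Z -> Pr (IZR m1) (IZR m2).
Proof.
 intros Add Ri Le HK.
 (* [n] bounds 2 K - (q + q'), which drops with every mediant; at n = 0 one already has q + q' >
    K. *)
 assert (Adj : forall n p q p' q', (p' * q - p * q' = 1)%Z -> (1 <= q <= K)%Z -> (1 <= q' <= K)%Z -> (2 * K - (q + q') <= Z.of_nat n)%Z -> Pr (IZR p / IZR q) (IZR p' / IZR q')).
 { assert (G1 : forall p q p' q', (p' * q - p * q' = 1)%Z -> Z.gcd p q = 1%Z).
  { intros p q p' q' E. apply Zgcd_1_rel_prime. apply bezout_rel_prime. apply (Bezout_intro _ _ _ (- q') p'). lia. }
  assert (G2 : forall p q p' q', (p' * q - p * q' = 1)%Z -> Z.gcd p' q' = 1%Z).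
  { intros p q p' q' E. apply Zgcd_1_rel_prime. apply bezout_rel_prime. apply (Bezout_intro _ _ _ q (- p)). lia. }
  assert (Med : forall p q p' q', (p' * q - p * q' = 1)%Z -> (1 <= q)%Z -> (1 <= q')%Z -> IZR (p + p') / IZR (q + q') = IZR p / IZR q + / (IZR q * IZR (q + q')) /\ IZR (p + p') / IZR (q + q') = IZR p' / IZR q' - / (IZR q' * IZR (q + q'))).
  { intros p q p' q' E H1 H2. eapply f_equal in E. rewrite minus_IZR, !mult_IZR in E. rewrite !plus_IZR. split.
   - replace (IZR p / IZR q + / (IZR q * (IZR q + IZR q'))) with ((IZR p * (IZR q + IZR q') + 1) / (IZR q * (IZR q + IZR q'))) by side.
    rewrite <- E. side.
   - replace (IZR p' / IZR q' - / (IZR q' * (IZR q + IZR q'))) with ((IZR p' * (IZR q + IZR q') - 1) / (IZR q' * (IZR q + IZR q'))) by side.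
    rewrite <- E. side. }
  assert (Arc : forall p q p' q', (p' * q - p * q' = 1)%Z -> (1 <= q <= K)%Z -> (1 <= q' <= K)%Z -> (K < q + q')%Z -> Pr (IZR p / IZR q) (IZR p' / IZR q')).
  { intros p q p' q' E H1 H2 H3. destruct (Med p q p' q' E !! !!) as [M1 M2]. have Q1 : 1 <= IZR q.
   have Q2 : 1 <= IZR q'. have Q3 : 1 <= IZR K. have Q4 : IZR K <= IZR (q + q').
   assert (Q5 : IZR (q + q') <= 2 * IZR K) by (rewrite <- mult_IZR; apply IZR_le; lia).
   have I1 : 0 < / (IZR q * IZR (q + q')). have I2 : 0 < / (IZR q' * IZR (q + q')).
   apply Add with (IZR (p + p') / IZR (q + q')).
   - side.
   - side.
   - rewrite M1. apply Ri; trivial.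
    + side.
    + apply Rinv_le_contravar; nra.
    + side.
   - rewrite M2. apply Le; trivial.
    + side.
    + apply Rinv_le_contravar; nra.
    + side. }
  induction n as [|n IH]; intros p q p' q' E H1 H2 H3.
  - apply Arc; trivial. lia.
  - destruct (Z_lt_le_dec K (q + q')) as [H|H]; [side|]. destruct (Med p q p' q' E !! !!) as [M1 M2].
   have I1 : 0 < / (IZR q * IZR (q + q')). have I2 : 0 < / (IZR q' * IZR (q + q')).
   apply Add with (IZR (p + p') / IZR (q + q')).
   + side.
   + side.
   + apply IH; lia.
   + apply IH; lia. }
 assert (One : forall m, Pr (IZR m) (IZR (m + 1))).
 { intros m. replace (IZR m) with (IZR m / IZR 1) by side. replace (IZR (m + 1)) with (IZR (m + 1) / IZR 1) by side.
  apply (Adj (Z.to_nat (2 * K))); lia. }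
 assert (Many : forall n m, Pr (IZR m) (IZR (m + Z.of_nat (S n)))).
 { induction n as [|n IH]; intros m; [side|]. apply Add with (IZR (m + Z.of_nat (S n))).
  - side.
  - side.
  - side.
  - replace (m + Z.of_nat (S (S n)))%Z with (m + Z.of_nat (S n) + 1)%Z by lia. side. }
 intros m1 m2 H. replace m2 with (m1 + Z.of_nat (S (Z.to_nat (m2 - m1 - 1))))%Z by lia. side.
Qed.

Record half_arc := { arc_p : Z; arc_q : Z; arc_right : bool; arc_lo : R; arc_hi : R }.

Definition arc_key (a : half_arc) := (arc_p a, arc_q a, arc_right a).

Definition good_arc (Q : Z) (a : half_arc) : Prop :=
  (1 <= arc_q a <= Q)%Z /\ Z.gcd (arc_p a) (arc_q a) = 1%Z /\
  arc_lo a < arc_hi a /\ arc_hi a - arc_lo a <= / (IZR (arc_q a) * IZR Q) /\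
  (if arc_right a then arc_lo a = IZR (arc_p a) / IZR (arc_q a)
   else arc_hi a = IZR (arc_p a) / IZR (arc_q a)).

(** Quantifying over all interval-additive [Phi] expresses that the arcs tile [m1, m2]; it is
    applied to integrals and to lengths. Keys are distinct because two arcs with the same key would
    start, or end, at the same fraction on the same side of it. *)
Lemma farey_arcs (Q : Z) (m1 m2 : Z) : (1 <= Q)%Z -> (m1 < m2)%Z -> exists l : list half_arc,
  NoDup (map arc_key l) /\
  (forall a, In a l -> good_arc Q a /\ IZR m1 <= arc_lo a /\ arc_hi a <= IZR m2) /\
  (forall Phi : R -> R -> C, (forall a b c, a <= b -> b <= c -> Phi a c = (Phi a b + Phi b c)%C) ->
     Csum (fun a => Phi (arc_lo a) (arc_hi a)) l = Phi (IZR m1) (IZR m2)).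
Proof.
 intros HQ Hm.
 apply (stern_brocot (fun x y => exists l : list half_arc, NoDup (map arc_key l) /\ (forall a, In a l -> good_arc Q a /\ x <= arc_lo a /\ arc_hi a <= y) /\ (forall Phi : R -> R -> C, (forall a b c, a <= b -> b <= c -> Phi a c = (Phi a b + Phi b c)%C) -> Csum (fun a => Phi (arc_lo a) (arc_hi a)) l = Phi x y)) Q); trivial.
 - intros a b c Hab Hbc (l1 & N1 & G1 & S1) (l2 & N2 & G2 & S2). exists (l1 ++ l2). split; [|split].
  + rewrite map_app. apply NoDup_app; trivial. intros k Hk1 Hk2. apply in_map_iff in Hk1. apply in_map_iff in Hk2.
   destruct Hk1 as (x & Ex & Ix). destruct Hk2 as (y & Ey & Iy).
   destruct (G1 x Ix) as ((_ & _ & L1 & _ & R1) & B1 & B2). destruct (G2 y Iy) as ((_ & _ & L2 & _ & R2) & B3 & B4).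
   rewrite <- Ey in Ex. inversion Ex as [[E1 E2 E3]]. rewrite E1, E2, E3 in R1. destruct (arc_right y); lra.
  + intros x Hx. apply in_app_iff in Hx. destruct Hx as [Hx|Hx].
   * destruct (G1 x Hx) as (B1 & B2 & B3). side.
   * destruct (G2 x Hx) as (B1 & B2 & B3). side.
  + intros Phi HP. rewrite Csum_app, S1, S2 by assumption. symmetry. side.
 - intros p q l H1 H2 H3 H4. have : 0 < / (2 * IZR q * IZR Q).
  exists ({| arc_p := p; arc_q := q; arc_right := true; arc_lo := IZR p / IZR q; arc_hi := IZR p / IZR q + l |} :: nil).
  split; [|split].
  + constructor; [side|constructor].
  + intros a [<-|[]]. unfold good_arc; simpl. side.
  + intros Phi HP. simpl. ring.
 - intros p q l H1 H2 H3 H4. have : 0 < / (2 * IZR q * IZR Q).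
  exists ({| arc_p := p; arc_q := q; arc_right := false; arc_lo := IZR p / IZR q - l; arc_hi := IZR p / IZR q |} :: nil).
  split; [|split].
  + constructor; [side|constructor].
  + intros a [<-|[]]. unfold good_arc; simpl. side.
  + intros Phi HP. simpl. ring.
Qed.

Lemma dirichlet (x : R) (Q : Z) : (1 <= Q)%Z -> exists p q : Z,
  (1 <= q <= Q)%Z /\ Z.gcd p q = 1%Z /\ IZR q * Rabs (x - IZR p / IZR q) <= / IZR Q.
Proof.
 intros HQ. destruct (archimed x) as [A1 A2].
 assert (Bd : forall p q l, (1 <= q <= Q)%Z -> Z.gcd p q = 1%Z -> l <= / (IZR q * IZR Q) -> Rabs (x - IZR p / IZR q) <= l -> IZR q * Rabs (x - IZR p / IZR q) <= / IZR Q).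
 { intros p q l H1 H2 H3 H4. via (IZR q * / (IZR q * IZR Q)).
  - side.
  - side. }
 apply (stern_brocot (fun a b => a <= x <= b -> exists p q : Z, (1 <= q <= Q)%Z /\ Z.gcd p q = 1%Z /\ IZR q * Rabs (x - IZR p / IZR q) <= / IZR Q) Q) with (m1 := (up x - 1)%Z) (m2 := up x); trivial; try lia.
 - intros a b c _ _ H1 H2 H. destruct (Rle_dec x b); [apply H1|apply H2]; lra.
 - intros p q l H1 H2 _ H3 H4. exists p, q. repeat split; try lia; trivial. apply (Bd p q l); trivial. side.
 - intros p q l H1 H2 _ H3 H4. exists p, q. repeat split; try lia; trivial. apply (Bd p q l); trivial. side.
 - rewrite minus_IZR. lra.
Qed.

(** * Symmetric partial sums over 0 < |n| <= N and Fourier coefficients *)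

Definition zs (N : nat) : list Z :=
  flat_map (fun j => Z.of_nat j :: (- Z.of_nat j)%Z :: nil) (seq 1 N).

Lemma zs_S N : zs (S N) = zs N ++ (Z.of_nat (S N) :: (- Z.of_nat (S N))%Z :: nil).
Proof. unfold zs. rewrite seq_S, flat_map_app. side. Qed.

Lemma in_zs N n : In n (zs N) <-> (n <> 0 /\ Z.abs n <= Z.of_nat N)%Z.
Proof.
 unfold zs. rewrite in_flat_map. split.
 - intros (j & Hj & Hn). apply in_seq in Hj. simpl in Hn. lia.
 - intros [H1 H2]. exists (Z.to_nat (Z.abs n)). split; [apply in_seq; lia|]. simpl. lia.
Qed.

Lemma NoDup_zs N : NoDup (zs N).
Proof.
 induction N; [constructor|]. rewrite zs_S. apply NoDup_app; trivial.
 - constructor; [simpl; lia|]. constructor; [side|constructor].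
 - intros n H1 H2. apply in_zs in H1. simpl in H2. lia.
Qed.

Lemma Csum_zs_S (f : Z -> C) N :
  Csum f (zs (S N)) = (Csum f (zs N) + (f (Z.of_nat (S N)) + f (- Z.of_nat (S N))%Z))%C.
Proof. rewrite zs_S, Csum_app. unfold Csum at 2. cbn [fold_right]. ring. Qed.

Lemma Cmod_le_abs_sum (z : C) : Cmod z <= Rabs (fst z) + Rabs (snd z).
Proof.
 note (Rabs_pos (fst z)) as H1. note (Rabs_pos (snd z)) as H2. unfold Cmod. rewrite <- pow2_abs, <- (pow2_abs (snd z)).
 rewrite <- sqrt_pow2 by lra. apply sqrt_le_1_alt. nra.
Qed.

Lemma series_Cmod_cv (s : nat -> C) (l : C) : is_series (V := C_R_NormedModule) s l ->
  forall eps, 0 < eps -> exists N0, forall n, (N0 <= n)%nat ->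
    Cmod (sum_n (G := C_AbelianMonoid) s n - l)%C < eps.
Proof.
 intros H eps He.
 destruct (proj1 (filterlim_locally (F := eventually) (sum_n (G := C_R_NormedModule) s) l) H (mkposreal (eps / 2) !!)) as [N0 HN].
 exists N0. intros n Hn. destruct (HN n Hn) as [H1 H2].
 change (Rabs (fst (sum_n (G := C_AbelianMonoid) s n) - fst l) < eps / 2) in H1.
 change (Rabs (snd (sum_n (G := C_AbelianMonoid) s n) - snd l) < eps / 2) in H2.
 eapply Rle_lt_trans; [apply Cmod_le_abs_sum|]. unfold Cminus, Cplus, Copp; cbn [fst snd]. unfold Rminus in *. lra.
Qed.

Lemma series_terms_bounded (s : nat -> C) (l : C) : is_series (V := C_R_NormedModule) s l ->
  exists B, 0 < B /\ forall j, Cmod (s j) <= B.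
Proof.
 intros H. destruct (series_Cmod_cv s l H 1 Rlt_0_1) as [N0 HN]. set (T := Rsum (fun j => Cmod (s j)) (seq 0 (S N0))).
 assert (HT : 0 <= T) by (apply Rsum_nonneg; intros; apply Cmod_ge_0). exists (T + 2). split; [lra|]. intros j.
 destruct (le_lt_dec j N0) as [Hj|Hj].
 - unfold T. assert (I : In j (seq 0 (S N0))) by (apply in_seq; lia).
  assert (Rsum (fun j => Cmod (s j)) (j :: nil) <= Rsum (fun j => Cmod (s j)) (seq 0 (S N0))).
  { apply Rsum_incl; [constructor; [side|constructor]| |side]. intros x [<-|[]]; assumption. } simpl in H0. simpl. lra.
 - destruct j as [|j]; [lia|]. note (HN (S j) !!) as H1. note (HN j !!) as H2. rewrite sum_Sn in H1.
  change plus with Cplus in H1.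
  replace (s (S j)) with ((sum_n (G := C_AbelianMonoid) s j + s (S j) - l) - (sum_n (G := C_AbelianMonoid) s j - l))%C by ring.
  upto Cmod_triangle. rewrite Cmod_opp. side.
Qed.

Lemma sum_nonzero_cv (a : Z -> C) (l : C) : is_sum_nonzero a l ->
  forall eps, 0 < eps -> exists N0, forall N, (N0 <= N)%nat -> Cmod (Csum a (zs N) - l)%C < eps.
Proof.
 intros (lp' & ln' & H1 & H2 & E) eps He. destruct (series_Cmod_cv _ _ H1 (eps / 2) !!) as [N1 HN1].
 destruct (series_Cmod_cv _ _ H2 (eps / 2) !!) as [N2 HN2].
 assert (K : forall N, Csum a (zs (S N)) = (sum_n (G := C_AbelianMonoid) (fun j => a (Z.of_nat (S j))) N + sum_n (G := C_AbelianMonoid) (fun j => a (- Z.of_nat (S j))%Z) N)%C).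
 { induction N.
  - rewrite !sum_O. simpl. ring.
  - rewrite Csum_zs_S, IHN, !sum_Sn. change (@plus C_AbelianMonoid) with Cplus. ring. }
 exists (S (Nat.max N1 N2)). intros N HN. destruct N as [|N]; [lia|]. rewrite K, E. specialize (HN1 N !!).
 specialize (HN2 N !!).
 match goal with |- Cmod ?z < _ => replace z with ((sum_n (G := C_AbelianMonoid) (fun j => a (Z.of_nat (S j))) N - lp') + (sum_n (G := C_AbelianMonoid) (fun j => a (- Z.of_nat (S j))%Z) N - ln'))%C by ring end.
 eapply Rle_lt_trans; [apply Cmod_triangle|]. lra.
Qed.

(* [sum_(j > N) 1 / j ^ 2 <= 2 / (N + 1)], in telescoping form. *)
Lemma tail_bound (a : Z -> C) (B : R) : (forall n, n <> 0%Z -> Cmod (a n) <= B / IZR n ^ 2) ->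
  forall N M, (N <= M)%nat ->
  Cmod (Csum a (zs M) - Csum a (zs N))%C <= 4 * B * (/ INR (S N) - / INR (S M)).
Proof.
 intros H N M HNM. induction HNM as [|M HNM IH].
 - replace (Csum a (zs N) - Csum a (zs N))%C with (RtoC 0) by ring. rewrite Cmod_0. lra.
 - rewrite Csum_zs_S.
  match goal with |- Cmod ?z <= _ => replace z with ((Csum a (zs M) - Csum a (zs N)) + (a (Z.of_nat (S M)) + a (- Z.of_nat (S M))%Z))%C by ring end.
  upto Cmod_triangle. assert (T : Cmod (a (Z.of_nat (S M)) + a (- Z.of_nat (S M))%Z)%C <= 2 * B / INR (S M) ^ 2).
  { upto Cmod_triangle. note (H (Z.of_nat (S M)) !!) as K1. note (H (- Z.of_nat (S M))%Z !!) as K2.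
   rewrite opp_IZR in K2. rewrite <- INR_IZR_INZ in K1, K2.
   replace ((- INR (S M)) ^ 2) with (INR (S M) ^ 2) in K2 by ring. lra. }
  assert (HB : 0 <= B). { note (H 1%Z !!). note (Cmod_ge_0 (a 1%Z)). side. } rewrite (S_INR (S M)) in *.
  assert (Hm : 1 <= INR (S M)) by (rewrite S_INR; note (pos_INR M); lra). set (m := INR (S M)) in *.
  assert (2 * B / m ^ 2 <= 4 * B * (/ m - / (m + 1))).
  { replace (4 * B * (/ m - / (m + 1))) with (4 * B / (m * (m + 1))) by side. unfold Rdiv.
   replace (2 * B * / m ^ 2) with (B * (2 * / m ^ 2)) by ring.
   replace (4 * B * / (m * (m + 1))) with (B * (4 * / (m * (m + 1)))) by ring. mul_l. cancel_r (m ^ 2 * (m + 1)).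
   replace (2 * / m ^ 2 * (m ^ 2 * (m + 1))) with (2 * (m + 1)) by side.
   replace (4 * / (m * (m + 1)) * (m ^ 2 * (m + 1))) with (4 * m) by side. lra. }
  lra.
Qed.

Lemma tail_bound_lim (a : Z -> C) (l : C) (B : R) : (forall n, n <> 0%Z -> Cmod (a n) <= B / IZR n ^ 2) ->
  (forall eps, 0 < eps -> exists N0, forall N, (N0 <= N)%nat -> Cmod (Csum a (zs N) - l)%C < eps) ->
  forall N, Cmod (l - Csum a (zs N))%C <= 4 * B / INR (S N).
Proof.
 intros H Cv N. apply Rnot_lt_le. intros Hlt. assert (HB : 0 <= B). { note (H 1%Z !!). note (Cmod_ge_0 (a 1%Z)). side. }
 destruct (Cv (Cmod (l - Csum a (zs N))%C - 4 * B / INR (S N)) !!) as [N0 HN0]. specialize (HN0 (Nat.max N N0) !!).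
 note (tail_bound a B H N (Nat.max N N0) !!) as T. assert (0 < / INR (S (Nat.max N N0))).
 { apply Rinv_0_lt_compat. side. }
 assert (Cmod (l - Csum a (zs N))%C <= Cmod (Csum a (zs (Nat.max N N0)) - l)%C + Cmod (Csum a (zs (Nat.max N N0)) - Csum a (zs N))%C).
 { replace (l - Csum a (zs N))%C with (- (Csum a (zs (Nat.max N N0)) - l) + (Csum a (zs (Nat.max N N0)) - Csum a (zs N)))%C by ring.
  upto Cmod_triangle. rewrite Cmod_opp. lra. }
 side.
Qed.

(** A uniform error O(1/N) allows termwise integration without infinite series: the integral differs
    from [a m] by at most B / (N + 1) for every N >= |m|, hence not at all. *)
Lemma fourier_coefficient (f : R -> C) (a : Z -> C) (B : R) :
  (forall x, ccont f x) ->
  (forall N x, Cmod (f x - Csum (fun n => a n * e (IZR n * x)) (zs N))%C <= B / INR (S N)) ->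
  forall m, m <> 0%Z -> is_cint (fun x => (f x * e (- (IZR m * x)))%C) 0 1 (a m).
Proof.
 intros Cf Hf m Hm. set (g := fun x => (f x * e (- (IZR m * x)))%C).
 have Ce : forall (n : Z) x, ccont (fun x => e (- (IZR n * x))) x. assert (Ig : is_cint g 0 1 (cint g 0 1)).
 { apply cint_ok; [lra|]. side. } assert (HB : 0 <= B).
 { note (Hf 0%nat 0). note (Cmod_ge_0 (f 0 - Csum (fun n => a n * e (IZR n * 0)) (zs 0))%C). simpl INR in H. side. }
 assert (Bd : forall N, (Z.abs m <= Z.of_nat N)%Z -> Cmod (cint g 0 1 - a m)%C <= B / INR (S N)).
 { intros N HN. set (s := fun x => (Csum (fun n => (a n * e (IZR n * x))%C) (zs N) * e (- (IZR m * x)))%C).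
  assert (Is : is_cint s 0 1 (a m)).
  { assert (S1 : forall l, NoDup l -> In m l -> Csum (fun n => if Z.eq_dec n m then a n else RtoC 0) l = a m).
   { induction l as [|n l IH]; intros Nd I; [destruct I|]. inversion Nd; subst. simpl. destruct (Z.eq_dec n m) as [E|E].
    - subst n. rewrite (Csum_ext _ (fun _ => RtoC 0)), Csum_0; [ring|]. intros n Hn.
     destruct (Z.eq_dec n m); [subst; contradiction|side].
    - destruct I as [I|I]; [side|]. rewrite IH; trivial. ring. }
   rewrite <- (S1 (zs N) (NoDup_zs N)) by (apply in_zs; lia). eapply is_cint_ext.
   2: { apply (is_cint_Csum (fun n x => (a n * e (IZR (n - m) * x))%C)). intros n Hn. destruct (Z.eq_dec n m) as [E|E].
    - subst n. rewrite Z.sub_diag. note (is_cint_scal _ _ _ _ (a m) is_cint_e_0) as K.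
     replace (a m * 1)%C with (a m) in K by ring. side.
    - note (is_cint_scal _ _ _ _ (a n) (is_cint_e_Z (n - m) !!)) as K. replace (a n * 0)%C with (RtoC 0) in K by ring.
     side. }
   intros x _. unfold s. rewrite Cmult_comm, <- Csum_scal. apply Csum_ext. intros n _. rewrite minus_IZR.
   replace ((IZR n - IZR m) * x) with (IZR n * x + - (IZR m * x)) by ring. rewrite e_plus. ring. }
  replace (B / INR (S N)) with ((1 - 0) * (B / INR (S N))) by ring.
  apply (cint_bound (fun x => (g x - s x)%C) 0 1); [lra| |apply is_cint_minus; assumption]. intros x _.
  unfold g, s.
  replace (f x * e (- (IZR m * x)) - Csum (fun n => a n * e (IZR n * x)) (zs N) * e (- (IZR m * x)))%C with ((f x - Csum (fun n => a n * e (IZR n * x)) (zs N)) * e (- (IZR m * x)))%C by ring.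
  rewrite Cmod_mult, Cmod_e, Rmult_1_r. side. }
 assert (E : (cint g 0 1 - a m)%C = RtoC 0).
 { apply Cmod_eq_0. apply Rle_antisym; [|side]. apply Rnot_lt_le. intros Hlt. set (d := Cmod (cint g 0 1 - a m)%C) in *.
  destruct (nfloor_ex (B / d)) as [n0 [_ Hn0]]; [side|]. set (N := Nat.max n0 (Z.to_nat (Z.abs m))).
  note (Bd N ltac:(unfold N; lia)) as K. fold d in K. assert (L : INR n0 + 1 <= INR (S N)). { rewrite <- S_INR. side. }
  assert (B < d * INR (S N)).
  { apply Rlt_le_trans with (d * (INR n0 + 1)).
   - replace B with (d * (B / d)) at 1 by side. side.
   - side. }
  assert (d * INR (S N) <= B); [|lra]. replace B with (B / INR (S N) * INR (S N)) by side. side. }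
 replace (a m) with (cint g 0 1); [side|]. replace (cint g 0 1) with (a m + (cint g 0 1 - a m))%C by ring. rewrite E.
 ring.
Qed.

(** * The cusp form near the real line *)

Lemma Rpower_anti x y a : 0 < x -> x <= y -> 0 <= a -> Rpower y (- a) <= Rpower x (- a).
Proof. intros. rewrite !Rpower_Ropp. side. Qed.

Lemma Rabs_IZR_ge_1 n : n <> 0%Z -> 1 <= Rabs (IZR n).
Proof. intros. rewrite Rabs_Zabs. side. Qed.

Section Form.
Variables (kappa theta : R) (psi : C -> C) (t : Z -> C).
Hypotheses (Hpsi : maass_cusp_form kappa psi) (Hparity : even_form psi \/ odd_form psi)
 (Hfourier : fourier_expansion kappa psi t) (Htheta : 0 <= theta) (Hcoeff : coeff_exponent t theta).

Definition wt (n : Z) (y : R) : R := sqrt y * KB kappa 0 (2 * PI * Rabs (IZR n) * y).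

Lemma psi_path_continuous (x y : R -> R) u :
  continuous x u -> continuous y u -> 0 < y u -> ccont (fun u => psi (x u, y u)) u.
Proof.
 intros Cx Cy Hy. destruct (mcf_smooth _ _ Hpsi) as [S1 S2]. destruct (S1 0%nat (x u) (y u) Hy) as [K1 _].
 destruct (S2 0%nat (x u) (y u) Hy) as [K2 _]. apply continuity_2d_pt_filterlim in K1.
 apply continuity_2d_pt_filterlim in K2. split.
 - apply (continuous_comp_2 x y (re_part psi)); assumption.
 - apply (continuous_comp_2 x y (im_part psi)); assumption.
Qed.

(** This is (a z + b)/(c z + d) = a/c - 1/(c^2 (z + d/c)), split into real and imaginary part. *)
Lemma psi_mobius a b c d x y : (a * d - b * c = 1)%Z -> c <> 0%Z -> 0 < y ->
  let w := x + IZR d / IZR c in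
  psi (x, y) = psi (IZR a / IZR c - w / (IZR c ^ 2 * (w ^ 2 + y ^ 2)), y / (IZR c ^ 2 * (w ^ 2 + y ^ 2))).
Proof.
 intros E Hc Hy w. rewrite <- (mcf_modular _ _ Hpsi a b c d (x, y) E Hy). f_equal. eapply f_equal in E.
 rewrite minus_IZR, !mult_IZR in E. assert (Hc' : IZR c <> 0) by (apply IZR_neq; assumption).
 have Hw : x = w - IZR d / IZR c. have Hq : w ^ 2 + y ^ 2 <> 0. unfold Cdiv, Cinv, Cmult, Cplus, RtoC; cbn [fst snd].
 set (X := IZR c * x + IZR d). assert (Ea : IZR a * x + IZR b = (IZR a * (IZR c * w) - 1) / IZR c).
 { rewrite <- E. side. } assert (Hq2 : (IZR c * w) ^ 2 + (IZR c * y) ^ 2 <> 0).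
 { replace ((IZR c * w) ^ 2 + (IZR c * y) ^ 2) with (IZR c ^ 2 * (w ^ 2 + y ^ 2)) by ring.
  apply Rmult_integral_contrapositive_currified; side. }
 replace (IZR c * x - 0 * y + IZR d) with (IZR c * w) by side.
 replace (IZR a * x - 0 * y + IZR b) with ((IZR a * (IZR c * w) - 1) / IZR c) by side.
 f_equal; field; repeat split; assumption.
Qed.

Lemma fourier_pointwise x y : 0 < y -> forall eps, 0 < eps -> exists N0, forall N, (N0 <= N)%nat ->
  Cmod (Csum (fun n => (t n * RtoC (wt n y) * e (IZR n * x))%C) (zs N) - psi (x, y))%C < eps.
Proof.
 intros Hy. note (Hfourier x y Hy) as F.
 assert (E : (fun n : Z => (sqrt y * t n * besselK_i kappa (2 * PI * Rabs (IZR n) * y) * e (IZR n * x))%C) = (fun n => (t n * RtoC (wt n y) * e (IZR n * x))%C)).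
 { apply FunctionalExtensionality.functional_extensionality. intros n. unfold wt. rewrite besselK_KB, RtoC_mult. ring. }
 rewrite E in F. apply sum_nonzero_cv; assumption.
Qed.

Lemma terms_bounded y : 0 < y -> exists B, 0 < B /\ forall n, n <> 0%Z -> Cmod (t n) * Rabs (wt n y) <= B.
Proof.
 intros Hy. destruct (Hfourier 0 y Hy) as (l1 & l2 & H1 & H2 & _).
 destruct (series_terms_bounded _ _ H1) as (B1 & HB1 & K1). destruct (series_terms_bounded _ _ H2) as (B2 & HB2 & K2).
 assert (E : forall n : Z, Cmod (sqrt y * t n * besselK_i kappa (2 * PI * Rabs (IZR n) * y) * e (IZR n * 0))%C = Cmod (t n) * Rabs (wt n y)).
 { intros n. rewrite !Cmod_mult, Cmod_e, !Cmod_R. unfold wt. rewrite besselK_KB, Rabs_mult. ring. } exists (B1 + B2).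
 split; [lra|]. intros n Hn. destruct (Z_lt_le_dec 0 n) as [H|H].
 - specialize (K1 (Z.to_nat (n - 1))). rewrite E in K1. replace (Z.of_nat (S (Z.to_nat (n - 1)))) with n in K1 by lia.
  lra.
 - specialize (K2 (Z.to_nat (- n - 1))). rewrite E in K2.
  replace (- Z.of_nat (S (Z.to_nat (- n - 1))))%Z with n in K2 by lia. lra.
Qed.

Lemma exp_neg_le_inv_sq x : 0 < x -> exp (- x) <= 4 / x ^ 2.
Proof.
 intros Hx. assert (H : x / 2 <= exp (x / 2)) by (note (exp_ineq1_le (x / 2)); lra).
 replace x with (x / 2 + x / 2) at 1 by field. rewrite exp_Ropp, exp_plus.
 replace (4 / x ^ 2) with (/ (x / 2 * (x / 2))) by side. side.
Qed.

Lemma abs_conv_large : exists y2 B, 0 < y2 /\ 0 < B /\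
  (forall n, n <> 0%Z -> wt n y2 <> 0) /\
  (forall n, n <> 0%Z -> Cmod (t n) * Rabs (wt n y2) <= B / IZR n ^ 2).
Proof.
 destruct (KB_lower kappa) as (v0 & c & Hv0 & Hc & L). destruct (KB_exp_upper kappa) as (B1 & HB1 & U).
 destruct (terms_bounded v0 !!) as (B & HB & K). note PI2_1 as Hpi.
 exists (8 * v0), (4 * (sqrt (8 * v0) * B1 * (B / (sqrt v0 * c)))). have S2 : 0 < sqrt (8 * v0). split; [lra|]. split.
 { side. } assert (Hm : forall n, n <> 0%Z -> v0 <= 2 * PI * Rabs (IZR n) * v0).
 { intros n Hn. note (Rabs_IZR_ge_1 n Hn). have : 1 <= 2 * PI * Rabs (IZR n). nra. } split.
 - intros n Hn. unfold wt. specialize (Hm n Hn). note (L (2 * PI * Rabs (IZR n) * (8 * v0)) !!) as L1.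
  note (exp_pos (- 2 * (2 * PI * Rabs (IZR n) * (8 * v0)))). have : 0 < KB kappa 0 (2 * PI * Rabs (IZR n) * (8 * v0)).
  side.
 - intros n Hn. note (Hm n Hn) as Hmn. specialize (K n Hn). unfold wt in *. set (x := 2 * PI * Rabs (IZR n) * v0) in *.
  note (L x Hmn) as L1. note (exp_pos (- 2 * x)) as E1. assert (Ht : Cmod (t n) <= B / (sqrt v0 * c) * exp (2 * x)).
  { rewrite Rabs_mult, (Rabs_pos_eq (sqrt v0)), (Rabs_pos_eq (KB kappa 0 x)) in K by side. note (Cmod_ge_0 (t n)).
   assert (Cmod (t n) * (sqrt v0 * (c * exp (- 2 * x))) <= B). { eapply Rle_trans; [|exact K]. side. }
   cancel_r (sqrt v0 * (c * exp (- 2 * x))). upto H0. right.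
   assert (E2 : exp (2 * x) * exp (- 2 * x) = 1) by (rewrite <- exp_plus, <- exp_0; f_equal; ring).
   replace (B / (sqrt v0 * c) * exp (2 * x) * (sqrt v0 * (c * exp (- 2 * x)))) with (B / (sqrt v0 * c) * (sqrt v0 * c) * (exp (2 * x) * exp (- 2 * x))) by ring.
   rewrite E2. side. }
  replace (2 * PI * Rabs (IZR n) * (8 * v0)) with (8 * x) by side.
  rewrite Rabs_mult, (Rabs_pos_eq (sqrt (8 * v0))) by lra. note (U (8 * x) !!) as U1.
  via (B / (sqrt v0 * c) * exp (2 * x) * (sqrt (8 * v0) * (B1 * exp (- (8 * x) / 2)))). { side. }
  via (sqrt (8 * v0) * B1 * (B / (sqrt v0 * c)) * exp (- x)).
  { replace (B / (sqrt v0 * c) * exp (2 * x) * (sqrt (8 * v0) * (B1 * exp (- (8 * x) / 2)))) with (sqrt (8 * v0) * B1 * (B / (sqrt v0 * c)) * (exp (2 * x) * exp (- (8 * x) / 2))) by ring.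
   apply Rmult_le_compat_l.
   - side.
   - rewrite <- exp_plus. apply exp_le_mono. lra. }
  replace (4 * (sqrt (8 * v0) * B1 * (B / (sqrt v0 * c))) / IZR n ^ 2) with (sqrt (8 * v0) * B1 * (B / (sqrt v0 * c)) * (4 / IZR n ^ 2)) by side.
  apply Rmult_le_compat_l.
  + side.
  + eapply Rle_trans; [apply exp_neg_le_inv_sq; lra|]. note (Rabs_IZR_ge_1 n Hn) as Hn1. rewrite <- (pow2_abs (IZR n)).
   mul_l. apply Rinv_le_contravar; [nra|]. apply pow_incr. split; [lra|]. unfold x. have : 1 <= 2 * PI * v0. nra.
Qed.

Lemma wt_neg n y : wt (- n) y = wt n y.
Proof. unfold wt. rewrite opp_IZR, Rabs_Ropp. side. Qed.

(** [coeff_exponent] speaks of n >= 1; parity carries it over to n < 0. The Fourier coefficients of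
    psi(x + iy) and psi(- x + iy) are compared at a height where the expansion converges absolutely
    and [wt] does not vanish. *)
Lemma coef_neg n : n <> 0%Z -> Cmod (t (- n)) = Cmod (t n).
Proof.
 intros Hn. destruct abs_conv_large as (y & B & Hy & HB & Nz & Bd). set (a := fun m => (t m * RtoC (wt m y))%C).
 assert (Ha : forall x m, m <> 0%Z -> Cmod (a m * e (IZR m * x))%C <= B / IZR m ^ 2).
 { intros x m Hm. unfold a. rewrite !Cmod_mult, Cmod_e, Cmod_R, Rmult_1_r. side. }
 assert (Ap : forall N x, Cmod (psi (x, y) - Csum (fun n => a n * e (IZR n * x)) (zs N))%C <= 4 * B / INR (S N)).
 { intros N x. apply tail_bound_lim; [side|]. apply fourier_pointwise; assumption. }
 assert (Cp : forall x, ccont (fun x => psi (x, y)) x). { intros x. apply psi_path_continuous; trivial; side. }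
 note (fourier_coefficient (fun x => psi (x, y)) a (4 * B) Cp Ap n Hn) as I1.
 assert (Rev : forall (f : Z -> C) N, Csum f (zs N) = Csum (fun m => f (- m)%Z) (zs N)).
 { intros f N. induction N; [side|]. rewrite !Csum_zs_S, IHN, Z.opp_involutive. ring. }
 assert (Ap2 : forall (N : nat) (x : R), Cmod (psi ((- x)%R, y) - Csum (fun n => a (- n)%Z * e (IZR n * x)) (zs N))%C <= 4 * B / INR (S N)).
 { intros N x. specialize (Ap N (- x)). rewrite Rev in Ap.
  replace (Csum (fun n0 : Z => (a (- n0)%Z * e (IZR n0 * x))%C) (zs N)) with (Csum (fun m : Z => (a (- m)%Z * e (IZR (- m) * - x))%C) (zs N)); [side|].
  apply Csum_ext. intros m _. rewrite opp_IZR. do 2 f_equal. ring. }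
 assert (Cp2 : forall x : R, ccont (fun x : R => psi ((- x)%R, y)) x).
 { intros x. apply (psi_path_continuous (fun x : R => - x) (fun _ : R => y)); trivial; [side|side]. }
 note (fourier_coefficient (fun x : R => psi ((- x)%R, y)) (fun m => a (- m)%Z) (4 * B) Cp2 Ap2 n Hn) as I2.
 assert (E : Cmod (a (- n)%Z) = Cmod (a n)).
 { destruct Hparity as [Hp|Hp].
  - f_equal. rewrite <- (cint_eq _ _ _ _ I1), <- (cint_eq _ _ _ _ I2). symmetry. apply cint_eq.
   eapply is_cint_ext; [|rewrite (cint_eq _ _ _ _ I2); exact I2]. intros x _. simpl. rewrite Hp by assumption.
   side.
  - replace (a (- n)%Z) with (- (a n))%C; [apply Cmod_opp|]. rewrite <- (cint_eq _ _ _ _ I2). symmetry.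
   apply cint_eq.
   eapply is_cint_ext; [|replace (- a n)%C with (RtoC (-1) * a n)%C; [apply is_cint_scal; exact I1|]].
   + intros x _. rewrite Hp by assumption. side.
   + side. }
 unfold a in E. rewrite wt_neg, !Cmod_mult in E. apply Rmult_eq_reg_r with (Cmod (RtoC (wt n y))); [side|].
 rewrite Cmod_R. apply Rabs_no_R0. side.
Qed.

Lemma coef_poly : exists B, 0 < B /\ forall n, n <> 0%Z -> Cmod (t n) <= B * Rpower (Rabs (IZR n)) (theta + 1).
Proof.
 destruct (Hcoeff 1 Rlt_0_1) as [B HB].
 assert (HB1 : forall n, (1 <= n)%Z -> Cmod (t n) <= (Rabs B + 1) * Rpower (Rabs (IZR n)) (theta + 1)).
 { intros n Hn. eapply Rle_trans; [apply HB; assumption|]. rewrite (Rabs_pos_eq (IZR n)) by side. mul_r.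
  note (Rle_abs B). lra. }
 exists (Rabs B + 1). split; [side|]. intros n Hn. destruct (Z_lt_le_dec 0 n) as [H|H]; [apply HB1; lia|].
 rewrite <- Z.opp_involutive at 1. rewrite coef_neg by lia. rewrite <- (Rabs_Ropp (IZR n)), <- opp_IZR. apply HB1. lia.
Qed.

Lemma wt_bound a : 0 < a -> exists B, 0 < B /\ forall n y, n <> 0%Z -> 0 < y ->
  Rabs (wt n y) <= B * sqrt y * Rpower (Rabs (IZR n) * y) (- a).
Proof.
 intros Ha. note PI2_1 as Hpi. exists (Rpower (a + INR 0) (a + INR 0) * Rpower 2 a / a). split. { side. }
 intros n y Hn Hy. note (Rabs_IZR_ge_1 n Hn). unfold wt. have Hny : 0 < Rabs (IZR n) * y.
 rewrite Rabs_mult, (Rabs_pos_eq (sqrt y)) by apply sqrt_pos.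
 note (KB_bound kappa 0 (2 * PI * Rabs (IZR n) * y) a ltac:(nra) Ha) as K.
 assert (K2 : Rpower (2 * PI * Rabs (IZR n) * y) (- (a + INR 0)) <= Rpower (Rabs (IZR n) * y) (- a)).
 { rewrite Rplus_0_r. apply Rpower_anti; try lra. nra. }
 have : 0 < Rpower (a + INR 0) (a + INR 0) * Rpower 2 a / a.
 have : Rabs (KB kappa 0 (2 * PI * Rabs (IZR n) * y)) <= Rpower (a + INR 0) (a + INR 0) * Rpower 2 a / a * Rpower (Rabs (IZR n) * y) (- a).
 note (sqrt_pos y). nra.
Qed.

Definition dwt (n : Z) (y : R) : R :=
  / (2 * sqrt y) * KB kappa 0 (2 * PI * Rabs (IZR n) * y)
  - sqrt y * (2 * PI * Rabs (IZR n)) * KB kappa 1 (2 * PI * Rabs (IZR n) * y).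

Lemma wt_derive n y : n <> 0%Z -> 0 < y -> is_derive (wt n) y (dwt n y).
Proof.
 intros Hn Hy. note PI_RGT_0. note (Rabs_IZR_ge_1 n Hn). unfold wt, dwt. set (c := 2 * PI * Rabs (IZR n)).
 have Hcy : 0 < c * y. note (KB_derive kappa 0 (c * y) Hcy) as D.
 assert (Ex : ex_derive (KB kappa 0) (c * y)) by (eexists; exact D). auto_derive.
 - side.
 - rewrite (is_derive_unique (fun x : R => KB kappa 0 x) _ _ D). side.
Qed.

Lemma dwt_continuous n y : n <> 0%Z -> 0 < y -> continuous (dwt n) y.
Proof.
 intros Hn Hy. note PI_RGT_0. note (Rabs_IZR_ge_1 n Hn). set (c := 2 * PI * Rabs (IZR n)). have Hcy : 0 < c * y.
 assert (Ex : ex_derive (KB kappa 0) (c * y)) by (eexists; apply KB_derive; exact Hcy).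
 assert (Ex1 : ex_derive (KB kappa 1) (c * y)) by (eexists; apply KB_derive; exact Hcy).
 apply (ex_derive_continuous (dwt n)). unfold dwt. fold c. auto_derive. side.
Qed.

(** The operator y d/dy does not change the size: in v [KB 1] v the factor v cancels the extra power
    that [KB_bound] loses at j = 1. *)
Lemma dwt_bound a : 0 < a -> exists B, 0 < B /\ forall n y, n <> 0%Z -> 0 < y ->
  y * Rabs (dwt n y) <= B * sqrt y * Rpower (Rabs (IZR n) * y) (- a).
Proof.
 intros Ha. note PI2_1 as Hpi. set (C0 := Rpower (a + INR 0) (a + INR 0) * Rpower 2 a / a).
 set (C1 := Rpower (a + INR 1) (a + INR 1) * Rpower 2 a / a). have H0 : 0 < C0. have H1 : 0 < C1. exists (C0 + C1).
 split; [lra|]. intros n y Hn Hy. note (Rabs_IZR_ge_1 n Hn) as Hn1. set (v := 2 * PI * Rabs (IZR n) * y).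
 have Hny : 0 < Rabs (IZR n) * y. have Hv : Rabs (IZR n) * y <= v. note (sqrt_lt_R0 y Hy) as Hs.
 note (sqrt_sqrt y !!) as Ess. assert (K0 : Rabs (KB kappa 0 v) <= C0 * Rpower (Rabs (IZR n) * y) (- a)).
 { eapply Rle_trans; [apply (KB_bound kappa 0 v a); lra|]. mul_l. rewrite Rplus_0_r. apply Rpower_anti; lra. }
 assert (K1 : v * Rabs (KB kappa 1 v) <= C1 * Rpower (Rabs (IZR n) * y) (- a)).
 { via (v * (C1 * Rpower v (- (a + INR 1)))). { mul_l. apply KB_bound; lra. }
  replace (v * (C1 * Rpower v (- (a + INR 1)))) with (C1 * Rpower v (- a)).
  - mul_l. apply Rpower_anti; lra.
  - replace (- a) with (1 + - (a + INR 1)) by (simpl; ring). rewrite Rpower_plus, Rpower_1 by lra. ring. }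
 assert (A1 : Rabs (/ (2 * sqrt y) * KB kappa 0 v - sqrt y * (2 * PI * Rabs (IZR n)) * KB kappa 1 v) <= / (2 * sqrt y) * Rabs (KB kappa 0 v) + sqrt y * (2 * PI * Rabs (IZR n)) * Rabs (KB kappa 1 v)).
 { upto Rabs_triang. rewrite Rabs_Ropp, !Rabs_mult. rewrite Rabs_pos_eq by side. side. }
 via (y * (/ (2 * sqrt y) * Rabs (KB kappa 0 v) + sqrt y * (2 * PI * Rabs (IZR n)) * Rabs (KB kappa 1 v))). { side. }
 replace (y * (/ (2 * sqrt y) * Rabs (KB kappa 0 v) + sqrt y * (2 * PI * Rabs (IZR n)) * Rabs (KB kappa 1 v))) with (sqrt y * (/ 2 * Rabs (KB kappa 0 v) + v * Rabs (KB kappa 1 v))).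
 2: { unfold v. replace (sqrt y) with (y / sqrt y) at 1 by (rewrite <- Ess at 1; field; lra).
  set (k0 := Rabs (KB kappa 0 (2 * PI * Rabs (IZR n) * y))). set (k1 := Rabs (KB kappa 1 (2 * PI * Rabs (IZR n) * y))).
  replace (y / sqrt y * (/ 2 * k0 + 2 * PI * Rabs (IZR n) * y * k1)) with (y * (/ (2 * sqrt y) * k0 + (y / sqrt y) * (2 * PI * Rabs (IZR n)) * k1)) by side.
  replace (y / sqrt y) with (sqrt y) by (rewrite <- Ess at 2; field; lra). side. }
 note (Rabs_pos (KB kappa 0 v)). side.
Qed.
End Form.

(** * Mean values of the coefficients, and the facts on the form used later *)

Lemma Rsum_zs_S (f : Z -> R) N :
  Rsum f (zs (S N)) = Rsum f (zs N) + (f (Z.of_nat (S N)) + f (- Z.of_nat (S N))%Z).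
Proof. rewrite zs_S, Rsum_app. unfold Rsum at 2. cbn [fold_right]. ring. Qed.

Lemma abel_summation (b : Z -> R) (w : nat -> R) C : 0 <= C ->
  (forall N, Rsum b (zs N) <= C * INR N) ->
  (forall j, (1 <= j)%nat -> 0 <= w (S j) <= w j) ->
  forall N, (1 <= N)%nat ->
  Rsum (fun n => b n * w (Z.abs_nat n)) (zs N) <= C * Rsum w (seq 1 N).
Proof.
 intros HC HA Hw N HN. assert (E : forall N (f : nat -> R), Rsum f (seq 1 (S N)) = Rsum f (seq 1 N) + f (S N)).
 { intros M f. rewrite seq_S, Rsum_app. unfold Rsum at 2. cbn [fold_right]. simpl Nat.add. ring. }
 (* The subtracted product is the boundary term of Abel summation; it is non-negative, and keeping
    it makes the induction work. *)
 assert (T : forall N, Rsum (fun n => b n * w (Z.abs_nat n)) (zs (S N)) <= C * Rsum w (seq 1 (S N)) - w (S N) * (C * INR (S N) - Rsum b (zs (S N)))).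
 { induction N0 as [|M IH].
  - simpl. change (Pos.to_nat 1) with 1%nat. side.
  - rewrite E, (Rsum_zs_S b (S M)), (Rsum_zs_S _ (S M)). replace (Z.abs_nat (Z.of_nat (S (S M)))) with (S (S M)) by lia.
   replace (Z.abs_nat (- Z.of_nat (S (S M)))) with (S (S M)) by lia. rewrite S_INR. note (HA (S M)). note (Hw (S M) !!).
   side. }
 destruct N as [|N]; [lia|]. upto T. note (HA (S N)). assert (0 <= w (S N)). { destruct (Hw (S N) !!). lra. } nra.
Qed.

Lemma sum_Rpower_le d : 0 < d -> forall N, Rsum (fun j => Rpower (INR j) (- (1 + d))) (seq 1 N) <= 1 + / d.
Proof.
 intros Hd N. assert (E : forall N (f : nat -> R), Rsum f (seq 1 (S N)) = Rsum f (seq 1 N) + f (S N)).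
 { intros M f. rewrite seq_S, Rsum_app. unfold Rsum at 2. cbn [fold_right]. simpl Nat.add. ring. } have Hi : 0 < / d.
 assert (T : forall N, Rsum (fun j => Rpower (INR j) (- (1 + d))) (seq 1 (S N)) <= 1 + / d * (1 - Rpower (INR (S N)) (- d))).
 { induction N0 as [|M IH].
  - simpl. rewrite !Rpower_1_base. lra.
  - rewrite E. set (x := INR (S M)) in *. assert (Hx : 1 <= x) by (unfold x; rewrite S_INR; note (pos_INR M); lra).
   (* An elementary comparison with the integral of z^(-1-d) over [x, x + 1]; both inequalities used
      are instances of e^z >= 1 + z. *)
   rewrite S_INR. fold x. assert (K : Rpower (x + 1) (- (1 + d)) <= / d * (Rpower x (- d) - Rpower (x + 1) (- d))).
   { replace (- (1 + d)) with (- (1) + - d) by ring. rewrite Rpower_plus.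
    replace (Rpower (x + 1) (- (1))) with (/ (x + 1)). 2: { rewrite Rpower_Ropp, Rpower_1 by lra. side. }
    assert (L : 1 + d * / (x + 1) <= Rpower ((x + 1) / x) d).
    { eapply Rle_trans; [|apply exp_ineq1_le]. apply Rplus_le_compat_l. mul_l. have : 0 < x / (x + 1).
     replace ((x + 1) / x) with (/ (x / (x + 1))) by side. rewrite ln_Rinv by assumption.
     note (exp_ineq1_le (ln (x / (x + 1)))) as K. rewrite exp_ln in K by assumption.
     replace (x / (x + 1)) with (1 - / (x + 1)) in K at 2 by side. lra. }
    assert (Ex : Rpower x (- d) = Rpower (x + 1) (- d) * Rpower ((x + 1) / x) d).
    { unfold Rpower. rewrite <- exp_plus. f_equal. rewrite ln_div by lra. ring. } rewrite Ex.
    note (Rpower_pos (x + 1) (- d)). set (r := Rpower (x + 1) (- d)) in *.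
    replace (/ d * (r * Rpower ((x + 1) / x) d - r)) with (r * (/ d * (Rpower ((x + 1) / x) d - 1))) by ring.
    rewrite Rmult_comm. mul_l. replace (/ (x + 1)) with (/ d * (d * / (x + 1))) by side. side. }
   lra. }
 destruct N as [|N]; [simpl; lra|]. upto T. note (Rpower_pos (INR (S N)) (- d)). nra.
Qed.

Lemma Rpower_INR_decr d : 0 < d -> forall j, (1 <= j)%nat ->
  0 <= Rpower (INR (S j)) (- d) <= Rpower (INR j) (- d).
Proof. intros Hd j Hj. split; [side|]. apply Rpower_anti; side. Qed.

(** What the integral estimates use of the form. [ff_square] is a weighted Rankin-Selberg mean
    square, for w and for y dw; [ff_linear] is adapted to a gain |n|^(-1/2) from van der Corput.
    Both are uniform in the truncation N. [ff_fourier] replaces the infinite expansion by finite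
    sums with a uniform error on y >= Y1. *)
Record form_facts (psi : C -> C) (t : Z -> C) (w dw : Z -> R -> R) : Prop := {
  ff_cont : forall (x y : R -> R) u, continuous x u -> continuous y u -> 0 < y u ->
    ccont (fun u => psi (x u, y u)) u;
  ff_mobius : forall a b c d x y, (a * d - b * c = 1)%Z -> c <> 0%Z -> 0 < y ->
    let v := x + IZR d / IZR c in
    psi (x, y) = psi (IZR a / IZR c - v / (IZR c ^ 2 * (v ^ 2 + y ^ 2)), y / (IZR c ^ 2 * (v ^ 2 + y ^ 2)));
  ff_parity : exists s : C, Cmod s = 1 /\ forall x y : R, 0 < y -> psi ((- x)%R, y) = (s * psi (x, y))%C;
  ff_decay : forall a, 0 <= a -> exists B, 0 < B /\ forall x y, 0 < y -> Cmod (psi (x, y)) <= B * Rpower y (- a);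
  ff_fourier : forall Y1, 0 < Y1 -> exists B, 0 < B /\ forall x y N, Y1 <= y ->
    Cmod (psi (x, y) - Csum (fun n => t n * RtoC (w n y) * e (IZR n * x)) (zs N))%C <= B / INR (S N);
  ff_derive : forall n y, n <> 0%Z -> 0 < y -> is_derive (w n) y (dw n y);
  ff_dcont : forall n y, n <> 0%Z -> 0 < y -> continuous (dw n) y;
  ff_square : forall eps, 0 < eps -> exists B, 0 < B /\ forall y N, 0 < y ->
    Rsum (fun n => Cmod (t n) ^ 2 * w n y ^ 2) (zs N) <= B * Rpower y (- eps) /\
    Rsum (fun n => Cmod (t n) ^ 2 * (y * dw n y) ^ 2) (zs N) <= B * Rpower y (- eps);
  ff_linear : forall eps, 0 < eps -> exists B, 0 < B /\ forall y0 N, 0 < y0 ->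
    Rsum (fun n => Cmod (t n) * / sqrt (Rabs (IZR n)) * Rpower (Rabs (IZR n) * y0) (- (/ 2 + eps))) (zs N)
      <= B * Rpower y0 (- (/ 2 + eps));
  ff_wbound : forall a, 0 < a -> exists B, 0 < B /\ forall n y, n <> 0%Z -> 0 < y ->
    Rabs (w n y) <= B * sqrt y * Rpower (Rabs (IZR n) * y) (- a) /\
    y * Rabs (dw n y) <= B * sqrt y * Rpower (Rabs (IZR n) * y) (- a)
}.

Section Facts.
Variables (kappa theta : R) (psi : C -> C) (t : Z -> C).
Hypotheses (Hpsi : maass_cusp_form kappa psi) (Hparity : even_form psi \/ odd_form psi)
 (Hfourier : fourier_expansion kappa psi t) (Htheta : 0 <= theta) (Hcoeff : coeff_exponent t theta).

Notation w := (wt kappa).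
Notation dw := (dwt kappa).

(** The exponent theta + 3 + b of the Bessel decay pays for |t n| << |n|^(theta + 1), leaves
    |n|^(-2) for convergence and keeps y^(- b) for the cusp. *)
Lemma term_bound b : 0 <= b -> exists B, 0 < B /\ forall n y, n <> 0%Z -> 0 < y ->
  Cmod (t n) * Rabs (w n y) <= B * Rpower y (/ 2 - (theta + 3 + b)) / IZR n ^ 2.
Proof.
 intros Hb. destruct (coef_poly kappa theta psi t Hpsi Hparity Hfourier Hcoeff) as (B1 & HB1 & K1).
 destruct (wt_bound kappa (theta + 3 + b) !!) as (B2 & HB2 & K2). exists (B1 * B2). split; [nra|]. intros n y Hn Hy.
 note (Rabs_IZR_ge_1 n Hn) as Hn1. specialize (K1 n Hn). specialize (K2 n y Hn Hy). set (m := Rabs (IZR n)) in *.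
 via (B1 * Rpower m (theta + 1) * (B2 * sqrt y * Rpower (m * y) (- (theta + 3 + b)))). { side. }
 rewrite <- Rpower_mult_distr by lra. rewrite <- Rpower_sqrt by assumption.
 replace (B1 * Rpower m (theta + 1) * (B2 * Rpower y (/ 2) * (Rpower m (- (theta + 3 + b)) * Rpower y (- (theta + 3 + b))))) with (B1 * B2 * (Rpower y (/ 2) * Rpower y (- (theta + 3 + b))) * (Rpower m (theta + 1) * Rpower m (- (theta + 3 + b)))) by ring.
 rewrite <- !Rpower_plus. apply Rmult_le_compat_l. { side. } via (Rpower m (- (2))). { side. }
 replace (- (2)) with (- INR 2) by side. rewrite Rpower_Ropp, Rpower_pow by lra. unfold m. rewrite pow2_abs. lra.
Qed.

Lemma fourier_uniform Y1 : 0 < Y1 -> exists B, 0 < B /\ forall x y N, Y1 <= y ->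
  Cmod (psi (x, y) - Csum (fun n => t n * RtoC (w n y) * e (IZR n * x)) (zs N))%C <= B / INR (S N).
Proof.
 intros HY. destruct (term_bound 0 (Rle_refl 0)) as (B & HB & K). exists (4 * (B * Rpower Y1 (/ 2 - (theta + 3 + 0)))).
 split. { side. } intros x y N Hy. apply tail_bound_lim.
 - intros n Hn. rewrite !Cmod_mult, Cmod_e, Cmod_R, Rmult_1_r. eapply Rle_trans; [apply K; side|].
  apply Rmult_le_compat_r; [left; apply Rinv_0_lt_compat; apply pow2_gt_0; apply IZR_neq; assumption|]. mul_l.
  replace (/ 2 - (theta + 3 + 0)) with (- (theta + 5 / 2)) by field. apply Rpower_anti; lra.
 - apply (fourier_pointwise kappa psi t Hfourier). lra.
Qed.

(** The threshold 1/5 is the height that Dirichlet's theorem guarantees in [decay]. *)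
Lemma decay_high b : 0 <= b -> exists B, 0 < B /\ forall x y, / 5 <= y -> Cmod (psi (x, y)) <= B * Rpower y (- b).
Proof.
 intros Hb. destruct (term_bound b Hb) as (B & HB & K). exists (4 * B * Rpower (/ 5) (- (theta + 5 / 2))). split.
 { side. } intros x y Hy.
 assert (T : Cmod (psi (x, y) - Csum (fun n => (t n * RtoC (w n y) * e (IZR n * x))%C) (zs 0))%C <= 4 * (B * Rpower y (/ 2 - (theta + 3 + b))) / INR 1).
 { apply tail_bound_lim.
  - intros n Hn. rewrite !Cmod_mult, Cmod_e, Cmod_R, Rmult_1_r. apply K; side.
  - apply (fourier_pointwise kappa psi t Hfourier). lra. }
 simpl in T. replace (psi (x, y) - 0)%C with (psi (x, y)) in T by ring. upto T. unfold Rdiv. rewrite Rinv_1, Rmult_1_r.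
 replace (/ 2 - (theta + 3 + b)) with (- (theta + 5 / 2) + - b) by field. rewrite Rpower_plus.
 assert (Rpower y (- (theta + 5 / 2)) <= Rpower (/ 5) (- (theta + 5 / 2))) by (apply Rpower_anti; lra).
 replace (4 * (B * (Rpower y (- (theta + 5 / 2)) * Rpower y (- b)))) with (4 * B * Rpower y (- (theta + 5 / 2)) * Rpower y (- b)) by ring.
 side.
Qed.

(** For y < 1 take p/q with q <= 2 / sqrt y and q |x - p/q| <= sqrt y. A modular map with lower row
    (q, - p) moves the point to height y / (q^2 (x - p/q)^2 + q^2 y^2) >= y / (y + 4 y). *)
Lemma decay b : 0 <= b -> exists B, 0 < B /\ forall x y, 0 < y -> Cmod (psi (x, y)) <= B * Rpower y (- b).
Proof.
 intros Hb. destruct (decay_high b Hb) as (B & HB & K). destruct (decay_high 0 (Rle_refl 0)) as (B0 & HB0 & K0).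
 exists (B + B0). split; [lra|]. intros x y Hy. destruct (Rle_lt_dec 1 y) as [H|H].
 - specialize (K x y !!). note (Rpower_pos y (- b)). nra.
 - assert (Hone : 1 <= Rpower y (- b)). { rewrite <- (Rpower_1_base (- b)). apply Rpower_anti; lra. }
  assert (Bd : Cmod (psi (x, y)) <= B0).
  { assert (Z0 : forall z, Rpower z (- 0) = 1) by (intros z; unfold Rpower; rewrite Ropp_0, Rmult_0_l, exp_0; reflexivity).
   set (r := / sqrt y). assert (Ess := sqrt_sqrt y !!). have Hs1 : sqrt y <= 1. assert (Hr : 1 <= r).
   { rewrite <- Rinv_1. side. } destruct (archimed r) as [A1 A2]. assert (HQ : (1 <= up r)%Z). { apply le_IZR. lra. }
   destruct (dirichlet x (up r) HQ) as (p & q & Hq & G & D). assert (HQr : / IZR (up r) <= sqrt y).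
   { rewrite <- Rinv_inv. apply Rinv_le_contravar; [side|]. fold r. lra. } assert (Hq2 : IZR q <= 2 * r).
   { via (IZR (up r)); side. } destruct (rel_prime_bezout p q) as [u v Ebz]; [apply Zgcd_1_rel_prime; assumption|].
   rewrite (psi_mobius kappa psi Hpsi (- u) (- v) q (- p) x y) by side. eapply Rle_trans; [apply K0|rewrite Z0; lra].
   set (wv := x + IZR (- p) / IZR q).
   assert (Ew : wv = x - IZR p / IZR q) by (unfold wv; rewrite opp_IZR; unfold Rdiv; ring). rewrite <- Ew in D.
   assert (B1 : IZR q ^ 2 * wv ^ 2 <= y).
   { rewrite <- (pow2_abs wv). rewrite <- Rpow_mult_distr, <- Ess. replace (sqrt y * sqrt y) with (sqrt y ^ 2) by ring.
    side. }
   assert (B2 : IZR q ^ 2 * y ^ 2 <= 4 * y).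
   { rewrite <- Rpow_mult_distr. assert (IZR q * y <= 2 * sqrt y).
    { via (2 * r * y); [side|]. unfold r. rewrite <- Ess at 2. side. } via ((2 * sqrt y) ^ 2); [side|]. side. }
   side. }
  nra.
Qed.

(** Boundedness of psi suffices. On a horizontal line of height about 1/M the weights with M < |n|
    <= 2 M have size sqrt y, because 2 pi |n| y stays in [v0, 2 v0] where K is bounded below;
    Bessel's inequality on that line bounds the dyadic block. *)
Lemma mean_square : exists B, 0 < B /\ forall N, Rsum (fun n => Cmod (t n) ^ 2) (zs N) <= B * INR N.
Proof.
 destruct (KB_lower kappa) as (v0 & c & Hv0 & Hc & L). destruct (decay 0 (Rle_refl 0)) as (B0 & HB0 & Dc).
 note PI2_1 as Hpi. set (c1 := c * exp (- 2 * (2 * v0))). have Hc1 : 0 < c1.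
 set (B := B0 ^ 2 * (2 * PI) / (v0 * c1 ^ 2)). have HB : 0 < B.
 assert (Blk : forall (M : nat) (l : list Z), NoDup l -> (forall n, In n l -> n <> 0%Z /\ (Z.of_nat (S M) <= Z.abs n <= 2 * Z.of_nat (S M))%Z) -> Rsum (fun n => Cmod (t n) ^ 2) l <= B * INR (S M)).
 { intros M l Nd Hl. have HM : 0 < INR (S M). set (y := v0 / (2 * PI * INR (S M))). have Hy : 0 < y.
  have Eyy : 2 * PI * INR (S M) * y = v0. destruct (fourier_uniform y Hy) as (B1 & HB1 & F).
  set (f := fun x => psi (x, y)). assert (Cp : forall x, ccont f x).
  { intros x. eapply psi_path_continuous; trivial; side. }
  assert (Co : forall m, m <> 0%Z -> is_cint (fun x => (f x * e (- (IZR m * x)))%C) 0 1 (t m * RtoC (w m y))%C).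
  { apply (fourier_coefficient f (fun m => (t m * RtoC (w m y))%C) B1 Cp). intros N x. apply F; lra. }
  (* One function on all of [0, 1]; the frequencies are negated because [coef] integrates against
     e(n t). *)
  note (bessel_inequality (A := unit) (fun _ => 0) (fun _ => 1) (fun _ => f) (tt :: nil) (map Z.opp l)) as Bs.
  assert (Bs' : Rsum (fun n => Cmod (coef (fun _ : unit => 0) (fun _ => 1) (fun _ => f) (tt :: nil) n) ^ 2) (map Z.opp l) <= B0 ^ 2).
  { upto Bs.
   - side.
   - side.
   - clear - Nd. induction l; simpl; [side|]. inversion Nd; subst. constructor; auto. intros H. apply in_map_iff in H.
    destruct H as [x [E Hx]]. apply H1. replace a with x by lia. side.
   - simpl. unfold overlap. rewrite Rmax_left, Rmin_left by lra. destruct (Rle_dec 0 1); [|lra]. rewrite !Rplus_0_r.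
    via ((1 - 0) * B0 ^ 2); [|lra]. apply (cint_bound (fun x => (f x * Cconj (f x))%C) 0 1); [lra| |].
    + intros x _. rewrite Cmod_mult, Cmod_conj. note (Dc x y Hy) as D. unfold Rpower in D.
     rewrite Ropp_0, Rmult_0_l, exp_0, Rmult_1_r in D. note (Cmod_ge_0 (psi (x, y))). side.
    + apply cint_ok; [lra|]. intros; apply ccont_mult; [side|apply ccont_conj; apply Cp]. }
  assert (E2 : Rsum (fun n => Cmod (t n) ^ 2) l * (y * c1 ^ 2) <= B0 ^ 2).
  { eapply Rle_trans; [|exact Bs']. rewrite Rsum_map, <- Rsum_scal_r. apply Rsum_le. intros n Hn.
   destruct (Hl n Hn) as [Hn0 Hn1]. simpl.
   replace (cint (fun t0 : R => (f t0 * e (IZR (- n) * t0))%C) 0 1 + 0)%C with (t n * RtoC (w n y))%C.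
   2: { assert (Ec : cint (fun t0 : R => (f t0 * e (IZR (- n) * t0))%C) 0 1 = (t n * RtoC (w n y))%C).
    { apply cint_eq. eapply is_cint_ext; [|apply (Co n Hn0)]. intros x _. rewrite opp_IZR. do 2 f_equal. ring. }
    rewrite Ec. ring. }
   rewrite Cmod_mult, Cmod_R. assert (Hw : sqrt y * c1 <= Rabs (w n y)).
   { unfold wt. rewrite Rabs_mult, (Rabs_pos_eq (sqrt y)) by apply sqrt_pos. mul_l. rewrite Rabs_Zabs.
    assert (K1 : INR (S M) <= IZR (Z.abs n) <= 2 * INR (S M)). { rewrite INR_IZR_INZ. rewrite <- mult_IZR. side. }
    have K2 : v0 <= 2 * PI * IZR (Z.abs n) * y <= 2 * v0. eapply Rle_trans; [|apply Rle_abs].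
    eapply Rle_trans; [|apply L; lra]. mul_l. apply exp_le_mono. lra. }
   assert (Ey : y * (c1 * (c1 * 1)) = (sqrt y * c1) * (sqrt y * c1)). { rewrite <- (sqrt_sqrt y) at 1 by lra. ring. }
   have : 0 <= sqrt y * c1. have : sqrt y * c1 * (sqrt y * c1) <= Rabs (w n y) * Rabs (w n y). side. }
  cancel_r (y * c1 ^ 2). upto E2. side. }
 (* Strong induction on N: the indices beyond half of the range form one block, and the halved range
    pays for the doubling of the constant. *)
 exists (2 * B). split; [lra|]. intros N. induction N as [N IH] using lt_wf_ind.
 destruct N as [|N]; [unfold zs; simpl; lra|]. set (M := Nat.div2 (S N)). note (Nat.div2_odd (S N)) as Ed. fold M in Ed.
 have HM : (M < S N)%nat. set (l := filter (fun n => (Z.of_nat M <? Z.abs n)%Z) (zs (S N))).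
 assert (Nl : NoDup l) by (apply NoDup_filter; apply NoDup_zs).
 assert (T : Rsum (fun n => Cmod (t n) ^ 2) (zs (S N)) <= Rsum (fun n => Cmod (t n) ^ 2) (zs M ++ l)).
 { apply Rsum_incl; [apply NoDup_zs| |side]. intros n Hn. apply in_app_iff.
  destruct (Z.ltb_spec (Z.of_nat M) (Z.abs n)).
  - right. apply filter_In. side.
  - left. apply in_zs in Hn. apply in_zs. lia. }
 rewrite Rsum_app in T. note (IH M HM) as IHM. assert (TB : Rsum (fun n => Cmod (t n) ^ 2) l <= B * INR (S M)).
 { apply Blk; [side|]. intros n Hn. apply filter_In in Hn. destruct Hn as [H1 H2]. apply Z.ltb_lt in H2.
  apply in_zs in H1. split; [lia|]. destruct (Nat.odd (S N)); simpl in Ed; lia. }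
 assert (2 * INR M + INR (S M) <= 2 * INR (S N)).
 { have H : (2 * M + S M <= 2 * S N)%nat. apply le_INR in H. rewrite plus_INR, !mult_INR in H. side. } nra.
Qed.
End Facts.

Lemma weighted_mean_square (b : Z -> R) C d : 0 <= C -> 0 < d ->
  (forall N, Rsum b (zs N) <= C * INR N) -> forall N,
  Rsum (fun n => b n * Rpower (Rabs (IZR n)) (- (1 + d))) (zs N) <= C * (1 + / d).
Proof.
 intros HC Hd HA N. have : 0 < / d. destruct N as [|N]. { unfold zs; simpl. nra. }
 note (abel_summation b (fun j => Rpower (INR j) (- (1 + d))) C HC HA (Rpower_INR_decr (1 + d) !!) (S N) !!) as K.
 replace (Rsum (fun n : Z => b n * Rpower (Rabs (IZR n)) (- (1 + d))) (zs (S N))) with (Rsum (fun n : Z => b n * Rpower (INR (Z.abs_nat n)) (- (1 + d))) (zs (S N))).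
 - upto K. mul_l. apply sum_Rpower_le; assumption.
 - apply Rsum_ext. intros n _. do 2 f_equal. rewrite INR_IZR_INZ, Rabs_Zabs. f_equal. lia.
Qed.

Lemma Rpower_sqr x a : 0 < x -> Rpower x a ^ 2 = Rpower x (2 * a).
Proof. intros. simpl. rewrite Rmult_1_r, <- Rpower_plus. f_equal. ring. Qed.

Lemma form_facts_intro (kappa theta : R) (psi : C -> C) (t : Z -> C)
  (Hpsi : maass_cusp_form kappa psi)
  (Hparity : even_form psi \/ odd_form psi)
  (Hfourier : fourier_expansion kappa psi t)
  (Htheta : 0 <= theta)
  (Hcoeff : coeff_exponent t theta) :
  form_facts psi t (wt kappa) (dwt kappa).
Proof.
 destruct (mean_square kappa theta psi t Hpsi Hparity Hfourier Htheta Hcoeff) as (Cm & HCm & MS).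
 (* With the exponent (1 + eps)/2 the squared weight is y^(- eps) |n|^(-1-eps), just summable
    against the mean square. *)
 assert (SqB : forall (f : Z -> R -> R) (eps B : R), 0 < eps -> 0 < B -> (forall n y, n <> 0%Z -> 0 < y -> Rabs (f n y) <= B * sqrt y * Rpower (Rabs (IZR n) * y) (- ((1 + eps) / 2))) -> forall y N, 0 < y -> Rsum (fun n => Cmod (t n) ^ 2 * f n y ^ 2) (zs N) <= B ^ 2 * (Cm * (1 + / eps)) * Rpower y (- eps)).
 { intros f eps B He HB Hf y N Hy.
  via (Rsum (fun n => Cmod (t n) ^ 2 * Rpower (Rabs (IZR n)) (- (1 + eps)) * (B ^ 2 * Rpower y (- eps))) (zs N)).
  - apply Rsum_le. intros n Hn. apply in_zs in Hn. destruct Hn as [Hn _]. rewrite Rmult_assoc. mul_l.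
   note (Rabs_IZR_ge_1 n Hn). via ((B * sqrt y * Rpower (Rabs (IZR n) * y) (- ((1 + eps) / 2))) ^ 2).
   + rewrite <- pow2_abs. apply pow_incr. side.
   + rewrite !Rpow_mult_distr, Rpower_sqr by nra. rewrite pow2_sqrt by lra. rewrite <- Rpower_mult_distr by lra. right.
    replace (2 * - ((1 + eps) / 2)) with (- (1 + eps)) by field.
    replace (Rpower y (- eps)) with (Rpower y (1 + - (1 + eps))) by (f_equal; ring).
    rewrite Rpower_plus, Rpower_1 by lra. ring.
  - rewrite Rsum_scal_r. note (weighted_mean_square (fun n => Cmod (t n) ^ 2) Cm eps !! He MS N) as K.
   replace (B ^ 2 * (Cm * (1 + / eps)) * Rpower y (- eps)) with (Cm * (1 + / eps) * (B ^ 2 * Rpower y (- eps))) by ring.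
   side. }
 constructor.
 - apply (psi_path_continuous kappa psi Hpsi).
 - apply (psi_mobius kappa psi Hpsi).
 - destruct Hparity as [H|H].
  + exists (RtoC 1). split; [rewrite Cmod_1; reflexivity|]. intros. rewrite H by assumption. ring.
  + exists (RtoC (-1)). split; [rewrite Cmod_R, Rabs_left; lra|]. intros. rewrite H by assumption. side.
 - apply (decay kappa theta psi t); assumption.
 - apply (fourier_uniform kappa theta psi t); assumption.
 - apply wt_derive.
 - apply dwt_continuous.
 - intros eps He. destruct (wt_bound kappa ((1 + eps) / 2) !!) as (B1 & HB1 & K1).
  destruct (dwt_bound kappa ((1 + eps) / 2) !!) as (B2 & HB2 & K2). exists ((B1 ^ 2 + B2 ^ 2) * (Cm * (1 + / eps))).
  split. { side. } intros y N Hy. note (SqB (wt kappa) eps B1 He HB1 K1 y N Hy) as A1.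
  note (SqB (fun n y => y * dwt kappa n y) eps B2 He HB2) as A2.
  specialize (A2 ltac:(intros n z Hn Hz; cbv beta; rewrite Rabs_mult, (Rabs_pos_eq z) by lra; apply K2; assumption) y N Hy).
  have P : 0 < Cm * (1 + / eps) * Rpower y (- eps). side.
 - intros eps He. have Hi : 0 < / eps. exists ((2 + Cm) * (1 + / eps)). split; [nra|]. intros y0 N Hy.
  (* The inequality |t| <= 1 + |t|^2 turns the mean square into a first-power mean. *)
  assert (M1 : forall N, Rsum (fun n => Cmod (t n)) (zs N) <= (2 + Cm) * INR N).
  { intros M. via (Rsum (fun n => 1 + Cmod (t n) ^ 2) (zs M)).
   - apply Rsum_le. side.
   - rewrite Rsum_plus. specialize (MS M). assert (E : Rsum (fun _ : Z => 1) (zs M) = 2 * INR M).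
    { clear. induction M; [unfold zs; simpl; ring|]. rewrite Rsum_zs_S, IHM, S_INR. ring. } side. }
  note (weighted_mean_square (fun n => Cmod (t n)) (2 + Cm) eps !! He M1 N) as K.
  via (Rsum (fun n => Cmod (t n) * Rpower (Rabs (IZR n)) (- (1 + eps)) * Rpower y0 (- (/ 2 + eps))) (zs N)).
  + apply Rsum_le. intros n Hn. apply in_zs in Hn. destruct Hn as [Hn _]. note (Rabs_IZR_ge_1 n Hn).
   rewrite !Rmult_assoc. right. f_equal. rewrite <- Rpower_mult_distr by lra. rewrite <- Rmult_assoc. f_equal.
   rewrite <- Rpower_sqrt, <- Rpower_Ropp, <- Rpower_plus by lra. f_equal. side.
  + rewrite Rsum_scal_r. side.
 - intros a Ha. destruct (wt_bound kappa a Ha) as (B1 & HB1 & K1). destruct (dwt_bound kappa a Ha) as (B2 & HB2 & K2).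
  exists (B1 + B2). split; [lra|]. intros n y Hn Hy. specialize (K1 n y Hn Hy). specialize (K2 n y Hn Hy).
  have : 0 <= sqrt y * Rpower (Rabs (IZR n) * y) (- a). side.
Qed.

(** * Integrals away from a rational point *)

Lemma le_of_tail x b c : (forall N : nat, x <= b + c / INR (S N)) -> x <= b.
Proof.
 intros H. apply Rnot_lt_le. intros Hlt. destruct (Rle_lt_dec c 0) as [Hc|Hc].
 - specialize (H 0%nat). simpl INR in H. side.
 - destruct (nfloor_ex (c / (x - b))) as [n0 [_ Hn0]]; [side|]. specialize (H n0). rewrite S_INR in H.
  assert (c < (x - b) * (INR n0 + 1)). { replace c with ((x - b) * (c / (x - b))) at 1 by side. side. }
  assert ((x - b) * (INR n0 + 1) <= c); [|lra]. replace c with (c / (INR n0 + 1) * (INR n0 + 1)) by side. side.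
Qed.

Lemma Csum_minus {A} (f g : A -> C) l : Csum (fun a => (f a - g a)%C) l = (Csum f l - Csum g l)%C.
Proof. induction l; simpl; [ring|]. rewrite IHl; ring. Qed.

Lemma cint_ext f g a b : (forall x, f x = g x) -> cint f a b = cint g a b.
Proof. intros H. unfold cint. f_equal; apply RInt_ext; intros; rewrite H; reflexivity. Qed.

Lemma is_cderive_cint (f : R -> C) a u : (forall x, ccont f x) -> is_cderive (fun x => cint f a x) u (f u).
Proof.
 intros Cf. split; simpl.
 - apply (is_derive_RInt (fun x => fst (f x)) (fun x => RInt (fun x => fst (f x)) a x) a u).
  + apply filter_forall. intros z. apply (RInt_correct (fun x => fst (f x))). apply ex_RInt_continuous.
   intros; exact (proj1 (Cf _)).
  + exact (proj1 (Cf u)).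
 - apply (is_derive_RInt (fun x => snd (f x)) (fun x => RInt (fun x => snd (f x)) a x) a u).
  + apply filter_forall. intros z. apply (RInt_correct (fun x => snd (f x))). apply ex_RInt_continuous.
   intros; exact (proj2 (Cf _)).
  + exact (proj2 (Cf u)).
Qed.

Section Analysis.
Context {psi : C -> C} {t : Z -> C} {w dw : Z -> R -> R} (FF : form_facts psi t w dw).

Definition PN (N : nat) (x y : R) : C := Csum (fun n => (t n * RtoC (w n y) * e (IZR n * x))%C) (zs N).

Lemma w_cont n y : n <> 0%Z -> 0 < y -> continuous (w n) y.
Proof. intros; eapply derive_cont; apply (ff_derive _ _ _ _ FF); assumption. Qed.

Lemma term_cont (n : Z) (X Y g : R -> R) u : n <> 0%Z -> continuous X u -> continuous Y u -> continuous g u -> 0 < Y u ->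
  ccont (fun u => (RtoC (w n (Y u)) * e (IZR n * X u + g u))%C) u.
Proof.
 intros Hn CX CY Cg HY. apply ccont_mult.
 - apply ccont_R. apply continuous_comp; [side|]. apply w_cont; assumption.
 - side.
Qed.

Lemma PN_e N x y s : (PN N x y * e s)%C = Csum (fun n => (t n * (RtoC (w n y) * e (IZR n * x + s)))%C) (zs N).
Proof. unfold PN. rewrite Cmult_comm, <- Csum_scal. apply Csum_ext; intros n _. rewrite e_plus. ring. Qed.

Lemma PN_cont N (X Y g : R -> R) u : continuous X u -> continuous Y u -> continuous g u -> 0 < Y u ->
  ccont (fun u => (PN N (X u) (Y u) * e (g u))%C) u.
Proof.
 intros CX CY Cg HY.
 apply ccont_ext with (fun u => Csum (fun n => (t n * (RtoC (w n (Y u)) * e (IZR n * X u + g u)))%C) (zs N)).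
 - intros v. rewrite PN_e. side.
 - apply ccont_Csum. intros n Hn. apply in_zs in Hn. apply ccont_mult; [side|]. apply term_cont; tauto.
Qed.

Lemma PN_cint N (X Y g : R -> R) a b : a <= b ->
  (forall u, a <= u <= b -> continuous X u /\ continuous Y u /\ continuous g u /\ 0 < Y u) ->
  cint (fun u => (PN N (X u) (Y u) * e (g u))%C) a b =
  Csum (fun n => (t n * cint (fun u => RtoC (w n (Y u)) * e (IZR n * X u + g u)) a b)%C) (zs N).
Proof.
 intros Hab H. apply cint_eq. eapply is_cint_ext.
 2: { apply is_cint_Csum. intros n Hn. apply in_zs in Hn. apply is_cint_scal. apply cint_ok; [side|].
  intros u Hu. destruct (H u Hu) as (H1 & H2 & H3 & H4). apply term_cont; tauto. }
 intros u _. rewrite PN_e. side.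
Qed.

(** All estimates are made for the finite sums [PN], uniformly in N, and pass to psi here. The lower
    bound Y1 on the heights makes the convergence uniform; its size does not enter the result. *)
Lemma approx_limit {A} (l : list A) (lo hi : A -> R) (X Y g : A -> R -> R) Y1 M : 0 < Y1 ->
  (forall a, In a l -> lo a <= hi a) ->
  (forall a, In a l -> forall u, lo a <= u <= hi a ->
     continuous (X a) u /\ continuous (Y a) u /\ continuous (g a) u /\ Y1 <= Y a u) ->
  (forall N, Cmod (Csum (fun a => cint (fun u => (PN N (X a u) (Y a u) * e (g a u))%C) (lo a) (hi a)) l) <= M) ->
  Cmod (Csum (fun a => cint (fun u => (psi (X a u, Y a u) * e (g a u))%C) (lo a) (hi a)) l) <= M.
Proof.
 intros HY Hl HC HM. destruct (ff_fourier _ _ _ _ FF Y1 HY) as (B & HB & F). eapply le_of_tail. intros N.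
 set (Ip := Csum (fun a => cint (fun u => (psi (X a u, Y a u) * e (g a u))%C) (lo a) (hi a)) l).
 set (Iq := Csum (fun a => cint (fun u => (PN N (X a u) (Y a u) * e (g a u))%C) (lo a) (hi a)) l).
 replace Ip with (Iq + (Ip - Iq))%C by ring. upto Cmod_triangle. apply Rplus_le_compat; [side|]. unfold Ip, Iq.
 rewrite <- Csum_minus. upto Cmod_Csum.
 replace (B * Rsum (fun a => hi a - lo a) l / INR (S N)) with (Rsum (fun a => (hi a - lo a) * (B / INR (S N))) l).
 2: { rewrite Rsum_scal_r. side. } apply Rsum_le. intros a Ha. eapply (cint_bound _ (lo a) (hi a)).
 3: { apply is_cint_minus; apply cint_ok.
  - side.
  - intros u Hu. destruct (HC a Ha u Hu) as (C1 & C2 & C3 & C4).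
   apply ccont_mult; [apply (ff_cont _ _ _ _ FF (X a) (Y a)); trivial; lra|side].
  - side.
  - intros u Hu. destruct (HC a Ha u Hu) as (C1 & C2 & C3 & C4). apply PN_cont; trivial; lra. }
 - side.
 - intros u Hu. simpl.
  replace (psi (X a u, Y a u) * e (g a u) - PN N (X a u) (Y a u) * e (g a u))%C with ((psi (X a u, Y a u) - PN N (X a u) (Y a u)) * e (g a u))%C by ring.
  rewrite Cmod_mult, Cmod_e, Rmult_1_r. apply F. apply (HC a Ha u). lra.
Qed.

(* The inversion [u + i y |-> u / (u^2 + y^2), y / (u^2 + y^2)]. *)
Definition Vf (y u : R) : R := u / (u ^ 2 + y ^ 2).
Definition dVf (y u : R) : R := (y ^ 2 - u ^ 2) / (u ^ 2 + y ^ 2) ^ 2.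
Definition ddVf (y u : R) : R := 2 * u * (u ^ 2 - 3 * y ^ 2) / (u ^ 2 + y ^ 2) ^ 3.

Lemma Vf_derive y u : 0 < y -> is_derive (Vf y) u (dVf y u).
Proof.
 intros Hy. unfold Vf, dVf. auto_derive.
 - side.
 - side.
Qed.

Lemma dVf_derive y u : 0 < y -> is_derive (dVf y) u (ddVf y u).
Proof.
 intros Hy. have : u ^ 2 + y ^ 2 <> 0. unfold dVf, ddVf. auto_derive.
 - side.
 - side.
Qed.

Lemma ddVf_continuous y u : 0 < y -> continuous (ddVf y) u.
Proof.
 intros Hy. have : u ^ 2 + y ^ 2 <> 0. apply (ex_derive_continuous (ddVf y)). unfold ddVf. auto_derive.
 repeat apply Rmult_integral_contrapositive_currified; lra.
Qed.

Lemma ddVf_lower y u : 0 < y -> 4 * y <= u -> / u ^ 3 <= ddVf y u.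
Proof.
 intros Hy Hu. unfold ddVf. have A2 : y ^ 2 <= / 16 * u ^ 2. have A3 : (u ^ 2 + y ^ 2) ^ 3 <= (17 / 16 * u ^ 2) ^ 3.
 apply Rmult_le_reg_r with (u ^ 3 * (u ^ 2 + y ^ 2) ^ 3). { side. }
 replace (/ u ^ 3 * (u ^ 3 * (u ^ 2 + y ^ 2) ^ 3)) with ((u ^ 2 + y ^ 2) ^ 3) by side.
 replace (2 * u * (u ^ 2 - 3 * y ^ 2) / (u ^ 2 + y ^ 2) ^ 3 * (u ^ 3 * (u ^ 2 + y ^ 2) ^ 3)) with (2 * u ^ 4 * (u ^ 2 - 3 * y ^ 2)) by side.
 side.
Qed.

(** The linear term mu u drops out of the second derivative, so the bound is uniform in mu and in
    the end points. *)
Lemma regime_one_phase (n : Z) (k y mu U a b c0 : R) : n <> 0%Z -> 1 <= k -> 0 < y -> 4 * y <= U ->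
  U <= a -> a <= b -> b <= 2 * U ->
  Cmod (cint (fun u => e (IZR n * (c0 - Vf y u / k ^ 2) + mu * u)) a b)
   <= 4 * sqrt (8 * k ^ 2 * U ^ 3 / Rabs (IZR n)).
Proof.
 intros Hn Hk Hy HU Ha Hab Hb. note (Rabs_IZR_ge_1 n Hn) as Hn1. set (m := IZR n) in *.
 have HkU : 0 < 8 * k ^ 2 * U ^ 3. set (l := Rabs m / (8 * k ^ 2 * U ^ 3)). have Hl : 0 < l.
 replace (8 * k ^ 2 * U ^ 3 / Rabs m) with (1 / l) by side. via (4 * 1 * sqrt (1 / l)); [|side].
 rewrite (cint_ext _ (fun u => (RtoC (1 * 1) * e (m * (c0 - Vf y u / k ^ 2) + mu * u))%C)).
 2: { intros u. rewrite Rmult_1_l, Cmult_1_l. side. } set (s2 := if Rle_dec 0 m then - (1) else 1).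
 assert (Es : s2 = 1 \/ s2 = -1) by (unfold s2; destruct (Rle_dec 0 m); [side|left]; lra).
 assert (Em : s2 * - m = Rabs m). { unfold s2. destruct (Rle_dec 0 m); [rewrite Rabs_pos_eq|rewrite Rabs_left1]; lra. }
 apply (vdc_second (fun u => m * (c0 - Vf y u / k ^ 2) + mu * u) (fun _ => 1) (fun _ => 1) (fun _ => 0) (fun u => mu - m * dVf y u / k ^ 2) (fun u => - m * ddVf y u / k ^ 2) a b 1 1 l 1 s2); trivial; try lra.
 - intros u Hu. note (Vf_derive y u Hy) as D. assert (ex_derive (Vf y) u) by (eexists; exact D). auto_derive; [side|].
  rewrite (is_derive_unique (fun x : R => Vf y x) _ _ D). side.
 - intros u Hu. auto_derive; trivial.
 - intros u Hu. note (dVf_derive y u Hy) as D. assert (ex_derive (dVf y) u) by (eexists; exact D). auto_derive; [side|].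
  rewrite (is_derive_unique (fun x : R => dVf y x) _ _ D). side.
 - side.
 - side.
 - intros u Hu. apply (continuous_mult (fun u => - m * ddVf y u) (fun _ => / k ^ 2)); [|side].
  apply (continuous_mult (fun _ => - m) (ddVf y)); [side|apply ddVf_continuous; assumption].
 - side.
 - side.
 - side.
 - intros u Hu. replace (s2 * (- m * ddVf y u / k ^ 2)) with (s2 * - m * (ddVf y u / k ^ 2)) by side. rewrite Em. mul_l.
  via (/ u ^ 3 * / k ^ 2).
  + rewrite <- Rinv_mult. apply Rinv_le_contravar.
   * side.
   * replace (8 * k ^ 2 * U ^ 3) with ((2 * U) ^ 3 * k ^ 2) by ring. side.
  + mul_r. apply ddVf_lower; lra.
Qed.

(** With b k = a h + 1 the matrix (a, - b; k, - h) is unimodular and sends h/k to infinity. Each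
    term of the Fourier expansion on the image arc is a smooth weight times the phase of
    [regime_one_phase]; the weight is removed by parts, and the gain |n|^(-1/2) makes the sum over n
    converge by [ff_linear]. *)
Lemma regime_one eps : 0 < eps -> exists B, 0 < B /\ forall (h k a : Z) y mu U U1 U2,
  (1 <= k)%Z -> Z.divide k (a * h + 1) -> 0 < y -> 4 * y <= U -> U <= U1 -> U1 <= U2 -> U2 <= 2 * U ->
  Cmod (cint (fun u => (psi ((IZR h / IZR k + u)%R, y) * e (mu * u))%C) U1 U2)
   <= B * (IZR k * (U * sqrt U)) * Rpower (y / (5 * IZR k ^ 2 * U ^ 2)) (- eps).
Proof.
 intros He. destruct (ff_wbound _ _ _ _ FF (/ 2 + eps) !!) as (B1 & HB1 & W).
 destruct (ff_linear _ _ _ _ FF eps He) as (B2 & HB2 & L). exists (12 * sqrt 8 * B1 * B2). split. { side. }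
 intros h k a y mu U U1 U2 Hk [b Hd] Hy HU H1 H12 H2. set (kk := IZR k). have Hk1 : 1 <= kk. have Hk2 : 1 <= kk ^ 2.
 set (Y := fun u => y / (kk ^ 2 * (u ^ 2 + y ^ 2))). set (Y0 := y / (5 * kk ^ 2 * U ^ 2)). have HY0 : 0 < Y0.
 assert (HYY : forall u, U <= u <= 2 * U -> Y0 <= Y u).
 { intros u Hu. mul_l. apply Rinv_le_contravar.
  - side.
  - replace (5 * kk ^ 2 * U ^ 2) with (kk ^ 2 * (5 * U ^ 2)) by ring. mul_l. nra. }
 assert (DY : forall u, is_derive Y u (- (2 * u) * y / (kk ^ 2 * (u ^ 2 + y ^ 2) ^ 2))).
 { intros u. unfold Y. auto_derive.
  - side.
  - side. }
 rewrite (cint_ext _ (fun u => (psi ((IZR a / kk - Vf y u / kk ^ 2)%R, Y u) * e (mu * u))%C)).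
 2: { intros u. f_equal. note (ff_mobius _ _ _ _ FF a (- b) k (- h) (IZR h / kk + u) y !! !! Hy) as Em. rewrite Em.
  f_equal. fold kk. replace (IZR h / kk + u + IZR (- h) / kk) with u by (rewrite opp_IZR; field; lra). unfold Vf, Y.
  f_equal. side. }
 set (X := fun u => IZR a / kk - Vf y u / kk ^ 2). assert (CX : forall u, continuous X u).
 { intros u. apply (continuous_minus (fun _ => IZR a / kk) (fun u => Vf y u / kk ^ 2)); [side|].
  apply (continuous_mult (Vf y) (fun _ => / kk ^ 2)); [eapply derive_cont; apply Vf_derive; assumption|side]. }
 have CY : forall u, continuous Y u. have Cm : forall u, continuous (fun u => mu * u) u.
 set (Bd := 12 * sqrt 8 * B1 * B2 * (kk * (U * sqrt U)) * Rpower Y0 (- eps)).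
 note (approx_limit (tt :: nil) (fun _ => U1) (fun _ => U2) (fun _ => X) (fun _ => Y) (fun _ u => mu * u) Y0 Bd HY0) as AL.
 simpl in AL.
 replace (cint (fun u => (psi (X u, Y u) * e (mu * u))%C) U1 U2 + 0)%C with (cint (fun u => (psi (X u, Y u) * e (mu * u))%C) U1 U2) in AL by ring.
 apply AL; clear AL. { side. } { intros _ _ u Hu. repeat split; auto. apply HYY. lra. } intros N.
 match goal with |- Cmod (?z + _)%C <= _ => replace (z + 0)%C with z by ring end. rewrite PN_cint; [|side|side].
 upto Cmod_Csum.
 via (Rsum (fun n => Cmod (t n) * / sqrt (Rabs (IZR n)) * Rpower (Rabs (IZR n) * Y0) (- (/ 2 + eps)) * (12 * sqrt 8 * B1 * (kk * (U * sqrt U)) * sqrt Y0)) (zs N)).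
 2: { rewrite Rsum_scal_r. unfold Bd. replace (Rpower Y0 (- eps)) with (Rpower Y0 (- (/ 2 + eps)) * sqrt Y0).
  2: { rewrite <- Rpower_sqrt, <- Rpower_plus by assumption. f_equal. side. }
  replace (12 * sqrt 8 * B1 * B2 * (kk * (U * sqrt U)) * (Rpower Y0 (- (/ 2 + eps)) * sqrt Y0)) with (B2 * Rpower Y0 (- (/ 2 + eps)) * (12 * sqrt 8 * B1 * (kk * (U * sqrt U)) * sqrt Y0)) by ring.
  apply Rmult_le_compat_r; [|side]. side. }
 apply Rsum_le. intros n Hn. apply in_zs in Hn. destruct Hn as [Hn _]. note (Rabs_IZR_ge_1 n Hn) as Hn1.
 rewrite Cmod_mult. rewrite !Rmult_assoc. mul_l. set (phi := fun u => e (IZR n * X u + mu * u)).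
 set (P0 := 4 * sqrt (8 * kk ^ 2 * U ^ 3 / Rabs (IZR n))). set (Psi := fun u => cint phi U1 u).
 assert (BP : forall u, U1 <= u <= U2 -> Cmod (Psi u) <= P0). { intros u Hu. apply regime_one_phase; trivial; lra. }
 assert (DPsi : forall u, U1 <= u <= U2 -> is_cderive Psi u (phi u)). { intros u Hu. apply is_cderive_cint. side. }
 set (s := sqrt Y0 * Rpower (Rabs (IZR n) * Y0) (- (/ 2 + eps))).
 (* In z the left side is a constant times z^(- eps), so the lowest height [Y0] is the worst. *)
 assert (Hs : forall z, Y0 <= z -> sqrt z * Rpower (Rabs (IZR n) * z) (- (/ 2 + eps)) <= s).
 { intros z Hz. unfold s. rewrite <- !Rpower_mult_distr by lra. rewrite <- !Rpower_sqrt by lra.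
  replace (Rpower z (/ 2) * (Rpower (Rabs (IZR n)) (- (/ 2 + eps)) * Rpower z (- (/ 2 + eps)))) with (Rpower (Rabs (IZR n)) (- (/ 2 + eps)) * (Rpower z (/ 2) * Rpower z (- (/ 2 + eps)))) by ring.
  replace (Rpower Y0 (/ 2) * (Rpower (Rabs (IZR n)) (- (/ 2 + eps)) * Rpower Y0 (- (/ 2 + eps)))) with (Rpower (Rabs (IZR n)) (- (/ 2 + eps)) * (Rpower Y0 (/ 2) * Rpower Y0 (- (/ 2 + eps)))) by ring.
  mul_l. rewrite <- !Rpower_plus. replace (/ 2 + - (/ 2 + eps)) with (- eps) by ring. apply Rpower_anti; lra. }
 set (A := fun u => w n (Y u)). set (dA := fun u => (- (2 * u) * y / (kk ^ 2 * (u ^ 2 + y ^ 2) ^ 2)) * dw n (Y u)).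
 have HYp : forall u, U1 <= u <= U2 -> 0 < Y u. assert (DA : forall u, U1 <= u <= U2 -> is_derive A u (dA u)).
 { intros u Hu. apply (is_derive_comp (w n) Y u); [|side]. apply (ff_derive _ _ _ _ FF); auto. }
 assert (CdA : forall u, U1 <= u <= U2 -> continuous dA u).
 { intros u Hu. apply (continuous_mult (fun u => - (2 * u) * y / (kk ^ 2 * (u ^ 2 + y ^ 2) ^ 2)) (fun u => dw n (Y u))).
  - side.
  - apply continuous_comp; [side|]. apply (ff_dcont _ _ _ _ FF); auto. }
 assert (Rm : forall x, Rmin U1 U2 <= x <= Rmax U1 U2 -> U1 <= x <= U2). { intros x. minmax. side. }
 assert (IP : is_cint (fun u => (RtoC (A u) * phi u)%C) U1 U2 (RtoC (A U2) * Psi U2 - RtoC (A U1) * Psi U1 - cint (fun u => RtoC (dA u) * Psi u) U1 U2)%C).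
 { apply (is_cint_parts (fun u => RtoC (A u)) Psi (fun u => RtoC (dA u)) phi).
  - intros x Hx. apply is_cderive_R. side.
  - side.
  - side.
  - side. }
 change (cint (fun u => (RtoC (w n (Y u)) * e (IZR n * X u + mu * u))%C) U1 U2) with (cint (fun u => (RtoC (A u) * phi u)%C) U1 U2).
 rewrite (cint_eq _ _ _ _ IP). assert (EP1 : Psi U1 = RtoC 0) by (apply cint_eq; apply is_cint_point).
 rewrite EP1. assert (T1 : Rabs (A U2) <= B1 * s).
 { eapply Rle_trans; [apply W; side|]. rewrite Rmult_assoc. mul_l. apply Hs. apply HYY; lra. }
 (* The height changes along the arc at relative speed 2 u / (u^2 + y^2) <= 2 / U, and the arc is no
    longer than U; so the weight varies by a constant multiple of its size. *)
 assert (T2 : Cmod (cint (fun u => RtoC (dA u) * Psi u)%C U1 U2) <= (U2 - U1) * (2 / U * (B1 * s) * P0)).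
 { apply (cint_bound (fun u => RtoC (dA u) * Psi u)%C); trivial.
  - intros u Hu. rewrite Cmod_mult, Cmod_R. apply Rmult_le_compat; [side|side| |apply BP; lra]. unfold dA.
   rewrite Rabs_mult. have HYu : 0 < Y u.
   assert (E1 : Rabs (- (2 * u) * y / (kk ^ 2 * (u ^ 2 + y ^ 2) ^ 2)) = Y u * (2 * u / (u ^ 2 + y ^ 2))).
   { replace (- (2 * u) * y / (kk ^ 2 * (u ^ 2 + y ^ 2) ^ 2)) with (- (y / (kk ^ 2 * (u ^ 2 + y ^ 2)) * (2 * u / (u ^ 2 + y ^ 2)))) by side.
    rewrite Rabs_Ropp. apply Rabs_pos_eq. side. }
   rewrite E1. assert (E2 : 2 * u / (u ^ 2 + y ^ 2) <= 2 / U).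
   { cancel_r (U * (u ^ 2 + y ^ 2)). replace (2 * u / (u ^ 2 + y ^ 2) * (U * (u ^ 2 + y ^ 2))) with (2 * u * U) by side.
    replace (2 / U * (U * (u ^ 2 + y ^ 2))) with (2 * (u ^ 2 + y ^ 2)) by side. nra. }
   destruct (W n (Y u) Hn HYu) as [_ W2]. assert (W3 : Y u * Rabs (dw n (Y u)) <= B1 * s).
   { upto W2. rewrite Rmult_assoc. mul_l. apply Hs. apply HYY; lra. }
   replace (Y u * (2 * u / (u ^ 2 + y ^ 2)) * Rabs (dw n (Y u))) with (2 * u / (u ^ 2 + y ^ 2) * (Y u * Rabs (dw n (Y u)))) by ring.
   side.
  - apply cint_ok; [side|]. intros u Hu. apply ccont_mult; [side|]. eapply is_cderive_ccont.
   apply DPsi; assumption. }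
 assert (T3 : (U2 - U1) * (2 / U * (B1 * s) * P0) <= 2 * (B1 * s) * P0).
 { replace (2 * (B1 * s) * P0) with (U * (2 / U * (B1 * s) * P0)) by side. side. } upto Cmod_triangle. rewrite Cmod_opp.
 match goal with |- Cmod ?z + _ <= _ => replace z with (RtoC (A U2) * Psi U2)%C by ring end. rewrite Cmod_mult, Cmod_R.
 assert (T4 : Rabs (A U2) * Cmod (Psi U2) <= B1 * s * P0).
 { apply Rmult_le_compat; trivial; [side|side|apply BP; lra]. } via (3 * (B1 * s) * P0). { side. } right. unfold P0, s.
 replace (8 * kk ^ 2 * U ^ 3 / Rabs (IZR n)) with (8 * (kk ^ 2 * (U ^ 2 * U)) * / Rabs (IZR n)) by side.
 rewrite sqrt_mult_alt, sqrt_mult_alt, sqrt_mult_alt, sqrt_mult_alt, sqrt_inv, !sqrt_pow2 by side. ring.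
Qed.
End Analysis.

(** * Correlations of pairs of arcs *)

(** For c = 2 y D, [Sg D c] inverts s = r / (D (r^2 + y^2)) on the branch r > y: it is the larger
    root of D s r^2 - r + D s y^2 = 0. [dSg] is its derivative with respect to t when s = ta - t,
    and [lgf] the logarithmic derivative of [dSg] in t. *)
Definition qh (c s : R) : R := sqrt (1 - (c * s) ^ 2).
Definition Sg (D c s : R) : R := (1 + qh c s) / (2 * D * s).
Definition dSg (D c s : R) : R := (1 + qh c s) / (2 * qh c s * D * s ^ 2).
Definition lgf (c s : R) : R := (2 - (1 - qh c s) / qh c s ^ 2) / s.

Section Inverse.
Variables (D c : R).
Hypothesis HD : 0 < D.

Lemma qh_sq s : Rabs (c * s) <= 1 / 100 -> qh c s * qh c s = 1 - (c * s) ^ 2.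
Proof. intros H. apply sqrt_sqrt. rewrite <- pow2_abs. note (Rabs_pos (c * s)). nra. Qed.

Lemma qh_range s : Rabs (c * s) <= 1 / 100 -> 1 - (c * s) ^ 2 <= qh c s <= 1 /\ 99 / 100 <= qh c s.
Proof.
 intros H. note (qh_sq s H) as E. assert (0 <= qh c s) by apply sqrt_pos.
 assert (B : (c * s) ^ 2 <= / 10000) by (rewrite <- pow2_abs; note (Rabs_pos (c * s)); nra). side.
Qed.

(** At c = 0 the inverse is 1 / (D s) and [lgf] is exactly 2 / s. *)
Lemma lgf_error s : Rabs (c * s) <= 1 / 100 -> s <> 0 -> Rabs (lgf c s - 2 / s) <= 2 * (c * s) ^ 2 / Rabs s.
Proof.
 intros H Hs. destruct (qh_range s H) as [[Q1 Q2] Q3]. unfold lgf.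
 replace ((2 - (1 - qh c s) / qh c s ^ 2) / s - 2 / s) with (- (((1 - qh c s) / qh c s ^ 2) * / s)). 2: { side. }
 rewrite Rabs_Ropp, Rabs_mult, Rabs_inv.
 apply Rmult_le_compat_r; [left; apply Rinv_0_lt_compat; apply Rabs_pos_lt; assumption|]. have : 0 < qh c s ^ 2.
 rewrite Rabs_pos_eq by side. cancel_r (qh c s ^ 2). unfold Rdiv. rewrite Rmult_assoc, Rinv_l, Rmult_1_r by lra.
 have : 1 / 2 <= qh c s ^ 2. side.
Qed.

Lemma dSg_bounds s : Rabs (c * s) <= 1 / 100 -> s <> 0 ->
  / (D * s ^ 2) <= dSg D c s <= / (D * s ^ 2) * (1 + (c * s) ^ 2).
Proof.
 intros H Hs. destruct (qh_range s H) as [[Q1 Q2] Q3]. unfold dSg. have Hs2 : 0 < s ^ 2. have Hi : 0 < / (D * s ^ 2).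
 replace ((1 + qh c s) / (2 * qh c s * D * s ^ 2)) with (/ (D * s ^ 2) * ((1 + qh c s) / (2 * qh c s))) by side. split.
 - rewrite <- Rmult_1_r at 1. side.
 - mul_l. cancel_r (2 * qh c s). div_cancel. side.
Qed.

Lemma Sg_derive ta t : Rabs (c * (ta - t)) <= 1 / 100 -> ta - t <> 0 ->
  is_derive (fun t => Sg D c (ta - t)) t (dSg D c (ta - t)).
Proof.
 intros H Hs. note (qh_sq _ H) as E. destruct (qh_range _ H) as [[Q1 Q2] Q3]. unfold Sg, dSg. unfold qh in *.
 auto_derive.
 - side.
 - set (r := sqrt (1 - (c * (ta - t)) ^ 2)) in *. set (s := ta - t) in *.
  replace (1 + - (c * (ta + - t) * (c * (ta + - t) * 1))) with (1 - (c * s) ^ 2) by side. fold r.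
  assert (Es : ta + - t = s) by reflexivity. rewrite !Es. field_simplify_eq; [|side]. side.
Qed.

Lemma dSg_derive ta t : Rabs (c * (ta - t)) <= 1 / 100 -> ta - t <> 0 ->
  is_derive (fun t => dSg D c (ta - t)) t (dSg D c (ta - t) * lgf c (ta - t)).
Proof.
 intros H Hs. note (qh_sq _ H) as E. destruct (qh_range _ H) as [[Q1 Q2] Q3].
 assert (Dq : is_derive (fun t => qh c (ta - t)) t (c ^ 2 * (ta - t) / qh c (ta - t))).
 { unfold qh in *. auto_derive.
  - side.
  - replace (1 + - (c * (ta + - t) * (c * (ta + - t) * 1))) with (1 - (c * (ta - t)) ^ 2) by side. side. }
 unfold dSg, lgf. set (r := qh c (ta - t)) in *. set (s := ta - t) in *.
 assert (DN : is_derive (fun t => 1 + qh c (ta - t)) t (c ^ 2 * s / r)).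
 { note (is_derive_plus (fun _ => 1) (fun t => qh c (ta - t)) t 0 _ (is_derive_const 1 t) Dq) as K.
  rewrite Rplus_0_l in K. side. }
 assert (Ds : is_derive (fun t => (ta - t) ^ 2) t (- 2 * s)). { auto_derive; [side|]. side. }
 assert (DM : is_derive (fun t => 2 * D * (qh c (ta - t) * (ta - t) ^ 2)) t (2 * D * (c ^ 2 * s / r * s ^ 2 + r * (- 2 * s)))).
 { apply is_derive_scal. exact (is_derive_mult (fun t => qh c (ta - t)) (fun t => (ta - t) ^ 2) t _ _ Dq Ds Rmult_comm). }
 have Hs2 : 0 < s ^ 2. assert (Hnz : 2 * D * (qh c (ta - t) * (ta - t) ^ 2) <> 0). { fold s r. side. }
 note (is_derive_div _ _ t _ _ DN DM Hnz) as K. fold r s in K. eapply is_derive_ext; [|].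
 { intros z. instantiate (1 := fun t => (1 + qh c (ta - t)) / (2 * D * (qh c (ta - t) * (ta - t) ^ 2))). simpl. f_equal.
  ring. }
 derive_eq K.
 - side.
 - assert (Ec : c ^ 2 = (1 - r * r) / (s * s)) by (rewrite E; field; assumption). rewrite Ec. side.
Qed.

Lemma lgf_continuous ta t : Rabs (c * (ta - t)) <= 1 / 100 -> ta - t <> 0 ->
  continuous (fun t => lgf c (ta - t)) t.
Proof.
 intros H Hs. destruct (qh_range _ H) as [[Q1 Q2] Q3].
 assert (B : (c * (ta - t)) ^ 2 <= / 10000) by (rewrite <- pow2_abs; note (Rabs_pos (c * (ta - t))); nra).
 apply (ex_derive_continuous (fun t => lgf c (ta - t))). unfold lgf, qh in *. auto_derive. side.
Qed.
End Inverse.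

Section Pair.
Variables (mu D1 c1 ta1 D2 c2 ta2 a b A A' : R).
Hypotheses (HD1 : 0 < D1) (HD2 : 0 < D2) (Hab : a <= b) (Hmu : mu <> 0) (HA' : 0 < A').
Variables (e1 e2 : R).
Hypotheses (He1 : e1 = 1 \/ e1 = -1) (He2 : e2 = 1 \/ e2 = -1)
 (Hs1 : forall t, a <= t <= b -> 0 < e1 * (ta1 - t) /\ Rabs (c1 * (ta1 - t)) <= 1 / 100)
 (Hs2 : forall t, a <= t <= b -> 0 < e2 * (ta2 - t) /\ Rabs (c2 * (ta2 - t)) <= 1 / 100)
 (HB1 : forall t, a <= t <= b -> A' <= dSg D1 c1 (ta1 - t) <= A)
 (HB2 : forall t, a <= t <= b -> A' <= dSg D2 c2 (ta2 - t) <= A).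

Let S1 t := Sg D1 c1 (ta1 - t).
Let S2 t := Sg D2 c2 (ta2 - t).
Let d1 t := dSg D1 c1 (ta1 - t).
Let d2 t := dSg D2 c2 (ta2 - t).

Definition pair_integral : C :=
  cint (fun t => (RtoC (dSg D1 c1 (ta1 - t) * dSg D2 c2 (ta2 - t)) *
    e (mu * (Sg D1 c1 (ta1 - t) - Sg D2 c2 (ta2 - t))))%C) a b.

Lemma nz1 t : a <= t <= b -> ta1 - t <> 0.
Proof. intros Ht E. destruct (Hs1 t Ht) as [H _]. rewrite E, Rmult_0_r in H. lra. Qed.
Lemma nz2 t : a <= t <= b -> ta2 - t <> 0.
Proof. intros Ht E. destruct (Hs2 t Ht) as [H _]. rewrite E, Rmult_0_r in H. lra. Qed.
Lemma D_S1 t : a <= t <= b -> is_derive S1 t (d1 t).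
Proof. intros Ht. apply Sg_derive; [side|apply Hs1; assumption|apply nz1; assumption]. Qed.
Lemma D_S2 t : a <= t <= b -> is_derive S2 t (d2 t).
Proof. intros Ht. apply Sg_derive; [side|apply Hs2; assumption|apply nz2; assumption]. Qed.
Lemma D_d1 t : a <= t <= b -> is_derive d1 t (d1 t * lgf c1 (ta1 - t)).
Proof. intros Ht. apply dSg_derive; [side|apply Hs1; assumption|apply nz1; assumption]. Qed.
Lemma D_d2 t : a <= t <= b -> is_derive d2 t (d2 t * lgf c2 (ta2 - t)).
Proof. intros Ht. apply dSg_derive; [side|apply Hs2; assumption|apply nz2; assumption]. Qed.

Let sm := if Rle_dec 0 mu then 1 else -1.
(** The phase mu (S1 - S2) has derivative |mu| d1 [kap]. Splitting off |mu| d1 leaves a ratio, whose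
    derivative is the ratio d2 / d1 times the difference of the two logarithmic derivatives; these
    are explicit up to small errors. *)
Let kap t := sm * (1 - d2 t / d1 t).
Let dkap t := sm * (d2 t / d1 t * (lgf c1 (ta1 - t) - lgf c2 (ta2 - t))).

Lemma sm_sign : sm = 1 \/ sm = -1.
Proof. unfold sm; destruct (Rle_dec 0 mu); [left|side]; lra. Qed.
Lemma sm_mu : mu = sm * Rabs mu.
Proof. unfold sm; destruct (Rle_dec 0 mu); [rewrite Rabs_pos_eq|rewrite Rabs_left1]; lra. Qed.

Lemma pair_integral_form : pair_integral =
  cint (fun t => (RtoC (Rabs mu * d1 t * (d2 t / Rabs mu)) * e (mu * (S1 t - S2 t)))%C) a b.
Proof. apply cint_ext. intros t. unfold d1, d2, S1, S2. do 2 f_equal. field. apply Rabs_no_R0. side. Qed.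

Lemma pair_kap t : a <= t <= b -> is_derive kap t (dkap t).
Proof.
 intros Ht. assert (P1 : 0 < d1 t) by (note (HB1 t Ht); unfold d1; lra).
 assert (K := is_derive_div d2 d1 t _ _ (D_d2 t Ht) (D_d1 t Ht) (Rgt_not_eq _ _ P1)).
 assert (K2 := is_derive_minus (fun _ => 1) (fun t => d2 t / d1 t) t 0 _ (is_derive_const 1 t) K).
 assert (K3 := is_derive_scal (fun t => minus 1 (d2 t / d1 t)) t sm _ K2). derive_eq K3.
 - side.
 - unfold minus, plus, opp, scal; simpl; unfold mult; simpl. side.
Qed.

Lemma pair_continuity t : a <= t <= b ->
  continuous (fun t => Rabs mu * d1 t) t /\
  continuous (fun t => d2 t * lgf c2 (ta2 - t) / Rabs mu) t /\ continuous dkap t.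
Proof.
 intros Ht. assert (C1 : continuous d1 t) by (eapply derive_cont; apply D_d1; assumption).
 assert (C2 : continuous d2 t) by (eapply derive_cont; apply D_d2; assumption).
 assert (P1 : 0 < d1 t) by (note (HB1 t Ht); unfold d1; lra).
 assert (L1 : continuous (fun t => lgf c1 (ta1 - t)) t) by (apply lgf_continuous; [apply Hs1; assumption|apply nz1; assumption]).
 assert (L2 : continuous (fun t => lgf c2 (ta2 - t)) t) by (apply lgf_continuous; [apply Hs2; assumption|apply nz2; assumption]).
 side.
Qed.

Lemma lgf_sign t : a <= t <= b -> 0 <= e2 * (d2 t * lgf c2 (ta2 - t) / Rabs mu).
Proof.
 intros Ht. destruct (Hs2 t Ht) as [H1 H2]. note (HB2 t Ht) as H3. note (lgf_error c2 (ta2 - t) H2 (nz2 t Ht)) as E.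
 assert (Hm : 0 < Rabs mu) by (apply Rabs_pos_lt; assumption).
 replace (e2 * (d2 t * lgf c2 (ta2 - t) / Rabs mu)) with (d2 t / Rabs mu * (e2 * lgf c2 (ta2 - t))) by side.
 apply Rmult_le_pos; [side|]. assert (Ha : Rabs (ta2 - t) = e2 * (ta2 - t)).
 { destruct He2 as [E2|E2]; rewrite E2 in *; [rewrite Rabs_pos_eq|rewrite Rabs_left1]; lra. }
 assert (B : (c2 * (ta2 - t)) ^ 2 <= / 10000) by (rewrite <- pow2_abs; note (Rabs_pos (c2 * (ta2 - t))); nra).
 rewrite Ha in E. set (s := e2 * (ta2 - t)) in *. have Hi : 0 < / s. assert (E3 : 2 / (ta2 - t) = e2 * (2 * / s)).
 { unfold s. destruct He2 as [E2|E2]; rewrite E2; field; apply nz2; assumption. }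
 have : 2 * (c2 * (ta2 - t)) ^ 2 * / s <= / s. apply Rabs_le_between in E.
 destruct He2 as [E2|E2]; rewrite E2 in *; lra.
Qed.

Variable lam : R.
Hypothesis Hlam : 0 < lam.
Variable ek : R.
Hypotheses (Hek : ek = 1 \/ ek = -1)
 (Hmain : forall t, a <= t <= b -> lam <= ek * (lgf c1 (ta1 - t) - lgf c2 (ta2 - t))).

Lemma HAA : A' <= A.
Proof. note (HB1 a !!). lra. Qed.

Lemma ratio_bounds t : a <= t <= b -> A' / A <= d2 t / d1 t.
Proof. intros Ht. note (HB1 t Ht). note (HB2 t Ht). note HAA. unfold d1, d2, Rdiv. side. Qed.

Lemma dkap_lower t : a <= t <= b -> A' / A * lam <= (sm * ek) * dkap t.
Proof.
 intros Ht. note (ratio_bounds t Ht) as R1. note (Hmain t Ht) as M. note HAA. unfold dkap.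
 replace (sm * ek * (sm * (d2 t / d1 t * (lgf c1 (ta1 - t) - lgf c2 (ta2 - t))))) with (sm * sm * (d2 t / d1 t * (ek * (lgf c1 (ta1 - t) - lgf c2 (ta2 - t))))) by ring.
 replace (sm * sm) with 1 by (destruct sm_sign as [E|E]; rewrite E; ring). rewrite Rmult_1_l. side.
Qed.

Lemma sek : sm * ek = 1 \/ sm * ek = -1.
Proof. destruct sm_sign as [E|E], Hek as [E'|E']; rewrite E, E'; [left|side|side|left]; ring. Qed.

Lemma Phi_derive t : a <= t <= b ->
  is_derive (fun t => mu * (S1 t - S2 t)) t (Rabs mu * d1 t * kap t).
Proof.
 intros Ht. assert (P1 : 0 < d1 t) by (note (HB1 t Ht); unfold d1; lra).
 note (is_derive_scal (fun t => minus (S1 t) (S2 t)) t mu _ (is_derive_minus _ _ _ _ _ (D_S1 t Ht) (D_S2 t Ht))) as K.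
 derive_eq K.
 - side.
 - unfold minus, plus, opp, scal; simpl; unfold mult; simpl. rewrite sm_mu at 1. side.
Qed.

Lemma pair_second : Cmod pair_integral <= 4 * (A / Rabs mu) * sqrt (Rabs mu * A / (A' / A * lam)).
Proof.
 rewrite pair_integral_form. assert (Hm : 0 < Rabs mu) by (apply Rabs_pos_lt; assumption). note HAA.
 apply (vdc_second (fun t => mu * (S1 t - S2 t)) (fun t => Rabs mu * d1 t) (fun t => d2 t / Rabs mu) (fun t => d2 t * lgf c2 (ta2 - t) / Rabs mu) kap dkap a b (A / Rabs mu) (Rabs mu * A) (A' / A * lam) e2 (sm * ek)); trivial.
 - side.
 - side.
 - side.
 - apply sek.
 - apply Phi_derive.
 - intros t Ht. note (is_derive_scal d2 t (/ Rabs mu) _ (D_d2 t Ht)) as K.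
  eapply is_derive_ext; [|derive_eq K; [exact K|]].
  + side.
  + side.
 - apply pair_kap.
 - intros t Ht. apply pair_continuity; assumption.
 - intros t Ht. apply pair_continuity; assumption.
 - intros t Ht. apply pair_continuity; assumption.
 - intros t Ht. note (HB2 t Ht). split.
  + side.
  + apply Rmult_le_compat_r; side.
 - intros t Ht. note (HB1 t Ht). rewrite Rabs_pos_eq by side. side.
 - apply lgf_sign.
 - apply dkap_lower.
Qed.

(** Here [kap] itself is bounded away from 0; the inequality between the two [lgf] supplies its
    monotonicity. *)
Lemma pair_first k0 es : 0 < k0 -> es = 1 \/ es = -1 ->
  (forall t, a <= t <= b -> k0 <= es * (1 - dSg D2 c2 (ta2 - t) / dSg D1 c1 (ta1 - t))) ->
  Cmod pair_integral <= A / Rabs mu / k0.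
Proof.
 intros Hk0 Hes Hk. rewrite pair_integral_form. assert (Hm : 0 < Rabs mu) by (apply Rabs_pos_lt; assumption). note HAA.
 apply (vdc_first (fun t => mu * (S1 t - S2 t)) (fun t => Rabs mu * d1 t) (fun t => d2 t / Rabs mu) (fun t => d2 t * lgf c2 (ta2 - t) / Rabs mu) kap dkap a b (A / Rabs mu) k0 e2 (sm * ek) (sm * es)); trivial.
 - side.
 - apply sek.
 - destruct sm_sign as [E|E], Hes as [E'|E']; rewrite E, E'; [left|side|side|left]; ring.
 - apply Phi_derive.
 - intros t Ht. note (is_derive_scal d2 t (/ Rabs mu) _ (D_d2 t Ht)) as K.
  eapply is_derive_ext; [|derive_eq K; [exact K|]].
  + side.
  + side.
 - apply pair_kap.
 - intros t Ht. apply pair_continuity; assumption.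
 - intros t Ht. apply pair_continuity; assumption.
 - intros t Ht. apply pair_continuity; assumption.
 - intros t Ht. note (HB2 t Ht). split.
  + side.
  + apply Rmult_le_compat_r; side.
 - apply lgf_sign.
 - intros t Ht. eapply Rle_trans; [|apply dkap_lower; assumption]. side.
 - intros t Ht. unfold kap.
  replace (sm * es * (sm * (1 - d2 t / d1 t))) with (sm * sm * (es * (1 - d2 t / d1 t))) by ring.
  replace (sm * sm) with 1 by (destruct sm_sign as [E|E]; rewrite E; ring). rewrite Rmult_1_l. side.
Qed.

Lemma pair_trivial : Cmod pair_integral <= A * (S1 b - S1 a).
Proof.
 assert (I1 : is_RInt (fun t => A * d1 t) a b (A * (S1 b - S1 a))).
 { apply (is_RInt_scal d1 a b A). apply (is_RInt_derive S1 d1).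
  - intros t. minmax. apply D_S1.
  - intros t. minmax. intros Ht. eapply derive_cont; apply D_d1; assumption. }
 apply (is_cint_bound (fun t => (RtoC (dSg D1 c1 (ta1 - t) * dSg D2 c2 (ta2 - t)) * e (mu * (Sg D1 c1 (ta1 - t) - Sg D2 c2 (ta2 - t))))%C) (fun t => A * d1 t) a b); [side| | |side].
 2: { apply cint_ok; [side|]. intros t Ht. note (derive_cont _ _ _ (D_d1 t Ht)) as C1.
  note (derive_cont _ _ _ (D_d2 t Ht)) as C2. note (derive_cont _ _ _ (D_S1 t Ht)) as C3.
  note (derive_cont _ _ _ (D_S2 t Ht)) as C4. side. }
 intros t Ht. rewrite Cmod_mult, Cmod_e, Cmod_R, Rmult_1_r. note (HB1 t !!). note (HB2 t !!). unfold d1.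
 rewrite Rabs_pos_eq by nra. nra.
Qed.
End Pair.

(** The part of the image of a Farey arc at p/q whose real part t lies in [m, m + 1], translated by
    - m into [0, 1]. *)
Record piece := { pc_p : Z; pc_q : Z; pc_right : bool; pc_m : Z; pc_lo : R; pc_hi : R }.

Definition pc_key (i : piece) := (pc_p i, pc_q i, pc_right i, pc_m i).

Section Core.
Variables (y X L W om mu b1 b2 : R) (k Q : Z) (al : Z -> Z -> Z).
Hypotheses (Hy : 0 < y) (HX : 1 <= X) (Hk : (1 <= k)%Z) (HQ : (1 <= Q)%Z) (HQW : IZR Q <= 13 * W) (HW1 : 1 <= W)
 (HL1 : 8000 * IZR Q * X <= L) (HL2 : 40000 <= L) (HWX : 1000 <= W * X) (Hrel : IZR k ^ 2 * X ^ 2 * y * (W ^ 2 * L) = 1)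
 (Hb1 : 0 < b1) (Hmu : b1 <= Rabs mu * y <= b2)
 (Hal : forall p q, (1 <= q)%Z -> Z.gcd p q = 1%Z -> Z.divide q (al p q * p + 1))
 (Hal2 : forall p p' q, (1 <= q)%Z -> Z.divide q (p - p') -> al p q = al p' q).

(** With om = a/k the number k q [Xa] is the integer a q - p k, the lower left entry of the matrix
    that moves the arc, and [Dp] is its square. [tp] is the image of infinity under that matrix, up
    to the translation by m. The scales are as follows: [Xa] is of size X, the image has heights
    near 1/L, and |tp - t| is of size W / q. *)
Definition Xa (i : piece) : R := om - IZR (pc_p i) / IZR (pc_q i).
Definition Dp (i : piece) : R := (IZR k * IZR (pc_q i) * Xa i) ^ 2.
Definition cp (i : piece) : R := 2 * y * Dp i.
Definition tp (i : piece) : R :=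
  IZR (al (pc_p i) (pc_q i)) / IZR (pc_q i) - / (IZR (pc_q i) ^ 2 * Xa i) - IZR (pc_m i).
Definition ep (i : piece) : R := if pc_right i then 1 else -1.
(** The integrand in the variable t: [Sg] is the signed distance from the centre of the arc, and
    [dSg] the Jacobian. *)
Definition fp (i : piece) (t : R) : C :=
  (RtoC (dSg (Dp i) (cp i) (tp i - t)) * e (mu * Sg (Dp i) (cp i) (tp i - t)))%C.
Definition len (i : piece) : R :=
  Sg (Dp i) (cp i) (tp i - pc_hi i) - Sg (Dp i) (cp i) (tp i - pc_lo i).

Definition good_piece (i : piece) : Prop :=
  (1 <= pc_q i <= Q)%Z /\ Z.gcd (pc_p i) (pc_q i) = 1%Z /\ X / 3 <= Xa i <= 2 * X /\
  0 <= pc_lo i /\ pc_lo i <= pc_hi i /\ pc_hi i <= 1 /\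
  (forall t, pc_lo i <= t <= pc_hi i ->
     0 < ep i * (tp i - t) /\
     W / (3 * IZR (pc_q i)) <= Rabs (tp i - t) <= 3 * W / IZR (pc_q i)).

Lemma ep_sign i : ep i = 1 \/ ep i = -1.
Proof. unfold ep; destruct (pc_right i); [left|side]; lra. Qed.

Lemma W_pos : 1 <= W.
Proof. side. Qed.

Lemma mu_nz : mu <> 0.
Proof. intros E. rewrite E, Rabs_R0 in Hmu. lra. Qed.

Section OnePiece.
Variable i : piece.
Hypothesis Gi : good_piece i.
Let q := IZR (pc_q i).

Lemma q_range : 1 <= q /\ q <= IZR Q /\ q <= 13 * W.
Proof. destruct Gi as (H & _). unfold q. have : 1 <= IZR (pc_q i). have : IZR (pc_q i) <= IZR Q. lra. Qed.

Lemma Dp_bounds : / 9 * q ^ 2 / (y * (W ^ 2 * L)) <= Dp i <= 4 * q ^ 2 / (y * (W ^ 2 * L)).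
Proof.
 destruct Gi as (_ & _ & [H1 H2] & _). destruct q_range as (Q1 & Q2 & Q3).
 assert (E : IZR k ^ 2 * X ^ 2 = / (y * (W ^ 2 * L))).
 { apply Rmult_eq_reg_r with (y * (W ^ 2 * L)); [|side]. rewrite Rinv_l by side. side. } unfold Dp, Rdiv. rewrite <- E.
 fold q. replace ((IZR k * q * Xa i) ^ 2) with (IZR k ^ 2 * q ^ 2 * Xa i ^ 2) by ring.
 replace (/ 9 * q ^ 2 * (IZR k ^ 2 * X ^ 2)) with (IZR k ^ 2 * q ^ 2 * (X / 3) ^ 2) by field.
 replace (4 * q ^ 2 * (IZR k ^ 2 * X ^ 2)) with (IZR k ^ 2 * q ^ 2 * (2 * X) ^ 2) by ring. side.
Qed.

Lemma Dp_pos : 0 < Dp i.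
Proof. destruct Dp_bounds as [H _]. destruct q_range as (Q1 & Q2 & Q3). eapply Rlt_le_trans; [|exact H]. side. Qed.

Variable t : R.
Hypothesis Ht : pc_lo i <= t <= pc_hi i.

Lemma s_range : 0 < ep i * (tp i - t) /\ W / (3 * q) <= Rabs (tp i - t) <= 3 * W / q.
Proof. destruct Gi as (_ & _ & _ & _ & _ & _ & H). side. Qed.

Lemma s_nz : tp i - t <> 0.
Proof. destruct s_range as [H _]. side. Qed.

Lemma s_inv : / Rabs (tp i - t) <= 3 * q / W.
Proof.
 destruct s_range as [_ [H _]]. destruct q_range as (Q1 & Q2 & Q3). replace (3 * q / W) with (/ (W / (3 * q))) by side.
 side.
Qed.

Lemma cs_bound : Rabs (cp i * (tp i - t)) <= 24 * q / (W * L) /\ 24 * q / (W * L) <= 312 / L /\ 312 / L <= 1 / 100.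
Proof.
 destruct s_range as [_ [H0 H]]. destruct q_range as (Q1 & Q2 & Q3). destruct Dp_bounds as [_ HD]. note Dp_pos as HD0.
 split; [|split].
 - unfold cp. rewrite Rabs_mult, (Rabs_pos_eq (2 * y * Dp i)) by nra.
  replace (24 * q / (W * L)) with (2 * y * (4 * q ^ 2 / (y * (W ^ 2 * L))) * (3 * W / q)) by side. side.
 - replace (24 * q / (W * L)) with (24 / L * (q / W)) by side. replace (312 / L) with (24 / L * 13) by side. side.
 - side.
Qed.

Lemma Ds2_bounds : / (81 * (y * L)) <= Dp i * (tp i - t) ^ 2 <= 36 / (y * L).
Proof.
 destruct s_range as [_ H]. destruct q_range as (Q1 & Q2 & Q3). note Dp_bounds as [D1 D2]. rewrite <- pow2_abs. split.
 - replace (/ (81 * (y * L))) with (/ 9 * q ^ 2 / (y * (W ^ 2 * L)) * (W / (3 * q)) ^ 2) by side. side.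
 - replace (36 / (y * L)) with (4 * q ^ 2 / (y * (W ^ 2 * L)) * (3 * W / q) ^ 2) by side. side.
Qed.

Lemma dS_bounds : L * y / 36 <= dSg (Dp i) (cp i) (tp i - t) <= 100 * (L * y).
Proof.
 destruct cs_bound as (C1 & C2 & C3). destruct Ds2_bounds as [B1 B2].
 destruct (dSg_bounds (Dp i) (cp i) Dp_pos (tp i - t) !! s_nz) as [H1 H2]. assert (Hp : 0 < Dp i * (tp i - t) ^ 2).
 { apply Rmult_lt_0_compat; [apply Dp_pos|apply pow2_gt_0; apply s_nz]. } split.
 - eapply Rle_trans; [|exact H1]. replace (L * y / 36) with (/ (36 / (y * L))) by side. side.
 - assert (I1 : / (Dp i * (tp i - t) ^ 2) <= 81 * (y * L)). { rewrite <- Rinv_inv. side. }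
  assert (I2 : (cp i * (tp i - t)) ^ 2 <= / 10000). { rewrite <- pow2_abs. note (Rabs_pos (cp i * (tp i - t))). nra. }
  note (pow2_ge_0 (cp i * (tp i - t))). side.
Qed.

Lemma lgf_close : Rabs (lgf (cp i) (tp i - t) - 2 / (tp i - t)) <= / (72 * (X ^ 2 * W ^ 2)).
Proof.
 destruct cs_bound as (C1 & C2 & C3). destruct q_range as (Q1 & Q2 & Q3).
 eapply Rle_trans; [apply lgf_error; [lra|apply s_nz]|]. note s_inv as SI. note (Rabs_pos_lt _ s_nz) as SP.
 assert (A : (cp i * (tp i - t)) ^ 2 <= (24 * q / (W * L)) ^ 2). { rewrite <- pow2_abs. side. }
 via (2 * (24 * q / (W * L)) ^ 2 * (3 * q / W)). { unfold Rdiv at 1. side. }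
 replace (2 * (24 * q / (W * L)) ^ 2 * (3 * q / W)) with (3456 * (q ^ 3 / (W ^ 3 * L ^ 2))) by side.
 via (3456 * (q ^ 2 / (W ^ 2 * L ^ 2) * 13)).
 { mul_l. replace (q ^ 3 / (W ^ 3 * L ^ 2)) with (q ^ 2 / (W ^ 2 * L ^ 2) * (q / W)) by side. side. }
 have B : 8000 * q * X <= L. have B2 : (8000 * q * X) ^ 2 <= L ^ 2.
 apply Rmult_le_reg_r with (72 * (X ^ 2 * W ^ 2) * L ^ 2). { side. }
 replace (3456 * (q ^ 2 / (W ^ 2 * L ^ 2) * 13) * (72 * (X ^ 2 * W ^ 2) * L ^ 2)) with (3234816 * (q ^ 2 * X ^ 2)) by side.
 replace (/ (72 * (X ^ 2 * W ^ 2)) * (72 * (X ^ 2 * W ^ 2) * L ^ 2)) with (L ^ 2) by side. side.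
Qed.
End OnePiece.

Section TwoPieces.
Variables i i' : piece.
Hypotheses (Gi : good_piece i) (Gi' : good_piece i').
Let a := Rmax (pc_lo i) (pc_lo i').
Let b := Rmin (pc_hi i) (pc_hi i').
Hypothesis Hab : a <= b.
Let q := IZR (pc_q i).
Let q' := IZR (pc_q i').
Let Dt := tp i' - tp i.

(** The integer nearest in structure to q q' (tp i' - tp i): by [Dt_formula] they differ by terms of
    size q / (q' X) and q' / (q X). Pairs of pieces are classified by it. *)
Definition cc : Z := (al (pc_p i') (pc_q i') * pc_q i - al (pc_p i) (pc_q i) * pc_q i'
   - (pc_m i' - pc_m i) * (pc_q i * pc_q i'))%Z.

Definition pint : C := pair_integral mu (Dp i) (cp i) (tp i) (Dp i') (cp i') (tp i') a b.

Lemma in1 t : a <= t <= b -> pc_lo i <= t <= pc_hi i.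
Proof. intros. note (Rmax_l (pc_lo i) (pc_lo i')). note (Rmin_l (pc_hi i) (pc_hi i')). unfold a, b in *. lra. Qed.
Lemma in2 t : a <= t <= b -> pc_lo i' <= t <= pc_hi i'.
Proof. intros. note (Rmax_r (pc_lo i) (pc_lo i')). note (Rmin_r (pc_hi i) (pc_hi i')). unfold a, b in *. lra. Qed.

Lemma Dt_formula : Dt * (q * q') = IZR cc - q / (q' * Xa i') + q' / (q * Xa i).
Proof.
 destruct (q_range i Gi) as (Q1 & _). destruct (q_range i' Gi') as (Q1' & _). destruct Gi as (_ & _ & [H1 _] & _).
 destruct Gi' as (_ & _ & [H1' _] & _). unfold Dt, cc, tp. rewrite !minus_IZR, !mult_IZR, !minus_IZR. side.
Qed.

Lemma trivial_bound : Cmod pint <= 100 * (L * y) * len i.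
Proof.
 eapply Rle_trans.
 - apply (pair_trivial mu (Dp i) (cp i) (tp i) (Dp i') (cp i') (tp i') a b (100 * (L * y)) (L * y / 36) (Dp_pos i Gi) (Dp_pos i' Gi') Hab (ltac:(nra)) (ep i) (ep i')).
  + intros t Ht. note (in1 t Ht) as I. split; [apply (s_range i Gi t I)|].
   destruct (cs_bound i Gi t I) as (B1 & B2 & B3). lra.
  + intros t Ht. note (in2 t Ht) as I. split; [apply (s_range i' Gi' t I)|].
   destruct (cs_bound i' Gi' t I) as (B1 & B2 & B3). lra.
  + intros t Ht. apply (dS_bounds i Gi t (in1 t Ht)).
  + intros t Ht. apply (dS_bounds i' Gi' t (in2 t Ht)).
 - mul_l. unfold len.
  assert (Mono : forall x z, pc_lo i <= x -> x <= z -> z <= pc_hi i -> Sg (Dp i) (cp i) (tp i - x) <= Sg (Dp i) (cp i) (tp i - z)).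
  { intros x z Hx Hxz Hz.
   destruct (MVT_gen (fun t => Sg (Dp i) (cp i) (tp i - t)) x z (fun t => dSg (Dp i) (cp i) (tp i - t))) as [c [Hc E]].
   - intros t. minmax. intros Ht. have I : pc_lo i <= t <= pc_hi i.
    apply Sg_derive; [apply (Dp_pos i Gi)| |apply (s_nz i Gi t I)]. destruct (cs_bound i Gi t I) as (B1 & B2 & B3). lra.
   - intros t. minmax. intros Ht. have I : pc_lo i <= t <= pc_hi i. apply derivable_continuous_pt.
    exists (dSg (Dp i) (cp i) (tp i - t)). apply is_derive_Reals.
    apply Sg_derive; [apply (Dp_pos i Gi)| |apply (s_nz i Gi t I)]. destruct (cs_bound i Gi t I) as (B1 & B2 & B3). lra.
   - rewrite Rmin_left, Rmax_right in Hc by assumption. note (dS_bounds i Gi c !!) as [B _].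
    assert (0 <= dSg (Dp i) (cp i) (tp i - c) * (z - x)). { apply Rmult_le_pos; nra. } lra. }
  note (in1 a !!). note (in1 b !!). note (Mono (pc_lo i) a !! !! !!). note (Mono b (pc_hi i) !! !! !!). lra.
Qed.

(** With s' - s = Dt one has 2/s - 2/s' = 2 Dt / (s s'), and |s s'| <= 9 W^2 / (q q'). The signs of
    s and s' are constant on the pieces, so the sign [ek] is too. Half of the main term absorbs the
    errors of [lgf_close]. *)
Lemma main_term lam : 0 < lam -> / (36 * (X ^ 2 * W ^ 2)) <= lam -> 9 * W ^ 2 * lam <= Rabs Dt * (q * q') ->
  exists ek, (ek = 1 \/ ek = -1) /\
  forall t, a <= t <= b -> lam <= ek * (lgf (cp i) (tp i - t) - lgf (cp i') (tp i' - t)).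
Proof.
 intros Hl Hl2 HD. destruct (q_range i Gi) as (Q1 & _). destruct (q_range i' Gi') as (Q1' & _). fold q in Q1.
 fold q' in Q1'. note W_pos as HW. set (ed := if Rle_dec 0 Dt then 1 else -1). assert (Hed : ed * Dt = Rabs Dt).
 { unfold ed. destruct (Rle_dec 0 Dt); [rewrite Rabs_pos_eq|rewrite Rabs_left1]; lra. } exists (ed * (ep i * ep i')).
 split.
 { unfold ed.
  destruct (Rle_dec 0 Dt), (ep_sign i) as [E|E], (ep_sign i') as [E'|E']; rewrite E, E'; try (left; ring); right; ring. }
 intros t Ht. note (lgf_close i Gi t (in1 t Ht)) as L1. note (lgf_close i' Gi' t (in2 t Ht)) as L2.
 destruct (s_range i Gi t (in1 t Ht)) as [S1 [_ S2]]. destruct (s_range i' Gi' t (in2 t Ht)) as [S1' [_ S2']].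
 note (s_nz i Gi t (in1 t Ht)) as N1. note (s_nz i' Gi' t (in2 t Ht)) as N2. set (s := tp i - t) in *.
 set (s' := tp i' - t) in *. fold q in S2. fold q' in S2'. have ED : Dt = s' - s. assert (A1 : Rabs s = ep i * s).
 { destruct (ep_sign i) as [E|E]; rewrite E in *; [rewrite Rabs_pos_eq|rewrite Rabs_left1]; lra. }
 assert (A2 : Rabs s' = ep i' * s').
 { destruct (ep_sign i') as [E|E]; rewrite E in *; [rewrite Rabs_pos_eq|rewrite Rabs_left1]; lra. }
 assert (M : ed * (ep i * ep i') * (2 / s - 2 / s') = 2 * (Rabs Dt / (Rabs s * Rabs s'))).
 { rewrite A1, A2, <- Hed, ED. assert (E1 : ep i * ep i = 1) by (destruct (ep_sign i) as [E|E]; rewrite E; ring).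
  assert (E2 : ep i' * ep i' = 1) by (destruct (ep_sign i') as [E|E]; rewrite E; ring).
  assert (P1 : ep i <> 0) by (destruct (ep_sign i) as [E|E]; rewrite E; lra).
  assert (P2 : ep i' <> 0) by (destruct (ep_sign i') as [E|E]; rewrite E; lra).
  transitivity (2 * (ed * (s' - s) / (ep i * s * (ep i' * s'))) * (ep i * ep i) * (ep i' * ep i')).
  - side.
  - rewrite E1, E2. ring. }
 assert (M2 : lam <= Rabs Dt / (Rabs s * Rabs s')).
 { have P : 0 < Rabs s * Rabs s'. cancel_r (Rabs s * Rabs s').
  replace (Rabs Dt / (Rabs s * Rabs s') * (Rabs s * Rabs s')) with (Rabs Dt) by side.
  have P2 : Rabs s * Rabs s' <= 3 * W / q * (3 * W / q'). via (lam * (3 * W / q * (3 * W / q'))); [side|].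
  cancel_r (q * q'). eapply Rle_trans; [|exact HD]. side. }
 assert (Es : Rabs (ed * (ep i * ep i')) = 1).
 { unfold ed.
  destruct (Rle_dec 0 Dt), (ep_sign i) as [E|E], (ep_sign i') as [E'|E']; rewrite E, E'; try (rewrite Rabs_pos_eq; lra); rewrite Rabs_left1; lra. }
 set (ss := ed * (ep i * ep i')) in *.
 assert (Err : Rabs (ss * ((lgf (cp i) s - 2 / s) - (lgf (cp i') s' - 2 / s'))) <= / (36 * (X ^ 2 * W ^ 2))).
 { rewrite Rabs_mult, Es, Rmult_1_l. upto Rabs_triang. rewrite Rabs_Ropp.
  replace (/ (36 * (X ^ 2 * W ^ 2))) with (/ (72 * (X ^ 2 * W ^ 2)) + / (72 * (X ^ 2 * W ^ 2))) by side. lra. }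
 apply Rabs_le_between in Err. side.
Qed.

Lemma corr_bound : Rabs (IZR cc) <= Rabs Dt * (q * q') + 3 / X * (q / q') + 3 / X * (q' / q).
Proof.
 destruct (q_range i Gi) as (Q1 & _). destruct (q_range i' Gi') as (Q1' & _). fold q in Q1. fold q' in Q1'.
 assert (I : forall j, good_piece j -> 0 < / Xa j <= 3 / X).
 { intros j Gj. destruct Gj as (_ & _ & [H1 _] & _). split.
  - side.
  - replace (3 / X) with (/ (X / 3)) by side. side. }
 note (I i Gi) as I1. note (I i' Gi') as I2. note Dt_formula as F.
 replace (IZR cc) with (Dt * (q * q') + q / q' * / Xa i' + - (q' / q * / Xa i)).
 2: { rewrite F. destruct Gi as (_ & _ & [H1 _] & _). destruct Gi' as (_ & _ & [H1' _] & _). side. }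
 have R1 : 0 < q / q'. have R2 : 0 < q' / q. upto Rabs_triang. rewrite Rabs_Ropp. apply Rplus_le_compat.
 - upto Rabs_triang. apply Rplus_le_compat.
  + rewrite Rabs_mult, (Rabs_pos_eq (q * q')) by nra. lra.
  + rewrite Rabs_pos_eq by nra. side.
 - rewrite Rabs_pos_eq by nra. side.
Qed.

Lemma cc_range : Rabs (IZR cc) <= 12 * (W * IZR Q).
Proof.
 destruct (q_range i Gi) as (Q1 & Q2 & Q3). destruct (q_range i' Gi') as (Q1' & Q2' & Q3'). fold q in Q1, Q2, Q3.
 fold q' in Q1', Q2', Q3'. note corr_bound as Cb. destruct (s_range i Gi a (in1 a !!)) as [_ [_ S2]].
 destruct (s_range i' Gi' a (in2 a !!)) as [_ [_ S2']]. fold q in S2. fold q' in S2'.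
 assert (HD : Rabs Dt <= 3 * W / q' + 3 * W / q).
 { unfold Dt. replace (tp i' - tp i) with ((tp i' - a) + - (tp i - a)) by ring. upto Rabs_triang. rewrite Rabs_Ropp.
  lra. }
 assert (H1 : Rabs Dt * (q * q') <= 3 * W * (q + q')).
 { via ((3 * W / q' + 3 * W / q) * (q * q')); [apply Rmult_le_compat_r; nra|]. right. field. lra. }
 assert (H2 : forall x z, 1 <= z -> 0 <= x -> x <= IZR Q -> 3 / X * (x / z) <= 3 * IZR Q).
 { intros x z Hz Hx HxQ. assert (3 / X <= 3). { cancel_r X. div_cancel. lra. }
  assert (0 <= 3 / X) by (apply Rdiv_le_0_compat; lra). assert (0 <= x / z) by (apply Rdiv_le_0_compat; lra).
  assert (x / z <= IZR Q). { cancel_r z. div_cancel. nra. }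
  apply Rmult_le_compat; lra. }
 note (H2 q q' Q1' !! Q2). note (H2 q' q Q1 !! Q2'). assert (1 <= IZR Q) by (apply IZR_le; assumption).
 have : 3 * W * (q + q') <= 6 * (W * IZR Q). have : IZR Q <= W * IZR Q. lra.
Qed.

(** The second derivative test works as soon as q q' |Dt| is comparable with |cc|. This can only
    fail when the corrections in [Dt_formula] cancel [cc], which requires comparable denominators
    and small |cc| X, the excluded case. *)
Lemma vdc_type : cc <> 0%Z ->
  ~ (Rabs (IZR cc) * X < 216 /\ q <= 18 * q' /\ q' <= 18 * q) ->
  Cmod pint <= 1440000 / b1 * sqrt b2 * (L * y ^ 2 * (W * sqrt L)) / sqrt (Rabs (IZR cc)).
Proof.
 intros Hc Hty. destruct (q_range i Gi) as (Q1 & Q2 & Q3). destruct (q_range i' Gi') as (Q1' & Q2' & Q3').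
 fold q in Q1, Q2, Q3. fold q' in Q1', Q2', Q3'. note W_pos as HW. note corr_bound as Cb.
 note (Rabs_IZR_ge_1 cc Hc) as Hc1. set (n := Rabs (IZR cc)) in *. have HiX : 0 < 3 / X.
 assert (HWi : 3 / X * 1000 <= 3 * W). { cancel_r X. replace (3 / X * 1000 * X) with 3000 by side. lra. }
 assert (Big : n <= 4 * (Rabs Dt * (q * q'))).
 { destruct (s_range i Gi a (in1 a !!)) as [_ [S1 S2]]. destruct (s_range i' Gi' a (in2 a !!)) as [_ [S1' S2']].
  fold q in S1, S2. fold q' in S1', S2'. assert (Tr1 : Rabs (tp i - a) <= Rabs Dt + Rabs (tp i' - a)).
  { replace (tp i - a) with (- Dt + (tp i' - a)) by side. upto Rabs_triang. rewrite Rabs_Ropp. lra. }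
  assert (Tr2 : Rabs (tp i' - a) <= Rabs Dt + Rabs (tp i - a)).
  { replace (tp i' - a) with (Dt + (tp i - a)) by side. apply Rabs_triang. }
  (* A ratio of denominators above 18 puts s and s' on different scales, at least W/(3 z) against at
     most 3 W/z' <= W/(6 z). Then |Dt| >= W/(6 z), and z z' |Dt| >= W z'/6 dominates the corrections
     because W X >= 1000. *)
  assert (NC : forall z z' d, 1 <= z -> 1 <= z' -> 18 * z < z' -> W / (3 * z) <= d + 3 * W / z' -> 3 / X * (z / z') + 3 / X * (z' / z) <= 3 * (d * (z * z'))).
  { intros z z' d Hz Hz' Hzz Hd. assert (E1 : 3 * W / z' <= W / (6 * z)).
   { cancel_r (6 * z * z'). replace (3 * W / z' * (6 * z * z')) with (W * (18 * z)) by side.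
    replace (W / (6 * z) * (6 * z * z')) with (W * z') by side. side. }
   have E2 : W / (3 * z) = W / (6 * z) + W / (6 * z). have E3 : W / (6 * z) <= d.
   assert (E4 : W / 6 * z' <= d * (z * z')). { via (W / (6 * z) * (z * z')); [side|]. side. }
   assert (E5 : z / z' <= z') . { cancel_r z'. div_cancel. nra. }
   assert (E6 : z' / z <= z') . { cancel_r z. div_cancel. nra. }
   have : 3 / X * (z / z') <= 3 / X * z'. have : 3 / X * (z' / z) <= 3 / X * z'. have : 3 / X * z' <= 3 * W / 1000 * z'.
   nra. }
  destruct (Rle_lt_dec q (18 * q')) as [H1|H1]; [destruct (Rle_lt_dec q' (18 * q)) as [H2|H2]|].
  (* For comparable denominators the corrections are at most 108 / X, which is at most |cc| / 2 once
     |cc| X >= 216. *)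
  - have : 3 / X * (q / q') <= 3 / X * 18. have : 3 / X * (q' / q) <= 3 / X * 18. have : 3 / X * 36 <= n / 2. lra.
  - note (NC q q' (Rabs Dt) Q1 Q1' H2 !!). lra.
  - note (NC q' q (Rabs Dt) Q1' Q1 H1 !!). side. }
 set (lam := n / (36 * W ^ 2)). have Hlam : 0 < lam. destruct (main_term lam Hlam) as (ek & Hek & Hm).
 { unfold lam. cancel_r (36 * (X ^ 2 * W ^ 2)).
  replace (/ (36 * (X ^ 2 * W ^ 2)) * (36 * (X ^ 2 * W ^ 2))) with 1 by side.
  replace (n / (36 * W ^ 2) * (36 * (X ^ 2 * W ^ 2))) with (n * X ^ 2) by side. nra. }
 { unfold lam. replace (9 * W ^ 2 * (n / (36 * W ^ 2))) with (n / 4) by side. lra. } have HLy : 0 < L * y.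
 have Hmp : 0 < Rabs mu. eapply Rle_trans.
 - apply (pair_second mu (Dp i) (cp i) (tp i) (Dp i') (cp i') (tp i') a b (100 * (L * y)) (L * y / 36) (Dp_pos i Gi) (Dp_pos i' Gi') Hab mu_nz (!!) (ep i) (ep i') (ep_sign i')) with (lam := lam) (ek := ek); trivial.
  + intros t Ht. note (in1 t Ht) as I. split; [apply (s_range i Gi t I)|].
   destruct (cs_bound i Gi t I) as (B1 & B2 & B3). lra.
  + intros t Ht. note (in2 t Ht) as I. split; [apply (s_range i' Gi' t I)|].
   destruct (cs_bound i' Gi' t I) as (B1 & B2 & B3). lra.
  + intros t Ht. apply (dS_bounds i Gi t (in1 t Ht)).
  + intros t Ht. apply (dS_bounds i' Gi' t (in2 t Ht)).
 - have Sn : 0 < sqrt n. assert (B1 : 100 * (L * y) / Rabs mu <= 100 * (L * y ^ 2) / b1).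
  { cancel_r (Rabs mu * b1). replace (100 * (L * y) / Rabs mu * (Rabs mu * b1)) with (100 * (L * y) * b1) by side.
   replace (100 * (L * y ^ 2) / b1 * (Rabs mu * b1)) with (100 * (L * y) * (Rabs mu * y)) by side. side. }
  assert (B2 : sqrt (Rabs mu * (100 * (L * y)) / (L * y / 36 / (100 * (L * y)) * lam)) <= 3600 * sqrt b2 * (W * sqrt L) / sqrt n).
  { via (sqrt (3600 ^ 2 * (b2 * (W ^ 2 * L)) / n)).
   - apply sqrt_le_1_alt.
    replace (Rabs mu * (100 * (L * y)) / (L * y / 36 / (100 * (L * y)) * lam)) with (12960000 * ((Rabs mu * y) * (W ^ 2 * L)) / n).
    2: { side. } unfold Rdiv. side.
   - right. unfold Rdiv. rewrite sqrt_mult_alt, sqrt_mult_alt, sqrt_mult_alt, sqrt_mult_alt, sqrt_inv, !sqrt_pow2.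
    + ring.
    + lra.
    + lra.
    + nra.
    + lra.
    + nra.
    + side. }
  via (4 * (100 * (L * y ^ 2) / b1) * (3600 * sqrt b2 * (W * sqrt L) / sqrt n)).
  + side.
  + side.
Qed.
End TwoPieces.
End Core.

(** Isolates the comparison of densities in [zero_type]: z is 1/X, P is x |s|, and the density [dSg]
    is 1/(K2 P^2) up to a factor 1 + d. A relative gap of 47/100 z between P and P' becomes one of
    at least 3/10 z between the densities. *)
Lemma ratio_core (z K2 P P' d d' dd dd' : R) :
  0 < z <= 1 -> 0 < K2 -> 0 < P -> 0 < P' -> 0 <= d <= 3 / 1000 * z -> 0 <= d' <= 3 / 1000 * z ->
  / (K2 * P ^ 2) <= dd <= / (K2 * P ^ 2) * (1 + d) ->
  / (K2 * P' ^ 2) <= dd' <= / (K2 * P' ^ 2) * (1 + d') ->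
  (P' * (1 + 47 / 100 * z) <= P -> 3 / 10 * z <= -1 * (1 - dd' / dd)) /\
  (P <= P' * (1 - 47 / 100 * z) -> 3 / 10 * z <= 1 * (1 - dd' / dd)).
Proof.
 intros Hz HK2 HP HP' Hd Hd' [E1 E2] [E1' E2']. have HI : 0 < / (K2 * P ^ 2). split; intros C.
 - assert (H1 : dd * (1 + 3 / 10 * z) <= dd').
  { eapply Rle_trans; [|exact E1']. via (/ (K2 * P ^ 2) * (1 + 3 / 1000 * z) * (1 + 3 / 10 * z)). { mul_r. side. }
   cancel_r (K2 * P ^ 2 * P' ^ 2).
   replace (/ (K2 * P ^ 2) * (1 + 3 / 1000 * z) * (1 + 3 / 10 * z) * (K2 * P ^ 2 * P' ^ 2)) with ((1 + 3 / 1000 * z) * (1 + 3 / 10 * z) * P' ^ 2) by side.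
   replace (/ (K2 * P' ^ 2) * (K2 * P ^ 2 * P' ^ 2)) with (P ^ 2) by side.
   have C3 : (P' * (1 + 47 / 100 * z)) ^ 2 <= P ^ 2. side. }
  cancel_r dd. replace (-1 * (1 - dd' / dd) * dd) with (dd' - dd) by side. lra.
 - assert (H1 : dd' <= dd * (1 - 3 / 10 * z)).
  { via (/ (K2 * P ^ 2) * (1 - 3 / 10 * z)); [|side]. upto E2'. via (/ (K2 * P' ^ 2) * (1 + 3 / 1000 * z)); [side|].
   cancel_r (K2 * P ^ 2 * P' ^ 2).
   replace (/ (K2 * P ^ 2) * (1 - 3 / 10 * z) * (K2 * P ^ 2 * P' ^ 2)) with ((1 - 3 / 10 * z) * P' ^ 2) by side.
   replace (/ (K2 * P' ^ 2) * (1 + 3 / 1000 * z) * (K2 * P ^ 2 * P' ^ 2)) with ((1 + 3 / 1000 * z) * P ^ 2) by side.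
   have C3 : P ^ 2 <= (P' * (1 - 47 / 100 * z)) ^ 2. side. }
  cancel_r dd. replace (1 * (1 - dd' / dd) * dd) with (dd - dd') by side. lra.
Qed.

Section ZeroType.
Variables (y X L W om mu b1 b2 : R) (k Q : Z) (al : Z -> Z -> Z).
Hypotheses (Hy : 0 < y) (HX : 1 <= X) (Hk : (1 <= k)%Z) (HQ : (1 <= Q)%Z) (HQW : IZR Q <= 13 * W) (HW1 : 1 <= W)
 (HL1 : 8000 * IZR Q * X <= L) (HL2 : 40000 <= L) (HWX : 1000 <= W * X) (Hrel : IZR k ^ 2 * X ^ 2 * y * (W ^ 2 * L) = 1)
 (Hb1 : 0 < b1) (Hmu : b1 <= Rabs mu * y <= b2)
 (Hal : forall p q, (1 <= q)%Z -> Z.gcd p q = 1%Z -> Z.divide q (al p q * p + 1))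
 (Hal2 : forall p p' q, (1 <= q)%Z -> Z.divide q (p - p') -> al p q = al p' q).

Lemma al_coprime p q : (1 <= q)%Z -> Z.gcd p q = 1%Z -> Z.gcd q (al p q) = 1%Z.
Proof.
 intros Hq Hg. destruct (Hal p q Hq Hg) as [z Hz]. apply Zgcd_1_rel_prime. apply bezout_rel_prime.
 apply (Bezout_intro q (al p q) 1 z (- p)). lia.
Qed.

(** Vanishing of [cc] gives q | al q' and q' | al' q, so q = q' by coprimality. Then al and al'
    agree mod q, hence p and p' do; and since [al] depends on p mod q only, al = al' and m = m'. *)
Lemma cc_zero i i' : good_piece X W om Q al i -> good_piece X W om Q al i' -> cc al i i' = 0%Z ->
  pc_q i' = pc_q i /\ pc_m i' = pc_m i /\ exists l, pc_p i' = (pc_p i + l * pc_q i)%Z.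
Proof.
 intros (G1 & G2 & _) (G1' & G2' & _) Hc. unfold cc in Hc. destruct i as [p q rt m lo hi], i' as [p' q' rt' m' lo' hi'].
 simpl in *. note (al_coprime p q !! G2) as A1. note (al_coprime p' q' !! G2') as A2. assert (D1 : (q | q')%Z).
 { eapply Z.gauss; [|side]. exists (al p' q' - (m' - m) * q')%Z. lia. } assert (D2 : (q' | q)%Z).
 { eapply Z.gauss; [|side]. exists (al p q + (m' - m) * q)%Z. lia. }
 assert (E : q' = q) by (apply Z.divide_antisym_nonneg; lia || assumption). subst q'.
 assert (E2 : al p' q = (al p q + (m' - m) * q)%Z). { apply Z.mul_reg_r with q; [lia|]. lia. }
 assert (D3 : (q | p' - p)%Z).
 { destruct (Hal p q !! G2) as [z Hz]. destruct (Hal p' q !! G2') as [z' Hz'].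
  apply (Z.gauss q (al p q) (p' - p)); [|side]. exists (z' - z - (m' - m) * p')%Z. side. }
 assert (E3 : al p q = al p' q). { apply Hal2; [lia|]. destruct D3 as [z Hz]. exists (- z)%Z. lia. } split; [side|].
 split; [nia|]. destruct D3 as [z Hz]. exists z. lia.
Qed.

Variables i i' : piece.
Hypotheses (Gi : good_piece X W om Q al i) (Gi' : good_piece X W om Q al i')
 (Hab : Rmax (pc_lo i) (pc_lo i') <= Rmin (pc_hi i) (pc_hi i')).
Variable l : Z.
Hypotheses (Hq : pc_q i' = pc_q i) (Hm : pc_m i' = pc_m i) (Hp : pc_p i' = (pc_p i + l * pc_q i)%Z) (Hl : l <> 0%Z).
Let q := IZR (pc_q i).
Let x := Xa om i.
Let x' := Xa om i'.

Lemma xa_diff : x = x' + IZR l.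
Proof. unfold x, x', Xa. rewrite Hp, Hq, plus_IZR, mult_IZR. destruct Gi as ((G1 & _) & _). side. Qed.

Lemma x_range : X / 3 <= x <= 2 * X /\ X / 3 <= x' <= 2 * X.
Proof. destruct Gi as (_ & _ & A & _), Gi' as (_ & _ & A' & _). side. Qed.

Lemma Dt_zero : tp om al i' - tp om al i = - IZR l / (x * x' * q ^ 2).
Proof.
 destruct (x_range) as [X1 X2]. destruct Gi as ((G1 & _) & _). have : 1 <= IZR (pc_q i). unfold tp. rewrite Hq, Hm.
 assert (E : al (pc_p i') (pc_q i) = al (pc_p i) (pc_q i)). { apply Hal2; [lia|]. exists l. lia. } rewrite E.
 fold q x x'. fold q in H. replace (IZR l) with (x - x') by (rewrite xa_diff; ring). side.
Qed.

(** Passing from x' to x = x' + l changes x' |s'| by a proportion at least |l|/(2 X), while s - s' =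
    l/(x x' q^2) changes it by at most 27/1000 |l|/X. The difference of 1/2 and 27/1000 exceeds
    47/100. *)
Lemma s_compare t : pc_lo i <= t <= pc_hi i -> pc_lo i' <= t <= pc_hi i' ->
  (0 < IZR l -> x' * Rabs (tp om al i' - t) * (1 + 47 / 100 / X) <= x * Rabs (tp om al i - t)) /\
  (IZR l < 0 -> x * Rabs (tp om al i - t) <= x' * Rabs (tp om al i' - t) * (1 - 47 / 100 / X)).
Proof.
 intros Ht Ht'. destruct (x_range) as [X1 X2]. destruct (q_range X W om Q al HQW i Gi) as (Q1 & Q2 & Q3).
 fold q in Q1, Q2, Q3. destruct (s_range X W om Q al i' Gi' t Ht') as (_ & S1 & _). rewrite Hq in S1. fold q in S1.
 note Dt_zero as HD. note xa_diff as XD. note (Rabs_IZR_ge_1 l Hl) as L1. set (s := tp om al i - t) in *.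
 set (s' := tp om al i' - t) in *. have Es : s = s' - - IZR l / (x * x' * q ^ 2). set (A := x' * Rabs s').
 note HW1 as W1. assert (Hs' : 0 < Rabs s'). { eapply Rlt_le_trans; [|exact S1]. side. } have HA : 0 < A.
 have HiX : 0 < / X. assert (Sb : A / (2 * X) <= Rabs s').
 { cancel_r (2 * X). div_cancel. side. }
 assert (Err : x * (Rabs (IZR l) / (x * x' * q ^ 2)) <= 27 / 1000 * (Rabs (IZR l) / X) * A).
 { set (n := Rabs (IZR l)) in *. replace (x * (n / (x * x' * q ^ 2))) with (n / (x' * q ^ 2)) by side.
  cancel_r (x' * q ^ 2 * X). replace (n / (x' * q ^ 2) * (x' * q ^ 2 * X)) with (n * X) by side.
  replace (27 / 1000 * (n / X) * A * (x' * q ^ 2 * X)) with (n * (27 / 1000 * A * (x' * q ^ 2))) by side. mul_l.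
  assert (B1 : X / 3 * (W / (3 * q)) <= A). { apply Rmult_le_compat; try lra. side. }
  assert (B2 : X / 3 * (X / 3 * (W / (3 * q)) * q ^ 2) <= A * (x' * q ^ 2)).
  { replace (A * (x' * q ^ 2)) with (x' * (A * q ^ 2)) by ring. side. }
  replace (X / 3 * (X / 3 * (W / (3 * q)) * q ^ 2)) with (X * (W * X * q) / 27) in B2 by side. have : 1000 <= W * X * q.
  nra. }
 assert (EX : Rabs (x * s - x * s') = x * (Rabs (IZR l) / (x * x' * q ^ 2))).
 { rewrite Es. replace (x * (s' - - IZR l / (x * x' * q ^ 2)) - x * s') with (x * (IZR l / (x * x' * q ^ 2))).
  - rewrite Rabs_mult, (Rabs_pos_eq x) by lra. unfold Rdiv. rewrite Rabs_mult, Rabs_inv.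
   rewrite (Rabs_pos_eq (x * x' * q ^ 2)); [side|]. side.
  - side. }
 assert (T1 : x * Rabs s' <= x * Rabs s + 27 / 1000 * (Rabs (IZR l) / X) * A).
 { rewrite <- (Rabs_pos_eq x) by lra. rewrite <- !Rabs_mult. replace (x * s') with (x * s + - (x * s - x * s')) by ring.
  upto Rabs_triang. rewrite Rabs_Ropp. lra. }
 assert (T2 : x * Rabs s <= x * Rabs s' + 27 / 1000 * (Rabs (IZR l) / X) * A).
 { rewrite <- (Rabs_pos_eq x) by lra. rewrite <- !Rabs_mult. replace (x * s) with (x * s' + (x * s - x * s')) by ring.
  upto Rabs_triang. lra. }
 assert (T3 : x * Rabs s' = A + IZR l * Rabs s') by (unfold A; rewrite XD; ring).
 assert (T4 : Rabs (IZR l) / X * A / 2 <= Rabs (IZR l) * Rabs s').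
 { replace (Rabs (IZR l) / X * A / 2) with (Rabs (IZR l) * (A / (2 * X))) by side. side. }
 have T5 : A / X <= Rabs (IZR l) / X * A. fold A. split; intros Hs.
 - assert (EL : Rabs (IZR l) = IZR l) by (apply Rabs_pos_eq; lra). rewrite EL in *. side.
 - assert (EL : Rabs (IZR l) = - IZR l) by (apply Rabs_left; lra). rewrite EL in *. side.
Qed.

(** The points tp and tp' almost coincide here, and second derivatives hardly differ. But D depends
    on x = om - p/q, so the first derivatives differ by a proportion of at least 3/(10 X), and the
    first derivative test applies; [main_term] with its least [lam] provides the monotonicity. *)
Lemma zero_type : Cmod (pint y om mu k al i i') <= 334 / b1 * (L * y ^ 2 * X).
Proof.
 destruct (x_range) as [X1 X2]. destruct (q_range X W om Q al HQW i Gi) as (Q1 & Q2 & Q3). fold q in Q1, Q2, Q3.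
 note HW1 as W1. assert (HLy : 0 < L * y) by (apply Rmult_lt_0_compat; lra).
 assert (Hmz : mu <> 0) by (intros E; rewrite E, Rabs_R0 in Hmu; lra).
 assert (Hmp : 0 < Rabs mu) by (apply Rabs_pos_lt; assumption). set (lam := / (36 * (X ^ 2 * W ^ 2))).
 assert (Hlam : 0 < lam) by (apply Rinv_0_lt_compat; nra).
 destruct (main_term y X L W om k Q al Hy HX HQW HW1 HL1 HL2 Hrel i i' Gi Gi' lam Hlam) as (ek & Hek & Hmain).
 { unfold lam; lra. }
 { rewrite Dt_zero, Hq. fold q. unfold Rdiv. rewrite Rabs_mult, Rabs_inv, Rabs_Ropp.
  assert (P0 : 0 < x * x') by (apply Rmult_lt_0_compat; lra).
  assert (P : 0 < x * x' * q ^ 2) by (apply Rmult_lt_0_compat; [assumption|apply pow_lt; lra]).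
  rewrite (Rabs_pos_eq (x * x' * q ^ 2)) by lra. note (Rabs_IZR_ge_1 l Hl).
  replace (Rabs (IZR l) * / (x * x' * q ^ 2) * (q * q)) with (Rabs (IZR l) * / (x * x')) by (field; lra).
  replace (9 * W ^ 2 * lam) with (1 * / (2 * X * (2 * X))) by (unfold lam; field; lra).
  apply Rmult_le_compat; try lra; [left; apply Rinv_0_lt_compat; nra|]. apply Rinv_le_contravar; [assumption|].
  apply Rmult_le_compat; lra. }
 set (a := Rmax (pc_lo i) (pc_lo i')) in *. set (b := Rmin (pc_hi i) (pc_hi i')) in *.
 assert (in1 : forall t, a <= t <= b -> pc_lo i <= t <= pc_hi i).
 { intros t Ht. note (Rmax_l (pc_lo i) (pc_lo i')). note (Rmin_l (pc_hi i) (pc_hi i')). unfold a, b in *. lra. }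
 assert (in2 : forall t, a <= t <= b -> pc_lo i' <= t <= pc_hi i').
 { intros t Ht. note (Rmax_r (pc_lo i) (pc_lo i')). note (Rmin_r (pc_hi i) (pc_hi i')). unfold a, b in *. lra. }
 assert (Hl0 : IZR l <> 0) by (intros E; apply Hl; apply eq_IZR; assumption).
 set (es := if Rlt_dec 0 (IZR l) then -1 else 1).
 assert (Hes : es = 1 \/ es = -1) by (unfold es; destruct (Rlt_dec 0 (IZR l)); lra).
 assert (P1 := Dp_pos y X L W om k Q al Hy HX HQW HW1 HL2 Hrel i Gi).
 assert (P2 := Dp_pos y X L W om k Q al Hy HX HQW HW1 HL2 Hrel i' Gi'). assert (HiX : 0 < / X <= 1).
 { split; [apply Rinv_0_lt_compat; lra|]. rewrite <- Rinv_1. apply Rinv_le_contravar; lra. }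
 assert (LX : 312 / L <= 48 / 1000 * / X).
 { assert (8000 * X <= L).
  { eapply Rle_trans; [|exact HL1]. assert (1 <= IZR Q) by (apply IZR_le; assumption). apply Rmult_le_compat_r; lra. }
  apply Rmult_le_reg_r with (L * X); [apply Rmult_lt_0_compat; lra|].
  replace (312 / L * (L * X)) with (312 * X) by (field; lra).
  replace (48 / 1000 * / X * (L * X)) with (48 / 1000 * L) by (field; lra). lra. }
 eapply Rle_trans.
 - unfold pint. fold a b.
  apply (pair_first mu (Dp om k i) (cp y om k i) (tp om al i) (Dp om k i') (cp y om k i') (tp om al i') a b (100 * (L * y)) (L * y / 36) P1 P2 Hab Hmz (!!) (ep i) (ep i') (ep_sign i')) with (lam := lam) (ek := ek) (k0 := 3 / 10 / X) (es := es); trivial.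
  + intros t Ht. split; [apply (s_range X W om Q al i Gi t (in1 t Ht))|].
   destruct (cs_bound y X L W om k Q al Hy HX HQW HW1 HL2 Hrel i Gi t (in1 t Ht)) as (B1 & B2 & B3). lra.
  + intros t Ht. split; [apply (s_range X W om Q al i' Gi' t (in2 t Ht))|].
   destruct (cs_bound y X L W om k Q al Hy HX HQW HW1 HL2 Hrel i' Gi' t (in2 t Ht)) as (B1 & B2 & B3). lra.
  + intros t Ht. apply (dS_bounds y X L W om k Q al Hy HX HQW HW1 HL2 Hrel i Gi t (in1 t Ht)).
  + intros t Ht. apply (dS_bounds y X L W om k Q al Hy HX HQW HW1 HL2 Hrel i' Gi' t (in2 t Ht)).
  + apply Rdiv_lt_0_compat; lra.
  + intros t Ht. destruct (s_compare t (in1 t Ht) (in2 t Ht)) as [C1 C2].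
   note (s_range X W om Q al i Gi t (in1 t Ht)) as (_ & R1 & _). fold q in R1.
   note (s_range X W om Q al i' Gi' t (in2 t Ht)) as (_ & R2 & _). rewrite Hq in R2. fold q in R2.
   assert (Wq : 0 < W / (3 * q)) by (apply Rdiv_lt_0_compat; lra).
   destruct (cs_bound y X L W om k Q al Hy HX HQW HW1 HL2 Hrel i Gi t (in1 t Ht)) as (B1 & B2 & B3).
   destruct (cs_bound y X L W om k Q al Hy HX HQW HW1 HL2 Hrel i' Gi' t (in2 t Ht)) as (B1' & B2' & B3').
   note (dS_bounds y X L W om k Q al Hy HX HQW HW1 HL2 Hrel i Gi t (in1 t Ht)) as (DP & _).
   note (s_nz X W om Q al i Gi t (in1 t Ht)) as N1. note (s_nz X W om Q al i' Gi' t (in2 t Ht)) as N2.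
   note (dSg_bounds _ (cp y om k i) P1 (tp om al i - t) !! N1) as [E1 E2].
   note (dSg_bounds _ (cp y om k i') P2 (tp om al i' - t) !! N2) as [E1' E2'].
   assert (EP : Dp om k i * (tp om al i - t) ^ 2 = (IZR k * q) ^ 2 * (x * Rabs (tp om al i - t)) ^ 2).
   { rewrite (Rpow_mult_distr x (Rabs (tp om al i - t))), pow2_abs. unfold Dp. fold q x. ring. }
   assert (EP' : Dp om k i' * (tp om al i' - t) ^ 2 = (IZR k * q) ^ 2 * (x' * Rabs (tp om al i' - t)) ^ 2).
   { rewrite (Rpow_mult_distr x' (Rabs (tp om al i' - t))), pow2_abs. unfold Dp. rewrite Hq. fold q x'. ring. }
   rewrite EP in E1, E2. rewrite EP' in E1', E2'.
   assert (DD : forall c, Rabs c <= 312 / L -> 0 <= c ^ 2 <= 3 / 1000 * / X).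
   { intros c Hc. split; [apply pow2_ge_0|]. rewrite <- pow2_abs.
    via ((48 / 1000 * / X) ^ 2); [apply pow_incr; split; [apply Rabs_pos|lra]|]. set (z := / X) in *. clearbody z.
    clear - HiX. nra. }
   destruct (ratio_core (/ X) ((IZR k * q) ^ 2) (x * Rabs (tp om al i - t)) (x' * Rabs (tp om al i' - t)) _ _ _ _ HiX ltac:(apply pow_lt; apply Rmult_lt_0_compat; [apply IZR_lt; lia|lra]) ltac:(apply Rmult_lt_0_compat; lra) ltac:(apply Rmult_lt_0_compat; lra) (DD _ (Rle_trans _ _ _ B1 B2)) (DD _ (Rle_trans _ _ _ B1' B2')) (conj E1 E2) (conj E1' E2')) as [K1 K2].
   unfold es. destruct (Rlt_dec 0 (IZR l)) as [Hlp|Hln].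
   * apply K1. apply C1. assumption.
   * apply K2. apply C2. lra.
 - cancel_r (Rabs mu * b1).
  replace (100 * (L * y) / Rabs mu / (3 / 10 / X) * (Rabs mu * b1)) with (1000 / 3 * (L * y * X) * b1) by (field; lra).
  replace (334 / b1 * (L * y ^ 2 * X) * (Rabs mu * b1)) with (334 * (L * y * X) * (Rabs mu * y)) by (field; lra).
  assert (0 < L * y * X) by (apply Rmult_lt_0_compat; lra). nra.
Qed.
End ZeroType.

Definition zrange (lo : Z) (n : nat) : list Z := map (fun j => (lo + Z.of_nat j)%Z) (seq 0 n).

Lemma in_zrange lo n z : (lo <= z < lo + Z.of_nat n)%Z -> In z (zrange lo n).
Proof. intros H. apply in_map_iff. exists (Z.to_nat (z - lo)). split; [lia|]. apply in_seq. lia. Qed.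

Lemma length_zrange lo n : length (zrange lo n) = n.
Proof. unfold zrange. rewrite length_map, length_seq. side. Qed.

Lemma sum_inv_sqrt_zs N : Rsum (fun n => / sqrt (Rabs (IZR n))) (zs N) <= 4 * sqrt (INR N).
Proof.
 induction N.
 - simpl. side.
 - rewrite Rsum_zs_S.
  assert (E1 : Rabs (IZR (Z.of_nat (S N))) = INR (S N)) by (rewrite <- INR_IZR_INZ; apply Rabs_pos_eq; apply pos_INR).
  assert (E2 : Rabs (IZR (- Z.of_nat (S N))) = INR (S N)) by (rewrite opp_IZR, Rabs_Ropp; exact E1). rewrite E1, E2.
  have P : 0 < INR (S N). note (pos_INR N). have Ps : 0 < sqrt (INR (S N)). note (sqrt_sqrt (INR (S N)) !!) as S1.
  note (sqrt_sqrt (INR N) !!) as S0. assert (Hd : INR (S N) = INR N + 1) by apply S_INR.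
  set (a := sqrt (INR (S N))) in *. set (b := sqrt (INR N)) in *. assert (K : / a <= 2 * (a - b)).
  { cancel_r a. rewrite Rinv_l by lra. nra. } lra.
Qed.

Lemma count_below_zs (B : R) (N m : nat) : B <= INR m ->
  Rsum (fun n => if Rlt_dec (Rabs (IZR n)) B then 1 else 0) (zs N) <= 2 * INR m.
Proof.
 intros HB. assert (H : Rsum (fun n => if Rlt_dec (Rabs (IZR n)) B then 1 else 0) (zs N) <= 2 * INR (Nat.min N m)).
 { induction N; [simpl; lra|]. rewrite Rsum_zs_S.
  assert (E1 : Rabs (IZR (Z.of_nat (S N))) = INR (S N)) by (rewrite <- INR_IZR_INZ; apply Rabs_pos_eq; apply pos_INR).
  assert (E2 : Rabs (IZR (- Z.of_nat (S N))) = INR (S N)) by (rewrite opp_IZR, Rabs_Ropp; exact E1). rewrite E1, E2.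
  destruct (Rlt_dec (INR (S N)) B) as [Hl|Hn].
  - assert (S N < m)%nat by (apply INR_lt; lra). rewrite Nat.min_l in * by lia. rewrite S_INR. lra.
  - have : INR (Nat.min N m) <= INR (Nat.min (S N) m). lra. }
 upto H. side.
Qed.

Section CoreSum.
Variables (y X L W om mu b1 b2 : R) (k Q : Z) (al : Z -> Z -> Z).
Hypotheses (Hy : 0 < y) (HX : 1 <= X) (Hk : (1 <= k)%Z) (HQ : (1 <= Q)%Z) (HQW : IZR Q <= 13 * W) (HW1 : 1 <= W)
 (HL1 : 8000 * IZR Q * X <= L) (HL2 : 40000 <= L) (HWX : 1000 <= W * X) (Hrel : IZR k ^ 2 * X ^ 2 * y * (W ^ 2 * L) = 1)
 (Hb1 : 0 < b1) (Hmu : b1 <= Rabs mu * y <= b2)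
 (Hal : forall p q, (1 <= q)%Z -> Z.gcd p q = 1%Z -> Z.divide q (al p q * p + 1))
 (Hal2 : forall p p' q, (1 <= q)%Z -> Z.divide q (p - p') -> al p q = al p' q).

Let good := good_piece X W om Q al.

Definition pair_key (i i' : piece) : Z * Z * Z * bool :=
  (cc al i i', (pc_q i' / pc_q i)%Z, (pc_p i' / pc_q i')%Z, pc_right i').

(** Since al p = -1 mod q, multiplying [cc] by p gives q' mod q; with the quotient q' / q this
    recovers q'. Then al(p', q') is known mod q', hence p' mod q', and the quotient p' / q' recovers
    p'. Finally [cc] determines m'. *)
Lemma pair_key_inj i i1 i2 : good i -> good i1 -> good i2 ->
  pair_key i i1 = pair_key i i2 -> pc_key i1 = pc_key i2.
Proof.
 intros (G1 & G2 & _) (G1' & G2' & _) (G1'' & G2'' & _) E. injection E as E1 E2 E3 E4. unfold cc in E1.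
 destruct i as [p q rt m lo hi], i1 as [p1 q1 rt1 m1 lo1 hi1], i2 as [p2 q2 rt2 m2 lo2 hi2]. simpl in *.
 destruct (Hal p q !! G2) as [z Hz]. assert (D1 : (q | q1 - q2)%Z).
 { exists (z * (q1 - q2) - (al p1 q1 * p - (m1 - m) * q1 * p) + (al p2 q2 * p - (m2 - m) * q2 * p))%Z.
  assert (E5 : ((al p1 q1 * q - al p q * q1 - (m1 - m) * (q * q1)) * p = (al p2 q2 * q - al p q * q2 - (m2 - m) * (q * q2)) * p)%Z) by (f_equal; exact E1).
  nia. }
 assert (Eq : q1 = q2).
 { note (Z.div_mod q1 q !!) as M1. note (Z.div_mod q2 q !!) as M2. assert (M : (q1 mod q = q2 mod q)%Z).
  { destruct D1 as [w Hw]. replace q1 with (q2 + w * q)%Z by lia. apply Z.mod_add. lia. } side. }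
 subst q2. assert (E6 : (al p1 q1 - (m1 - m) * q1 = al p2 q1 - (m2 - m) * q1)%Z).
 { apply Z.mul_reg_r with q; [lia|]. lia. } assert (D2 : (q1 | p1 - p2)%Z).
 { destruct (Hal p1 q1 !! G2') as [z1 Hz1]. destruct (Hal p2 q1 !! G2'') as [z2 Hz2].
  apply (Z.gauss q1 (al p1 q1) (p1 - p2)); [|apply al_coprime; side]. exists (z1 - z2 - (m1 - m2) * p2)%Z. side. }
 assert (Ep : p1 = p2).
 { note (Z.div_mod p1 q1 !!) as M1. note (Z.div_mod p2 q1 !!) as M2. assert (M : (p1 mod q1 = p2 mod q1)%Z).
  { destruct D2 as [w Hw]. replace p1 with (p2 + w * q1)%Z by lia. apply Z.mod_add. lia. } side. }
 subst p2. assert (m1 = m2) by nia. subst. side.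
Qed.

Lemma overlap_pint i i' : Rmax (pc_lo i) (pc_lo i') <= Rmin (pc_hi i) (pc_hi i') ->
  overlap pc_lo pc_hi (fp y om mu k al) i i' = pint y om mu k al i i'.
Proof.
 intros H. unfold overlap. destruct (Rle_dec _ _) as [_|N]; [|side]. apply cint_ext. intros t. unfold fp.
 rewrite RtoC_mult.
 replace (mu * (Sg (Dp om k i) (cp y om k i) (tp om al i - t) - Sg (Dp om k i') (cp y om k i') (tp om al i' - t))) with (mu * Sg (Dp om k i) (cp y om k i) (tp om al i - t) + - (mu * Sg (Dp om k i') (cp y om k i') (tp om al i' - t))) by ring.
 rewrite e_plus, <- e_conj, Cmult_conj.
 assert (E : forall x : R, Cconj (RtoC x) = RtoC x) by (intros x; unfold Cconj, RtoC; simpl; f_equal; ring). rewrite E.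
 ring.
Qed.

Lemma floor_range i : good i ->
  (Int_part (om - 2 * X) <= pc_p i / pc_q i < Int_part (om - 2 * X) + Z.of_nat (Z.to_nat (Int_part (2 * X) + 2)))%Z.
Proof.
 intros ((G1 & _) & _ & [A1 A2] & _). unfold Xa in *. set (p := pc_p i) in *. set (q := pc_q i) in *.
 have Hq : 0 < IZR q. destruct (base_Int_part (om - 2 * X)) as [F1 F2]. destruct (base_Int_part (2 * X)) as [F3 F4].
 assert (P1 : IZR (p / q) <= IZR p / IZR q).
 { cancel_r (IZR q). unfold Rdiv. rewrite Rmult_assoc, Rinv_l, Rmult_1_r by lra. rewrite <- mult_IZR. apply IZR_le.
  rewrite Z.mul_comm. apply Z.mul_div_le; lia. }
 assert (P2 : IZR p / IZR q < IZR (p / q) + 1).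
 { apply Rmult_lt_reg_r with (IZR q); [side|]. unfold Rdiv. rewrite Rmult_assoc, Rinv_l, Rmult_1_r by lra.
  rewrite <- plus_IZR, <- mult_IZR. apply IZR_lt. note (Z.mod_pos_bound p q !!). note (Z.div_mod p q !!). lia. }
 assert (I0 : (0 <= Int_part (2 * X))%Z). { assert (-1 < Int_part (2 * X))%Z; [apply lt_IZR; simpl; lra|lia]. }
 rewrite Z2Nat.id by lia. split.
 - assert (Int_part (om - 2 * X) < p / q + 1)%Z; [|lia]. apply lt_IZR. rewrite plus_IZR. side.
 - apply lt_IZR. rewrite !plus_IZR. side.
Qed.

Let T (i : piece) := 100 * (L * y) * len y om k al i.
Let V0 := 334 / b1 * (L * y ^ 2 * X).
Let V := 1440000 / b1 * sqrt b2 * (L * y ^ 2 * (W * sqrt L)).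

(** A bound for the overlap with a partner of given key. For c = 0 the partner has the same q, so a
    = 1, and d tells whether p is also the same. [V0] comes from [zero_type], [V] from [vdc_type],
    and [T] is the trivial bound for the exceptional keys. *)
Let key_bound (i : piece) (k : Z * Z * Z * bool) : R :=
  match k with (c, a, d, _) =>
    if Z.eq_dec c 0 then
      (if Z.eq_dec a 1 then V0 + (if Z.eq_dec d (pc_p i / pc_q i) then T i else 0) else 0)
    else V / sqrt (Rabs (IZR c)) + (if Rlt_dec (Rabs (IZR c)) (216 / X) then if Z_le_dec a 18 then T i else 0 else 0)
  end.

Lemma len_nonneg i : good i -> 0 <= len y om k al i.
Proof.
 intros G. destruct (G) as (_ & _ & _ & A1 & A2 & A3 & _).
 assert (Hab : Rmax (pc_lo i) (pc_lo i) <= Rmin (pc_hi i) (pc_hi i)) by (rewrite Rmax_left, Rmin_left; lra).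
 note (trivial_bound y X L W om mu k Q al Hy HX HQW HW1 HL2 Hrel i i G G Hab) as H.
 note (Cmod_ge_0 (pint y om mu k al i i)). have : 0 < 100 * (L * y). side.
Qed.

Lemma V_nonneg : 0 <= V0 /\ 0 <= V.
Proof.
 note (sqrt_pos b2). note (sqrt_pos L). have : 1 <= IZR Q. have : 0 <= L * y ^ 2. split.
 - side.
 - side.
Qed.

Lemma T_nonneg i : good i -> 0 <= T i.
Proof. intros G. apply Rmult_le_pos; [|apply len_nonneg; assumption]. side. Qed.

Lemma key_bound_nonneg i kk : good i -> 0 <= key_bound i kk.
Proof.
 intros G. note (T_nonneg i G). destruct V_nonneg as [N0 N1]. unfold key_bound. destruct kk as [[[c a] d] s].
 destruct (Z.eq_dec c 0).
 - destruct (Z.eq_dec a 1); [|lra]. destruct (Z.eq_dec _ _); lra.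
 - assert (0 <= V / sqrt (Rabs (IZR c))).
  { apply Rdiv_le_0_compat; [side|]. apply sqrt_lt_R0. note (Rabs_IZR_ge_1 c n). lra. }
  destruct (Rlt_dec _ _); [destruct (Z_le_dec _ _)|]; lra.
Qed.

Lemma key_bound_correct i i' : good i -> good i' ->
  Rmax (pc_lo i) (pc_lo i') <= Rmin (pc_hi i) (pc_hi i') ->
  Cmod (overlap pc_lo pc_hi (fp y om mu k al) i i') <= key_bound i (pair_key i i').
Proof.
 intros G G' Hab. rewrite overlap_pint by assumption.
 note (trivial_bound y X L W om mu k Q al Hy HX HQW HW1 HL2 Hrel i i' G G' Hab) as TB. fold (T i) in TB.
 destruct V_nonneg as [N0 N1]. destruct (G) as (Gq & _). destruct (G') as (Gq' & _). unfold key_bound, pair_key.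
 destruct (Z.eq_dec (cc al i i') 0) as [E|E].
 - destruct (cc_zero X W om Q al Hal Hal2 i i' G G' E) as (Eq & Em & l & El). rewrite Eq, El. rewrite Z.div_same by lia.
  destruct (Z.eq_dec 1 1) as [_|]; [|lia]. rewrite Z.div_add by lia.
  destruct (Z.eq_dec (pc_p i / pc_q i + l) (pc_p i / pc_q i)) as [E2|E2]; [lra|]. rewrite Rplus_0_r.
  apply (zero_type y X L W om mu b1 b2 k Q al Hy HX Hk HQ HQW HW1 HL1 HL2 HWX Hrel Hb1 Hmu Hal2 i i' G G' Hab l Eq Em El).
  lia.
 - assert (VN : 0 <= V / sqrt (Rabs (IZR (cc al i i')))).
  { apply Rdiv_le_0_compat; [side|]. apply sqrt_lt_R0. note (Rabs_IZR_ge_1 _ E). lra. }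
  destruct (classic (Rabs (IZR (cc al i i')) * X < 216 /\ IZR (pc_q i) <= 18 * IZR (pc_q i') /\ IZR (pc_q i') <= 18 * IZR (pc_q i))) as [(C1 & C2 & C3)|NC].
  + destruct (Rlt_dec _ _) as [_|N].
   2: { exfalso; apply N. apply Rmult_lt_reg_r with X; [lra|]. div_cancel. lra. }
   destruct (Z_le_dec _ _) as [_|N]; [lra|]. exfalso; apply N. rewrite <- mult_IZR in C3. apply le_IZR in C3.
   apply Z.div_le_upper_bound; lia.
  + note (vdc_type y X L W om mu b1 b2 k Q al Hy HX HQW HW1 HL1 HL2 HWX Hrel Hb1 Hmu i i' G G' Hab E NC) as VB.
   fold V in VB. destruct (Rlt_dec _ _); [destruct (Z_le_dec _ _)|]; lra.
Qed.

Let C0 := Z.to_nat (up (12 * (W * IZR Q))).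
Let box (i : piece) : list (Z * Z * Z * bool) :=
  flat_map (fun c => flat_map (fun a => flat_map (fun d => (c, a, d, true) :: (c, a, d, false) :: nil)
     (zrange (Int_part (om - 2 * X)) (Z.to_nat (Int_part (2 * X) + 2))))
     (zrange 0 (Z.to_nat (Q / pc_q i + 1)))) (0%Z :: zs C0).

Lemma in_box i i' : good i -> good i' -> Rmax (pc_lo i) (pc_lo i') <= Rmin (pc_hi i) (pc_hi i') ->
  In (pair_key i i') (box i).
Proof.
 intros G G' Hab. unfold box, pair_key. apply in_flat_map. exists (cc al i i'). split.
 { destruct (Z.eq_dec (cc al i i') 0) as [E|E]; [left; symmetry; assumption|right]. apply in_zs. split; [side|].
  note (cc_range X W om Q al HX HQ HQW HW1 i i' G G' Hab) as B. rewrite <- abs_IZR in B.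
  destruct (archimed (12 * (W * IZR Q))) as [A1 _].
  assert (Z.abs (cc al i i') < up (12 * (W * IZR Q)))%Z by (apply lt_IZR; lra). side. }
 apply in_flat_map. exists (pc_q i' / pc_q i)%Z. destruct (G) as (Gq & _). destruct (G') as (Gq' & _). split.
 { apply in_zrange. note (Z.div_pos (pc_q i') (pc_q i) !! !!). note (Z.div_le_mono (pc_q i') Q (pc_q i) !! !!). lia. }
 apply in_flat_map. exists (pc_p i' / pc_q i')%Z. split. { apply in_zrange. apply floor_range; assumption. }
 destruct (pc_right i'); simpl; tauto.
Qed.

(** The trivial bound is used for boundedly many keys. With c = 0 only a = 1 and at most 5 X values
    of d remain, on two sides. With c <> 0 the sum of |c|^(-1/2) up to 12 W Q is << sqrt (W Q),
    times the number of a and d. *)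
Lemma box_sum i : good i ->
  Rsum (key_bound i) (box i) <= 20000000 * T i + 10 * X * V0 + 200 * (X * (IZR Q / IZR (pc_q i) + 1) * sqrt (W * IZR Q)) * V.
Proof.
 intros G. pose proof (T_nonneg i G) as TN. destruct V_nonneg as [N0 N1]. destruct (G) as ((Gq & Gq2) & _).
 set (ds := zrange (Int_part (om - 2 * X)) (Z.to_nat (Int_part (2 * X) + 2))).
 set (as_ := zrange 0 (Z.to_nat (Q / pc_q i + 1))). assert (Ld : INR (length ds) <= 5 * X).
 { unfold ds. rewrite length_zrange. destruct (base_Int_part (2 * X)) as [F3 F4].
  assert (I0 : (0 <= Int_part (2 * X))%Z). { assert (-1 < Int_part (2 * X))%Z; [apply lt_IZR; simpl; lra|lia]. }
  rewrite INR_IZR_INZ, Z2Nat.id by lia. rewrite plus_IZR. side. }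
 assert (La : INR (length as_) <= IZR Q / IZR (pc_q i) + 1).
 { unfold as_. rewrite length_zrange. pose proof (Z.div_pos Q (pc_q i) ltac:(lia) ltac:(lia)).
  rewrite INR_IZR_INZ, Z2Nat.id by lia. rewrite plus_IZR. assert (Hq : 0 < IZR (pc_q i)) by side.
  assert (IZR (Q / pc_q i) <= IZR Q / IZR (pc_q i)); [|lra]. apply Rmult_le_reg_r with (IZR (pc_q i)); [side|].
  unfold Rdiv. rewrite Rmult_assoc, Rinv_l, Rmult_1_r by lra. rewrite <- mult_IZR. apply IZR_le. rewrite Z.mul_comm.
  apply Z.mul_div_le; lia. }
 assert (La0 := pos_INR (length as_)). assert (Ld0 := pos_INR (length ds)). unfold box. rewrite Rsum_flat_map.
 fold ds as_.
 assert (S1 : forall c, Rsum (key_bound i) (flat_map (fun a => flat_map (fun d => (c, a, d, true) :: (c, a, d, false) :: nil) ds) as_) = Rsum (fun a => Rsum (fun d => 2 * key_bound i (c, a, d, true)) ds) as_).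
 { intros c. rewrite Rsum_flat_map. apply Rsum_ext. intros a _. rewrite Rsum_flat_map. apply Rsum_ext. intros d _.
  simpl. ring. }
 erewrite Rsum_ext; [|intros c _; apply S1].
 change (Rsum (fun c => Rsum (fun a => Rsum (fun d => 2 * key_bound i (c, a, d, true)) ds) as_) (0%Z :: zs C0)) with (Rsum (fun a => Rsum (fun d => 2 * key_bound i (0%Z, a, d, true)) ds) as_ + Rsum (fun c => Rsum (fun a => Rsum (fun d => 2 * key_bound i (c, a, d, true)) ds) as_) (zs C0)).
 assert (NDz : forall lo n, NoDup (zrange lo n)).
 { intros lo n. apply Injective_map_NoDup; [intros u v; lia|apply seq_NoDup]. }
 assert (Ind1 : forall (l : list Z) v0 z, NoDup l -> 0 <= z -> Rsum (fun d => if Z.eq_dec d v0 then z else 0) l <= z).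
 { intros l v0 z. induction l as [|d l IH]; simpl; intros N Hz; [lra|]. inversion N; subst.
  destruct (Z.eq_dec d v0) as [->|].
  - assert (E0 : Rsum (fun d => if Z.eq_dec d v0 then z else 0) l = 0); [|side].
   transitivity (Rsum (fun _ : Z => 0) l); [|apply Rsum_0]. apply Rsum_ext. intros d Hd.
   destruct (Z.eq_dec d v0); [subst; contradiction|side].
  - specialize (IH H2 Hz). side. }
 assert (Zero : Rsum (fun a => Rsum (fun d => 2 * key_bound i (0%Z, a, d, true)) ds) as_ <= 10 * X * V0 + 2 * T i).
 { eapply Rle_trans; [|apply (Ind1 as_ 1%Z (10 * X * V0 + 2 * T i)); [side|nra]]. apply Rsum_le. intros a _.
  rewrite Rsum_scal. simpl. destruct (Z.eq_dec a 1).
  - rewrite Rsum_plus, Rsum_const. pose proof (Ind1 ds (pc_p i / pc_q i)%Z (T i) (NDz _ _) TN). nra.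
  - rewrite Rsum_0. lra. }
 assert (NonZero : Rsum (fun c => Rsum (fun a => Rsum (fun d => 2 * key_bound i (c, a, d, true)) ds) as_) (zs C0) <= Rsum (fun c => 10 * X * (IZR Q / IZR (pc_q i) + 1) * V * / sqrt (Rabs (IZR c)) + 10 * X * 19 * T i * (if Rlt_dec (Rabs (IZR c)) (216 / X) then 1 else 0)) (zs C0)).
 { apply Rsum_le. intros c Hc. apply in_zs in Hc. unfold key_bound. destruct (Z.eq_dec c 0); [lia|].
  assert (VN : 0 <= V / sqrt (Rabs (IZR c))).
  { apply Rdiv_le_0_compat; [side|]. apply sqrt_lt_R0. pose proof (Rabs_IZR_ge_1 c n). lra. }
  set (Tc := if Rlt_dec (Rabs (IZR c)) (216 / X) then T i else 0).
  assert (TcN : 0 <= Tc) by (unfold Tc; destruct (Rlt_dec _ _); lra). erewrite Rsum_ext.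
  2: { intros a _. rewrite Rsum_const.
   instantiate (1 := fun a => INR (length ds) * (2 * (V / sqrt (Rabs (IZR c)))) + INR (length ds) * 2 * (if Z_le_dec a 18 then Tc else 0)).
   unfold Tc. destruct (Rlt_dec _ _), (Z_le_dec a 18); ring. }
  rewrite Rsum_plus, Rsum_const, Rsum_scal.
  assert (S19 : Rsum (fun a => if Z_le_dec a 18 then Tc else 0) as_ <= 19 * Tc).
  { assert (F : forall m, Rsum (fun a => if Z_le_dec a 18 then Tc else 0) (zrange 0 m) <= INR (Nat.min m 19) * Tc).
   { induction m as [|m IHm]; [simpl; lra|]. unfold zrange in *. rewrite seq_S, map_app, Rsum_app. simpl Rsum.
    simpl Z.add in *. destruct (Z_le_dec _ _).
    - replace (Nat.min m 19) with m in IHm by lia. replace (Nat.min (S m) 19) with (S m) by lia. rewrite S_INR. lra.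
    - replace (Nat.min m 19) with 19%nat in IHm by lia. replace (Nat.min (S m) 19) with 19%nat by lia. lra. }
   eapply Rle_trans; [apply F|]. apply Rmult_le_compat_r; [side|]. replace 19 with (INR 19) by (simpl; ring). side. }
  apply Rplus_le_compat.
  - apply Rle_trans with ((IZR Q / IZR (pc_q i) + 1) * (5 * X * (2 * (V / sqrt (Rabs (IZR c)))))).
   + side.
   + side.
  - apply Rle_trans with (5 * X * 2 * (19 * Tc)).
   + side.
   + right. unfold Tc. destruct (Rlt_dec _ _); ring. }
 rewrite Rsum_plus, !Rsum_scal in NonZero.
 (* If X > 216 no nonzero integer lies below 216 / X; otherwise both X and the number of such c are
    bounded. *)
 assert (Cn : Rsum (fun c => 10 * X * 19 * T i * (if Rlt_dec (Rabs (IZR c)) (216 / X) then 1 else 0)) (zs C0) <= 1000000 * T i * 19).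
 { destruct (Rle_lt_dec X 216) as [Hx|Hx].
  - rewrite Rsum_scal.
   assert (B : Rsum (fun c => if Rlt_dec (Rabs (IZR c)) (216 / X) then 1 else 0) (zs C0) <= 2 * INR 216).
   { apply count_below_zs. replace (INR 216) with 216 by (rewrite INR_IZR_INZ; reflexivity). side. }
   replace (INR 216) with 216 in B by (rewrite INR_IZR_INZ; reflexivity). assert (P0 : 0 <= X * T i) by side. side.
  - match goal with |- ?S <= _ => assert (E0 : S = 0); [|side] end.
   transitivity (Rsum (fun _ : Z => 0) (zs C0)); [|apply Rsum_0]. apply Rsum_ext. intros c Hc. apply in_zs in Hc.
   pose proof (Rabs_IZR_ge_1 c ltac:(lia)). destruct (Rlt_dec _ _) as [Hl|]; [|ring]. exfalso.
   assert (216 / X < 1); [|lra]. apply Rmult_lt_reg_r with X; [lra|]. div_cancel.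
   lra. }
 rewrite Rsum_scal in Cn. assert (HC0 : sqrt (INR C0) <= 5 * sqrt (W * IZR Q)).
 { assert (1 <= IZR Q) by side. assert (WQ1 : 1 <= W * IZR Q) by nra. apply Rle_trans with (sqrt (25 * (W * IZR Q))).
  - apply sqrt_le_1_alt. unfold C0. destruct (archimed (12 * (W * IZR Q))) as [A1 A2].
   rewrite INR_IZR_INZ, Z2Nat.id; [lra|]. apply le_IZR. side.
  - rewrite sqrt_mult_alt by lra. right. f_equal. replace 25 with (5 * 5) by ring. apply sqrt_square; lra. }
 pose proof (sum_inv_sqrt_zs C0) as SI.
 assert (A1 : 10 * X * (IZR Q / IZR (pc_q i) + 1) * V * Rsum (fun c => / sqrt (Rabs (IZR c))) (zs C0) <= 200 * (X * (IZR Q / IZR (pc_q i) + 1) * sqrt (W * IZR Q)) * V).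
 { apply Rle_trans with (10 * X * (IZR Q / IZR (pc_q i) + 1) * V * (20 * sqrt (W * IZR Q))).
  - side.
  - side. }
 lra.
Qed.

Theorem core_sum (P : list piece) :
  (forall i, In i P -> good_piece X W om Q al i) -> NoDup (map pc_key P) ->
  Rsum (fun i => Rsum (fun i' => Cmod (overlap pc_lo pc_hi (fp y om mu k al) i i')) P) P <=
  Rsum (fun i => 20000000 * (100 * (L * y) * len y om k al i) + 10 * X * (334 / b1 * (L * y ^ 2 * X))
     + 200 * (X * (IZR Q / IZR (pc_q i) + 1) * sqrt (W * IZR Q)) * (1440000 / b1 * sqrt b2 * (L * y ^ 2 * (W * sqrt L)))) P.
Proof.
 intros HP ND. apply Rsum_le. intros i Hi. note (HP i Hi) as G. eapply Rle_trans; [|exact (box_sum i G)].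
 (* Pieces with disjoint intervals have overlap 0 by definition, and [key_bound_correct] concerns
    pieces that meet. *)
 set (test := fun i' => if Rle_dec (Rmax (pc_lo i) (pc_lo i')) (Rmin (pc_hi i) (pc_hi i')) then true else false).
 via (Rsum (fun i' => Cmod (overlap pc_lo pc_hi (fp y om mu k al) i i')) (filter test P)).
 { clear - P. induction P as [|j P IH]; simpl; [lra|]. unfold test at 1. destruct (Rle_dec _ _) as [Hr|Hr]; simpl.
  - lra.
  - unfold overlap at 1. destruct (Rle_dec _ _); [side|]. rewrite Cmod_0. lra. }
 assert (Inj : forall l, NoDup (map pc_key l) -> forall u v, In u l -> In v l -> pc_key u = pc_key v -> u = v).
 { induction l as [|z l IH]; simpl; intros N u v Hu Hv E; [side|]. inversion N; subst.
  destruct Hu as [<-|Hu], Hv as [<-|Hv]; try reflexivity.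
  - exfalso; apply H1. rewrite E. apply in_map; assumption.
  - exfalso; apply H1. rewrite <- E. apply in_map; assumption.
  - side. }
 assert (NDP : NoDup P) by (eapply NoDup_map_inv; exact ND).
 assert (Ht : forall j, In j (filter test P) -> In j P /\ Rmax (pc_lo i) (pc_lo j) <= Rmin (pc_hi i) (pc_hi j)).
 { intros j Hj. apply filter_In in Hj. destruct Hj as [Hj1 Hj2]. split; [side|]. unfold test in Hj2.
  destruct (Rle_dec _ _); side. }
 apply (Rsum_inj _ _ (pair_key i)).
 - apply NoDup_filter; assumption.
 - intros u v Hu Hv E. destruct (Ht u Hu), (Ht v Hv). apply (Inj P ND); trivial.
  apply (pair_key_inj i); trivial; apply HP; assumption.
 - intros j Hj. destruct (Ht j Hj). apply in_box; trivial. side.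
 - intros j Hj. destruct (Ht j Hj). apply key_bound_correct; trivial. side.
 - intros kk _. apply key_bound_nonneg; assumption.
Qed.
End CoreSum.

(** * Integrals close to a rational point *)

Lemma is_cint_swap f a b l : is_cint f a b l -> is_cint f b a (- l)%C.
Proof.
 intros [H1 H2].
 split; simpl; [apply (is_RInt_swap (fun x => fst (f x)))|apply (is_RInt_swap (fun x => snd (f x)))]; assumption.
Qed.

Lemma cint_chasles f a b c : a <= b -> b <= c -> (forall t, a <= t <= c -> ccont f t) ->
  cint f a c = (cint f a b + cint f b c)%C.
Proof.
 intros H1 H2 H. apply cint_eq.
 apply is_cint_Chasles with b; apply cint_ok; trivial; intros; apply H; lra.
Qed.

Lemma cint_shift f m a b : a <= b -> (forall t, a + m <= t <= b + m -> ccont f t) ->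
  cint f (a + m) (b + m) = cint (fun t => f (t + m)) a b.
Proof.
 intros Hab H. symmetry. apply cint_eq. apply (is_cint_ext (fun x => (RtoC 1 * f (x + m)%R)%C)); [side|].
 apply (is_cint_comp f (fun t => t + m) (fun _ => 1)).
 - intros x. minmax. intros. apply H. lra.
 - intros x _. split; [auto_derive; [side|ring]|side].
Qed.

Definition Zcount (a b : R) : nat := Z.to_nat (Int_part b - Int_part a + 1).

Lemma Int_part_bounds x : IZR (Int_part x) <= x < IZR (Int_part x) + 1.
Proof. destruct (base_Int_part x). lra. Qed.

Lemma Int_part_mono a b : a <= b -> (Int_part a <= Int_part b)%Z.
Proof.
 intros H. destruct (Int_part_bounds a), (Int_part_bounds b). assert (Int_part a < Int_part b + 1)%Z; [|lia].
 apply lt_IZR. rewrite plus_IZR. side.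
Qed.

Lemma Csum_zrange_S (f : Z -> C) lo n : Csum f (zrange lo (S n)) = (Csum f (zrange lo n) + f (lo + Z.of_nat n)%Z)%C.
Proof. unfold zrange. rewrite seq_S, map_app, Csum_app. simpl. ring. Qed.

Lemma in_zrange_iff lo n z : In z (zrange lo n) <-> (lo <= z < lo + Z.of_nat n)%Z.
Proof.
 split; [|apply in_zrange]. intros H. apply in_map_iff in H. destruct H as (j & <- & Hj). apply in_seq in Hj. lia.
Qed.

(** Additivity forces Phi u u = 0, so empty end intervals do no harm; the partial sums over m give
    Phi from a to the running integer, clipped to [a, b]. *)
Lemma integer_cut (Phi : R -> R -> C) (a b : R) : a <= b ->
  (forall u v w, a <= u -> u <= v -> v <= w -> w <= b -> Phi u w = (Phi u v + Phi v w)%C) ->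
  Csum (fun m => Phi (Rmax a (IZR m)) (Rmin b (IZR m + 1))) (zrange (Int_part a) (Zcount a b)) = Phi a b.
Proof.
 intros Hab Add. destruct (Int_part_bounds a) as [A1 A2]. destruct (Int_part_bounds b) as [B1 B2].
 note (Int_part_mono a b Hab) as Hm. assert (Z0 : forall u, a <= u <= b -> Phi u u = RtoC 0).
 { intros u Hu. note (Add u u u !! !! !! !!) as E.
  assert (E2 : (Phi u u - Phi u u = Phi u u)%C) by (rewrite E at 1; ring). rewrite <- E2. ring. }
 assert (H : forall n, (n <= Zcount a b)%nat -> Csum (fun m => Phi (Rmax a (IZR m)) (Rmin b (IZR m + 1))) (zrange (Int_part a) n) = Phi a (Rmax a (Rmin b (IZR (Int_part a + Z.of_nat n))))).
 { induction n; intros Hn.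
  - rewrite Z.add_0_r. rewrite Rmin_right by lra. rewrite Rmax_left by lra. rewrite Z0 by lra. side.
  - rewrite Csum_zrange_S, IHn by lia. unfold Zcount in Hn. set (m := (Int_part a + Z.of_nat n)%Z).
   assert (Hmb : IZR m <= b). { via (IZR (Int_part b)); [|lra]. side. }
   replace (IZR (Int_part a + Z.of_nat (S n))) with (IZR m + 1).
   2: { rewrite Nat2Z.inj_succ, <- plus_IZR. f_equal. lia. } assert (Hm1 : a <= IZR m + 1).
   { have : IZR (Int_part a) <= IZR m. lra. } rewrite Rmin_right by assumption.
   rewrite (Rmax_right a (Rmin b (IZR m + 1))). 2: { unfold Rmin; destruct (Rle_dec b (IZR m + 1)); lra. } symmetry.
   apply Add; [lra| apply Rmax_l | | apply Rmin_l]. unfold Rmin, Rmax.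
   destruct (Rle_dec a (IZR m)), (Rle_dec b (IZR m + 1)); lra. }
 rewrite H by lia. f_equal. unfold Zcount. rewrite Rmin_left; [rewrite Rmax_right; lra|].
 rewrite plus_IZR, <- INR_IZR_INZ. rewrite INR_IZR_INZ, Z2Nat.id by lia. rewrite <- plus_IZR.
 replace (Int_part a + (Int_part b - Int_part a + 1))%Z with (Int_part b + 1)%Z by lia. rewrite plus_IZR. lra.
Qed.

(** * Arcs at Farey fractions in the variable r, and their images *)

Record varc := { va_p : Z; va_q : Z; va_right : bool; va_r1 : R; va_r2 : R }.

Definition va_key (i : varc) := (va_p i, va_q i, va_right i).

Section VArc.
Variables (y X L W om mu b1 b2 : R) (k Q : Z) (al : Z -> Z -> Z).
Hypotheses (Hy : 0 < y) (HX : 1 <= X) (Hk : (1 <= k)%Z) (HQ : (1 <= Q)%Z) (HQW : IZR Q <= 13 * W) (HW1 : 1 <= W)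
 (HL2 : 40000 <= L) (Hrel : IZR k ^ 2 * X ^ 2 * y * (W ^ 2 * L) = 1).

(** [va_u] is the centre of the arc, the u with om - 1/(k^2 u) = p/q; r is the distance from it, to
    the right or to the left according to [va_ep]. The modular map of [arc_transform] takes that
    point to real part [va_T] and height [va_Y]. *)
Definition va_X (i : varc) : R := om - IZR (va_p i) / IZR (va_q i).
Definition va_D (i : varc) : R := (IZR k * IZR (va_q i) * va_X i) ^ 2.
Definition va_ta (i : varc) : R := IZR (al (va_p i) (va_q i)) / IZR (va_q i) - / (IZR (va_q i) ^ 2 * va_X i).
Definition va_ep (i : varc) : R := if va_right i then 1 else -1.
Definition va_u (i : varc) : R := / (IZR k ^ 2 * va_X i).
Definition va_T (i : varc) (r : R) : R := va_ta i - va_ep i * Vf y r / va_D i.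
Definition va_Y (i : varc) (r : R) : R := y / (va_D i * (r ^ 2 + y ^ 2)).

Definition good_varc (i : varc) : Prop :=
  (1 <= va_q i <= Q)%Z /\ Z.gcd (va_p i) (va_q i) = 1%Z /\ X / 3 <= va_X i <= 2 * X /\
  0 <= va_r1 i /\ va_r1 i <= va_r2 i.
(** The image heights [va_Y] lie in [1/(2 L), 1/L]. *)
Definition in_class (i : varc) : Prop :=
  L * y <= va_D i * (va_r1 i ^ 2 + y ^ 2) /\ va_D i * (va_r2 i ^ 2 + y ^ 2) <= 2 * L * y.

Definition va_lo (i : varc) : R := Rmin (va_T i (va_r1 i)) (va_T i (va_r2 i)).
Definition va_hi (i : varc) : R := Rmax (va_T i (va_r1 i)) (va_T i (va_r2 i)).

Definition va_pieces (i : varc) : list piece :=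
  map (fun m => {| pc_p := va_p i; pc_q := va_q i; pc_right := va_right i; pc_m := m;
                   pc_lo := Rmax (va_lo i) (IZR m) - IZR m; pc_hi := Rmin (va_hi i) (IZR m + 1) - IZR m |})
    (zrange (Int_part (va_lo i)) (Zcount (va_lo i) (va_hi i))).

Lemma va_ep_sign i : va_ep i = 1 \/ va_ep i = -1.
Proof. unfold va_ep; destruct (va_right i); [left|side]; lra. Qed.

Section OneArc.
Variable i : varc.
Hypotheses (Gi : good_varc i) (Ci : in_class i).
Let q := IZR (va_q i).
Let D := va_D i.
Let ta := va_ta i.
Let ep := va_ep i.

Lemma va_q_range : 1 <= q /\ q <= 13 * W.
Proof. destruct Gi as (H & _). unfold q. have : 1 <= IZR (va_q i). have : IZR (va_q i) <= IZR Q. lra. Qed.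

Lemma va_D_bounds : q ^ 2 <= D * (9 * (y * (W ^ 2 * L))) /\ D * (y * (W ^ 2 * L)) <= 4 * q ^ 2.
Proof.
 destruct Gi as (_ & _ & [H1 H2] & _). assert (E : D * (y * (W ^ 2 * L)) = q ^ 2 * (va_X i / X) ^ 2).
 { unfold D, va_D. fold q. apply Rmult_eq_reg_r with (X ^ 2); [|side].
  replace ((IZR k * q * va_X i) ^ 2 * (y * (W ^ 2 * L)) * X ^ 2) with ((IZR k ^ 2 * X ^ 2 * y * (W ^ 2 * L)) * (q ^ 2 * va_X i ^ 2)) by ring.
  rewrite Hrel. side. }
 have R1 : / 3 <= va_X i / X <= 2. set (z := va_X i / X) in *. have : / 9 <= z ^ 2 <= 4. side.
Qed.

Lemma va_D_pos : 0 < D.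
Proof. apply pow_lt. destruct Gi as ((H & _) & _ & [H1 H2] & _). side. Qed.

(** Low image height forces r to be much larger than y, since L >= 40000; so the branch r > y
    inverted by [Sg] is the right one. *)
Lemma va_class r : va_r1 i <= r <= va_r2 i -> L * y <= D * (r ^ 2 + y ^ 2) <= 2 * L * y /\ 100 * y <= r.
Proof.
 intros Hr. destruct Gi as (_ & _ & _ & R0 & R1). note va_D_pos as HD. destruct Ci as [C1 C2].
 destruct va_D_bounds as [_ DB]. destruct va_q_range as [Q1 Q2]. fold D in C1, C2. have M1 : va_r1 i ^ 2 <= r ^ 2.
 have M2 : r ^ 2 <= va_r2 i ^ 2. have B : L * y <= D * (r ^ 2 + y ^ 2) <= 2 * L * y. split; [side|].
 destruct B as [B _]. assert (DL : D * (y * L) <= 676). { cancel_r (W ^ 2). side. } assert (E : (100 * y) ^ 2 <= r ^ 2).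
 { apply Rmult_le_reg_l with D; [side|]. assert (S : 10001 * (D * y ^ 2) <= L * y).
  { cancel_r L. replace (10001 * (D * y ^ 2) * L) with (10001 * (D * (y * L)) * y) by ring.
   replace (L * y * L) with (L * L * y) by ring. side. }
  side. }
 side.
Qed.

Section Point.
Variable r : R.
Hypothesis Hr : va_r1 i <= r <= va_r2 i.

Lemma va_s : ta - va_T i r = ep * (r / (D * (r ^ 2 + y ^ 2))).
Proof. destruct (va_class r Hr) as [_ HH]. note va_D_pos. unfold va_T, Vf. side. Qed.

Lemma va_cs_eq : 2 * y * D * (ta - va_T i r) = ep * (2 * y * r / (r ^ 2 + y ^ 2)).
Proof. destruct (va_class r Hr) as [_ HH]. note va_D_pos. rewrite va_s. side. Qed.

Lemma va_qh : qh (2 * y * D) (ta - va_T i r) = (r ^ 2 - y ^ 2) / (r ^ 2 + y ^ 2).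
Proof.
 destruct (va_class r Hr) as [_ HH]. unfold qh. rewrite va_cs_eq.
 assert (E2 : ep * ep = 1) by (unfold ep; destruct (va_ep_sign i) as [E|E]; rewrite E; ring).
 replace (1 - (ep * (2 * y * r / (r ^ 2 + y ^ 2))) ^ 2) with (((r ^ 2 - y ^ 2) / (r ^ 2 + y ^ 2)) ^ 2).
 - apply sqrt_pow2. apply Rdiv_le_0_compat; [nra|side].
 - replace ((ep * (2 * y * r / (r ^ 2 + y ^ 2))) ^ 2) with ((ep * ep) * (2 * y * r / (r ^ 2 + y ^ 2)) ^ 2) by ring.
  rewrite E2. side.
Qed.

Lemma va_Sg : Sg D (2 * y * D) (ta - va_T i r) = ep * r.
Proof.
 destruct (va_class r Hr) as [_ HH]. note va_D_pos. unfold Sg. rewrite va_qh, va_s.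
 destruct (va_ep_sign i) as [E|E]; fold ep in E; rewrite E; field; repeat split; nra.
Qed.

Lemma va_dSg : dSg D (2 * y * D) (ta - va_T i r) = D * (r ^ 2 + y ^ 2) ^ 2 / (r ^ 2 - y ^ 2).
Proof.
 destruct (va_class r Hr) as [_ HH]. note va_D_pos. unfold dSg. rewrite va_qh, va_s.
 destruct (va_ep_sign i) as [E|E]; fold ep in E; rewrite E; field; repeat split; nra.
Qed.

Lemma va_T_derive : is_derive (va_T i) r (ep * ((r ^ 2 - y ^ 2) / (D * (r ^ 2 + y ^ 2) ^ 2))).
Proof.
 destruct (va_class r Hr) as [_ HH]. note va_D_pos as HD.
 note (is_derive_minus (fun _ => ta) (fun r => ep / D * Vf y r) r 0 _ (is_derive_const ta r) (is_derive_scal (Vf y) r (ep / D) _ (Vf_derive y r Hy))) as K.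
 eapply is_derive_ext; [|derive_eq K; [exact K|]].
 - intros z. unfold va_T, minus, plus, opp; simpl. side.
 - unfold minus, plus, opp, scal; simpl; unfold mult; simpl. unfold dVf. side.
Qed.

Lemma va_s_range : 0 < ep * (ta - va_T i r) /\ W / (3 * q) <= Rabs (ta - va_T i r) <= 3 * W / q.
Proof.
 destruct (va_class r Hr) as [[B1 B2] HH]. note va_D_pos as HD. destruct va_D_bounds as [D1 D2].
 destruct va_q_range as [Q1 Q2]. rewrite va_s. have P : 0 < r ^ 2 + y ^ 2. have Ps : 0 < r / (D * (r ^ 2 + y ^ 2)).
 set (s := r / (D * (r ^ 2 + y ^ 2))) in *. assert (E1 : Rabs (ep * s) = s).
 { unfold ep. destruct (va_ep_sign i) as [E|E]; rewrite E; [rewrite Rabs_pos_eq by lra|rewrite Rabs_left1 by lra]; ring. }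
 assert (E2 : ep * (ep * s) = s) by (unfold ep; destruct (va_ep_sign i) as [E|E]; rewrite E; ring). split; [side|].
 set (G := D * (r ^ 2 + y ^ 2)) in *. have HG : 0 < G. have Es : s ^ 2 * (D * G) = r ^ 2 / (r ^ 2 + y ^ 2).
 assert (F : 99 / 100 <= r ^ 2 / (r ^ 2 + y ^ 2) <= 1).
 { split; apply Rmult_le_reg_r with (r ^ 2 + y ^ 2); try assumption; unfold Rdiv; rewrite (Rmult_assoc (r ^ 2)), Rinv_l by lra; nra. }
 destruct F as [F1 F2]. split.
 - apply Rsqr_incr_0_var; [|lra]. unfold Rsqr. cancel_r (9 * q ^ 2).
  replace (W / (3 * q) * (W / (3 * q)) * (9 * q ^ 2)) with (W ^ 2) by side. have K : D * G * W ^ 2 <= 8 * q ^ 2. side.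
 - apply Rsqr_incr_0_var; [|side]. unfold Rsqr. cancel_r (q ^ 2).
  replace (3 * W / q * (3 * W / q) * q ^ 2) with (9 * W ^ 2) by side. have K : q ^ 2 <= 9 * W ^ 2 * (D * G). side.
Qed.
End Point.

Lemma va_r12 : va_r1 i <= va_r1 i <= va_r2 i /\ va_r1 i <= va_r2 i <= va_r2 i.
Proof. destruct Gi as (_ & _ & _ & R0 & R1). lra. Qed.

Lemma va_lo_hi_cases : (ep = 1 /\ va_lo i = va_T i (va_r1 i) /\ va_hi i = va_T i (va_r2 i)) \/
  (ep = -1 /\ va_lo i = va_T i (va_r2 i) /\ va_hi i = va_T i (va_r1 i)).
Proof.
 destruct va_r12 as [H1 H2]. destruct Gi as (_ & _ & _ & R0 & R1). note va_D_pos as HD. note (va_s _ H1) as S1.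
 note (va_s _ H2) as S2. destruct (va_class _ H1) as [[B1 B1'] C1]. destruct (va_class _ H2) as [[B2 B2'] C2].
 assert (M : va_r2 i / (D * (va_r2 i ^ 2 + y ^ 2)) <= va_r1 i / (D * (va_r1 i ^ 2 + y ^ 2))).
 { set (u := va_r1 i) in *. set (v := va_r2 i) in *. cancel_r (D * (u ^ 2 + y ^ 2) * (v ^ 2 + y ^ 2)).
  replace (v / (D * (v ^ 2 + y ^ 2)) * (D * (u ^ 2 + y ^ 2) * (v ^ 2 + y ^ 2))) with (v * (u ^ 2 + y ^ 2)) by side.
  replace (u / (D * (u ^ 2 + y ^ 2)) * (D * (u ^ 2 + y ^ 2) * (v ^ 2 + y ^ 2))) with (u * (v ^ 2 + y ^ 2)) by side.
  have : y * y <= u * v. side. }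
 unfold va_lo, va_hi. destruct (va_ep_sign i) as [E|E]; fold ep in E; rewrite E in *; [left|right].
 - split; [side || assumption|]. minmax. side.
 - split; [side || assumption|]. rewrite Rmin_right, Rmax_left by lra. side.
Qed.

Lemma va_lo_le_hi : va_lo i <= va_hi i.
Proof. eapply Rle_trans; [apply Rmin_l|apply Rmax_l]. Qed.

Lemma va_t_range t : va_lo i <= t <= va_hi i ->
  0 < ep * (ta - t) /\ W / (3 * q) <= Rabs (ta - t) <= 3 * W / q.
Proof.
 intros Ht. destruct va_r12 as [H1 H2]. note (va_s_range _ H1) as (P1 & A1 & B1).
 note (va_s_range _ H2) as (P2 & A2 & B2).
 destruct va_lo_hi_cases as [(E & E1 & E2)|(E & E1 & E2)]; rewrite E1, E2 in Ht; rewrite E in *.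
 - rewrite Rabs_pos_eq in * by lra. lra.
 - rewrite Rabs_left1 in * by lra. lra.
Qed.

Lemma va_piece_good pc : In pc (va_pieces i) ->
  good_piece X W om Q al pc /\ pc_p pc = va_p i /\ pc_q pc = va_q i /\ pc_right pc = va_right i.
Proof.
 intros H. apply in_map_iff in H. destruct H as (m & <- & Hm). apply in_zrange_iff in Hm. unfold Zcount in Hm.
 destruct (Int_part_bounds (va_lo i)) as [A1 A2]. destruct (Int_part_bounds (va_hi i)) as [B1 B2].
 have M1 : IZR (Int_part (va_lo i)) <= IZR m. have M2 : IZR m <= IZR (Int_part (va_hi i)). note va_lo_le_hi as LH.
 assert (N1 : va_lo i <= Rmax (va_lo i) (IZR m) /\ IZR m <= Rmax (va_lo i) (IZR m)) by (split; [apply Rmax_l|apply Rmax_r]).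
 assert (N2 : Rmin (va_hi i) (IZR m + 1) <= va_hi i /\ Rmin (va_hi i) (IZR m + 1) <= IZR m + 1) by (split; [apply Rmin_l|apply Rmin_r]).
 assert (N3 : Rmax (va_lo i) (IZR m) <= Rmin (va_hi i) (IZR m + 1)).
 { unfold Rmin, Rmax. destruct (Rle_dec (va_lo i) (IZR m)), (Rle_dec (va_hi i) (IZR m + 1)); lra. } split; [|side].
 destruct Gi as (G1 & G2 & G3 & _). split; [side|]. split; [side|]. split; [side|]. simpl. split; [lra|]. split; [lra|].
 split; [lra|]. intros t Ht. note (va_t_range (t + IZR m) !!) as R.
 match goal with |- context [tp om al ?pc] => replace (tp om al pc - t) with (ta - (t + IZR m)) by (unfold tp, ta, va_ta, Xa, va_X; simpl; ring) end.
 side.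
Qed.

Lemma va_fs_cont t n : va_lo i <= t <= va_hi i ->
  ccont (fun t => (RtoC (dSg D (2 * y * D) (ta - t)) * e (mu * Sg D (2 * y * D) (ta - t)) * e (IZR n * t))%C) t.
Proof.
 intros Ht. note (va_t_range t Ht) as (P & A & B). note va_D_pos as HD. have Hnz : ta - t <> 0.
 assert (Hcs : Rabs (2 * y * D * (ta - t)) <= 1 / 100).
 { rewrite Rabs_mult, (Rabs_pos_eq (2 * y * D)) by nra. destruct va_D_bounds as [_ DB]. destruct va_q_range as [Q1 Q2].
  via (2 * y * D * (3 * W / q)); [side|]. cancel_r (q * (W ^ 2 * L)).
  replace (2 * y * D * (3 * W / q) * (q * (W ^ 2 * L))) with (6 * W * (D * (y * (W ^ 2 * L)))) by side.
  via (6 * W * (4 * q ^ 2)); [side|]. replace (6 * W * (4 * q ^ 2)) with (q * W * (24 * q)) by ring.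
  replace (1 / 100 * (q * (W ^ 2 * L))) with (q * W * (1 / 100 * (W * L))) by ring. mul_l. nra. }
 apply ccont_mult; [apply ccont_mult|].
 - apply ccont_R. eapply derive_cont. apply dSg_derive; assumption.
 - apply ccont_e. apply (continuous_mult (fun _ => mu) (fun t => Sg D (2 * y * D) (ta - t))); [side|].
  eapply derive_cont. apply Sg_derive; assumption.
 - side.
Qed.

(** With t = [va_T] r as the variable the phase n [va_T] r becomes n t; the rest of the integrand no
    longer depends on n, so the integral is a Fourier coefficient. *)
Lemma va_substitution n :
  cint (fun r => e (IZR n * va_T i r + mu * (va_u i + ep * r))) (va_r1 i) (va_r2 i) =
  (e (mu * va_u i) * cint (fun t => RtoC (dSg D (2 * y * D) (ta - t)) * e (mu * Sg D (2 * y * D) (ta - t)) * e (IZR n * t))%C (va_lo i) (va_hi i))%C.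
Proof.
 set (F := fun t => (RtoC (dSg D (2 * y * D) (ta - t)) * e (mu * Sg D (2 * y * D) (ta - t)) * e (IZR n * t))%C).
 destruct Gi as (_ & _ & _ & R0 & R1). note va_D_pos as HD.
 assert (Tin : forall r, va_r1 i <= r <= va_r2 i -> va_lo i <= va_T i r <= va_hi i).
 { assert (Mono : forall a b, va_r1 i <= a -> a <= b -> b <= va_r2 i -> ep * va_T i a <= ep * va_T i b).
  { intros a b Ha Hab Hb.
   destruct (MVT_gen (va_T i) a b (fun r => ep * ((r ^ 2 - y ^ 2) / (D * (r ^ 2 + y ^ 2) ^ 2)))) as [c [Hc E]].
   - intros r. minmax. intros Hr. apply va_T_derive. lra.
   - intros r. minmax. intros Hr. apply derivable_continuous_pt. eexists. apply is_derive_Reals. apply va_T_derive. lra.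
   - rewrite Rmin_left, Rmax_right in Hc by assumption. destruct (va_class c !!) as [_ HH].
    assert (0 <= (c ^ 2 - y ^ 2) / (D * (c ^ 2 + y ^ 2) ^ 2)). { apply Rdiv_le_0_compat; [nra|]. side. }
    assert (E2 : ep * ep = 1) by (unfold ep; destruct (va_ep_sign i) as [E2|E2]; rewrite E2; ring).
    set (z := (c ^ 2 - y ^ 2) / (D * (c ^ 2 + y ^ 2) ^ 2)) in *.
    have E3 : ep * va_T i b - ep * va_T i a = (ep * ep) * (z * (b - a)). rewrite E2 in E3. side. }
  intros r Hr. note (Mono (va_r1 i) r !! !! !!) as M1. note (Mono r (va_r2 i) !! !! !!) as M2.
  destruct va_lo_hi_cases as [(E & E1 & E2)|(E & E1 & E2)]; rewrite E1, E2; rewrite E in M1, M2; lra. }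
 assert (K : is_cint (fun r => (RtoC (ep * ((r ^ 2 - y ^ 2) / (D * (r ^ 2 + y ^ 2) ^ 2))) * F (va_T i r))%C) (va_r1 i) (va_r2 i) (cint F (va_T i (va_r1 i)) (va_T i (va_r2 i)))).
 { apply is_cint_comp.
  - intros r. minmax. intros Hr. apply va_fs_cont. side.
  - intros r. minmax. intros Hr. split; [apply va_T_derive; assumption|]. side. }
 assert (Es : (RtoC ep * cint F (va_T i (va_r1 i)) (va_T i (va_r2 i)))%C = cint F (va_lo i) (va_hi i)).
 { destruct va_lo_hi_cases as [(E & E1 & E2)|(E & E1 & E2)]; rewrite E1, E2, E.
  - ring.
  - assert (KK : is_cint F (va_T i (va_r1 i)) (va_T i (va_r2 i)) (- cint F (va_T i (va_r2 i)) (va_T i (va_r1 i)))%C).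
   { apply is_cint_swap. apply cint_ok; [rewrite <- E1, <- E2; apply va_lo_le_hi|]. intros t Ht.
    apply va_fs_cont. side. }
   rewrite (cint_eq _ _ _ _ KK). side. }
 rewrite <- Es. apply cint_eq.
 replace (e (mu * va_u i) * (RtoC ep * cint F (va_T i (va_r1 i)) (va_T i (va_r2 i))))%C with ((e (mu * va_u i) * RtoC ep) * cint F (va_T i (va_r1 i)) (va_T i (va_r2 i)))%C by ring.
 eapply is_cint_ext_le; [side| |exact (is_cint_scal _ _ _ _ (e (mu * va_u i) * RtoC ep)%C K)]. intros r Hr.
 destruct (va_class r !!) as [_ HH]. unfold F. rewrite (va_Sg r !!), (va_dSg r !!). rewrite Rmult_plus_distr_l, !e_plus.
 set (A := e (mu * va_u i)). set (B := e (mu * (ep * r))). set (E := e (IZR n * va_T i r)).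
 transitivity (RtoC (ep * (ep * ((r ^ 2 - y ^ 2) / (D * (r ^ 2 + y ^ 2) ^ 2))) * (D * (r ^ 2 + y ^ 2) ^ 2 / (r ^ 2 - y ^ 2))) * (A * B * E))%C.
 - rewrite !RtoC_mult. ring.
 - replace (ep * (ep * ((r ^ 2 - y ^ 2) / (D * (r ^ 2 + y ^ 2) ^ 2))) * (D * (r ^ 2 + y ^ 2) ^ 2 / (r ^ 2 - y ^ 2))) with (ep * ep) by side.
  replace (ep * ep) with 1 by (unfold ep; destruct (va_ep_sign i) as [E2|E2]; rewrite E2; ring). ring.
Qed.

(** As e(n t) has period 1, cutting at the integers and translating into [0, 1] preserves the
    integral and prepares it for [bessel_inequality]. *)
Lemma va_split n :
  cint (fun t => RtoC (dSg D (2 * y * D) (ta - t)) * e (mu * Sg D (2 * y * D) (ta - t)) * e (IZR n * t))%C (va_lo i) (va_hi i) =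
  Csum (fun pc => cint (fun t => (fp y om mu k al pc t * e (IZR n * t))%C) (pc_lo pc) (pc_hi pc)) (va_pieces i).
Proof.
 set (F := fun t => (RtoC (dSg D (2 * y * D) (ta - t)) * e (mu * Sg D (2 * y * D) (ta - t)) * e (IZR n * t))%C).
 note va_lo_le_hi as LH. rewrite <- (integer_cut (fun u v => cint F u v) (va_lo i) (va_hi i) LH).
 2: { intros u v w H1 H2 H3 H4. apply cint_chasles; trivial. intros t Ht. apply va_fs_cont. lra. } unfold va_pieces.
 rewrite Csum_map. apply Csum_ext. intros m Hm. apply in_zrange_iff in Hm. unfold Zcount in Hm.
 destruct (Int_part_bounds (va_lo i)) as [A1 A2]. destruct (Int_part_bounds (va_hi i)) as [B1 B2].
 have M1 : IZR (Int_part (va_lo i)) <= IZR m. have M2 : IZR m <= IZR (Int_part (va_hi i)).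
 set (lo := Rmax (va_lo i) (IZR m)). set (hi := Rmin (va_hi i) (IZR m + 1)).
 assert (N1 : va_lo i <= lo) by apply Rmax_l. assert (N2 : hi <= va_hi i) by apply Rmin_l. assert (N3 : lo <= hi).
 { unfold lo, hi, Rmin, Rmax. destruct (Rle_dec (va_lo i) (IZR m)), (Rle_dec (va_hi i) (IZR m + 1)); lra. }
 replace lo with (lo - IZR m + IZR m) at 1 by ring. replace hi with (hi - IZR m + IZR m) at 1 by ring.
 rewrite cint_shift; [|lra|]. 2: { intros t Ht. apply va_fs_cont. lra. } apply cint_ext. intros t.
 unfold F, fp, tp, cp, Dp, Xa. unfold ta, va_ta, D, va_D, va_X.
 replace (IZR n * (t + IZR m)) with (IZR n * t + IZR (n * m)) by (rewrite mult_IZR; ring). rewrite e_add_Z.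
 replace (IZR (al (va_p i) (va_q i)) / IZR (va_q i) - / (IZR (va_q i) ^ 2 * (om - IZR (va_p i) / IZR (va_q i))) - (t + IZR m)) with (IZR (al (va_p i) (va_q i)) / IZR (va_q i) - / (IZR (va_q i) ^ 2 * (om - IZR (va_p i) / IZR (va_q i))) - IZR m - t) by ring.
 side.
Qed.

Lemma va_len : Rsum (len y om k al) (va_pieces i) = va_r2 i - va_r1 i.
Proof.
 note va_lo_le_hi as LH. set (G := fun t => Sg D (2 * y * D) (ta - t)).
 note (integer_cut (fun u v => RtoC (G v - G u)) (va_lo i) (va_hi i) LH) as K.
 assert (K1 : RtoC (Rsum (len y om k al) (va_pieces i)) = RtoC (G (va_hi i) - G (va_lo i))).
 { rewrite <- K.
  - rewrite <- Csum_R. unfold va_pieces. rewrite Csum_map. apply Csum_ext. intros m _. f_equal. unfold len, G.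
   match goal with |- context [tp om al ?pc] => assert (Et : forall t, tp om al pc - (t - IZR m) = ta - t) by (intros t; unfold tp, ta, va_ta, Xa, va_X; simpl; ring); change (Dp om k pc) with D; change (cp y om k pc) with (2 * y * D) end.
   cbn [pc_hi pc_lo]. rewrite !Et. side.
  - intros. rewrite <- RtoC_plus. f_equal. ring. }
 apply RtoC_inj in K1. rewrite K1. unfold G. destruct va_r12 as [H1 H2]. note (va_Sg _ H1) as S1.
 note (va_Sg _ H2) as S2. destruct va_lo_hi_cases as [(E & E1 & E2)|(E & E1 & E2)]; rewrite E1, E2, S1, S2, E; ring.
Qed.

(** The t-interval has length at most 3 W / q, and the 2 incomplete pieces cost at most 26 W / q
    because q <= 13 W. This is why the Farey order must not exceed 13 W. *)
Lemma va_count : INR (length (va_pieces i)) <= 29 * W / q.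
Proof.
 unfold va_pieces. rewrite length_map, length_zrange. unfold Zcount. note va_lo_le_hi as LH.
 note (Int_part_mono _ _ LH) as IM. rewrite INR_IZR_INZ, Z2Nat.id by lia. rewrite plus_IZR, minus_IZR.
 destruct (Int_part_bounds (va_lo i)) as [A1 A2]. destruct (Int_part_bounds (va_hi i)) as [B1 B2].
 note (va_t_range (va_lo i) !!) as (P1 & _ & Q1). note (va_t_range (va_hi i) !!) as (P2 & _ & Q2).
 assert (HH : va_hi i - va_lo i <= 3 * W / q).
 { unfold ep in *. destruct (va_ep_sign i) as [E|E]; rewrite E in *.
  - rewrite Rabs_pos_eq in Q1, Q2 by lra. lra.
  - rewrite Rabs_left1 in Q1, Q2 by lra. lra. }
 destruct va_q_range as [R1 R2]. have : 2 <= 26 * W / q. side.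
Qed.
End OneArc.
End VArc.

Definition harm (n : nat) : R := Rsum (fun j => / INR j) (seq 1 n).

Section ClassBessel.
Variables (y X L W om mu b1 b2 : R) (k Q : Z) (al : Z -> Z -> Z).
Hypotheses (Hy : 0 < y) (HX : 1 <= X) (Hk : (1 <= k)%Z) (HQ : (1 <= Q)%Z) (HQW : IZR Q <= 13 * W) (HW1 : 1 <= W)
 (HL1 : 8000 * IZR Q * X <= L) (HL2 : 40000 <= L) (HWX : 1000 <= W * X) (Hrel : IZR k ^ 2 * X ^ 2 * y * (W ^ 2 * L) = 1)
 (Hb1 : 0 < b1) (Hmu : b1 <= Rabs mu * y <= b2)
 (Hal : forall p q, (1 <= q)%Z -> Z.gcd p q = 1%Z -> Z.divide q (al p q * p + 1))
 (Hal2 : forall p p' q, (1 <= q)%Z -> Z.divide q (p - p') -> al p q = al p' q).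

(** For a given q the numerators lie in an interval of length below 2 X q, so there are at most 4 X
    q of them, on two sides. *)
Lemma varc_count (VA : list varc) (f : Z -> R) :
  (forall i, In i VA -> good_varc X om Q i) -> NoDup (map va_key VA) ->
  (forall q, (1 <= q)%Z -> 0 <= f q) ->
  Rsum (fun i => f (va_q i)) VA <= Rsum (fun j => 8 * X * INR j * f (Z.of_nat j)) (seq 1 (Z.to_nat Q)).
Proof.
 intros HG ND Hf. set (lo := fun j : nat => Int_part (INR j * (om - 2 * X))).
 set (cnt := fun j : nat => Z.to_nat (Int_part (2 * X * INR j) + 2)).
 set (box := flat_map (fun j => flat_map (fun p => (p, Z.of_nat j, true) :: (p, Z.of_nat j, false) :: nil) (zrange (lo j) (cnt j))) (seq 1 (Z.to_nat Q))).
 via (Rsum (fun kk : Z * Z * bool => f (snd (fst kk))) box).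
 - apply (Rsum_inj _ _ va_key).
  + eapply NoDup_map_inv; exact ND.
  + clear - ND. induction VA as [|z l IH]; simpl; intros u v Hu Hv E; [side|]. inversion ND; subst.
   destruct Hu as [<-|Hu], Hv as [<-|Hv]; try reflexivity.
   * exfalso; apply H1. rewrite E. apply in_map; assumption.
   * exfalso; apply H1. rewrite <- E. apply in_map; assumption.
   * side.
  + intros i Hi. destruct (HG i Hi) as ((G1 & G1') & _ & [A1 A2] & _). unfold va_X in *. unfold box, va_key.
   have Hq : 0 < IZR (va_q i). apply in_flat_map. exists (Z.to_nat (va_q i)). split; [apply in_seq; lia|].
   assert (Eq : INR (Z.to_nat (va_q i)) = IZR (va_q i)) by (rewrite INR_IZR_INZ, Z2Nat.id by lia; reflexivity).
   apply in_flat_map. exists (va_p i). split.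
   * apply in_zrange. unfold lo, cnt. rewrite Eq. set (q := IZR (va_q i)) in *.
    assert (P1 : q * (om - 2 * X) <= IZR (va_p i)).
    { replace (IZR (va_p i)) with (q * (IZR (va_p i) / q)) by side. side. }
    assert (P2 : IZR (va_p i) <= q * (om - X / 3)).
    { replace (IZR (va_p i)) with (q * (IZR (va_p i) / q)) by side. side. }
    destruct (Int_part_bounds (q * (om - 2 * X))) as [F1 F2]. destruct (Int_part_bounds (2 * X * q)) as [F3 F4].
    assert (I0 : (0 <= Int_part (2 * X * q))%Z).
    { assert (-1 < Int_part (2 * X * q))%Z; [apply lt_IZR; simpl; lra|lia]. } rewrite Z2Nat.id by lia. split.
    -- assert (Int_part (q * (om - 2 * X)) < va_p i + 1)%Z; [|lia]. apply lt_IZR. rewrite plus_IZR. side.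
    -- apply lt_IZR. rewrite !plus_IZR. side.
   * rewrite Z2Nat.id by lia. destruct (va_right i); simpl; tauto.
  + intros i Hi. simpl. lra.
  + intros kk Hkk. apply in_flat_map in Hkk. destruct Hkk as (j & Hj & Hkk). apply in_flat_map in Hkk.
   destruct Hkk as (p & Hp & Hkk). apply in_seq in Hj. apply Hf. destruct Hkk as [<-|[<-|[]]]; simpl; lia.
 - unfold box. rewrite Rsum_flat_map. apply Rsum_le. intros j Hj. apply in_seq in Hj. rewrite Rsum_flat_map.
  assert (Hj1 : 1 <= INR j) by (replace 1 with (INR 1) by reflexivity; apply le_INR; lia).
  rewrite (Rsum_ext _ (fun _ => 2 * f (Z.of_nat j))) by (intros; simpl; ring). rewrite Rsum_const, length_zrange.
  unfold cnt. have PXq : 1 <= X * INR j. destruct (Int_part_bounds (2 * X * INR j)) as [F3 F4].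
  assert (I0 : (0 <= Int_part (2 * X * INR j))%Z).
  { assert (-1 < Int_part (2 * X * INR j))%Z; [apply lt_IZR; simpl; lra|lia]. } rewrite INR_IZR_INZ, Z2Nat.id by lia.
  rewrite plus_IZR. note (Hf (Z.of_nat j) !!) as Pf. side.
Qed.

(** The three terms come from pairs bounded trivially, from cc = 0 and from cc <> 0. The constants
    are 232 = 29 * 8 and 464 = 58 * 8, from [va_count] and [varc_count]; the harmonic sum is what
    remains of the sum over q. *)
Definition core_bound (U : R) : R :=
  2000000000 * (L * y) * U + 232 * (W * X * IZR Q) * (10 * X * (334 / b1 * (L * y ^ 2 * X)))
  + 464 * (W * X * IZR Q) * harm (Z.to_nat Q) * (200 * (X * sqrt (W * IZR Q)) * (1440000 / b1 * sqrt b2 * (L * y ^ 2 * (W * sqrt L)))).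

Lemma class_bessel (VA : list varc) (U : R) (N : nat) :
  (forall i, In i VA -> good_varc X om Q i /\ in_class y L om k i) -> NoDup (map va_key VA) ->
  Rsum (fun i => va_r2 i - va_r1 i) VA <= U ->
  Rsum (fun n => Cmod (Csum (fun i => cint (fun r => e (IZR n * va_T y om k al i r + mu * (va_u om k i + va_ep i * r))) (va_r1 i) (va_r2 i)) VA) ^ 2) (zs N)
   <= core_bound U.
Proof.
 intros HG ND HU. set (P := flat_map (va_pieces y om k al) VA).
 (* Each arc carries the phase of its centre, so that the arcs add up correctly; it has modulus 1
    and disappears from the overlaps. *)
 set (f := fun pc t => (e (mu * (/ (IZR k ^ 2 * Xa om pc))) * fp y om mu k al pc t)%C).
 assert (HPg : forall pc, In pc P -> good_piece X W om Q al pc).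
 { intros pc Hpc. apply in_flat_map in Hpc. destruct Hpc as (i & Hi & Hpc). destruct (HG i Hi) as [G C].
  apply (va_piece_good y X L W om k Q al Hy HX Hk HQW HW1 HL2 Hrel i G C pc Hpc). }
 assert (NDP : NoDup (map pc_key P)).
 { unfold P. clear HU HPg. induction VA as [|i VA IH]; simpl; [constructor|]. inversion ND as [|? ? NI ND']; subst.
  rewrite map_app. apply NoDup_app.
  - unfold va_pieces. rewrite map_map. apply Injective_map_NoDup.
   + intros u v E. unfold pc_key in E. simpl in E. congruence.
   + apply Injective_map_NoDup; [intros u v; lia|apply seq_NoDup].
  - apply IH; trivial. intros; apply HG; right; assumption.
  - intros kk H1 H2. apply in_map_iff in H1. destruct H1 as (pc & <- & H1). apply in_map_iff in H2.
   destruct H2 as (pc' & E & H2). apply in_flat_map in H2. destruct H2 as (i' & Hi' & H2).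
   destruct (HG i (or_introl eq_refl)) as [G C]. destruct (HG i' (or_intror Hi')) as [G' C'].
   destruct (va_piece_good y X L W om k Q al Hy HX Hk HQW HW1 HL2 Hrel i G C pc H1) as (_ & E1 & E2 & E3).
   destruct (va_piece_good y X L W om k Q al Hy HX Hk HQW HW1 HL2 Hrel i' G' C' pc' H2) as (_ & E1' & E2' & E3').
   apply NI. apply in_map_iff. exists i'. split; [|side]. unfold va_key. unfold pc_key in E. congruence. }
 assert (Cf : forall pc t, In pc P -> pc_lo pc <= t <= pc_hi pc -> ccont (fp y om mu k al pc) t).
 { intros pc t Hpc Ht. note (HPg pc Hpc) as Gp. note (s_nz X W om Q al pc Gp t Ht) as Nz.
  note (cs_bound y X L W om k Q al Hy HX HQW HW1 HL2 Hrel pc Gp t Ht) as (B1 & B2 & B3).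
  note (Dp_pos y X L W om k Q al Hy HX HQW HW1 HL2 Hrel pc Gp) as HD. apply ccont_mult.
  + apply ccont_R. eapply derive_cont. apply dSg_derive; side.
  + apply ccont_e.
   apply (continuous_mult (fun _ => mu) (fun t => Sg (Dp om k pc) (cp y om k pc) (tp om al pc - t))); [side|].
   eapply derive_cont. apply Sg_derive; side. }
 assert (Coef : forall n, Csum (fun i => cint (fun r => e (IZR n * va_T y om k al i r + mu * (va_u om k i + va_ep i * r))) (va_r1 i) (va_r2 i)) VA = coef pc_lo pc_hi f P n).
 { intros n. unfold coef, P. rewrite Csum_flat_map. apply Csum_ext. intros i Hi. destruct (HG i Hi) as [G C].
  rewrite (va_substitution y X L W om mu k Q al Hy HX Hk HQW HW1 HL2 Hrel i G C n).
  rewrite (va_split y X L W om mu k Q al Hy HX Hk HQW HW1 HL2 Hrel i G C n). rewrite <- Csum_scal. apply Csum_ext.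
  intros pc Hpc.
  destruct (va_piece_good y X L W om k Q al Hy HX Hk HQW HW1 HL2 Hrel i G C pc Hpc) as (Gp & E1 & E2 & E3).
  destruct Gp as (_ & _ & _ & L1 & L2 & L3 & _). symmetry. apply cint_eq.
  eapply is_cint_ext_le; [side| |apply is_cint_scal; apply cint_ok; [side|]].
  - intros t Ht. unfold f. replace (Xa om pc) with (va_X om i) by (unfold Xa, va_X; rewrite E1, E2; reflexivity).
   unfold va_u. side.
  - intros t Ht. apply ccont_mult; [|side]. apply Cf; [unfold P; apply in_flat_map; exists i; split; assumption|side]. }
 erewrite Rsum_ext; [|intros n _; rewrite Coef; reflexivity]. eapply Rle_trans.
 { apply bessel_inequality.
  - intros pc Hpc. destruct (HPg pc Hpc) as (_ & _ & _ & L1 & L2 & L3 & _). lra.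
  - intros pc Hpc t Ht. apply ccont_mult; [side|]. apply Cf; assumption.
  - apply NoDup_zs. }
 via (Rsum (fun i => Rsum (fun i' => Cmod (overlap pc_lo pc_hi (fp y om mu k al) i i')) P) P).
 { apply Rsum_le. intros a Ha. apply Rsum_le. intros b Hb. right. unfold overlap.
  destruct (Rle_dec _ _) as [Hr|Hr]; [|side].
  set (c := (e (mu * (/ (IZR k ^ 2 * Xa om a))) * Cconj (e (mu * (/ (IZR k ^ 2 * Xa om b)))))%C).
  assert (Ec : Cmod c = 1). { unfold c. rewrite e_conj, Cmod_mult, !Cmod_e. ring. }
  assert (EI : cint (fun t => (f a t * Cconj (f b t))%C) (Rmax (pc_lo a) (pc_lo b)) (Rmin (pc_hi a) (pc_hi b)) = (c * cint (fun t => (fp y om mu k al a t * Cconj (fp y om mu k al b t))%C) (Rmax (pc_lo a) (pc_lo b)) (Rmin (pc_hi a) (pc_hi b)))%C).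
  { apply cint_eq. eapply is_cint_ext_le; [side| |apply is_cint_scal; apply cint_ok; [side|]].
   - intros t Ht. unfold f, c. rewrite Cmult_conj. ring.
   - intros t Ht. note (Rmax_l (pc_lo a) (pc_lo b)). note (Rmax_r (pc_lo a) (pc_lo b)).
    note (Rmin_l (pc_hi a) (pc_hi b)). note (Rmin_r (pc_hi a) (pc_hi b)).
    apply ccont_mult; [apply Cf; side|apply ccont_conj; apply Cf; side]. }
  rewrite EI, Cmod_mult, Ec. ring. }
 eapply Rle_trans.
 { apply (core_sum y X L W om mu b1 b2 k Q al Hy HX Hk HQ HQW HW1 HL1 HL2 HWX Hrel Hb1 Hmu Hal Hal2 P HPg NDP). }
 set (A := 10 * X * (334 / b1 * (L * y ^ 2 * X))).
 set (B := 200 * (X * sqrt (W * IZR Q)) * (1440000 / b1 * sqrt b2 * (L * y ^ 2 * (W * sqrt L)))). unfold P.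
 rewrite Rsum_flat_map.
 via (Rsum (fun i => 2000000000 * (L * y) * (va_r2 i - va_r1 i) + (29 * W * A * / IZR (va_q i) + 58 * W * B * IZR Q * (/ IZR (va_q i) * / IZR (va_q i)))) VA).
 { apply Rsum_le. intros i Hi. destruct (HG i Hi) as [G C].
  rewrite (Rsum_ext _ (fun pc => 2000000000 * (L * y) * len y om k al pc + (A + B * (IZR Q / IZR (va_q i) + 1)))).
  2: { intros pc Hpc.
   destruct (va_piece_good y X L W om k Q al Hy HX Hk HQW HW1 HL2 Hrel i G C pc Hpc) as (_ & _ & E2 & _). rewrite E2.
   side. }
  rewrite Rsum_plus, Rsum_scal, Rsum_const. rewrite (va_len y X L W om k Q al Hy HX Hk HQW HW1 HL2 Hrel i G C).
  note (va_count y X L W om k Q al Hy HX Hk HQW HW1 HL2 Hrel i G C) as Cnt. destruct (G) as ((Gq1 & Gq2) & _).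
  have Hq2 : IZR (va_q i) <= IZR Q. apply Rplus_le_compat_l.
  via (29 * W / IZR (va_q i) * (A + B * (2 * IZR Q / IZR (va_q i)))).
  - have Q3 : 1 <= IZR Q / IZR (va_q i). side.
  - side. }
 rewrite Rsum_plus, Rsum_scal, Rsum_plus, !Rsum_scal.
 assert (HG' : forall i, In i VA -> good_varc X om Q i) by (intros i Hi; apply HG; assumption).
 note (varc_count VA (fun q => / IZR q) HG' ND ltac:(intros q Hq; left; apply Rinv_0_lt_compat; apply IZR_lt; lia)) as C1.
 note (varc_count VA (fun q => / IZR q * / IZR q) HG' ND ltac:(intros q Hq; assert (0 < / IZR q) by side; nra)) as C2.
 assert (D1 : Rsum (fun j => 8 * X * INR j * / IZR (Z.of_nat j)) (seq 1 (Z.to_nat Q)) = 8 * X * IZR Q).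
 { rewrite (Rsum_ext _ (fun _ => 8 * X)).
  - rewrite Rsum_const, length_seq, INR_IZR_INZ, Z2Nat.id by lia. ring.
  - intros j Hj. apply in_seq in Hj. rewrite <- INR_IZR_INZ. have : 0 < INR j. side. }
 assert (D2 : Rsum (fun j => 8 * X * INR j * (/ IZR (Z.of_nat j) * / IZR (Z.of_nat j))) (seq 1 (Z.to_nat Q)) = 8 * X * harm (Z.to_nat Q)).
 { unfold harm. rewrite <- Rsum_scal. apply Rsum_ext. intros j Hj. apply in_seq in Hj. rewrite <- INR_IZR_INZ.
  have : 0 < INR j. side. }
 unfold core_bound. fold A B.
 have T1 : 2000000000 * (L * y) * Rsum (fun i => va_r2 i - va_r1 i) VA <= 2000000000 * (L * y) * U.
 have T2 : 29 * W * A * Rsum (fun i => / IZR (va_q i)) VA <= 29 * W * A * (8 * X * IZR Q).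
 have T3 : 58 * W * B * IZR Q * Rsum (fun i => / IZR (va_q i) * / IZR (va_q i)) VA <= 58 * W * B * IZR Q * (8 * X * harm (Z.to_nat Q)).
 lra.
Qed.
End ClassBessel.

Definition clip (r1 r2 r : R) : R := Rmin r2 (Rmax r1 r).

Lemma clip_range r1 r2 r : r1 <= r2 -> r1 <= clip r1 r2 r <= r2.
Proof. intros H. split; [apply Rmin_glb; [side|apply Rmax_l]|apply Rmin_l]. Qed.

Lemma clip_id r1 r2 r : r1 <= r <= r2 -> clip r1 r2 r = r.
Proof. intros H. unfold clip. rewrite Rmax_right, Rmin_right; lra. Qed.

Lemma clip_below r1 r2 r : r1 <= r2 -> r <= r1 -> clip r1 r2 r = r1.
Proof. intros H H1. unfold clip. rewrite Rmax_left, Rmin_right; lra. Qed.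

Lemma clip_above r1 r2 r : r1 <= r2 -> r2 <= r -> clip r1 r2 r = r2.
Proof. intros H H1. unfold clip. rewrite Rmax_right, Rmin_left; lra. Qed.

Lemma continuous_clip (f : R -> R) r1 r2 x : continuous f x -> continuous (fun t => clip r1 r2 (f t)) x.
Proof.
 intros Cf. assert (E : forall t, (r1 + f t + Rabs (r1 - f t)) / 2 = Rmax r1 (f t)).
 { intros t. unfold Rmax, Rabs. destruct (Rle_dec r1 (f t)), (Rcase_abs (r1 - f t)); lra. }
 assert (E2 : forall t, (r2 + Rmax r1 (f t) - Rabs (r2 - Rmax r1 (f t))) / 2 = clip r1 r2 (f t)).
 { intros t. unfold clip. set (z := Rmax r1 (f t)). unfold Rmin, Rabs.
  destruct (Rle_dec r2 z), (Rcase_abs (r2 - z)); lra. }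
 assert (C1 : continuous (fun t => Rmax r1 (f t)) x).
 { apply continuous_ext with (fun t => (r1 + f t + Rabs (r1 - f t)) / 2); [side|].
  apply (continuous_mult (fun t => r1 + f t + Rabs (r1 - f t)) (fun _ => / 2)); [|side].
  apply (continuous_plus (fun t => r1 + f t) (fun t => Rabs (r1 - f t))).
  - side.
  - apply continuous_comp; [|apply continuous_Rabs]. side. }
 apply continuous_ext with (fun t => (r2 + Rmax r1 (f t) - Rabs (r2 - Rmax r1 (f t))) / 2); [side|].
 apply (continuous_mult (fun t => r2 + Rmax r1 (f t) - Rabs (r2 - Rmax r1 (f t))) (fun _ => / 2)); [|side].
 apply (continuous_minus (fun t => r2 + Rmax r1 (f t)) (fun t => Rabs (r2 - Rmax r1 (f t)))).
 - side.
 - apply continuous_comp; [|apply continuous_Rabs]. side.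
Qed.

(** The radius at which an arc reaches height [tau], from tau = y / (D (r^2 + y^2)). For heights
    above the maximum the square root of a negative number is 0, as it should be. *)
Definition rho (y D tau : R) : R := sqrt (y / (D * tau) - y ^ 2).

Lemma continuous_rho y D tau : 0 < D -> 0 < tau -> continuous (rho y D) tau.
Proof. intros HD Ht. unfold rho. side. Qed.

Section Parts.
Variables (y D r1 r2 Y0 Y1 : R) (w dw : R -> R) (g : R -> C).
Hypotheses (Hy : 0 < y) (HD : 0 < D) (Hr1 : 0 < r1) (Hr : r1 <= r2) (HY0 : 0 < Y0)
 (Hw : forall tau, 0 < tau -> is_derive w tau (dw tau) /\ continuous dw tau) (Hg : forall r, ccont g r).
Let Yf r := y / (D * (r ^ 2 + y ^ 2)).
Hypotheses (H0 : Y0 <= Yf r2) (H1 : Yf r1 <= Y1).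
Let G r := cint g r1 r.
Let H tau := G (clip r1 r2 (rho y D tau)).

Lemma Yf_pos r : 0 < Yf r.
Proof. side. Qed.

Lemma Yf_anti a b : 0 <= a -> a <= b -> Yf b <= Yf a.
Proof. intros Ha Hab. unfold Yf, Rdiv. side. Qed.

Lemma rho_Yf r : 0 <= r -> rho y D (Yf r) = r.
Proof.
 intros Hr0. unfold rho, Yf. replace (y / (D * (y / (D * (r ^ 2 + y ^ 2)))) - y ^ 2) with (r ^ 2).
 - apply sqrt_pow2; assumption.
 - side.
Qed.

Lemma rho_anti a b : 0 < a -> a <= b -> rho y D b <= rho y D a.
Proof. intros Ha Hab. apply sqrt_le_1_alt. apply Rplus_le_compat_r. unfold Rdiv. side. Qed.

Lemma G_derive r : is_cderive G r (g r).
Proof. apply is_cderive_cint. side. Qed.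

Lemma H_cont tau : 0 < tau -> ccont H tau.
Proof.
 intros Ht. apply (ccont_comp G (fun tau => clip r1 r2 (rho y D tau))).
 - apply continuous_clip. apply continuous_rho; assumption.
 - eapply is_cderive_ccont. apply G_derive.
Qed.

(** The weight is written as w(Y0) plus the integral of dw from Y0 to the height at r, and the r
    with height at least tau form the initial segment up to [rho]. Integrating over tau instead of r
    gives all arcs a common variable, so that dw(n, tau) can leave the sum over arcs. *)
Lemma class_parts :
  cint (fun r => (RtoC (w (Yf r)) * g r)%C) r1 r2 =
  (RtoC (w Y0) * cint g r1 r2 + cint (fun tau => RtoC (dw tau) * cint g r1 (clip r1 r2 (rho y D tau))) Y0 Y1)%C.
Proof.
 set (dY := fun r => - (2 * r * y / (D * (r ^ 2 + y ^ 2) ^ 2))). assert (DY : forall r, is_derive Yf r (dY r)).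
 { intros r. unfold Yf, dY. have : 0 < r ^ 2 + y ^ 2. auto_derive.
  - side.
  - side. }
 assert (Cdw : forall tau, 0 < tau -> ccont (fun tau => RtoC (dw tau) * H tau)%C tau).
 { intros tau Ht. apply ccont_mult; [apply ccont_R; apply Hw; assumption|apply H_cont; assumption]. }
 note (Yf_anti r1 r2 !! Hr) as A12.
 assert (W' : forall tau, 0 < tau -> is_cderive (fun r => RtoC (w r)) tau (RtoC (dw tau))).
 { intros tau Ht. apply is_cderive_R. apply Hw; assumption. }
 assert (DWY : forall r, is_cderive (fun r => RtoC (w (Yf r))) r (RtoC (dY r * dw (Yf r)))).
 { intros r. apply is_cderive_R. apply (is_derive_comp w Yf r (dw (Yf r)) (dY r)); [apply Hw; apply Yf_pos|side]. }
 assert (IBP : is_cint (fun r => (RtoC (w (Yf r)) * g r)%C) r1 r2 (RtoC (w (Yf r2)) * G r2 - RtoC (w (Yf r1)) * G r1 - cint (fun r => RtoC (dY r * dw (Yf r)) * G r) r1 r2)%C).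
 { apply (is_cint_parts (fun r => RtoC (w (Yf r))) G (fun r => RtoC (dY r * dw (Yf r))) g).
  - side.
  - intros r _. apply G_derive.
  - intros r _. apply ccont_R. apply (continuous_mult dY (fun r => dw (Yf r))); [side|].
   apply continuous_comp; [side|apply Hw; apply Yf_pos].
  - side. }
 rewrite (cint_eq _ _ _ _ IBP).
 assert (G1 : G r1 = RtoC 0) by (unfold G; apply cint_eq; apply is_cint_point). rewrite G1.
 assert (Sub : cint (fun r => RtoC (dY r * dw (Yf r)) * G r)%C r1 r2 = cint (fun tau => RtoC (dw tau) * H tau)%C (Yf r1) (Yf r2)).
 { apply cint_eq.
  eapply is_cint_ext_le; [side| |apply (is_cint_comp (fun tau => RtoC (dw tau) * H tau)%C Yf dY)].
  - intros r Hrr. unfold H. rewrite rho_Yf by lra. rewrite clip_id by lra. rewrite RtoC_mult. ring.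
  - intros r _. apply Cdw. side.
  - side. }
 rewrite Sub.
 assert (I2 : is_cint (fun tau => RtoC (dw tau) * H tau)%C (Yf r1) (Yf r2) (- cint (fun tau => RtoC (dw tau) * H tau)%C (Yf r2) (Yf r1))%C).
 { apply is_cint_swap. apply cint_ok; [side|]. intros tau Ht. apply Cdw. lra. }
 rewrite (cint_eq _ _ _ _ I2).
 assert (I1 : cint (fun tau => RtoC (dw tau) * H tau)%C Y0 (Yf r2) = ((RtoC (w (Yf r2)) - RtoC (w Y0)) * G r2)%C).
 { apply cint_eq. eapply is_cint_ext_le; [side| |].
  2: { replace ((RtoC (w (Yf r2)) - RtoC (w Y0)) * G r2)%C with (G r2 * (RtoC (w (Yf r2)) - RtoC (w Y0)))%C by ring.
   apply is_cint_scal. apply (is_cint_derive (fun r => RtoC (w r)) (fun tau => RtoC (dw tau))).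
   - intros tau. minmax. intros Ht. apply W'. lra.
   - intros tau. minmax. intros Ht. apply ccont_R. apply Hw. lra. }
  intros tau Ht. unfold H. rewrite clip_above; [ring|side|]. rewrite <- (rho_Yf r2) by lra. apply rho_anti; lra. }
 assert (I3 : cint (fun tau => RtoC (dw tau) * H tau)%C (Yf r1) Y1 = RtoC 0).
 { apply cint_eq. eapply is_cint_ext_le; [side| |apply is_cint_0]. intros tau Ht. unfold H.
  rewrite clip_below; [rewrite G1; ring|side|]. rewrite <- rho_Yf by lra. apply rho_anti; lra. }
 fold (G r2).
 change (cint (fun tau => RtoC (dw tau) * cint g r1 (clip r1 r2 (rho y D tau)))%C Y0 Y1) with (cint (fun tau => RtoC (dw tau) * H tau)%C Y0 Y1).
 rewrite (cint_chasles (fun tau => RtoC (dw tau) * H tau)%C Y0 (Yf r2) Y1); [|lra|lra|intros tau Ht; apply Cdw; lra].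
 rewrite (cint_chasles (fun tau => RtoC (dw tau) * H tau)%C (Yf r2) (Yf r1) Y1); [|lra|lra|intros tau Ht; apply Cdw; lra].
 rewrite I1, I3. ring.
Qed.
End Parts.

Section ClassBound.
Variables (psi : C -> C) (t : Z -> C) (w dw : Z -> R -> R).
Hypothesis FF : form_facts psi t w dw.

(** Arcs cut at height tau form a class again, so [class_bessel] bounds the mean square over n of
    the truncated sums [Gn] uniformly in tau. Cauchy-Schwarz over n against [ff_square] then treats
    the boundary term and, for each tau, the integrand. *)
Lemma class_bound eps : 0 < eps -> exists B, 0 < B /\
  forall (y X L W om mu b1 b2 : R) (k Q : Z) (al : Z -> Z -> Z),
  0 < y -> 1 <= X -> (1 <= k)%Z -> (1 <= Q)%Z -> IZR Q <= 13 * W -> 1 <= W -> 8000 * IZR Q * X <= L -> 40000 <= L ->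
  1000 <= W * X -> IZR k ^ 2 * X ^ 2 * y * (W ^ 2 * L) = 1 -> 0 < b1 -> b1 <= Rabs mu * y <= b2 ->
  (forall p q, (1 <= q)%Z -> Z.gcd p q = 1%Z -> Z.divide q (al p q * p + 1)) ->
  (forall p p' q, (1 <= q)%Z -> Z.divide q (p - p') -> al p q = al p' q) ->
  forall (VA : list varc) (U : R),
  (forall i, In i VA -> good_varc X om Q i /\ in_class y L om k i) -> NoDup (map va_key VA) ->
  Rsum (fun i => va_r2 i - va_r1 i) VA <= U ->
  Cmod (Csum (fun i => cint (fun r => (psi (va_T y om k al i r, va_Y y om k i r) * e (mu * (va_u om k i + va_ep i * r)))%C) (va_r1 i) (va_r2 i)) VA)
    <= 2 * sqrt (B * Rpower (2 * L) eps) * sqrt (core_bound y X L W b1 b2 Q U).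
Proof.
 intros Heps. destruct (ff_square _ _ _ _ FF eps Heps) as (B & HB & Sq). exists B. split; [side|].
 intros y X L W om mu b1 b2 k Q al Hy HX Hk HQ HQW HW1 HL1 HL2 HWX Hrel Hb1 Hmu Hal Hal2 VA U HG ND HU.
 set (K := core_bound y X L W b1 b2 Q U). set (Y0 := / (2 * L)). set (Y1 := / L). have HY0 : 0 < Y0.
 assert (Fac : forall i, In i VA -> 0 < va_D om k i /\ 0 < va_r1 i /\ va_r1 i <= va_r2 i /\ Y0 <= va_Y y om k i (va_r2 i) /\ va_Y y om k i (va_r1 i) <= Y1).
 { intros i Hi. destruct (HG i Hi) as [G C]. note (va_D_pos X om k Q HX Hk i G) as HD.
  destruct (va_r12 X om Q i G) as [R1 R2].
  destruct (va_class y X L W om k Q Hy HX Hk HQW HW1 HL2 Hrel i G C _ R1) as [_ P1]. destruct C as [C1 C2].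
  split; [side|]. split; [lra|]. split; [lra|]. unfold va_Y, Y0, Y1. have : 0 < va_D om k i * (va_r2 i ^ 2 + y ^ 2).
  split.
  - cancel_r (va_D om k i * (va_r2 i ^ 2 + y ^ 2)). unfold Rdiv. rewrite Rmult_assoc, Rinv_l, Rmult_1_r by lra.
   apply Rmult_le_reg_l with (2 * L); [lra|]. rewrite <- Rmult_assoc, Rinv_r, Rmult_1_l by lra. lra.
  - cancel_r (va_D om k i * (va_r1 i ^ 2 + y ^ 2)). unfold Rdiv. rewrite Rmult_assoc, Rinv_l, Rmult_1_r by lra.
   apply Rmult_le_reg_l with L; [lra|]. rewrite <- Rmult_assoc, Rinv_r, Rmult_1_l by lra. lra. }
 assert (CT : forall i r, In i VA -> continuous (va_T y om k al i) r).
 { intros i r Hi. destruct (Fac i Hi) as (HD & _).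
  apply (continuous_minus (fun _ => va_ta om al i) (fun r => va_ep i * Vf y r / va_D om k i)); [side|].
  apply (continuous_mult (fun r => va_ep i * Vf y r) (fun _ => / va_D om k i)); [|side].
  apply (continuous_mult (fun _ => va_ep i) (Vf y)); [side|]. eapply derive_cont. apply Vf_derive. side. }
 assert (CY : forall i r, In i VA -> continuous (va_Y y om k i) r).
 { intros i r Hi. destruct (Fac i Hi) as (HD & _). unfold va_Y. side. }
 apply (approx_limit FF VA va_r1 va_r2 (va_T y om k al) (va_Y y om k) (fun i r => mu * (va_u om k i + va_ep i * r)) Y0 _ HY0).
 { intros i Hi. apply Fac; assumption. }
 { intros i Hi u Hu. destruct (Fac i Hi) as (HD & R1 & R2 & F1 & F2). split; [side|]. split; [side|]. split; [side|].
  upto F1. apply Yf_anti; lra. }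
 intros N.
 set (g := fun (n : Z) (i : varc) (r : R) => e (IZR n * va_T y om k al i r + mu * (va_u om k i + va_ep i * r))).
 set (trunc := fun (tau : R) (i : varc) => {| va_p := va_p i; va_q := va_q i; va_right := va_right i; va_r1 := va_r1 i; va_r2 := clip (va_r1 i) (va_r2 i) (rho y (va_D om k i) tau) |}).
 set (Gn := fun (n : Z) (tau : R) => Csum (fun i => cint (g n i) (va_r1 i) (clip (va_r1 i) (va_r2 i) (rho y (va_D om k i) tau))) VA).
 assert (Kb : forall tau, Rsum (fun n => Cmod (Gn n tau) ^ 2) (zs N) <= K).
 { intros tau.
  note (class_bessel y X L W om mu b1 b2 k Q al Hy HX Hk HQ HQW HW1 HL1 HL2 HWX Hrel Hb1 Hmu Hal Hal2 (map (trunc tau) VA) U N) as CB.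
  assert (E : forall n, Gn n tau = Csum (fun i => cint (fun r => e (IZR n * va_T y om k al i r + mu * (va_u om k i + va_ep i * r))) (va_r1 i) (va_r2 i)) (map (trunc tau) VA)).
  { intros n. rewrite Csum_map. side. } erewrite Rsum_ext; [|intros n _; rewrite E; reflexivity]. apply CB.
  - intros i' Hi'. apply in_map_iff in Hi'. destruct Hi' as (i & <- & Hi).
   destruct (HG i Hi) as [(G1 & G2 & G3 & G4 & G5) [C1 C2]]. destruct (Fac i Hi) as (HD & R1 & R2 & _).
   note (clip_range (va_r1 i) (va_r2 i) (rho y (va_D om k i) tau) G5) as [K1 K2]. split.
   + unfold good_varc, trunc. side.
   + unfold in_class, trunc. cbn [va_r1 va_r2]. change (va_D om k _) with (va_D om k i). split; [side|].
    eapply Rle_trans; [|exact C2]. side.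
  - rewrite map_map. side.
  - rewrite Rsum_map. eapply Rle_trans; [|exact HU]. apply Rsum_le. intros i Hi. unfold trunc. cbn [va_r1 va_r2].
   destruct (HG i Hi) as [(_ & _ & _ & _ & G5) _]. note (clip_range (va_r1 i) (va_r2 i) (rho y (va_D om k i) tau) G5).
   lra. }
 assert (K0 : 0 <= K). { eapply Rle_trans; [|apply (Kb 1)]. apply Rsum_nonneg. side. }
 assert (Dec : Csum (fun i => cint (fun u => (PN (t:=t) (w:=w) N (va_T y om k al i u) (va_Y y om k i u) * e (mu * (va_u om k i + va_ep i * u)))%C) (va_r1 i) (va_r2 i)) VA = (Csum (fun n => (t n * RtoC (w n Y0)) * Gn n Y0) (zs N) + cint (fun tau => Csum (fun n => (t n * RtoC (dw n tau)) * Gn n tau) (zs N)) Y0 Y1)%C).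
 { assert (I : is_cint (fun tau => Csum (fun n => (t n * RtoC (dw n tau)) * Gn n tau)%C (zs N)) Y0 Y1 (Csum (fun n => Csum (fun i => t n * cint (fun tau => RtoC (dw n tau) * cint (g n i) (va_r1 i) (clip (va_r1 i) (va_r2 i) (rho y (va_D om k i) tau))) Y0 Y1) VA) (zs N))%C).
  { apply is_cint_Csum. intros n Hn. apply in_zs in Hn. destruct Hn as [Hn _].
   apply (is_cint_ext (fun tau => Csum (fun i => t n * (RtoC (dw n tau) * cint (g n i) (va_r1 i) (clip (va_r1 i) (va_r2 i) (rho y (va_D om k i) tau))))%C VA)).
   { intros tau _. unfold Gn. rewrite <- Csum_scal. apply Csum_ext. side. } apply is_cint_Csum. intros i Hi.
   apply is_cint_scal. apply cint_ok; [side|]. intros tau Ht. destruct (Fac i Hi) as (HD & R1 & R2 & _).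
   apply ccont_mult; [apply ccont_R; eapply ff_dcont; side|]. apply H_cont; side. }
  rewrite (cint_eq _ _ _ _ I), <- Csum_plus.
  transitivity (Csum (fun i => Csum (fun n => t n * cint (fun u => RtoC (w n (va_Y y om k i u)) * g n i u) (va_r1 i) (va_r2 i)) (zs N))%C VA).
  { apply Csum_ext. intros i Hi. destruct (Fac i Hi) as (HD & R1 & R2 & _).
   apply (PN_cint FF N (va_T y om k al i) (va_Y y om k i) (fun u => mu * (va_u om k i + va_ep i * u)) _ _ R2).
   intros u Hu. split; [side|]. split; [side|]. split; [side|]. apply (Yf_pos y (va_D om k i) Hy HD). }
  rewrite Csum_exchange. apply Csum_ext. intros n Hn. apply in_zs in Hn. destruct Hn as [Hn _]. unfold Gn.
  rewrite <- Csum_scal, <- Csum_plus. apply Csum_ext. intros i Hi. destruct (Fac i Hi) as (HD & R1 & R2 & F1 & F2).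
  rewrite clip_above; [|side|].
  2: { rewrite <- (rho_Yf y (va_D om k i) Hy HD (va_r2 i)) by lra. apply rho_anti; assumption. } unfold va_Y.
  rewrite (class_parts y (va_D om k i) (va_r1 i) (va_r2 i) Y0 Y1 (w n) (dw n) (g n i) Hy HD R1 R2 HY0); trivial.
  - ring.
  - intros tau Ht. split; [apply (ff_derive _ _ _ _ FF); assumption|apply (ff_dcont _ _ _ _ FF); assumption].
  - side. }
 rewrite Dec. assert (ER : Rpower Y0 (- eps) = Rpower (2 * L) eps).
 { unfold Y0. unfold Rpower. rewrite ln_Rinv by lra. f_equal. ring. }
 assert (CS : forall (a : Z -> R) tau Bd, Rsum (fun n => Cmod (t n) ^ 2 * a n ^ 2) (zs N) <= Bd -> Cmod (Csum (fun n => (t n * RtoC (a n)) * Gn n tau)%C (zs N)) <= sqrt Bd * sqrt K).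
 { intros a tau Bd HBd. assert (HBd0 : 0 <= Bd). { eapply Rle_trans; [|exact HBd]. apply Rsum_nonneg. side. }
  rewrite <- sqrt_mult by assumption. rewrite <- (sqrt_pow2 (Cmod _)) by apply Cmod_ge_0. apply sqrt_le_1_alt.
  upto Csum_CS.
  apply Rmult_le_compat; [apply Rsum_nonneg; intros; apply pow2_ge_0|apply Rsum_nonneg; intros; apply pow2_ge_0| |side].
  eapply Rle_trans; [|exact HBd]. apply Rsum_le. intros n _. rewrite Cmod_mult, Cmod_R, Rpow_mult_distr, pow2_abs. lra. }
 upto Cmod_triangle.
 replace (2 * sqrt (B * Rpower (2 * L) eps) * sqrt K) with (sqrt (B * Rpower (2 * L) eps) * sqrt K + sqrt (B * Rpower (2 * L) eps) * sqrt K) by ring.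
 apply Rplus_le_compat.
 - apply CS. rewrite <- ER. apply (Sq Y0 N HY0).
 (* The tau-interval has length exactly [Y0], which cancels the factor 1/tau lost to dw. *)
 - replace (sqrt (B * Rpower (2 * L) eps) * sqrt K) with ((Y1 - Y0) * (/ Y0 * (sqrt (B * Rpower (2 * L) eps) * sqrt K))) by side.
  eapply (cint_bound (fun tau => Csum (fun n => (t n * RtoC (dw n tau)) * Gn n tau)%C (zs N)) Y0 Y1); [side| |apply cint_ok; [side|]].
  + intros tau Ht. have Pt : 0 < tau. rewrite <- ER.
   assert (S2 : Rsum (fun n => Cmod (t n) ^ 2 * dw n tau ^ 2) (zs N) <= (/ tau) ^ 2 * (B * Rpower tau (- eps))).
   { destruct (Sq tau N Pt) as [_ S].
    rewrite (Rsum_ext _ (fun n => (/ tau) ^ 2 * (Cmod (t n) ^ 2 * (tau * dw n tau) ^ 2))).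
    - rewrite Rsum_scal. side.
    - side. }
   eapply Rle_trans; [apply CS; exact S2|]. rewrite sqrt_mult_alt by apply pow2_ge_0. rewrite sqrt_pow2 by side.
   rewrite Rmult_assoc. apply Rmult_le_compat.
   * side.
   * side.
   * side.
   * mul_r. apply sqrt_le_1_alt. mul_l. apply Rpower_anti; lra.
  + intros tau Ht. apply ccont_Csum. intros n Hn. apply in_zs in Hn. destruct Hn as [Hn _].
   apply ccont_mult; [apply ccont_mult; [side|apply ccont_R; eapply ff_dcont; side]|]. apply ccont_Csum. intros i Hi.
   destruct (Fac i Hi) as (HD & R1 & R2 & _). apply H_cont; side.
Qed.
End ClassBound.

(** The first suitable residue is searched with p replaced by p mod q, which makes the choice depend
    on the class of p alone. The default 0 is never reached when p is prime to q. *)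
Lemma al_exists : exists al : Z -> Z -> Z,
  (forall p q, (1 <= q)%Z -> Z.gcd p q = 1%Z -> Z.divide q (al p q * p + 1)) /\
  (forall p p' q, (1 <= q)%Z -> Z.divide q (p - p') -> al p q = al p' q).
Proof.
 set (test := fun p q z => Z.eqb ((z * (p mod q) + 1) mod q) 0).
 exists (fun p q => match find (test p q) (zrange 0 (Z.to_nat q)) with Some z => z | None => 0%Z end). split.
 - intros p q Hq Hg. assert (Ex : exists z, In z (zrange 0 (Z.to_nat q)) /\ test p q z = true).
  { apply Zgcd_1_rel_prime in Hg. destruct (rel_prime_bezout _ _ Hg) as [u v Huv]. exists ((- u) mod q)%Z.
   note (Z.mod_pos_bound (- u) q !!). split; [apply in_zrange; lia|]. apply Z.eqb_eq.
   rewrite Z.add_mod, Z.mul_mod, !Z.mod_mod by lia. rewrite <- Z.mul_mod, <- Z.add_mod by lia.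
   replace (- u * p + 1)%Z with (v * q)%Z by lia. apply Z.mod_mul. lia. }
  destruct Ex as (z & Hz & Tz). destruct (find (test p q) (zrange 0 (Z.to_nat q))) as [z'|] eqn:E.
  + apply find_some in E. destruct E as [_ E]. apply Z.eqb_eq in E. apply Z.mod_divide; [lia|].
   rewrite Z.add_mod, Z.mul_mod by lia. rewrite Z.add_mod, Z.mul_mod, Z.mod_mod in E by lia. side.
  + note (find_none _ _ E z Hz). congruence.
 - intros p p' q Hq [z Hz]. assert (E : (p mod q = p' mod q)%Z).
  { replace p with (p' + z * q)%Z by lia. apply Z.mod_add. lia. } unfold test. rewrite E. side.
Qed.

Section Transform.
Variables (psi : C -> C) (t : Z -> C) (w dw : Z -> R -> R).
Hypothesis FF : form_facts psi t w dw.

(** The centre of the arc, seen from h/k, is the rational point - d/c with c = a q - p k. The matrix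
    (a', b'; c, d) combines the map for h/k with one that sends p/q to infinity. *)
Lemma arc_transform (y X : R) (h k a Q : Z) (al : Z -> Z -> Z) (i : varc) (r : R) :
  0 < y -> 1 <= X -> (1 <= k)%Z -> Z.divide k (a * h + 1) ->
  (forall p q, (1 <= q)%Z -> Z.gcd p q = 1%Z -> Z.divide q (al p q * p + 1)) ->
  good_varc X (IZR a / IZR k) Q i ->
  psi (IZR h / IZR k + (va_u (IZR a / IZR k) k i + va_ep i * r), y) =
  psi (va_T y (IZR a / IZR k) k al i r, va_Y y (IZR a / IZR k) k i r).
Proof.
 intros Hy HX Hk [m Hm] Hal ((G1 & _) & G2 & [G3 G4] & _). set (p := va_p i) in *. set (q := va_q i) in *.
 destruct (Hal p q G1 G2) as [z Hz]. set (c := (a * q - p * k)%Z). have Kp : 0 < IZR k. have Qp : 0 < IZR q.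
 set (x := va_X (IZR a / IZR k) i) in *. assert (Ex : IZR c = IZR k * IZR q * x).
 { unfold c, x, va_X. fold p q. rewrite minus_IZR, !mult_IZR. side. } assert (Cp : 0 < IZR c). { rewrite Ex. side. }
 assert (Cz : (c <> 0)%Z). { intros E. rewrite E in Cp. lra. } set (d := (h * p - q * m)%Z).
 set (a' := (al p q * a - z * k)%Z). assert (Ea : (a' * q = al p q * c - k)%Z) by (unfold a', c; nia).
 set (b' := (- (al p q * m) + z * h)%Z). assert (Det : (a' * d - b' * c = 1)%Z).
 { unfold a', b', c, d. have E1 : (m * k = a * h + 1)%Z. have E2 : (z * q = al p q * p + 1)%Z.
  replace ((al p q * a - z * k) * (h * p - q * m) - (- (al p q * m) + z * h) * (a * q - p * k))%Z with ((z * q - al p q * p) * (m * k - a * h))%Z by ring.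
  rewrite E1, E2. ring. }
 note (ff_mobius _ _ _ _ FF a' b' c d (IZR h / IZR k + (va_u (IZR a / IZR k) k i + va_ep i * r)) y Det Cz Hy) as M.
 assert (Ev : IZR h / IZR k + (va_u (IZR a / IZR k) k i + va_ep i * r) + IZR d / IZR c = va_ep i * r).
 { unfold va_u. fold x. unfold d. rewrite minus_IZR, !mult_IZR.
  assert (E1 : IZR m * IZR k = IZR a * IZR h + 1) by (rewrite <- !mult_IZR, <- plus_IZR; f_equal; lia).
  assert (E3 : IZR m = (IZR a * IZR h + 1) / IZR k) by (rewrite <- E1; field; lra).
  assert (E4 : x = IZR c / (IZR k * IZR q)) by (rewrite Ex; field; lra). rewrite E3, E4.
  assert (E5 : IZR p = (IZR a * IZR q - IZR c) / IZR k). { unfold c. rewrite minus_IZR, !mult_IZR. side. } rewrite E5.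
  side. }
 rewrite Ev in M. rewrite M. unfold va_T, va_Y, Vf. assert (ED : va_D (IZR a / IZR k) k i = IZR c ^ 2).
 { unfold va_D. fold q x. side. } assert (E2 : (va_ep i * r) ^ 2 = r ^ 2).
 { destruct (va_ep_sign i) as [E|E]; rewrite E; ring. } rewrite ED, E2.
 assert (ET : va_ta (IZR a / IZR k) al i = IZR a' / IZR c).
 { unfold va_ta. fold p q x. assert (E6 : IZR a' = (IZR (al p q) * IZR c - IZR k) / IZR q).
  { rewrite <- mult_IZR, <- minus_IZR, <- Ea, mult_IZR. side. } rewrite E6.
  assert (E4 : x = IZR c / (IZR k * IZR q)) by (rewrite Ex; field; lra). rewrite E4. side. }
 rewrite ET. do 2 f_equal. side.
Qed.
End Transform.

(** * Farey dissection of an arc near h/k *)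

Section Arcs.
Variables (X om U1 U2 : R) (k Q : Z).
Hypotheses (HX : 1 <= X) (Hk : (1 <= k)%Z) (HQ : (6 <= Q)%Z).
Let K2 := IZR k ^ 2.
Hypotheses (HU1 : / (K2 * X) <= U1) (HU12 : U1 < U2) (HU2 : U2 <= 2 * / (K2 * X)).
(** The image of h/k + u has real part om - 1/(k^2 u) if y is neglected; [uw] inverts this.
    Neglecting y only affects where the cuts are made, so the dissection is exact. *)
Let uw x := / (K2 * (om - x)).
Let w1 := om - / (K2 * U1).
Let w2 := om - / (K2 * U2).

Lemma K2_pos : 1 <= K2.
Proof. side. Qed.

Lemma w_bounds : w1 < w2 /\ om - X <= w1 /\ w2 <= om - X / 2.
Proof.
 note K2_pos as HK. unfold w1, w2. split; [|split].
 - assert (/ (K2 * U2) < / (K2 * U1)); [|lra]. apply Rinv_lt_contravar; side.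
 - assert (/ (K2 * U1) <= X); [|lra]. rewrite <- Rinv_inv. apply Rinv_le_contravar; [side|].
  replace (/ X) with (K2 * / (K2 * X)) by side. side.
 - assert (X / 2 <= / (K2 * U2)); [|lra]. replace (X / 2) with (/ (K2 * (2 * / (K2 * X)))) by side. side.
Qed.

Lemma uw_mono x x' : om - X <= x -> x <= x' -> x' <= om - X / 2 -> 0 < uw x /\ uw x <= uw x'.
Proof. side. Qed.

Lemma uw_ends : uw w1 = U1 /\ uw w2 = U2.
Proof. note K2_pos as HK. have P0 : 0 < K2 * X. have P1 : 0 < / (K2 * X). side. Qed.

Lemma Csum_filter_0 {A} (f : A -> C) (p : A -> bool) l :
  (forall x, In x l -> p x = false -> f x = RtoC 0) -> Csum f (filter p l) = Csum f l.
Proof.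
 induction l as [|x l IH]; simpl; intros H; [side|]. destruct (p x) eqn:E; simpl; rewrite IH by auto; [side|].
 rewrite H by auto. ring.
Qed.

(** On the left of p/q the distance r decreases as u grows, so there the ends are exchanged. *)
Definition to_varc (b : half_arc) : varc :=
  let u0 := uw (clip w1 w2 (arc_lo b)) in let u1 := uw (clip w1 w2 (arc_hi b)) in
  let ua := / (K2 * (om - IZR (arc_p b) / IZR (arc_q b))) in
  {| va_p := arc_p b; va_q := arc_q b; va_right := arc_right b;
     va_r1 := if arc_right b then u0 - ua else ua - u1;
     va_r2 := if arc_right b then u1 - ua else ua - u0 |}.

(** The radius is |x - p/q| / (k^2 (om - x) Xa) with |x - p/q| <= 1/(q Q), om - x >= X/2 and Xa >=
    X/3, whence the 6. *)
Lemma to_varc_good b : good_arc Q b -> clip w1 w2 (arc_lo b) < clip w1 w2 (arc_hi b) ->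
  good_varc X om Q (to_varc b) /\
  va_r2 (to_varc b) <= 6 / (IZR (arc_q b) * IZR Q * (K2 * X ^ 2)).
Proof.
 intros (G1 & G2 & G3 & G4 & G5) Hc. destruct w_bounds as (W1 & W2 & W3). note K2_pos as HK.
 set (lo := clip w1 w2 (arc_lo b)) in *. set (hi := clip w1 w2 (arc_hi b)) in *.
 note (clip_range w1 w2 (arc_lo b) !!) as Rlo. note (clip_range w1 w2 (arc_hi b) !!) as Rhi. fold lo in Rlo.
 fold hi in Rhi. assert (Llo : arc_lo b <= lo).
 { destruct (Rle_dec (arc_lo b) w2) as [H|H]; [unfold lo, clip; apply Rmin_glb; [side|apply Rmax_r]|]. exfalso.
  unfold lo in Hc. rewrite clip_above in Hc by lra. lra. }
 assert (Lhi : hi <= arc_hi b).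
 { destruct (Rle_dec w1 (arc_hi b)) as [H|H].
  - upto Rmin_r. rewrite Rmax_right by assumption. lra.
  - exfalso. unfold hi in Hc. rewrite clip_below in Hc by lra. lra. }
 set (p := IZR (arc_p b)) in *. set (q := IZR (arc_q b)) in *. have Hq : 1 <= q. have HQ6 : 6 <= IZR Q.
 assert (Hs : / (q * IZR Q) <= X / 6). { via (/ 6); [apply Rinv_le_contravar; nra|]. lra. }
 assert (Near : forall x, lo <= x <= hi -> Rabs (x - p / q) <= / (q * IZR Q)).
 { intros x Hx. destruct (arc_right b); rewrite <- G5; apply Rabs_le; lra. } set (xa := om - p / q).
 assert (Hxa : X / 3 <= xa <= 2 * X). { note (Near lo !!) as N. apply Rabs_le_between in N. side. }
 assert (Diff : forall x, lo <= x <= hi -> uw x - / (K2 * xa) = (x - p / q) / (K2 * (om - x) * xa)).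
 { intros x Hx. replace (x - p / q) with (xa - (om - x)) by (unfold xa; ring). side. }
 assert (DiffB : forall x, lo <= x <= hi -> Rabs (uw x - / (K2 * xa)) <= 6 / (q * IZR Q * (K2 * X ^ 2))).
 { intros x Hx. rewrite Diff by assumption. unfold Rdiv at 1. rewrite Rabs_mult, Rabs_inv.
  assert (P : K2 * X ^ 2 / 6 <= K2 * (om - x) * xa).
  { replace (K2 * X ^ 2 / 6) with (K2 * ((X / 2) * (X / 3))) by field. rewrite Rmult_assoc. side. }
  have P2 : 0 < K2 * X ^ 2 / 6. rewrite (Rabs_pos_eq (K2 * (om - x) * xa)) by lra.
  replace (6 / (q * IZR Q * (K2 * X ^ 2))) with (/ (q * IZR Q) * / (K2 * X ^ 2 / 6)) by side.
  apply Rmult_le_compat; side. }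
 note (uw_mono lo hi !! !! !!) as [U0 U01]. split.
 - split; [side|]. split; [side|]. split; [side|]. simpl. fold p q. fold xa. fold lo hi. destruct (arc_right b).
  + split; [|lra]. note (Diff lo !!) as E. rewrite E. side.
  + split; [|lra]. note (Diff hi !!) as E. assert (0 <= - (uw hi - / (K2 * xa))); [|lra]. rewrite E.
   replace (- ((hi - p / q) / (K2 * (om - hi) * xa))) with ((p / q - hi) / (K2 * (om - hi) * xa)) by side. side.
 - unfold to_varc. cbn [va_r2]. fold p q. fold xa. fold lo hi. note (DiffB lo !!) as B1. note (DiffB hi !!) as B2.
  apply Rabs_le_between in B1. apply Rabs_le_between in B2. destruct (arc_right b); lra.
Qed.

Lemma to_varc_integral (F : R -> C) b : (forall u, U1 <= u <= U2 -> ccont F u) ->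
  clip w1 w2 (arc_lo b) <= clip w1 w2 (arc_hi b) ->
  cint F (uw (clip w1 w2 (arc_lo b))) (uw (clip w1 w2 (arc_hi b))) =
  cint (fun r => F (va_u om k (to_varc b) + va_ep (to_varc b) * r)) (va_r1 (to_varc b)) (va_r2 (to_varc b)).
Proof.
 intros CF Hc. destruct w_bounds as (W1 & W2 & W3). destruct uw_ends as [E1 E2]. set (lo := clip w1 w2 (arc_lo b)) in *.
 set (hi := clip w1 w2 (arc_hi b)) in *. note (clip_range w1 w2 (arc_lo b) !!) as Rlo.
 note (clip_range w1 w2 (arc_hi b) !!) as Rhi. fold lo in Rlo. fold hi in Rhi.
 note (uw_mono w1 lo !! !! !!) as [U0 U01]. note (uw_mono lo hi !! !! !!) as [U3 U02].
 note (uw_mono hi w2 !! !! !!) as [U4 U03]. unfold to_varc, va_u, va_ep, va_X. cbn [va_p va_q va_right va_r1 va_r2].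
 fold lo hi. fold K2. set (ua := / (K2 * (om - IZR (arc_p b) / IZR (arc_q b)))). symmetry. apply cint_eq.
 destruct (arc_right b).
 - replace (cint F (uw lo) (uw hi)) with (cint F (ua + 1 * (uw lo - ua)) (ua + 1 * (uw hi - ua))) by (f_equal; ring).
  apply (is_cint_ext (fun r => (RtoC 1 * F (ua + 1 * r)%R)%C)); [side|].
  apply (is_cint_comp F (fun r => ua + 1 * r) (fun _ => 1)).
  + intros r. minmax. intros Hr. apply CF. lra.
  + intros r _. split; [auto_derive; [side|ring]|side].
 - assert (K : is_cint (fun r => (RtoC (-1) * F (ua + -1 * r)%R)%C) (ua - uw hi) (ua - uw lo) (cint F (ua + -1 * (ua - uw hi)) (ua + -1 * (ua - uw lo)))).
  { apply (is_cint_comp F (fun r => ua + -1 * r) (fun _ => -1)).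
   + intros r. minmax. intros Hr. apply CF. lra.
   + intros r _. split; [auto_derive; [side|ring]|side]. }
  replace (ua + -1 * (ua - uw hi)) with (uw hi) in K by ring.
  replace (ua + -1 * (ua - uw lo)) with (uw lo) in K by ring.
  assert (S : cint F (uw hi) (uw lo) = (- cint F (uw lo) (uw hi))%C).
  { apply cint_eq. apply is_cint_swap. apply cint_ok; [side|]. intros u Hu. apply CF. lra. }
  rewrite S in K. replace (cint F (uw lo) (uw hi)) with (RtoC (-1) * (- cint F (uw lo) (uw hi)))%C by side.
  eapply is_cint_ext; [|exact (is_cint_scal _ _ _ _ (RtoC (-1)) K)]. side.
Qed.

Lemma arcs_exist : exists VA : list varc, NoDup (map va_key VA) /\
  (forall i, In i VA -> good_varc X om Q i /\ va_r2 i <= 6 / (IZR (va_q i) * IZR Q * (K2 * X ^ 2))) /\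
  Rsum (fun i => va_r2 i - va_r1 i) VA = U2 - U1 /\
  (forall F : R -> C, (forall u, U1 <= u <= U2 -> ccont F u) ->
    cint F U1 U2 = Csum (fun i => cint (fun r => F (va_u om k i + va_ep i * r)) (va_r1 i) (va_r2 i)) VA).
Proof.
 destruct w_bounds as (W1 & W2 & W3). destruct uw_ends as [E1 E2]. note (Int_part_mono w1 w2 !!) as IM.
 destruct (farey_arcs Q (Int_part w1) (Int_part w2 + 1) !! !!) as (l & ND & HG & HPhi).
 (* The Farey arcs tile an interval with integer ends; those outside [w1, w2] are clipped to a
    point, contribute 0 and are dropped. *)
 set (test := fun b => if Rlt_dec (clip w1 w2 (arc_lo b)) (clip w1 w2 (arc_hi b)) then true else false).
 assert (Ht : forall b, In b (filter test l) -> In b l /\ clip w1 w2 (arc_lo b) < clip w1 w2 (arc_hi b)).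
 { intros b Hb. apply filter_In in Hb. destruct Hb as [Hb T]. split; [side|]. unfold test in T.
  destruct (Rlt_dec _ _); side. }
 assert (Mono : forall x x', x <= x' -> clip w1 w2 x <= clip w1 w2 x').
 { intros x x' Hx. apply Rle_min_compat_l. apply Rle_max_compat_l. side. }
 assert (Cl1 : clip w1 w2 (IZR (Int_part w1)) = w1) by (apply clip_below; [lra|apply Int_part_bounds]).
 assert (Cl2 : clip w1 w2 (IZR (Int_part w2 + 1)) = w2).
 { apply clip_above; [lra|]. rewrite plus_IZR. destruct (Int_part_bounds w2). lra. }
 exists (map to_varc (filter test l)). split; [|split; [|split]].
 - rewrite map_map. clear - ND. induction l as [|b l IH]; simpl; [side|]. inversion ND; subst.
  destruct (test b); [|auto]. constructor; [|auto]. intros HH. apply H1. apply in_map_iff in HH.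
  destruct HH as (b' & E & Hb'). apply in_map_iff. exists b'. split; [side|]. apply filter_In in Hb'. apply Hb'.
 - intros i Hi. apply in_map_iff in Hi. destruct Hi as (b & <- & Hb). destruct (Ht b Hb) as [Hl Hc].
  destruct (HG b Hl) as [G _]. exact (to_varc_good b G Hc).
 - apply RtoC_inj. rewrite <- Csum_R, Csum_map.
  transitivity (Csum (fun b => RtoC (uw (clip w1 w2 (arc_hi b)) - uw (clip w1 w2 (arc_lo b)))) l).
  + rewrite <- (Csum_filter_0 _ test l).
   * apply Csum_ext. intros b _. f_equal. unfold to_varc. cbn [va_r1 va_r2]. destruct (arc_right b); ring.
   * intros b Hb T. destruct (HG b Hb) as [(_ & _ & G3 & _) _]. unfold test in T.
    destruct (Rlt_dec _ _) as [|N]; [side|]. note (Mono _ _ (Rlt_le _ _ G3)).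
    replace (clip w1 w2 (arc_hi b)) with (clip w1 w2 (arc_lo b)) by lra. f_equal. ring.
  + rewrite (HPhi (fun x x' => RtoC (uw (clip w1 w2 x') - uw (clip w1 w2 x)))).
   * rewrite Cl1, Cl2, E1, E2. side.
   * intros a b c _ _. rewrite <- RtoC_plus. f_equal. ring.
 - intros F CF. rewrite Csum_map.
  transitivity (Csum (fun b => cint F (uw (clip w1 w2 (arc_lo b))) (uw (clip w1 w2 (arc_hi b)))) l).
  + rewrite (HPhi (fun x x' => cint F (uw (clip w1 w2 x)) (uw (clip w1 w2 x')))).
   * rewrite Cl1, Cl2, E1, E2. side.
   * intros a b c Hab Hbc. note (Mono _ _ Hab). note (Mono _ _ Hbc). note (clip_range w1 w2 a !!).
    note (clip_range w1 w2 c !!). note (uw_mono w1 (clip w1 w2 a) !! !! !!).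
    note (uw_mono (clip w1 w2 a) (clip w1 w2 b) !! !! !!). note (uw_mono (clip w1 w2 b) (clip w1 w2 c) !! !! !!).
    note (uw_mono (clip w1 w2 c) w2 !! !! !!). apply cint_chasles; [lra|lra|]. intros u Hu. apply CF. lra.
  + rewrite <- (Csum_filter_0 _ test l).
   * apply Csum_ext. intros b Hb. destruct (Ht b Hb) as [Hl Hc]. apply to_varc_integral; side.
   * intros b Hb T. destruct (HG b Hb) as [(_ & _ & G3 & _) _]. unfold test in T.
    destruct (Rlt_dec _ _) as [|N]; [side|]. note (Mono _ _ (Rlt_le _ _ G3)).
    replace (clip w1 w2 (arc_hi b)) with (clip w1 w2 (arc_lo b)) by lra. apply cint_eq. apply is_cint_point.
Qed.
End Arcs.

Lemma harm_nonneg n : 0 <= harm n.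
Proof. apply Rsum_nonneg. intros j Hj. apply in_seq in Hj. left. apply Rinv_0_lt_compat. side. Qed.

Lemma harm_bound d n : 0 < d -> (1 <= n)%nat -> harm n <= Rpower (INR n) d * (1 + / d).
Proof.
 intros Hd Hn. via (Rpower (INR n) d * Rsum (fun j => Rpower (INR j) (- (1 + d))) (seq 1 n)).
 - rewrite <- Rsum_scal. apply Rsum_le. intros j Hj. apply in_seq in Hj. have P : 0 < INR j.
  replace (/ INR j) with (Rpower (INR j) d * Rpower (INR j) (- (1 + d))).
  + side.
  + rewrite <- Rpower_plus. replace (d + - (1 + d)) with (- (1)) by ring. rewrite Rpower_Ropp, Rpower_1 by assumption.
   side.
 - mul_l. apply sum_Rpower_le. side.
Qed.

Definition core_const (b1 b2 : R) : R := 400000000000 + 30000000 / b1 + 1700000000000 / b1 * sqrt b2.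

(** Up to constants the first term of [core_bound] attains (U / (s sqrt X))^2 at the largest l,
    about s^3 X. The terms from cc = 0 and cc <> 0 are smaller by factors s^6 and s. *)
Lemma core_estimate s X l b1 b2 U Q : 1 <= s -> 1 <= X -> 0 < l -> l <= 13 * (s ^ 3 * X) -> 0 < b1 -> 0 <= U ->
  1 <= IZR Q <= 2 * s ->
  core_bound (U / (s ^ 8 * X ^ 3)) X (l * l) (s ^ 4 * X / l) b1 b2 Q U <=
  core_const b1 b2 * (1 + harm (Z.to_nat Q)) * (U / (s * sqrt X)) ^ 2.
Proof.
 intros Hs HX Hl Hl2 Hb1 HU HQ. unfold core_bound, core_const. set (hm := harm (Z.to_nat Q)).
 assert (Hh : 0 <= hm) by apply harm_nonneg. set (W := s ^ 4 * X / l). set (y := U / (s ^ 8 * X ^ 3)).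
 set (E := U ^ 2 / (s ^ 2 * X)). assert (EE : (U / (s * sqrt X)) ^ 2 = E).
 { unfold E. replace (U / (s * sqrt X)) with (U * / (s * sqrt X)) by reflexivity. rewrite Rpow_mult_distr. unfold Rdiv.
  f_equal. rewrite pow_inv. f_equal. rewrite Rpow_mult_distr. f_equal. simpl. rewrite Rmult_1_r. side. }
 have E0 : 0 <= E. have HW : 0 < W. assert (Sll : sqrt (l * l) = l) by (apply sqrt_square; lra).
 have EWl : W * l = s ^ 4 * X. have L1 : l * l <= 169 * (s ^ 3 * X) ^ 2.
 assert (T1 : 2000000000 * (l * l * y) * U <= 338000000000 * E).
 { via (2000000000 * (169 * (s ^ 3 * X) ^ 2 * y) * U).
  - side.
  - side. }
 assert (T2 : 232 * (W * X * IZR Q) * (10 * X * (334 / b1 * (l * l * y ^ 2 * X))) <= 30000000 / b1 * E).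
 { replace (232 * (W * X * IZR Q) * (10 * X * (334 / b1 * (l * l * y ^ 2 * X)))) with (774880 / b1 * ((W * l) * (l * IZR Q) * (X ^ 3 * y ^ 2))) by side.
  rewrite EWl. assert (H2 : s ^ 4 * X * (l * IZR Q) * (X ^ 3 * y ^ 2) <= 26 * E).
  { via (s ^ 4 * X * (13 * (s ^ 3 * X) * (2 * s)) * (X ^ 3 * y ^ 2)).
   - side.
   - via (26 * (E * / s ^ 6)).
    + side.
    + mul_l. rewrite <- (Rmult_1_r E) at 2. mul_l. rewrite <- Rinv_1. side. }
  have P : 0 <= 774880 / b1. side. }
 assert (T3 : 464 * (W * X * IZR Q) * hm * (200 * (X * sqrt (W * IZR Q)) * (1440000 / b1 * sqrt b2 * (l * l * y ^ 2 * (W * l)))) <= 1700000000000 / b1 * sqrt b2 * hm * E).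
 { set (V := sqrt (W * IZR Q)). assert (HV : V * l <= 6 * (s ^ 4 * X)).
  { unfold V. rewrite <- Sll at 1. rewrite <- sqrt_mult by nra.
   via (sqrt ((6 * (s ^ 4 * X)) ^ 2)); [apply sqrt_le_1_alt|rewrite sqrt_pow2; [lra|]].
   - have H1 : l * IZR Q <= 13 * (s ^ 3 * X) * (2 * s). have P4 : 0 < s ^ 4 * X. side.
   - side. }
  replace (464 * (W * X * IZR Q) * hm * (200 * (X * V) * (1440000 / b1 * sqrt b2 * (l * l * y ^ 2 * (W * l))))) with (133632000000 / b1 * sqrt b2 * hm * (IZR Q * (V * l) * (W * l) * (W * l) * (X ^ 2 * y ^ 2))) by side.
  rewrite EWl. assert (H2 : IZR Q * (V * l) * (s ^ 4 * X) * (s ^ 4 * X) * (X ^ 2 * y ^ 2) <= 12 * E).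
  { via (2 * s * (6 * (s ^ 4 * X)) * (s ^ 4 * X) * (s ^ 4 * X) * (X ^ 2 * y ^ 2)).
   - side.
   - via (12 * (E * / s)).
    + side.
    + mul_l. rewrite <- (Rmult_1_r E) at 2. mul_l. rewrite <- Rinv_1. side. }
  have P : 0 <= / b1 * sqrt b2 * hm. side. }
 have N3 : 0 <= (1700000000000 / b1 * sqrt b2) * E. have N4 : 0 <= 30000000 / b1 * (hm * E). side.
Qed.

Lemma dyadic_count (a b : R) : 0 < a -> exists J : nat, b <= 2 ^ J * a /\ forall j, (j < J)%nat -> 2 ^ j * a < b.
Proof.
 intros Ha. assert (Ex : exists n : nat, b <= 2 ^ n * a).
 { destruct (Pow_x_infinity 2 ltac:(rewrite Rabs_pos_eq; lra) (b / a)) as [N HN]. exists N.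
  specialize (HN N (Nat.le_refl _)). rewrite Rabs_pos_eq in HN by side. apply Rge_le in HN.
  replace b with (b / a * a) by side. side. }
 destruct Ex as [n Hn]. revert Hn. induction n as [|n IH]; intros Hn.
 - exists 0%nat. side.
 - destruct (Rle_lt_dec b (2 ^ n * a)) as [H|H]; [side|]. exists (S n). split; [side|]. intros j Hj.
  eapply Rle_lt_trans; [|exact H]. mul_r. apply Rle_pow; side.
Qed.

Lemma geometric_sum (a d : R) J : 0 < a -> 0 < d ->
  Rsum (fun j => Rpower (2 ^ j * a) d) (seq 0 J) <= Rpower (2 ^ J * a) d / (Rpower 2 d - 1).
Proof.
 intros Ha Hd. assert (P2 : 1 < Rpower 2 d). { rewrite <- Rpower_1_base at 1. apply Rlt_Rpower_l; lra. } induction J.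
 - apply Rdiv_le_0_compat; side.
 - rewrite seq_S, Rsum_app. simpl Rsum at 2. eapply Rle_trans; [apply Rplus_le_compat_r; exact IHJ|].
  replace (2 ^ S J * a) with (2 * (2 ^ J * a)) by (simpl; ring). have Pj : 0 < 2 ^ J * a.
  rewrite <- (Rpower_mult_distr 2) by lra. side.
Qed.

Lemma cint_telescope F (c : nat -> R) J : (forall j, c j <= c (S j)) -> (forall u, ccont F u) ->
  Csum (fun j => cint F (c j) (c (S j))) (seq 0 J) = cint F (c 0%nat) (c J).
Proof.
 intros Hc HF. assert (M : forall j, c 0%nat <= c j) by (induction j; [lra|specialize (Hc j); lra]). induction J.
 - symmetry. apply cint_eq. apply is_cint_point.
 - rewrite seq_S, Csum_app, IHJ. simpl. rewrite (cint_chasles F (c 0%nat) (c J) (c (S J))); [ring|side|side|side].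
Qed.

Section RegimeTwo.
Variables (psi : C -> C) (t : Z -> C) (w dw : Z -> R -> R).
Hypothesis FF : form_facts psi t w dw.

(** The arcs of the dissection are cut at the image heights 1/(2^j L0). The top part is estimated by
    the supremum of psi; every other layer is one class for [class_bound], and their number is
    absorbed by the geometric sum of (2^j L0)^(eps/2). *)
Lemma regime_two eps b1 b2 : 0 < eps -> 0 < b1 -> exists B, 0 < B /\
  forall (h k a : Z) (y mu s X U1 U2 : R),
  (1 <= k)%Z -> Z.divide k (a * h + 1) -> 1 <= X -> 13000 <= s -> y = / (IZR k ^ 2 * (s ^ 8 * X ^ 4)) ->
  b1 <= Rabs mu * y <= b2 -> / (IZR k ^ 2 * X) <= U1 -> U1 <= U2 -> U2 <= 2 * / (IZR k ^ 2 * X) ->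
  Cmod (cint (fun u => psi ((IZR h / IZR k + u)%R, y) * e (mu * u))%C U1 U2) <= B * (/ (IZR k ^ 2 * X) / (s * sqrt X)) * Rpower y (- eps).
Proof.
 intros Heps Hb1. destruct (class_bound psi t w dw FF eps Heps) as (B1 & HB1 & CB).
 destruct (ff_decay _ _ _ _ FF 0 (Rle_refl 0)) as (B0 & HB0 & Dec).
 assert (Dec0 : forall x y, 0 < y -> Cmod (psi (x, y)) <= B0).
 { intros x y Hy. note (Dec x y Hy) as D. replace (- 0) with 0 in D by ring. rewrite Rpower_O in D by assumption. lra. }
 set (x2 := Rpower 2 (eps / 2)). assert (Hx2 : 1 < x2). { rewrite <- Rpower_1_base at 1. apply Rlt_Rpower_l; lra. }
 set (CK := core_const b1 b2). assert (HCK : 0 < CK). { unfold CK, core_const. side. }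
 set (E1 := sqrt (CK * (2 + / eps)) * Rpower 2 (eps / 2)).
 set (C1 := 2 * sqrt B1 * (Rpower 580 (eps / 2) / (x2 - 1)) * E1). have HC1 : 0 <= C1. exists (B0 * 6816 + C1 + 1).
 split; [nra|]. intros h k a y mu s X U1 U2 Hk Hdiv HX Hs Ey Hmu HU1 HU12 HU2. set (U := / (IZR k ^ 2 * X)) in *.
 have Hk1 : 1 <= IZR k. have HkX : 0 < IZR k ^ 2 * X. have HU : 0 < U. have Ps : forall n, 1 <= s ^ n.
 have PX : forall n, 1 <= X ^ n. have Eky : IZR k ^ 2 = / (U * X). assert (EyU : y = U / (s ^ 8 * X ^ 3)).
 { rewrite Ey, Eky. side. } have Hden : 1 <= IZR k ^ 2 * (s ^ 8 * X ^ 4).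
 assert (Hy : 0 < y) by (rewrite Ey; apply Rinv_0_lt_compat; lra).
 assert (Hy1 : y <= 1) by (rewrite Ey, <- Rinv_1; apply Rinv_le_contravar; lra). assert (Hyi : s ^ 8 * X ^ 4 <= / y).
 { rewrite Ey, Rinv_inv. have : 1 <= IZR k ^ 2. side. } have HsX : 0 < sqrt X. have SX2 : sqrt X * sqrt X = X.
 set (G := U / (s * sqrt X)). have HG : 0 < G. set (F := fun u => (psi ((IZR h / IZR k + u)%R, y) * e (mu * u))%C).
 assert (Rpy : 1 <= Rpower y (- eps)). { rewrite <- (Rpower_1_base (- eps)). apply Rpower_anti; lra. }
 destruct (Rle_lt_or_eq_dec _ _ HU12) as [HU12'|Eq].
 2: { rewrite Eq. replace (cint F U2 U2) with (RtoC 0) by (symmetry; apply cint_eq; apply is_cint_point).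
  rewrite Cmod_0. side. }
 set (Q := up s). destruct (archimed s) as [Q1 Q2]. fold Q in Q1, Q2. assert (HQ6 : (6 <= Q)%Z).
 { assert (6 < Q)%Z; [apply lt_IZR; lra|lia]. } destruct al_exists as (al & Hal & Hal2). set (om := IZR a / IZR k).
 destruct (arcs_exist X om U1 U2 k Q HX Hk HQ6 HU1 HU12' HU2) as (VA & ND & HVA & HSum & HInt).
 set (G_i := fun (i : varc) (r : R) => (psi (va_T y om k al i r, va_Y y om k i r) * e (mu * (va_u om k i + va_ep i * r)))%C).
 assert (CF : forall u, ccont F u).
 { intros u. apply ccont_mult.
  - apply (ff_cont _ _ _ _ FF (fun u => IZR h / IZR k + u) (fun _ => y)); [|side|side]. side.
  - side. }
 assert (EGF : forall i, In i VA -> forall r, F (va_u om k i + va_ep i * r) = G_i i r).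
 { intros i Hi r. unfold F, G_i. f_equal. apply (arc_transform psi t w dw FF y X h k a Q al i r Hy HX Hk Hdiv Hal).
  apply HVA; assumption. }
 assert (HD : forall i, In i VA -> 0 < va_D om k i) by (intros i Hi; apply (va_D_pos X om k Q HX Hk); apply HVA; assumption).
 assert (CG : forall i, In i VA -> forall r, ccont (G_i i) r).
 { intros i Hi r. apply ccont_ext with (fun r => F (va_u om k i + va_ep i * r)); [side|]. apply ccont_comp; [|side].
  side. }
 (* [L0] is the largest scale at which the trivial bound is still good enough; [Lend] lies beyond
    the lowest image height that occurs. *)
 rewrite (HInt F (fun u _ => CF u)). set (L0 := 20000 * (s ^ 4 * X)). set (Lend := 145 * (s ^ 6 * X ^ 2)).
 have PL0 : 0 < L0. destruct (dyadic_count L0 Lend PL0) as (J & HJ1 & HJ2).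
 set (Rj := fun (i : varc) (j : nat) => rho y (va_D om k i) (/ (2 ^ j * L0))).
 set (cj := fun (i : varc) (j : nat) => clip (va_r1 i) (va_r2 i) (Rj i j)). have PLj : forall j, 0 < 2 ^ j * L0.
 assert (RjE : forall i j, In i VA -> Rj i j = sqrt (2 ^ j * L0 * y / va_D om k i - y ^ 2)).
 { intros i j Hi. unfold Rj, rho. f_equal. f_equal. note (HD i Hi). side. }
 assert (RjM : forall i j, In i VA -> Rj i j <= Rj i (S j)).
 { intros i j Hi. apply rho_anti; [side|side|side|]. apply Rinv_le_contravar; [side|]. note (PLj j). simpl. lra. }
 assert (cjM : forall i j, In i VA -> cj i j <= cj i (S j)).
 { intros i j Hi. apply Rle_min_compat_l. apply Rle_max_compat_l. side. }
 assert (Gd : forall i, In i VA -> (1 <= IZR (va_q i)) /\ X / 3 <= va_X om i <= 2 * X /\ 0 <= va_r1 i /\ va_r1 i <= va_r2 i).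
 { intros i Hi. destruct (HVA i Hi) as [((g1 & _) & _ & g3 & g4 & g5) _]. side. }
 (* The 145 in [Lend]: r <= 6/(q Q k^2 X^2) and D <= (2 k q X)^2 bound D r^2 by 144 s^6 X^2 y, and D
    y^2 is at most s^6 X^2 y. *)
 assert (cjJ : forall i, In i VA -> cj i J = va_r2 i).
 { intros i Hi. destruct (Gd i Hi) as (g1 & g3 & g4 & g5). destruct (HVA i Hi) as [Gv Rv]. apply clip_above; [side|].
  rewrite RjE by assumption. rewrite <- (sqrt_pow2 (va_r2 i)) by lra. apply sqrt_le_1_alt. note (HD i Hi) as Di.
  cancel_r (va_D om k i).
  replace ((2 ^ J * L0 * y / va_D om k i - y ^ 2) * va_D om k i) with (2 ^ J * L0 * y - va_D om k i * y ^ 2) by side.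
  set (q := IZR (va_q i)) in *. assert (Dq : va_D om k i <= (IZR k * q * (2 * X)) ^ 2). { unfold va_D. fold q. side. }
  assert (qQ : q <= IZR Q). { destruct Gv as ((_ & g) & _). side. }
  assert (B1' : va_r2 i ^ 2 * va_D om k i <= 144 * (s ^ 6 * X ^ 2) * y).
  { via ((6 / (q * IZR Q * (IZR k ^ 2 * X ^ 2))) ^ 2 * (IZR k * q * (2 * X)) ^ 2).
   - side.
   - replace ((6 / (q * IZR Q * (IZR k ^ 2 * X ^ 2))) ^ 2 * (IZR k * q * (2 * X)) ^ 2) with (144 * / (IZR k ^ 2 * X ^ 2) * / (IZR Q ^ 2)) by side.
    replace (144 * (s ^ 6 * X ^ 2) * y) with (144 * / (IZR k ^ 2 * X ^ 2) * / s ^ 2) by (rewrite Ey; field; repeat split; lra).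
    side. }
  assert (B2' : va_D om k i * y ^ 2 <= s ^ 6 * X ^ 2 * y).
  { replace (va_D om k i * y ^ 2) with (va_D om k i * y * y) by ring. mul_r. via ((IZR k * (2 * s) * (2 * X)) ^ 2 * y).
   - mul_r. upto Dq. side.
   - replace ((IZR k * (2 * s) * (2 * X)) ^ 2 * y) with (16 * / (s ^ 6 * X ^ 2)) by (rewrite Ey; field; repeat split; lra).
    note (Ps 6%nat). note (PX 2%nat). assert (16 <= s ^ 6 * X ^ 2).
    { assert (s ^ 1 <= s ^ 6) by (apply Rle_pow; side). nra. } have : / (s ^ 6 * X ^ 2) <= / 1. side. }
  have B3' : Lend * y <= 2 ^ J * L0 * y. unfold Lend in B3'. lra. }
 assert (Split : forall i, In i VA -> cint (fun r => F (va_u om k i + va_ep i * r)) (va_r1 i) (va_r2 i) = (cint (G_i i) (va_r1 i) (cj i 0%nat) + Csum (fun j => cint (G_i i) (cj i j) (cj i (S j))) (seq 0 J))%C).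
 { intros i Hi. destruct (Gd i Hi) as (g1 & g3 & g4 & g5). rewrite (cint_ext _ (G_i i)) by side.
  rewrite cint_telescope; [|side|side]. rewrite cjJ by assumption.
  note (clip_range (va_r1 i) (va_r2 i) (Rj i 0%nat) g5) as K. apply cint_chasles; side. }
 rewrite (Csum_ext _ (fun i => (cint (G_i i) (va_r1 i) (cj i 0%nat) + Csum (fun j => cint (G_i i) (cj i j) (cj i (S j))) (seq 0 J))%C)) by exact Split.
 rewrite Csum_plus, Csum_exchange. upto Cmod_triangle.
 assert (Part1 : Cmod (Csum (fun i => cint (G_i i) (va_r1 i) (cj i 0%nat)) VA) <= B0 * 6816 * G).
 (* With D >= (k q X / 3)^2 the square of the radius at scale [L0] has the constant 9 * 20000 =
    180000 < 426^2. There are at most 8 X q arcs for each q <= 2 s, and 6816 = 426 * 16. *)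
 { upto Cmod_Csum. via (Rsum (fun i => B0 * (426 * U / (s ^ 2 * (X * sqrt X))) * / IZR (va_q i)) VA).
  - apply Rsum_le. intros i Hi. destruct (Gd i Hi) as (g1 & g3 & g4 & g5).
   note (clip_range (va_r1 i) (va_r2 i) (Rj i 0%nat) g5) as [K1 K2]. fold (cj i 0%nat) in K1, K2.
   via ((cj i 0%nat - va_r1 i) * B0).
   + eapply cint_bound; [side| |apply cint_ok; side]. intros r Hr. unfold G_i.
    rewrite Cmod_mult, Cmod_e, Rmult_1_r. apply Dec0. apply (Yf_pos y (va_D om k i) Hy (HD i Hi)).
   + assert (R0 : 0 <= Rj i 0%nat) by (unfold Rj, rho; apply sqrt_pos).
    assert (C0 : cj i 0%nat - va_r1 i <= Rj i 0%nat).
    { unfold cj, clip. destruct (Rle_dec (va_r1 i) (Rj i 0%nat)) as [H|H].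
     - rewrite Rmax_right by assumption. note (Rmin_r (va_r2 i) (Rj i 0%nat)). lra.
     - rewrite Rmax_left by lra. note (Rmin_r (va_r2 i) (va_r1 i)). lra. }
    assert (RB : Rj i 0%nat <= 426 * U / (s ^ 2 * (X * sqrt X)) * / IZR (va_q i)).
    { rewrite RjE by assumption. set (q := IZR (va_q i)) in *. have Pz : 0 <= 426 * U / (s ^ 2 * (X * sqrt X)) * / q.
     rewrite <- sqrt_pow2 by assumption. apply sqrt_le_1_alt.
     via (2 ^ 0 * L0 * y / va_D om k i); [note (pow2_ge_0 y); lra|].
     assert (Dq : (IZR k * q * (X / 3)) ^ 2 <= va_D om k i). { unfold va_D. fold q. side. }
     via (2 ^ 0 * L0 * y / (IZR k * q * (X / 3)) ^ 2). { unfold Rdiv. side. }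
     replace ((IZR k * q * (X / 3)) ^ 2) with (IZR k ^ 2 * (q ^ 2 * X ^ 2 / 9)) by field. rewrite Eky, EyU. unfold L0.
     replace ((426 * U / (s ^ 2 * (X * sqrt X)) * / q) ^ 2) with (181476 * U ^ 2 / (s ^ 4 * (X ^ 2 * (sqrt X * sqrt X)) * q ^ 2)) by side.
     replace (2 ^ 0 * (20000 * (s ^ 4 * X)) * (U / (s ^ 8 * X ^ 3)) / (/ (U * X) * (q ^ 2 * X ^ 2 / 9))) with (180000 * U ^ 2 / (s ^ 4 * (X ^ 2 * X) * q ^ 2)) by side.
     unfold Rdiv. side. }
    replace (B0 * (426 * U / (s ^ 2 * (X * sqrt X))) * / IZR (va_q i)) with ((426 * U / (s ^ 2 * (X * sqrt X)) * / IZR (va_q i)) * B0) by ring.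
    side.
  - rewrite Rsum_scal.
   note (varc_count y X om mu b1 b2 Q HX !! Hmu VA (fun q => / IZR q) (fun i Hi => proj1 (HVA i Hi)) ND ltac:(intros q Hq; left; apply Rinv_0_lt_compat; apply IZR_lt; lia)) as C1'.
   cbv beta in C1'.
   assert (D1 : Rsum (fun j => 8 * X * INR j * / IZR (Z.of_nat j)) (seq 1 (Z.to_nat Q)) = 8 * X * IZR Q).
   { rewrite (Rsum_ext _ (fun _ => 8 * X)).
    - rewrite Rsum_const, length_seq, INR_IZR_INZ, Z2Nat.id by lia. ring.
    - intros j Hj. apply in_seq in Hj. rewrite <- INR_IZR_INZ. have : 0 < INR j. side. }
   rewrite D1 in C1'. via (B0 * (426 * U / (s ^ 2 * (X * sqrt X))) * (16 * X * s)).
   + apply Rmult_le_compat_l.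
    * side.
    * side.
   + right. unfold G. side. }
 assert (Part2 : forall j, (j < J)%nat -> Cmod (Csum (fun i => cint (G_i i) (cj i j) (cj i (S j))) VA) <= 2 * sqrt B1 * Rpower (2 ^ j * (2 * L0)) (eps / 2) * (E1 * Rpower y (- (eps / 2)) * G)).
 { intros j Hj. set (L := 2 ^ j * L0). note (HJ2 j Hj) as HLe. fold L in HLe. assert (HL0 : L0 <= L).
  { unfold L. have : 1 <= 2 ^ j. nra. } have PL : 0 < L. set (l := sqrt L). have Hl : 0 < l. have Hll : l * l = L.
  (* The constant 12.05 is just above sqrt 145; hence s <= 12.05 W, and Q <= 13 W. *)
  have P3 : 0 < s ^ 3 * X. assert (Hl2 : l <= 1205 / 100 * (s ^ 3 * X)).
  { apply Rsqr_incr_0_var; [|lra]. unfold Rsqr. unfold Lend in HLe. side. } set (W := s ^ 4 * X / l).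
  assert (HWs : s <= 1205 / 100 * W).
  { unfold W. cancel_r l. replace (1205 / 100 * (s ^ 4 * X / l) * l) with (s * (1205 / 100 * (s ^ 3 * X))) by side.
   side. }
  have PLs : 1 <= s ^ 4 * X.
  set (trunc := fun i : varc => {| va_p := va_p i; va_q := va_q i; va_right := va_right i; va_r1 := cj i j; va_r2 := cj i (S j) |}).
  set (test := fun i => if Rlt_dec (cj i j) (cj i (S j)) then true else false). set (VJ := map trunc (filter test VA)).
  assert (Ht : forall i, In i (filter test VA) -> In i VA /\ cj i j < cj i (S j)).
  { intros i Hi. apply filter_In in Hi. destruct Hi as [Hi T]. split; [side|]. unfold test in T.
   destruct (Rlt_dec _ _); side. }
  assert (EJ : Csum (fun i => cint (G_i i) (cj i j) (cj i (S j))) VA = Csum (fun i => cint (fun r => (psi (va_T y om k al i r, va_Y y om k i r) * e (mu * (va_u om k i + va_ep i * r)))%C) (va_r1 i) (va_r2 i)) VJ).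
  { unfold VJ. rewrite Csum_map. rewrite <- (Csum_filter_0 _ test VA).
   - side.
   - intros i Hi T. unfold test in T. destruct (Rlt_dec _ _) as [|N]; [side|]. note (cjM i j Hi).
    replace (cj i (S j)) with (cj i j) by lra. apply cint_eq. apply is_cint_point. }
  rewrite EJ. eapply Rle_trans.
  - apply (CB y X L W om mu b1 b2 k Q al) with (U := U); trivial.
   + lia.
   + lra.
   + lra.
   + via (16000 * (s * X)).
    * have : IZR Q * X <= 2 * s * X. lra.
    * eapply Rle_trans; [|exact HL0]. unfold L0. assert (s ^ 1 <= s ^ 4) by (apply Rle_pow; side). side.
   + eapply Rle_trans; [|exact HL0]. unfold L0. assert (s ^ 1 <= s ^ 4) by (apply Rle_pow; side). nra.
   (* Here s >= 13000 is needed, through s <= 12.05 W. *)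
   + have : 1000 <= W. nra.
   + rewrite Ey. rewrite <- Hll. side.
   + intros i' Hi'. apply in_map_iff in Hi'. destruct Hi' as (i & <- & Hi). destruct (Ht i Hi) as [Hin Hlt].
    destruct (HVA i Hin) as [(v1 & v2 & v3 & v4 & v5) _]. note (clip_range (va_r1 i) (va_r2 i) (Rj i j) v5) as [a1 a2].
    note (clip_range (va_r1 i) (va_r2 i) (Rj i (S j)) v5) as [a3 a4]. fold (cj i j) in a1, a2.
    fold (cj i (S j)) in a3, a4. split.
    * unfold good_varc, trunc. cbn [va_p va_q va_r1 va_r2]. side.
    * unfold in_class, trunc. cbn [va_r1 va_r2]. change (va_D om k _) with (va_D om k i). note (HD i Hin) as Di.
     assert (e1 : Rj i j <= cj i j).
     { unfold cj in *. unfold clip in *. destruct (Rle_dec (Rj i j) (va_r2 i)) as [H|H].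
      - apply Rmin_glb; [side|apply Rmax_r].
      - exfalso. rewrite Rmin_left in Hlt.
       + lra.
       + note (Rmax_r (va_r1 i) (Rj i j)). lra. }
     assert (e2 : cj i (S j) <= Rj i (S j)).
     { unfold cj in *. unfold clip in *. destruct (Rle_dec (va_r1 i) (Rj i (S j))) as [H|H].
      - rewrite Rmax_right by assumption. apply Rmin_r.
      - exfalso. rewrite (Rmax_left (va_r1 i) (Rj i (S j))) in a4, Hlt by lra. note (Rmin_r (va_r2 i) (va_r1 i)). lra. }
     assert (n0 : 0 <= Rj i j) by (unfold Rj, rho; apply sqrt_pos). split.
     -- via (va_D om k i * (Rj i j ^ 2 + y ^ 2)). 2: { side. } rewrite RjE by assumption. fold L.
      destruct (Rle_dec 0 (L * y / va_D om k i - y ^ 2)) as [H|H].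
      ++ rewrite pow2_sqrt by assumption. side.
      ++ rewrite sqrt_neg_0 by lra. replace (L * y) with (va_D om k i * (L * y / va_D om k i)) by side. side.
     -- via (va_D om k i * (Rj i (S j) ^ 2 + y ^ 2)). { side. } have Pos : 0 < Rj i (S j).
      rewrite RjE in * by assumption. assert (H : 0 <= 2 ^ S j * L0 * y / va_D om k i - y ^ 2).
      { destruct (Rle_dec 0 (2 ^ S j * L0 * y / va_D om k i - y ^ 2)) as [H|H]; [side|]. exfalso.
       rewrite sqrt_neg_0 in Pos by lra. lra. }
      rewrite pow2_sqrt by assumption. right. unfold L. simpl. side.
   + unfold VJ. rewrite map_map. clear - ND. induction VA as [|b lst IH]; simpl; [side|]. inversion ND; subst.
    destruct (test b); [|auto]. constructor; [|auto]. intros HH. apply H1. apply in_map_iff in HH.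
    destruct HH as (b' & Eb & Hb'). apply in_map_iff. exists b'. split; [side|]. apply filter_In in Hb'. apply Hb'.
   + unfold VJ. rewrite Rsum_map. cbn [va_r1 va_r2 trunc]. via (Rsum (fun i => cj i (S j) - cj i j) VA).
    { apply Rsum_filter_le. intros i Hi. note (cjM i j Hi). lra. } via (U2 - U1); [|lra]. rewrite <- HSum.
    apply Rsum_le. intros i Hi. destruct (Gd i Hi) as (g1 & g3 & g4 & g5).
    note (clip_range (va_r1 i) (va_r2 i) (Rj i j) g5) as [a1 a2].
    note (clip_range (va_r1 i) (va_r2 i) (Rj i (S j)) g5) as [a3 a4]. fold (cj i j) in a1, a2.
    fold (cj i (S j)) in a3, a4. lra.
  - note (core_estimate s X l b1 b2 U Q !! HX Hl !! Hb1 !! !!) as CE. rewrite Hll in CE. rewrite <- EyU in CE.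
   fold W in CE. fold G in CE. fold CK in CE. assert (HH : 1 + harm (Z.to_nat Q) <= (2 + / eps) * Rpower (2 * / y) eps).
   { note (harm_bound eps (Z.to_nat Q) Heps !!) as H1.
    assert (EQ : INR (Z.to_nat Q) = IZR Q) by (rewrite INR_IZR_INZ, Z2Nat.id by lia; reflexivity). rewrite EQ in H1.
    assert (sy : s <= / y).
    { eapply Rle_trans; [|exact Hyi]. assert (s ^ 1 <= s ^ 8) by (apply Rle_pow; side). note (PX 4%nat). nra. }
    have R1 : Rpower (IZR Q) eps <= Rpower (2 * / y) eps. have R2 : 1 <= Rpower (2 * / y) eps. have : 0 < / eps. nra. }
   assert (SK : sqrt (core_bound y X L W b1 b2 Q U) <= E1 * Rpower y (- (eps / 2)) * G).
   { via (sqrt (CK * ((2 + / eps) * Rpower (2 * / y) eps) * G ^ 2)).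
    - apply sqrt_le_1_alt. upto CE. side.
    - have Py : 0 < / y. have Pcc : 0 <= CK * ((2 + / eps) * Rpower (2 * / y) eps). rewrite sqrt_mult_alt by exact Pcc.
     rewrite sqrt_pow2 by lra. mul_r. unfold E1. rewrite <- Rmult_assoc. rewrite sqrt_mult_alt by side.
     rewrite Rmult_assoc. mul_l. rewrite <- Rpower_sqrt by apply Rpower_pos. rewrite Rpower_mult.
     rewrite <- Rpower_mult_distr by lra. replace (eps * / 2) with (eps / 2) by reflexivity. mul_l. right.
     unfold Rpower. rewrite ln_Rinv by assumption. f_equal. ring. }
   assert (SB : sqrt (B1 * Rpower (2 * L) eps) = sqrt B1 * Rpower (2 ^ j * (2 * L0)) (eps / 2)).
   { rewrite sqrt_mult_alt by lra. f_equal. rewrite <- Rpower_sqrt by apply Rpower_pos. rewrite Rpower_mult.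
    replace (2 * L) with (2 ^ j * (2 * L0)) by (unfold L; ring). side. }
   side. }
 assert (Part2' : Cmod (Csum (fun j => Csum (fun i => cint (G_i i) (cj i j) (cj i (S j))) VA) (seq 0 J)) <= C1 * G * Rpower y (- eps)).
 { upto Cmod_Csum.
  via (Rsum (fun j => 2 * sqrt B1 * (E1 * Rpower y (- (eps / 2)) * G) * Rpower (2 ^ j * (2 * L0)) (eps / 2)) (seq 0 J)).
  { apply Rsum_le. intros j Hj. apply in_seq in Hj. eapply Rle_trans; [apply Part2; lia|]. side. } rewrite Rsum_scal.
  assert (GS : Rsum (fun j => Rpower (2 ^ j * (2 * L0)) (eps / 2)) (seq 0 J) <= Rpower 580 (eps / 2) / (x2 - 1) * Rpower y (- (eps / 2))).
  { destruct J as [|J'].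
   - simpl. side.
   - eapply Rle_trans; [apply geometric_sum; lra|]. fold x2. note (HJ2 J' !!) as HL.
    assert (A1 : Rpower (2 ^ S J' * (2 * L0)) (eps / 2) <= Rpower (580 * / y) (eps / 2)).
    { apply Rpower_base_le; [|simpl|lra].
     - side.
     - via (4 * Lend); [nra|]. unfold Lend. assert (s ^ 6 * X ^ 2 <= s ^ 8 * X ^ 4).
      { apply Rmult_le_compat; try (apply pow_le; lra); apply Rle_pow; try lra; lia. } lra. }
    rewrite <- (Rpower_mult_distr 580 (/ y)) in A1 by side.
    replace (Rpower (/ y) (eps / 2)) with (Rpower y (- (eps / 2))) in A1 by (unfold Rpower; rewrite ln_Rinv by assumption; f_equal; ring).
    unfold Rdiv at 1. cancel_r (x2 - 1).
    replace (Rpower (2 ^ S J' * (2 * L0)) (eps / 2) * / (x2 - 1) * (x2 - 1)) with (Rpower (2 ^ S J' * (2 * L0)) (eps / 2)) by side.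
    upto A1. side. }
  eapply Rle_trans; [apply Rmult_le_compat_l; [side|exact GS]|].
  replace (Rpower y (- eps)) with (Rpower y (- (eps / 2)) * Rpower y (- (eps / 2))) by (rewrite <- Rpower_plus; f_equal; field).
  unfold C1. side. }
 assert (Last : B0 * 6816 * G <= B0 * 6816 * G * Rpower y (- eps)). { rewrite <- Rmult_1_r at 1. side. }
 have : 0 <= G * Rpower y (- eps). nra.
Qed.
End RegimeTwo.

Lemma Rpower_inv_base x a : 0 < x -> Rpower (/ x) a = Rpower x (- a).
Proof. intros H. unfold Rpower. rewrite ln_Rinv by assumption. f_equal. ring. Qed.

Section HalfArc.
Variables (psi : C -> C) (t : Z -> C) (w dw : Z -> R -> R).
Hypothesis FF : form_facts psi t w dw.

Lemma psi_line_cont c y mu u : 0 < y -> ccont (fun u => psi ((c + u)%R, y) * e (mu * u))%C u.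
Proof.
 intros Hy. apply ccont_mult.
 - apply (ff_cont _ _ _ _ FF (fun u => c + u) (fun _ => y)); [|side|side]. side.
 - side.
Qed.

(** The equation s^8 = 1/(k^2 y X^4) gives 1/(s sqrt X) = k^(1/4) y^(1/8). When s < 13000 the factor
    1/s is a constant, and [regime_one], that is U / sqrt X, already suffices. *)
Lemma dyadic_bound eps b1 b2 : 0 < eps -> 0 < b1 -> exists B, 0 < B /\
  forall (h k a : Z) (y mu U U1 U2 : R),
  (1 <= k)%Z -> Z.divide k (a * h + 1) -> 0 < y <= 1 -> b1 <= Rabs mu * y <= b2 ->
  4 * y <= U -> U <= / IZR k ^ 2 -> U <= U1 -> U1 <= U2 -> U2 <= 2 * U ->
  Cmod (cint (fun u => psi ((IZR h / IZR k + u)%R, y) * e (mu * u))%C U1 U2) <=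
    B * U * (Rpower (IZR k) (1 / 4) * Rpower y (1 / 8)) * Rpower y (- eps).
Proof.
 intros Heps Hb1. destruct (regime_two psi t w dw FF eps b1 b2 Heps Hb1) as (B2 & HB2 & R2).
 destruct (regime_one FF eps Heps) as (B1 & HB1 & R1). exists (B2 + B1 * 13000 * Rpower 5 eps). split. { side. }
 intros h k a y mu U U1 U2 Hk Hdiv [Hy Hy1] Hmu H4 HUk HU1 HU12 HU2. have Hk1 : 1 <= IZR k. have Hk2 : 1 <= IZR k ^ 2.
 set (X := / (IZR k ^ 2 * U)). assert (HkU1 : IZR k ^ 2 * U <= 1).
 { apply Rmult_le_reg_l with (/ IZR k ^ 2); [side|]. rewrite <- Rmult_assoc, Rinv_l, Rmult_1_l by lra. lra. }
 assert (HX : 1 <= X). { rewrite <- Rinv_1. side. } have EU : / (IZR k ^ 2 * X) = U.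
 set (s := Rpower (/ (IZR k ^ 2 * y * X ^ 4)) (/ 8)). assert (Hs : 0 < s) by apply Rpower_pos.
 have Pz : 0 < IZR k ^ 2 * y * X ^ 4. assert (Es8 : s ^ 8 = / (IZR k ^ 2 * y * X ^ 4)).
 { rewrite <- Rpower_pow by assumption. unfold s. rewrite Rpower_mult. replace (/ 8 * INR 8) with 1 by (simpl; field).
  apply Rpower_1. side. }
 assert (Ey : y = / (IZR k ^ 2 * (s ^ 8 * X ^ 4))) by (rewrite Es8; field; repeat split; lra).
 assert (Ea : / (s * sqrt X) = Rpower (IZR k) (1 / 4) * Rpower y (1 / 8)).
 { rewrite <- Rpower_sqrt by lra. unfold s. rewrite Rpower_inv_base by assumption. rewrite <- Rpower_mult_distr by side.
  rewrite <- Rpower_mult_distr by lra. rewrite <- Rpower_pow, <- (Rpower_pow 4 X) by lra. rewrite !Rpower_mult.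
  replace (INR 2 * - / 8) with (- (1 / 4)) by (simpl; field). replace (INR 4 * - / 8) with (- / 2) by (simpl; field).
  replace (- / 8) with (- (1 / 8)) by field. rewrite !Rpower_Ropp. side. }
 set (am := Rpower (IZR k) (1 / 4) * Rpower y (1 / 8)) in *. have Base : 0 <= U * am * Rpower y (- eps).
 have P5 : 0 < B1 * 13000 * Rpower 5 eps. destruct (Rle_lt_dec 13000 s) as [H|H].
 - upto (R2 h k a y mu s X U1 U2 Hk Hdiv HX H Ey Hmu).
  + side.
  + side.
  + side.
  + side.
 - upto (R1 h k a y mu U U1 U2 Hk Hdiv Hy H4 HU1 HU12 HU2). assert (E1 : IZR k * sqrt U <= 13000 * am).
  { rewrite <- Ea. assert (ES : IZR k * sqrt U = / sqrt X).
   { unfold X. rewrite sqrt_inv. rewrite sqrt_mult_alt by side. rewrite sqrt_pow2 by lra. side. } rewrite ES.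
   replace (13000 * / (s * sqrt X)) with ((13000 * / s) * / sqrt X) by side. rewrite <- Rmult_1_l at 1. mul_r.
   cancel_r s. rewrite Rmult_assoc, Rinv_l by lra. lra. }
  assert (E2 : Rpower (y / (5 * IZR k ^ 2 * U ^ 2)) (- eps) <= Rpower 5 eps * Rpower y (- eps)).
  { via (Rpower (y / 5) (- eps)).
   - apply Rpower_anti; [lra| |lra]. mul_l. apply Rinv_le_contravar.
    + side.
    + side.
   - unfold Rdiv. rewrite Rmult_comm. rewrite <- Rpower_mult_distr by lra. rewrite Rpower_inv_base by lra. side. }
  via (B1 * (U * (13000 * am)) * (Rpower 5 eps * Rpower y (- eps))).
  + apply Rmult_le_compat; [| |mul_l|side].
   * side.
   * side.
   * side.
  + nra.
Qed.

(** For u <= 8 y the map to infinity gives height at least 1/(65 k^2 y), with 65 = 8^2 + 1; decay of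
    order 1/8 in the height is (k^2 y)^(1/8). *)
Lemma near_cusp : exists B, 0 < B /\ forall (h k a : Z) (y u : R),
  (1 <= k)%Z -> Z.divide k (a * h + 1) -> 0 < y -> 0 <= u <= 8 * y ->
  Cmod (psi (IZR h / IZR k + u, y)) <= B * (Rpower (IZR k) (1 / 4) * Rpower y (1 / 8)).
Proof.
 destruct (ff_decay _ _ _ _ FF (1 / 8) !!) as (B & HB & Dec). exists (B * Rpower 65 (1 / 8)). split; [side|].
 intros h k a y u Hk [m Hm] Hy Hu. have Hk1 : 1 <= IZR k.
 note (ff_mobius _ _ _ _ FF a (- m) k (- h) (IZR h / IZR k + u) y !! !! Hy) as M.
 replace (IZR h / IZR k + u + IZR (- h) / IZR k) with u in M by (rewrite opp_IZR; field; lra). rewrite M.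
 have P2 : 0 < IZR k ^ 2 * (u ^ 2 + y ^ 2). have Pk : 0 < IZR k ^ 2.
 eapply Rle_trans; [apply Dec; apply Rdiv_lt_0_compat; assumption|]. rewrite Rmult_assoc. mul_l.
 via (Rpower (/ (65 * (IZR k ^ 2 * y))) (- (1 / 8))).
 - apply Rpower_anti; [side| |lra].
  replace (/ (65 * (IZR k ^ 2 * y))) with (y / (IZR k ^ 2 * (65 * y ^ 2))) by side. mul_l.
  apply Rinv_le_contravar; [side|]. mul_l. side.
 - rewrite Rpower_inv_base by nra. replace (- - (1 / 8)) with (1 / 8) by ring. have : 0 < IZR k ^ 2 * y.
  rewrite <- Rpower_mult_distr by lra. rewrite <- Rpower_mult_distr by lra. rewrite <- Rpower_pow by lra.
  rewrite Rpower_mult. replace (INR 2 * (1 / 8)) with (1 / 4) by (simpl; field). lra.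
Qed.

(** The interval [0, x] is halved down to 8 y, with [near_cusp] at the bottom. The bound is linear
    in x, so the dyadic pieces add up without loss, and this linearity is what the kernel estimates
    use. *)
Lemma half_arc_bound eps b1 b2 : 0 < eps -> 0 < b1 -> exists B, 0 < B /\
  forall (h k : Z) (y mu x : R),
  (1 <= k)%Z -> Z.gcd h k = 1%Z -> 0 < y <= 1 -> b1 <= Rabs mu * y <= b2 -> 0 <= x <= / IZR k ^ 2 ->
  Cmod (cint (fun u => psi ((IZR h / IZR k + u)%R, y) * e (mu * u))%C 0 x) <=
    B * (Rpower (IZR k) (1 / 4) * Rpower y (1 / 8 - eps)) * x.
Proof.
 intros Heps Hb1. destruct (dyadic_bound eps b1 b2 Heps Hb1) as (B1 & HB1 & D). destruct near_cusp as (B2 & HB2 & Nc).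
 exists (B1 + B2). split; [lra|]. intros h k y mu x Hk Hg Hy Hmu. destruct al_exists as (al & Hal & _).
 note (Hal h k Hk Hg) as Hdiv. set (am := Rpower (IZR k) (1 / 4) * Rpower y (1 / 8)).
 assert (EA : Rpower (IZR k) (1 / 4) * Rpower y (1 / 8 - eps) = am * Rpower y (- eps)).
 { unfold am, Rminus. rewrite Rpower_plus. ring. } rewrite EA. assert (Rpy : 1 <= Rpower y (- eps)).
 { rewrite <- (Rpower_1_base (- eps)). apply Rpower_anti; lra. }
 set (F := fun u => (psi ((IZR h / IZR k + u)%R, y) * e (mu * u))%C).
 assert (CF : forall u, ccont F u) by (intros; apply psi_line_cont; lra).
 assert (Ind : forall n x, x <= 8 * y * 2 ^ n -> 0 <= x <= / IZR k ^ 2 -> Cmod (cint F 0 x) <= (B1 + B2) * (am * Rpower y (- eps)) * x).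
 { clear x. intros n. induction n as [|n IH]; intros x Hxn Hx.
  - via ((x - 0) * (B2 * am)).
   + eapply cint_bound; [lra| |apply cint_ok; side]. intros u Hu. unfold F.
    rewrite Cmod_mult, Cmod_e, Rmult_1_r. apply (Nc h k (al h k)); trivial; lra.
   + have : 0 <= B1 * am * x. have : 0 <= B2 * am * x. nra.
  - destruct (Rle_lt_dec x (8 * y)) as [H8|H8].
   + apply IH; [|side]. have : 1 <= 2 ^ n. nra.
   + rewrite (cint_chasles F 0 (x / 2) x); [|lra|lra|side]. upto Cmod_triangle.
    note (IH (x / 2) ltac:(simpl in Hxn; lra) !!) as I1.
    note (D h k (al h k) y mu (x / 2) (x / 2) x Hk Hdiv Hy Hmu !! !! !! !! !!) as I2. fold F in I2. fold am in I2.
    have : 0 <= B2 * (am * Rpower y (- eps)) * (x / 2). lra. }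
 intros Hx. destruct (dyadic_count (8 * y) x !!) as (n & Hn & _). apply (Ind n); side.
Qed.

(** Reflection in the imaginary axis replaces h by - h at the cost of a factor of modulus 1. *)
Lemma half_arc_bound_left eps b1 b2 : 0 < eps -> 0 < b1 -> exists B, 0 < B /\
  forall (h k : Z) (y mu x : R),
  (1 <= k)%Z -> Z.gcd h k = 1%Z -> 0 < y <= 1 -> b1 <= Rabs mu * y <= b2 -> 0 <= x <= / IZR k ^ 2 ->
  Cmod (cint (fun u => psi ((IZR h / IZR k - u)%R, y) * e (mu * u))%C 0 x) <=
    B * (Rpower (IZR k) (1 / 4) * Rpower y (1 / 8 - eps)) * x.
Proof.
 intros Heps Hb1. destruct (half_arc_bound eps b1 b2 Heps Hb1) as (B & HB & H). exists B. split; [side|].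
 intros h k y mu x Hk Hg Hy Hmu Hx. destruct (ff_parity _ _ _ _ FF) as (s & Hs & Par).
 specialize (H (- h)%Z k y mu x Hk ltac:(rewrite Z.gcd_opp_l; assumption) Hy Hmu Hx).
 assert (I : is_cint (fun u => psi ((IZR h / IZR k - u)%R, y) * e (mu * u))%C 0 x (s * cint (fun u => psi ((IZR (- h) / IZR k + u)%R, y) * e (mu * u))%C 0 x)%C).
 { eapply is_cint_ext_le; [lra| |apply is_cint_scal; apply cint_ok; [lra|intros; apply psi_line_cont; lra]].
  intros u Hu. simpl. rewrite Cmult_assoc. rewrite <- Par by lra. f_equal. f_equal. f_equal. rewrite opp_IZR. side. }
 rewrite (cint_eq _ _ _ _ I), Cmod_mult, Hs. lra.
Qed.
End HalfArc.

(** * Dirichlet kernels on the circle *)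

Lemma sign_abs s : s = 1 \/ s = -1 -> Rabs s = 1.
Proof. intros [->| ->]; [apply Rabs_pos_eq|rewrite Rabs_left1]; lra. Qed.

Lemma sign_abs_mult s u : s = 1 \/ s = -1 -> 0 <= u -> Rabs (s * u) = u.
Proof. intros Hs Hu. rewrite Rabs_mult, sign_abs, Rabs_pos_eq by assumption. ring. Qed.

(** The range reaches past 1/2 because an arc starting at distance d <= 1/2 may extend by d/4 <=
    1/8. The cubic Taylor bound leaves sin x >= x/3 with x = pi z, and pi >= 3. *)
Lemma sin_PI_lower z : 0 <= z <= 5 / 8 -> z <= sin (PI * z).
Proof.
 intros Hz. note PI_4. assert (P3 : 3 < PI). { note PI2_3_2. lra. } have Hx0 : 0 <= PI * z. have H1 : PI * z <= 5 / 2.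
 destruct (pre_sin_bound (PI * z) 0 Hx0 !!) as [L _]. eapply Rle_trans; [|exact L]. unfold sin_approx, sin_term. simpl.
 set (x := PI * z) in *. assert (Hpi : PI <= 315 / 100).
 { note (PI_2_3_7_ineq 1) as [_ U]. unfold tg_alt, PI_2_3_7_tg, Ratan_seq in U. simpl in U. lra. }
 have H3 : x * x <= (315 / 100 * (5 / 8)) * (315 / 100 * (5 / 8)). via (x * (1 / 3)); [side|]. side.
Qed.

Lemma sin_PI_abs z : Rabs z <= 5 / 8 -> Rabs z <= Rabs (sin (PI * z)).
Proof.
 intros Hz. destruct (Rle_lt_dec 0 z) as [H|H].
 - rewrite Rabs_pos_eq in * by assumption. eapply Rle_trans; [apply sin_PI_lower; lra|apply Rle_abs].
 - rewrite Rabs_left in * by assumption. replace (PI * z) with (- (PI * - z)) by ring. rewrite sin_neg, Rabs_Ropp.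
  eapply Rle_trans; [apply sin_PI_lower; lra|apply Rle_abs].
Qed.

Definition dker (m : Z) (len : nat) (z : R) : C := Csum (fun n => e (- (IZR n * z))) (zrange (m + 1) len).

Lemma dker_period m len z i : dker m len (z - IZR i) = dker m len z.
Proof.
 apply Csum_ext. intros n _.
 replace (- (IZR n * (z - IZR i))) with (- (IZR n * z) + IZR (n * i)) by (rewrite mult_IZR; ring). apply e_add_Z.
Qed.

Lemma dker_closed m len z :
  (dker m len z * (RtoC (2 * sin (PI * z)) * Ci) =
   e (- ((IZR m + 1 / 2) * z)) - e (- ((IZR m + INR len + 1 / 2) * z)))%C.
Proof.
 unfold dker. induction len as [|len IH].
 - simpl. rewrite Rplus_0_r. ring.
 - rewrite Csum_zrange_S, Cmult_plus_distr_r, IH.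
  assert (E : forall x, (e (- ((x + 1) * z)) * (RtoC (2 * sin (PI * z)) * Ci) = e (- ((x + 1 / 2) * z)) - e (- ((x + 1 + 1 / 2) * z)))%C).
  { intros x. replace (- ((x + 1 / 2) * z)) with (- ((x + 1) * z) + z / 2) by field.
   replace (- ((x + 1 + 1 / 2) * z)) with (- ((x + 1) * z) + - (z / 2)) by field. rewrite !e_plus.
   assert (E2 : (e (z / 2) - e (- (z / 2)) = RtoC (2 * sin (PI * z)) * Ci)%C).
   { unfold e. replace (2 * PI * (z / 2)) with (PI * z) by field.
    replace (2 * PI * - (z / 2)) with (- (PI * z)) by field. rewrite cos_neg, sin_neg.
    unfold Cminus, Cplus, Copp, Cmult, RtoC, Ci; simpl. f_equal; ring. }
   rewrite <- E2. ring. }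
  replace (IZR (m + 1 + Z.of_nat len)) with (IZR m + INR len + 1) by (rewrite !plus_IZR, <- INR_IZR_INZ; ring).
  rewrite E. rewrite S_INR. replace (IZR m + (INR len + 1) + 1 / 2) with (IZR m + INR len + 1 + 1 / 2) by ring. ring.
Qed.

Lemma parts_bound (f : R -> C) (A dA g : R -> R) a b P G : 0 <= a -> a <= b -> (forall u, ccont f u) ->
  (forall u, a <= u <= b -> is_derive A u (dA u) /\ continuous dA u) ->
  (forall u, a <= u <= b -> Rabs (dA u) * Cmod (cint f 0 u) <= g u) -> is_RInt g a b G ->
  Rabs (A b) * Cmod (cint f 0 b) + Rabs (A a) * Cmod (cint f 0 a) <= P ->
  Cmod (cint (fun u => (RtoC (A u) * f u)%C) a b) <= P + G.
Proof.
 intros Ha Hab Cf HA Hg IG HP.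
 assert (I : is_cint (fun u => (RtoC (A u) * f u)%C) a b (RtoC (A b) * cint f 0 b - RtoC (A a) * cint f 0 a - cint (fun u => RtoC (dA u) * cint f 0 u) a b)%C).
 { apply (is_cint_parts (fun u => RtoC (A u)) (cint f 0) (fun u => RtoC (dA u)) f); intros u; minmax; intros Hu.
  - apply is_cderive_R. apply HA; assumption.
  - apply is_cderive_cint. side.
  - apply ccont_R. apply HA; assumption.
  - side. }
 rewrite (cint_eq _ _ _ _ I). assert (B : Cmod (cint (fun u => RtoC (dA u) * cint f 0 u)%C a b) <= G).
 { apply (is_cint_bound (fun u => RtoC (dA u) * cint f 0 u)%C g a b); trivial.
  - intros u Hu. rewrite Cmod_mult, Cmod_R. apply Hg. lra.
  - apply cint_ok; [side|]. intros u Hu. apply ccont_mult; [apply ccont_R; apply HA; assumption|].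
   eapply is_cderive_ccont. apply is_cderive_cint. side. }
 upto Cmod_triangle. rewrite Cmod_opp. apply Rplus_le_compat; [|side]. upto Cmod_triangle.
 rewrite Cmod_opp, !Cmod_mult, !Cmod_R. lra.
Qed.

Lemma cosec_derive c s u : sin (PI * (c + s * u)) <> 0 -> s = 1 \/ s = -1 ->
  is_derive (fun u => / sin (PI * (c + s * u))) u (- (PI * s * cos (PI * (c + s * u)) / sin (PI * (c + s * u)) ^ 2)) /\
  continuous (fun u => - (PI * s * cos (PI * (c + s * u)) / sin (PI * (c + s * u)) ^ 2)) u.
Proof.
 intros H Hs. split.
 - auto_derive; [side|]. side.
 - side.
Qed.

Lemma cosec_bounds c s u d : 0 < d -> s = 1 \/ s = -1 -> d <= Rabs (c + s * u) <= 5 / 8 ->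
  sin (PI * (c + s * u)) <> 0 /\
  Rabs (/ sin (PI * (c + s * u))) <= / d /\
  Rabs (- (PI * s * cos (PI * (c + s * u)) / sin (PI * (c + s * u)) ^ 2)) <= 4 / d ^ 2.
Proof.
 intros Hd Hs [H1 H2]. note (sin_PI_abs _ H2) as HS. set (z := c + s * u) in *. set (S := sin (PI * z)) in *.
 have HdS : d <= Rabs S. assert (Hn : S <> 0) by (intros E; rewrite E, Rabs_R0 in HdS; lra). split; [side|]. split.
 - rewrite Rabs_inv. side.
 - rewrite Rabs_Ropp. unfold Rdiv. rewrite Rabs_mult, Rabs_inv, <- RPow_abs, !Rabs_mult. note (sign_abs s Hs).
  note PI_RGT_0. rewrite Rabs_pos_eq by lra. assert (Rabs (cos (PI * z)) <= 1) by (apply Rabs_le; apply COS_bound).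
  apply Rmult_le_compat.
  + side.
  + side.
  + note PI_4. side.
  + side.
Qed.

Section KernelArc.
Variables (f : R -> C) (c s ell Th : R) (m : Z) (len : nat) (lo hi : R).
Hypotheses (Cf : forall u, ccont f u) (Hs : s = 1 \/ s = -1) (Hell : 0 <= ell) (HTh : 0 <= Th)
 (Hf : forall mu x, lo <= Rabs mu <= hi -> 0 <= x <= ell -> Cmod (cint (fun u => (f u * e (mu * u))%C) 0 x) <= Th * x)
 (Hm : (0 <= m)%Z) (Hlo : lo <= IZR m + 1 / 2) (Hhi : IZR m + INR len + 1 / 2 <= hi).

Definition fm (v u : R) : C := (f u * e (- v * s * u))%C.

Lemma fm_cont v u : ccont (fm v) u.
Proof. apply ccont_mult; [side|]. side. Qed.

Lemma fm_bound v x : lo <= v <= hi -> 0 <= v -> 0 <= x <= ell -> Cmod (cint (fm v) 0 x) <= Th * x.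
Proof.
 intros Hv Hv0 Hx. apply Hf; [|side]. rewrite Rabs_mult, Rabs_Ropp, (Rabs_pos_eq v) by assumption. note (sign_abs s Hs).
 side.
Qed.

(** By [dker_closed] the kernel is a difference of two exponentials over 2 i sin; each half
    contributes at most E / 2. *)
Lemma kernel_split a b : 0 <= a -> a <= b ->
  (forall u, a <= u <= b -> sin (PI * (c + s * u)) <> 0) ->
  forall E, (forall v, v = IZR m + 1 / 2 \/ v = IZR m + INR len + 1 / 2 ->
    Cmod (cint (fun u => (RtoC (/ sin (PI * (c + s * u))) * fm v u)%C) a b) <= E) ->
  Cmod (cint (fun u => (f u * dker m len (c + s * u))%C) a b) <= E.
Proof.
 intros Ha Hab Hnz E HE. set (v1 := IZR m + 1 / 2) in *. set (v2 := IZR m + INR len + 1 / 2) in *.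
 set (k1 := (RtoC (1 / 2) * - Ci * e (- (v1 * c)))%C). set (k2 := (RtoC (1 / 2) * - Ci * e (- (v2 * c)))%C).
 assert (CA : forall v u, a <= u <= b -> ccont (fun u => (RtoC (/ sin (PI * (c + s * u))) * fm v u)%C) u).
 { intros v u Hu. apply ccont_mult; [|apply fm_cont]. apply ccont_R. eapply derive_cont.
  apply cosec_derive; side. }
 assert (I : is_cint (fun u => (f u * dker m len (c + s * u))%C) a b (k1 * cint (fun u => (RtoC (/ sin (PI * (c + s * u))) * fm v1 u)%C) a b - k2 * cint (fun u => (RtoC (/ sin (PI * (c + s * u))) * fm v2 u)%C) a b)%C).
 { eapply is_cint_ext_le; [side| |apply is_cint_minus; apply is_cint_scal; apply cint_ok; side]. intros u Hu.
  cbv beta. note (Hnz u !!) as N. note (dker_closed m len (c + s * u)) as K. fold v1 v2 in K. set (z := c + s * u) in *.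
  set (S := sin (PI * z)) in *.
  assert (ED : dker m len z = (RtoC (/ S) * (RtoC (1 / 2) * - Ci) * (e (- (v1 * z)) - e (- (v2 * z))))%C).
  { rewrite <- K. replace (RtoC (2 * S)) with (RtoC 2 * RtoC S)%C by (rewrite <- RtoC_mult; reflexivity).
   assert (E1 : (RtoC (/ S) * RtoC S = 1)%C) by (rewrite <- RtoC_mult, Rinv_l by assumption; reflexivity).
   assert (E2 : (RtoC (1 / 2) * RtoC 2 = 1)%C) by (rewrite <- RtoC_mult; replace (1 / 2 * 2) with 1 by field; reflexivity).
   assert (E3 : (- Ci * Ci = 1)%C) by (unfold Ci, Copp, Cmult, RtoC; simpl; f_equal; ring).
   transitivity (dker m len z * ((RtoC (/ S) * RtoC S) * (RtoC (1 / 2) * RtoC 2) * (- Ci * Ci)))%C; [rewrite E1, E2, E3; ring|ring]. }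
  rewrite ED. unfold fm, k1, k2. replace (- (v1 * z)) with (- (v1 * c) + - v1 * s * u) by side.
  replace (- (v2 * z)) with (- (v2 * c) + - v2 * s * u) by side. rewrite !e_plus. ring. }
 rewrite (cint_eq _ _ _ _ I). assert (Ek : forall v, Cmod (RtoC (1 / 2) * - Ci * e (- (v * c)))%C = 1 / 2).
 { intros v. rewrite !Cmod_mult, Cmod_e, Cmod_R, Cmod_opp. rewrite Rabs_pos_eq by lra. replace (Cmod Ci) with 1. ring.
  unfold Cmod, Ci; simpl. replace (0 * (0 * 1) + 1 * (1 * 1)) with 1 by ring. symmetry; apply sqrt_1. }
 upto Cmod_triangle. rewrite Cmod_opp, (Cmod_mult k1), (Cmod_mult k2). unfold k1, k2. rewrite !Ek.
 note (HE v1 (or_introl eq_refl)). note (HE v2 (or_intror eq_refl)). lra.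
Qed.

(** On an arc shorter than a quarter of its distance d from the singularity the cosecant has size
    1/d and derivative O(1/d^2), so one integration by parts loses only a constant. *)
Lemma kernel_regular d : 0 < d -> Rabs c = d -> d <= 1 / 2 -> ell <= d / 4 ->
  Cmod (cint (fun u => (f u * dker m len (c + s * u))%C) 0 ell) <= 4 * Th * (ell / d).
Proof.
 intros Hd Hc Hd2 Hed. note (pos_INR len).
 assert (Zr : forall u, 0 <= u <= ell -> 3 / 4 * d <= Rabs (c + s * u) <= 5 / 8).
 { intros u Hu. assert (Ha : Rabs (s * u) = u). { apply sign_abs_mult; side. } note (Rabs_triang c (s * u)).
  note (Rabs_triang (c + s * u) (- (s * u))) as T. rewrite Rabs_Ropp in T.
  replace (c + s * u + - (s * u)) with c in T by ring. lra. }
 apply kernel_split; [lra|side| |]. { intros u Hu. apply (cosec_bounds c s u (3 / 4 * d)); side. } intros v Hv.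
 have Hm0 : 0 <= IZR m. via (Th * (4 / 3 * (ell / d)) + ell * (Th * (64 / 9 * ell / d ^ 2))).
 - apply (parts_bound (fm v) (fun u => / sin (PI * (c + s * u))) (fun u => - (PI * s * cos (PI * (c + s * u)) / sin (PI * (c + s * u)) ^ 2)) (fun _ => Th * (64 / 9 * ell / d ^ 2)) 0 ell).
  + lra.
  + side.
  + apply fm_cont.
  + intros u Hu. apply cosec_derive; [|side]. apply (cosec_bounds c s u (3 / 4 * d)); side.
  + intros u Hu. destruct (cosec_bounds c s u (3 / 4 * d) !! Hs (Zr u Hu)) as (_ & _ & B2).
   via (4 / (3 / 4 * d) ^ 2 * (Th * ell)).
   * apply Rmult_le_compat; [side|side|side|]. eapply Rle_trans; [apply fm_bound; try apply Hv2; lra|]. side.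
   * side.
  + note (is_RInt_const (V := R_NormedModule) 0 ell (Th * (64 / 9 * ell / d ^ 2))) as K. rewrite Rminus_0_r in K. side.
  + destruct (cosec_bounds c s ell (3 / 4 * d) !! Hs (Zr ell !!)) as (_ & B1 & _).
   replace (cint (fm v) 0 0) with (RtoC 0) by (symmetry; apply cint_eq; apply is_cint_point).
   rewrite Cmod_0, Rmult_0_r, Rplus_0_r. via (/ (3 / 4 * d) * (Th * ell)).
   * apply Rmult_le_compat; [side|side|side|]. apply fm_bound; try apply Hv2; lra.
   * side.
 - replace (ell * (Th * (64 / 9 * ell / d ^ 2))) with (Th * (64 / 9 * (ell / d)) * (ell / d)) by side.
  have : ell / d <= / 4. have : 0 <= Th * (64 / 9 * (ell / d)). side.
Qed.

(** Up to eta <= 1/len the kernel is treated as a sum of [len] exponentials; from there on as a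
    cosecant, whose derivative 1/u^2 against the bound Th u leaves the integral of 1/u. *)
Lemma kernel_singular eta : c = 0 -> 0 < eta -> eta <= ell -> ell <= 1 / 2 -> INR len * eta <= 1 ->
  Cmod (cint (fun u => (f u * dker m len (c + s * u))%C) 0 ell) <= 10 * Th * ln (1 + ell / eta).
Proof.
 intros Hc Heta He Hl2 Hlen. note (pos_INR len) as Pl. have Hm0 : 0 <= IZR m.
 assert (Cd : forall u, ccont (fun u => (f u * dker m len (c + s * u))%C) u).
 { intros u. apply ccont_mult; [side|]. apply ccont_Csum. side. } rewrite (cint_chasles _ 0 eta ell) by side.
 assert (Ha : forall u, 0 <= u -> Rabs (c + s * u) = u).
 { intros u Hu. rewrite Hc, Rplus_0_l. apply sign_abs_mult; side. }
 assert (Part1 : Cmod (cint (fun u => (f u * dker m len (c + s * u))%C) 0 eta) <= Th).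
 { assert (I : is_cint (fun u => (f u * dker m len (c + s * u))%C) 0 eta (Csum (fun n => cint (fm (IZR n)) 0 eta) (zrange (m + 1) len))).
  { eapply is_cint_ext_le; [lra| |apply is_cint_Csum; intros n _; apply cint_ok; [lra|intros; apply fm_cont]].
   intros u Hu. unfold dker. rewrite <- Csum_scal. apply Csum_ext. intros n _. unfold fm. do 2 f_equal. side. }
  rewrite (cint_eq _ _ _ _ I). upto Cmod_Csum. via (Rsum (fun _ => Th * eta) (zrange (m + 1) len)).
  - apply Rsum_le. intros n Hn. apply in_zrange_iff in Hn.
   assert (N1 : IZR m + 1 <= IZR n) by (rewrite <- plus_IZR; apply IZR_le; lia).
   assert (N2 : IZR n <= IZR m + INR len) by (rewrite INR_IZR_INZ, <- plus_IZR; apply IZR_le; lia). apply fm_bound; lra.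
  - rewrite Rsum_const, length_zrange. side. }
 have Hr : 1 <= ell / eta. assert (HL2 : / 2 <= ln (1 + ell / eta)).
 { via (ln 2); [note ln_lt_2; lra|]. destruct Hr as [Hr|Hr]; [left; apply ln_increasing; lra|right; f_equal; lra]. }
 assert (HL3 : ln (ell / eta) <= ln (1 + ell / eta)) by (left; apply ln_increasing; lra).
 assert (Part2 : Cmod (cint (fun u => (f u * dker m len (c + s * u))%C) eta ell) <= Th * 2 + 4 * Th * ln (ell / eta)).
 { apply kernel_split; [lra|side| |].
  { intros u Hu. apply (cosec_bounds c s u u); [lra|side|]. rewrite Ha by lra. lra. } intros v Hv.
  apply (parts_bound (fm v) (fun u => / sin (PI * (c + s * u))) (fun u => - (PI * s * cos (PI * (c + s * u)) / sin (PI * (c + s * u)) ^ 2)) (fun u => 4 * Th * / u) eta ell).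
  - lra.
  - side.
  - apply fm_cont.
  - intros u Hu. apply cosec_derive; [|side]. apply (cosec_bounds c s u u); [lra|side|]. rewrite Ha by lra. lra.
  - intros u Hu. destruct (cosec_bounds c s u u !! Hs ltac:(rewrite Ha by lra; lra)) as (_ & _ & B2).
   via (4 / u ^ 2 * (Th * u)).
   + apply Rmult_le_compat; [side|side|side|]. apply fm_bound; try apply Hv2; lra.
   + side.
  - assert (K : is_RInt (fun u => 4 * Th * / u) eta ell (4 * Th * ln ell - 4 * Th * ln eta)).
   { apply (is_RInt_derive (fun u => 4 * Th * ln u) (fun u => 4 * Th * / u)).
    - intros u. minmax. intros Hu. auto_derive; [lra|]. side.
    - intros u. minmax. side. }
   replace (4 * Th * ln (ell / eta)) with (4 * Th * ln ell - 4 * Th * ln eta); [side|]. unfold Rdiv.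
   rewrite ln_mult, ln_Rinv; try lra. side.
  - assert (Pt : forall u, eta <= u <= ell -> Rabs (/ sin (PI * (c + s * u))) * Cmod (cint (fm v) 0 u) <= Th).
   { intros u Hu. destruct (cosec_bounds c s u u !! Hs ltac:(rewrite Ha by lra; lra)) as (_ & B1 & _).
    via (/ u * (Th * u)).
    - apply Rmult_le_compat; [side|side|side|]. apply fm_bound; try apply Hv2; lra.
    - side. }
   note (Pt ell !!). note (Pt eta !!). lra. }
 upto Cmod_triangle. side.
Qed.
End KernelArc.

(** The odd primitive of 1/(eta + |z|). *)
Definition slog (eta z : R) : R := if Rle_dec 0 z then ln (1 + z / eta) else - ln (1 - z / eta).

Lemma slog_abs eta z b : 0 < eta -> Rabs z <= b -> Rabs (slog eta z) <= ln (1 + b / eta).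
Proof.
 intros He Hz. have Hi : 0 < / eta. assert (M : forall x, 0 <= x <= b -> 0 <= ln (1 + x / eta) <= ln (1 + b / eta)).
 { intros x Hx. have : 0 <= x / eta <= b / eta.
  split; [rewrite <- ln_1; destruct (Rle_lt_or_eq_dec 0 (x / eta) !!) as [H0|H0]; [left; apply ln_increasing; lra|right; f_equal; lra]|].
  destruct (Rle_lt_or_eq_dec (x / eta) (b / eta) !!) as [H0|H0]; [left; apply ln_increasing; lra|right; f_equal; lra]. }
 unfold slog. destruct (Rle_dec 0 z) as [H|H].
 - rewrite Rabs_pos_eq in Hz by assumption. note (M z !!). side.
 - rewrite Rabs_left in Hz by lra. replace (1 - z / eta) with (1 + (- z) / eta) by side. note (M (- z) !!). side.
Qed.

Lemma slog_increment eta a b : 0 < eta -> a <= b -> 0 <= a \/ b <= 0 ->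
  (b - a) / (eta + Rmax (Rabs a) (Rabs b)) <= slog eta b - slog eta a.
Proof.
 intros He Hab Hs.
 assert (Core : forall x z, 0 <= x -> x <= z -> (z - x) / (eta + z) <= ln (1 + z / eta) - ln (1 + x / eta)).
 { intros x z Hx Hxz. have : 0 <= x / eta. have : 0 <= z / eta. rewrite <- ln_div by lra.
  set (r := (1 + z / eta) / (1 + x / eta)). have Hr : 0 < r. have E : (z - x) / (eta + z) = 1 - / r.
  note (exp_ineq1_le (- ln r)) as K. rewrite exp_Ropp, exp_ln in K by assumption. lra. }
 destruct Hs as [H|H].
 - unfold slog. destruct (Rle_dec 0 a) as [_|N]; [|side]. destruct (Rle_dec 0 b) as [_|N]; [|lra].
  rewrite !Rabs_pos_eq by lra. rewrite Rmax_right by lra. side.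
 - rewrite !Rabs_left1 by lra. rewrite Rmax_left by lra.
  assert (E : forall x, x <= 0 -> slog eta x = - ln (1 + (- x) / eta)).
  { intros x Hx. unfold slog. destruct (Rle_dec 0 x) as [H0|H0].
   - replace x with 0 by lra. unfold Rdiv. rewrite Ropp_0, Rmult_0_l, Rplus_0_r, ln_1. ring.
   - f_equal. f_equal. side. }
  rewrite !E by lra. note (Core (- b) (- a) !! !!) as K. side.
Qed.

Lemma slog_mono eta a b : 0 < eta -> a <= b -> slog eta a <= slog eta b.
Proof.
 intros He Hab. assert (P : forall x z, 0 <= (z - x) / (eta + Rmax (Rabs x) (Rabs z)) \/ z < x).
 { intros x z. destruct (Rle_lt_dec x z); [left|side]. apply Rdiv_le_0_compat; [lra|]. note (Rmax_l (Rabs x) (Rabs z)).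
  note (Rabs_pos x). lra. }
 destruct (Rle_lt_dec 0 a) as [Ha|Ha]; [|destruct (Rle_lt_dec b 0) as [Hb|Hb]].
 - note (slog_increment eta a b He Hab (or_introl Ha)). destruct (P a b); lra.
 - note (slog_increment eta a b He Hab (or_intror Hb)). destruct (P a b); lra.
 - note (slog_increment eta a 0 He !! ltac:(right; lra)). note (slog_increment eta 0 b He !! ltac:(left; lra)).
  destruct (P a 0); [|lra]. destruct (P 0 b); lra.
Qed.

Section Block.
Variables (psi : C -> C) (t : Z -> C) (w dw : Z -> R -> R).
Hypothesis FF : form_facts psi t w dw.

Lemma twisted_coefficient n x0 y : n <> 0%Z -> 0 < y ->
  is_cint (fun x => (psi (x, y) * e (- (IZR n * (x - x0))))%C) 0 1 (t n * RtoC (w n y) * e (IZR n * x0))%C.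
Proof.
 intros Hn Hy. destruct (ff_fourier _ _ _ _ FF y Hy) as (B & HB & Ff).
 assert (Cf : forall x, ccont (fun x => psi (x, y)) x). { intros x. eapply ff_cont; side. }
 note (fourier_coefficient (fun x => psi (x, y)) (fun n => t n * RtoC (w n y))%C B Cf (fun N x => Ff x y N (Rle_refl y)) n Hn) as K.
 eapply is_cint_ext; [|rewrite Cmult_comm; exact (is_cint_scal _ _ _ _ (e (IZR n * x0)) K)]. intros x _.
 replace (- (IZR n * (x - x0))) with (- (IZR n * x) + IZR n * x0) by ring. rewrite e_plus. ring.
Qed.

Lemma block_integral m len x0 y : (0 <= m)%Z -> 0 < y ->
  Csum (fun n => t n * RtoC (w n y) * e (IZR n * x0))%C (zrange (m + 1) len) =
  cint (fun x => psi (x, y) * dker m len (x - x0))%C 0 1.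
Proof.
 intros Hm Hy. symmetry. apply cint_eq. eapply is_cint_ext; [|apply is_cint_Csum].
 - intros x _. unfold dker. rewrite <- Csum_scal. side.
 - intros n Hn. apply in_zrange_iff in Hn. apply twisted_coefficient; side.
Qed.

Lemma block_cont m len x0 y x : 0 < y -> ccont (fun x => psi (x, y) * dker m len (x - x0))%C x.
Proof.
 intros Hy. apply ccont_mult.
 - eapply ff_cont; side.
 - apply ccont_Csum. side.
Qed.

Lemma flip_integral (F : R -> C) c l : 0 <= l -> (forall u, ccont F u) ->
  cint F c (c + l) = cint (fun u => F (c + 1 * u)) 0 l /\ cint F (c - l) c = cint (fun u => F (c + -1 * u)) 0 l.
Proof.
 intros Hl CF. split; symmetry; apply cint_eq.
 - replace (cint F c (c + l)) with (cint F (c + 1 * 0) (c + 1 * l)) by (f_equal; ring).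
  apply (is_cint_ext (fun r => (RtoC 1 * F (c + 1 * r)%R)%C)); [side|].
  apply (is_cint_comp F (fun r => c + 1 * r) (fun _ => 1)).
  + side.
  + intros r _. split; [auto_derive; [side|ring]|side].
 - assert (K : is_cint (fun r => (RtoC (-1) * F (c + -1 * r)%R)%C) 0 l (cint F (c + -1 * 0) (c + -1 * l))).
  { apply (is_cint_comp F (fun r => c + -1 * r) (fun _ => -1)).
   + side.
   + intros r _. split; [auto_derive; [side|ring]|side]. }
  replace (c + -1 * 0) with c in K by ring. replace (c + -1 * l) with (c - l) in K by ring.
  assert (S : cint F c (c - l) = (- cint F (c - l) c)%C).
  { apply cint_eq. apply is_cint_swap. apply cint_ok; [lra|]. side. } rewrite S in K.
  replace (cint F (c - l) c) with (RtoC (-1) * (- cint F (c - l) c))%C by side.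
  eapply is_cint_ext; [|exact (is_cint_scal _ _ _ _ (RtoC (-1)) K)]. intros r _. cbv beta. side.
Qed.

Lemma nearest_shift z : -1 <= z <= 1 -> exists i, (-1 <= i <= 1)%Z /\ Rabs (z - IZR i) <= 1 / 2.
Proof.
 intros Hz.
 destruct (Rle_lt_dec z (- / 2)); [exists (-1)%Z|destruct (Rle_lt_dec z (/ 2)); [exists 0%Z|exists 1%Z]]; (split; [lia|]); apply Rabs_le; simpl; lra.
Qed.

(** Over the Farey arcs of the circle the kernel estimates amount to a Riemann sum of 1/distance to
    h/k. Each arc is bounded by the increment of [Gam], a logarithmic primitive, so that the sum
    telescopes along [stern_brocot]. *)
Lemma block_bound eps b1 b2 : 0 < eps -> 0 < b1 -> exists B, 0 < B /\
  forall (h k m : Z) (y N : R) (len : nat), (0 <= h < k)%Z -> Z.gcd h k = 1%Z -> (0 <= m)%Z -> 0 < y <= 1 -> 1 <= N -> INR len <= N ->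
  b1 <= (IZR m + 1 / 2) * y -> (IZR m + INR len + 1 / 2) * y <= b2 ->
  Cmod (Csum (fun n => t n * RtoC (w n y) * e (IZR n * (IZR h / IZR k)))%C (zrange (m + 1) len)) <=
   B * (Rpower (IZR k) (1 / 4) * Rpower y (1 / 8 - eps)) * ln (1 + 64 * IZR k ^ 2 * N).
Proof.
 intros Heps Hb1. destruct (half_arc_bound psi t w dw FF eps b1 b2 Heps Hb1) as (B1 & HB1 & HR).
 destruct (half_arc_bound_left psi t w dw FF eps b1 b2 Heps Hb1) as (B2 & HB2 & HL). set (B0 := (B1 + B2) * 2).
 exists (60 * B0). split; [side|]. intros h k m y N len Hh Hg Hm Hy HN Hlen H1 H2. set (x0 := IZR h / IZR k).
 (* The order 4 k: an arc at p/q different from h/k mod 1 has length at most 1/(4 q k), a quarter of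
    the least possible distance 1/(q k) from h/k. *)
 rewrite block_integral by side. have Hk1 : 1 <= IZR k. set (K := (4 * k)%Z). set (K4 := Rpower (IZR k) (1 / 4)).
 set (ya := Rpower y (1 / 8 - eps)). set (Th := B0 * (K4 * ya)). assert (HK4 : 0 < K4) by apply Rpower_pos.
 (* This eta is below 1/N and below every arc length, since these are at least 1/(2 q K) >= 1/(32
    k^2). *)
 assert (Hya : 0 < ya) by apply Rpower_pos. have HB0 : 0 < B0. have HTh : 0 <= Th. set (eta := / (32 * IZR k ^ 2 * N)).
 have Hk2 : 1 <= IZR k ^ 2. have PkN : 1 <= IZR k ^ 2 * N. have Heta : 0 < eta.
 set (F := fun x => (psi (x, y) * dker m len (x - x0))%C).
 assert (CF : forall x, ccont F x) by (intros; apply block_cont; lra).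
 (* Distances are taken modulo 1; as x - x0 lies in [-1, 1], one of the three shifts realizes the
    distance and the other two are monotone anyway. *)
 set (Gam := fun x => slog eta (x - x0 + 1) + slog eta (x - x0) + slog eta (x - x0 - 1)).
 assert (Kr : IZR K = 4 * IZR k) by (unfold K; rewrite mult_IZR; reflexivity). assert (Hx0 : 0 <= x0 < 1).
 { unfold x0. have : 0 <= IZR h. have : IZR h < IZR k. split.
  - side.
  - apply Rmult_lt_reg_r with (IZR k); [lra|]. div_cancel. lra. }
 assert (Gm : forall a b i, a <= b -> (-1 <= i <= 1)%Z -> slog eta (b - x0 - IZR i) - slog eta (a - x0 - IZR i) <= Gam b - Gam a).
 { intros a b i Hab Hi. unfold Gam. note (slog_mono eta (a - x0 + 1) (b - x0 + 1) Heta !!).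
  note (slog_mono eta (a - x0) (b - x0) Heta !!). note (slog_mono eta (a - x0 - 1) (b - x0 - 1) Heta !!).
  have Ei : i = (-1)%Z \/ i = 0%Z \/ i = 1%Z. destruct Ei as [-> | [-> | ->]]; simpl IZR.
  - replace (b - x0 - -1) with (b - x0 + 1) by ring. replace (a - x0 - -1) with (a - x0 + 1) by ring. lra.
  - rewrite !Rminus_0_r. lra.
  - lra. }
 assert (Arc : forall p q l s, (1 <= q <= K)%Z -> Z.gcd p q = 1%Z -> / (2 * IZR q * IZR K) <= l -> l <= / (IZR q * IZR K) -> 0 <= IZR p / IZR q <= 1 -> s = 1 \/ s = -1 -> Cmod (cint (fun u => F (IZR p / IZR q + s * u)) 0 l) <= 10 * Th * Rabs (Gam (IZR p / IZR q + s * l) - Gam (IZR p / IZR q))).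
 { intros p q l s Hq Hpq Hl1 Hl2 Hpq1 Hs. have Hq1 : 1 <= IZR q. have HqK : IZR q <= IZR K.
  have PqK : 0 < IZR q * IZR K. assert (Hl0 : 0 < l). { eapply Rlt_le_trans; [|exact Hl1]. side. }
  set (x1 := IZR p / IZR q) in *. destruct (nearest_shift (x1 - x0) !!) as (i & Hi & Hd).
  set (c := x1 - x0 - IZR i) in *.
  assert (HG : forall a b, a <= b -> 0 <= a - x0 - IZR i \/ b - x0 - IZR i <= 0 -> (b - a) / (eta + Rmax (Rabs (a - x0 - IZR i)) (Rabs (b - x0 - IZR i))) <= Gam b - Gam a).
  { intros a b Hab Hsg. eapply Rle_trans; [|apply (Gm a b i Hab Hi)].
   note (slog_increment eta (a - x0 - IZR i) (b - x0 - IZR i) Heta !! Hsg) as S. side. }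
  set (f := fun u => psi ((x1 + s * u)%R, y)).
  assert (Ef : forall u, F (x1 + s * u) = (f u * dker m len (c + s * u))%C).
  { intros u. unfold F, f. f_equal. rewrite <- (dker_period m len (x1 + s * u - x0) i). f_equal. unfold c. ring. }
  rewrite (cint_ext _ _ _ _ Ef). assert (Cf : forall u, ccont f u).
  { intros u. apply (ff_cont _ _ _ _ FF (fun u => x1 + s * u) (fun _ => y)); [|side|lra]. side. }
  assert (Hf : forall mu x, b1 / y <= Rabs mu <= b2 / y -> 0 <= x <= l -> Cmod (cint (fun u => (f u * e (mu * u))%C) 0 x) <= Th * x).
  { intros mu x Hmu Hx. assert (Hmu2 : b1 <= Rabs mu * y <= b2).
   { destruct Hmu as [M1 M2]. split.
    - replace b1 with (b1 / y * y) by side. side.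
    - replace b2 with (b2 / y * y) by side. side. }
   assert (Hxq : 0 <= x <= / IZR q ^ 2).
   { split; [lra|]. via (/ (IZR q * IZR K)); [lra|]. apply Rinv_le_contravar; [nra|]. side. }
   (* The arc bound at p/q has q^(1/4), and q <= 4 k. *)
   assert (Q4 : Rpower (IZR q) (1 / 4) <= 2 * K4).
   { via (Rpower (16 * IZR k) (1 / 4)); [side|]. rewrite <- Rpower_mult_distr by lra. fold K4. mul_r.
    replace 16 with (Rpower 2 4). rewrite Rpower_mult. replace (4 * (1 / 4)) with 1 by field. rewrite Rpower_1; lra.
    replace 4 with (INR 4) by (simpl; ring). rewrite Rpower_pow by lra. side. }
   assert (Fin : forall B z, 0 <= B -> B <= B1 + B2 -> z <= B * (Rpower (IZR q) (1 / 4) * ya) * x -> z <= Th * x).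
   { intros B z HB HB12 Hz. upto Hz. mul_r. unfold Th, B0. via ((B1 + B2) * (2 * K4 * ya)); [|side]. side. }
   destruct Hs as [Es|Es].
   - apply (Fin B1); [lra|lra|]. note (HR p q y mu x !! Hpq Hy Hmu2 Hxq) as R. fold ya in R.
    rewrite (cint_ext _ (fun u => (psi ((IZR p / IZR q + u)%R, y) * e (mu * u))%C)); [side|]. intros u. unfold f, x1.
    rewrite Es, Rmult_1_l. side.
   - apply (Fin B2); [lra|lra|]. note (HL p q y mu x !! Hpq Hy Hmu2 Hxq) as R. fold ya in R.
    rewrite (cint_ext _ (fun u => (psi ((IZR p / IZR q - u)%R, y) * e (mu * u))%C)); [side|]. intros u. unfold f, x1.
    rewrite Es. replace (IZR p / IZR q + -1 * u) with (IZR p / IZR q - u) by ring. side. }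
  have Lo : b1 / y <= IZR m + 1 / 2. have Hi' : IZR m + INR len + 1 / 2 <= b2 / y. assert (Pl := pos_INR len).
  assert (GA : forall d', (forall a b, a <= b -> (a = x1 /\ b = x1 + s * l) \/ (a = x1 + s * l /\ b = x1) -> d' <= Gam b - Gam a) -> d' <= Rabs (Gam (x1 + s * l) - Gam x1)).
  { intros d' H. destruct Hs as [Es|Es].
   - eapply Rle_trans; [|apply Rle_abs]. apply H; side.
   - rewrite Rabs_minus_sym. eapply Rle_trans; [|apply Rle_abs]. apply H; side. }
  assert (Ha : forall u, 0 <= u -> Rabs (s * u) = u). { intros u Hu. apply sign_abs_mult; side. }
  destruct (Req_dec c 0) as [Hc|Hc].
  - assert (E1 : eta <= l).
   { eapply Rle_trans; [|exact Hl1]. apply Rinv_le_contravar; [nra|].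
    assert (IZR q * IZR K <= 16 * IZR k ^ 2) by (rewrite Kr in *; simpl; nra). nra. }
   assert (E2 : INR len * eta <= 1).
   { via (N * eta); [side|]. unfold eta. cancel_r (32 * IZR k ^ 2 * N). rewrite Rmult_assoc, Rinv_l by lra. nra. }
   assert (E3 : l <= 1 / 2). { upto Hl2. via (/ 4); [|lra]. apply Rinv_le_contravar; [lra|]. rewrite Kr in *. nra. }
   note (kernel_singular f c s l Th m len (b1 / y) (b2 / y) Cf Hs HTh Hf Hm Lo Hi' eta Hc Heta E1 E3 E2) as KS. upto KS.
   mul_l. apply GA. intros a b Hab Hcase. eapply Rle_trans; [|apply (Gm a b i Hab Hi)]. assert (S0 : slog eta 0 = 0).
   { unfold slog. destruct (Rle_dec 0 0); [|lra]. unfold Rdiv. rewrite Rmult_0_l, Rplus_0_r. apply ln_1. }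
   destruct Hcase as [[Ea Eb]|[Ea Eb]].
   + assert (Es : s = 1) by (destruct Hs; side). replace (a - x0 - IZR i) with 0 by (rewrite Ea; unfold c in Hc; lra).
    replace (b - x0 - IZR i) with l by (rewrite Eb, Es; unfold c in Hc; lra). rewrite S0. unfold slog.
    destruct (Rle_dec 0 l); lra.
   + have Es : s = -1. replace (b - x0 - IZR i) with 0 by (rewrite Eb; unfold c in Hc; lra).
    replace (a - x0 - IZR i) with (- l) by (rewrite Ea, Es; unfold c in Hc; lra). rewrite S0. unfold slog.
    destruct (Rle_dec 0 (- l)); [lra|]. replace (1 - - l / eta) with (1 + l / eta) by side. lra.
  - assert (Hd0 : / (IZR q * IZR k) <= Rabs c).
   { assert (Ec : c = IZR (p * k - h * q - i * (q * k)) / (IZR q * IZR k)).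
    { unfold c, x1, x0. rewrite !minus_IZR, !mult_IZR. side. } assert (Nz : (p * k - h * q - i * (q * k) <> 0)%Z).
    { intros E0. rewrite E0 in Ec. side. } rewrite Ec. unfold Rdiv. rewrite Rabs_mult, Rabs_inv.
    rewrite (Rabs_pos_eq (IZR q * IZR k)) by nra. note (Rabs_IZR_ge_1 _ Nz). rewrite <- Rmult_1_l at 1. side. }
   set (d := Rabs c) in *. have Pqk : 0 < IZR q * IZR k. assert (Hdp : 0 < d) by (apply Rabs_pos_lt; assumption).
   assert (Hld : l <= d / 4).
   { upto Hl2. rewrite Kr. replace (/ (IZR q * (4 * IZR k))) with (/ (IZR q * IZR k) / 4) by side. lra. }
   assert (Hed : eta <= d). { eapply Rle_trans; [|exact Hd0]. apply Rinv_le_contravar; [side|]. rewrite Kr in *. nra. }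
   note (kernel_regular f c s l Th m len (b1 / y) (b2 / y) Cf Hs (Rlt_le _ _ Hl0) HTh Hf Hm Lo Hi' d Hdp eq_refl Hd Hld) as KS.
   upto KS. via (10 * Th * (l / (eta + 5 / 4 * d))).
   { replace (10 * Th * (l / (eta + 5 / 4 * d))) with (Th * (10 * (l / (eta + 5 / 4 * d)))) by ring.
    replace (4 * Th * (l / d)) with (Th * (4 * (l / d))) by ring. mul_l. cancel_r (d * (eta + 5 / 4 * d)).
    replace (4 * (l / d) * (d * (eta + 5 / 4 * d))) with (4 * l * (eta + 5 / 4 * d)) by side.
    replace (10 * (l / (eta + 5 / 4 * d)) * (d * (eta + 5 / 4 * d))) with (10 * l * d) by side. nra. }
   mul_l. apply GA. intros a b Hab Hcase. assert (Tb : forall z, z = a \/ z = b -> Rabs (z - x0 - IZR i) <= 5 / 4 * d).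
   { assert (forall z, z = x1 \/ z = x1 + s * l -> Rabs (z - x0 - IZR i) <= 5 / 4 * d).
    { intros z [-> | ->]; [fold c; fold d; lra|].
     replace (x1 + s * l - x0 - IZR i) with (c + s * l) by (unfold c; ring). upto Rabs_triang. rewrite Ha by lra.
     fold d. lra. }
    intros z Hz. apply H. side. }
   assert (Hdl : b - a = l).
   { destruct Hcase as [[Ea Eb]|[Ea Eb]]; rewrite Ea, Eb in *; destruct Hs as [Es|Es]; rewrite Es in *; lra. }
   assert (Hsg : 0 <= a - x0 - IZR i \/ b - x0 - IZR i <= 0).
   { destruct (Rle_lt_dec 0 c) as [Hc0|Hc0].
    - left. assert (d = c) by (apply Rabs_pos_eq; assumption).
     destruct Hcase as [[Ea Eb]|[Ea Eb]]; rewrite Ea in *; unfold c in *; lra.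
    - right. assert (d = - c) by (apply Rabs_left; assumption).
     destruct Hcase as [[Ea Eb]|[Ea Eb]]; rewrite Eb in *; unfold c in *; lra. }
   eapply Rle_trans; [|apply (HG a b Hab Hsg)]. rewrite Hdl. mul_l. note (Tb a (or_introl eq_refl)).
   note (Tb b (or_intror eq_refl)). apply Rinv_le_contravar.
   + note (Rmax_l (Rabs (a - x0 - IZR i)) (Rabs (b - x0 - IZR i))). note (Rabs_pos (a - x0 - IZR i)). lra.
   + apply Rplus_le_compat_l. apply Rmax_lub; assumption. }
 assert (Main : 0 <= 0 -> IZR 1 <= 1 -> Cmod (cint F (IZR 0) (IZR 1)) <= 10 * Th * (Gam (IZR 1) - Gam (IZR 0))).
 { apply (stern_brocot (fun a b => 0 <= a -> b <= 1 -> Cmod (cint F a b) <= 10 * Th * (Gam b - Gam a)) K); try lia.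
  - intros a b c Hab Hbc P1 P2 Ha Hc. rewrite (cint_chasles F a b c) by side. upto Cmod_triangle. side.
  - intros p q l Hq Hpq Hl1 Hl2 Ha Hb. assert (Hl0 : 0 <= l). { eapply Rle_trans; [|exact Hl1]. side. }
   destruct (flip_integral F (IZR p / IZR q) l Hl0 CF) as [E _]. rewrite E. eapply Rle_trans; [apply Arc; side|]. right.
   rewrite Rmult_1_l. f_equal. apply Rabs_pos_eq. note (Gm (IZR p / IZR q) (IZR p / IZR q + l) 0%Z !! !!) as G0.
   note (slog_mono eta (IZR p / IZR q - x0 - 0) (IZR p / IZR q + l - x0 - 0) Heta !!). side.
  - intros p q l Hq Hpq Hl1 Hl2 Ha Hb. assert (Hl0 : 0 <= l). { eapply Rle_trans; [|exact Hl1]. side. }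
   destruct (flip_integral F (IZR p / IZR q) l Hl0 CF) as [_ E]. rewrite E. eapply Rle_trans; [apply Arc; side|]. right.
   f_equal. replace (IZR p / IZR q + -1 * l) with (IZR p / IZR q - l) by ring. rewrite Rabs_minus_sym.
   apply Rabs_pos_eq. note (Gm (IZR p / IZR q - l) (IZR p / IZR q) 0%Z !! !!) as G0.
   note (slog_mono eta (IZR p / IZR q - l - x0 - 0) (IZR p / IZR q - x0 - 0) Heta !!). side. }
 specialize (Main (Rle_refl 0) (Rle_refl 1)). have E2 : 2 / eta = 64 * IZR k ^ 2 * N.
 assert (GB : Gam 1 - Gam 0 <= 6 * ln (1 + 2 / eta)).
 { assert (A : forall z, Rabs z <= 2 -> Rabs (slog eta z) <= ln (1 + 2 / eta)) by (intros; apply slog_abs; assumption).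
  assert (AA : forall z, -2 <= z <= 2 -> - ln (1 + 2 / eta) <= slog eta z <= ln (1 + 2 / eta)).
  { intros z Hz. specialize (A z ltac:(apply Rabs_le; lra)). apply Rabs_le_between in A. side. } unfold Gam.
  note (AA (1 - x0 + 1) !!). note (AA (1 - x0) !!). note (AA (1 - x0 - 1) !!). note (AA (0 - x0 + 1) !!).
  note (AA (0 - x0) !!). note (AA (0 - x0 - 1) !!). lra. }
 rewrite E2 in GB. via (10 * Th * (6 * ln (1 + 64 * IZR k ^ 2 * N))); [side|]. side.
Qed.
End Block.

(** * From integrals to sums *)

Lemma Csum_seq_S (b : nat -> C) n : Csum b (seq 0 (S n)) = (Csum b (seq 0 n) + b n)%C.
Proof. rewrite seq_S, Csum_app. simpl. ring. Qed.

Lemma abel_bound (b : nat -> C) (g : nat -> R) E G dl len : 0 <= E -> 0 <= G -> 0 <= dl ->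
  (forall j, (j <= len)%nat -> Cmod (Csum b (seq 0 j)) <= E) ->
  (forall j, (j < len)%nat -> Rabs (g j) <= G) ->
  (forall j, (S j < len)%nat -> Rabs (g (S j) - g j) <= dl) ->
  Cmod (Csum (fun j => b j * RtoC (g j))%C (seq 0 len)) <= E * (G + INR len * dl).
Proof.
 intros HE HG Hd Hb Hg Hgd. destruct len as [|n]. { simpl. rewrite Cmod_0. side. }
 assert (K : forall j, (j <= n)%nat -> Cmod (Csum (fun j => b j * RtoC (g j))%C (seq 0 (S j)) - Csum b (seq 0 (S j)) * RtoC (g j))%C <= E * (INR j * dl)).
 { induction j as [|j IH]; intros Hj.
  - simpl. match goal with |- Cmod ?z <= _ => replace z with (RtoC 0) by ring end. rewrite Cmod_0. lra.
  - rewrite Csum_seq_S, (Csum_seq_S b (S j)).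
   replace (Csum (fun j0 => b j0 * RtoC (g j0)) (seq 0 (S j)) + b (S j) * RtoC (g (S j)) - (Csum b (seq 0 (S j)) + b (S j)) * RtoC (g (S j)))%C with ((Csum (fun j0 => b j0 * RtoC (g j0)) (seq 0 (S j)) - Csum b (seq 0 (S j)) * RtoC (g j)) + - (Csum b (seq 0 (S j)) * RtoC (g (S j) - g j)))%C.
   2: { rewrite RtoC_minus. ring. } upto Cmod_triangle. rewrite Cmod_opp, Cmod_mult, Cmod_R. assert (A1 := IH !!).
   assert (A2 := Hb (S j) !!). assert (A3 := Hgd j !!).
   have : Cmod (Csum b (seq 0 (S j))) * Rabs (g (S j) - g j) <= E * dl. rewrite S_INR. lra. }
 specialize (K n (Nat.le_refl n)). set (A := Csum (fun j => b j * RtoC (g j))%C (seq 0 (S n))) in *.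
 set (T := Csum b (seq 0 (S n))) in *. replace A with ((A - T * RtoC (g n)) + T * RtoC (g n))%C by ring.
 upto Cmod_triangle. rewrite Cmod_mult, Cmod_R. assert (Cmod T * Rabs (g n) <= E * G) by (apply Rmult_le_compat; side).
 have : 0 <= E * dl. rewrite S_INR. lra.
Qed.

Lemma ln_le_Rpower x d : 0 < x -> 0 < d -> ln x <= Rpower x d / d.
Proof.
 intros Hx Hd. cancel_r d. unfold Rdiv. rewrite Rmult_assoc, Rinv_l, Rmult_1_r by lra. unfold Rpower.
 note (exp_ineq1_le (d * ln x)). lra.
Qed.

(** With y = v0 / (pi N) the argument 2 pi n y runs through [v0, 2 v0] for N/2 <= n <= N, where
    [KB_lower] applies. So the inverse weights have size and total variation O(sqrt N), and partial
    summation removes them. *)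
Lemma unweight (kappa : R) (t : Z -> C) : exists v0 C0, 1 <= v0 /\ 0 < C0 /\
  forall (m : Z) (len : nat) (N x0 E : R), (0 <= m)%Z -> 1 <= N -> N / 2 <= IZR m + 1 -> IZR m + INR len <= N -> 0 <= E ->
  (forall l, (l <= len)%nat -> Cmod (Csum (fun n => t n * RtoC (wt kappa n (v0 / (PI * N))) * e (IZR n * x0))%C (zrange (m + 1) l)) <= E) ->
  Cmod (Csum (fun n => t n * e (IZR n * x0))%C (zrange (m + 1) len)) <= C0 * E * sqrt N.
Proof.
 destruct (KB_lower kappa) as (v0 & c & Hv0 & Hc & Low). set (c1 := c * exp (- 2 * (2 * v0))). have Hc1 : 0 < c1.
 set (K1 := Rpower (1 + INR 1) (1 + INR 1) * Rpower 2 1 / 1).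
 assert (KB1 : forall v, v0 <= v -> Rabs (KB kappa 1 v) <= K1).
 { intros v Hv. note (KB_bound kappa 1 v 1 !! !!) as B. fold K1 in B. upto B. rewrite <- (Rmult_1_r K1) at 2. mul_l.
  via (Rpower 1 (- (1 + INR 1))); [apply Rpower_anti; simpl; lra|rewrite Rpower_1_base; lra]. }
 assert (KBl : forall v, v0 <= v <= 2 * v0 -> c1 <= KB kappa 0 v).
 { intros v Hv. eapply Rle_trans; [|apply Low; lra]. mul_l. apply exp_le_mono. lra. }
 assert (KBd : forall v v', v0 <= v -> v <= v' -> Rabs (KB kappa 0 v' - KB kappa 0 v) <= K1 * (v' - v)).
 { intros v v' Hv Hvv. destruct (MVT_gen (KB kappa 0) v v' (fun z => - KB kappa 1 z)) as [z [Hz E]].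
  - intros z. minmax. intros Hz. apply KB_derive. lra.
  - intros z. minmax. intros Hz. apply derivable_continuous_pt. eexists. apply is_derive_Reals. apply KB_derive. lra.
  - rewrite Rmin_left, Rmax_right in Hz by assumption. rewrite E, Rabs_mult, Rabs_Ropp, (Rabs_pos_eq (v' - v)) by lra.
   mul_r. apply KB1. lra. }
 set (Q := sqrt (PI / v0)). exists v0, (Q * (/ c1 + 2 * v0 * K1 / c1 ^ 2) + 1). split; [side|]. note PI_RGT_0 as HP.
 split. { side. } intros m len N x0 E Hm HN Hm2 Hlen HE Hpart. set (y := v0 / (PI * N)). have HPN : 0 < PI * N.
 set (nj := fun j : nat => (m + 1 + Z.of_nat j)%Z). set (vj := fun j : nat => 2 * PI * Rabs (IZR (nj j)) * y).
 assert (Evj : forall j, vj j = 2 * v0 * (IZR m + 1 + INR j) / N).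
 { intros j. unfold vj, nj. rewrite Rabs_pos_eq by side. rewrite !plus_IZR, <- INR_IZR_INZ. side. }
 assert (Rvj : forall j, (j < len)%nat -> v0 <= vj j <= 2 * v0).
 { intros j Hj. rewrite Evj. note (pos_INR j). assert (INR j + 1 <= INR len) by (rewrite <- S_INR; apply le_INR; lia).
  split; apply Rmult_le_reg_r with N; try lra; unfold Rdiv; rewrite Rmult_assoc, Rinv_l by lra; nra. }
 set (b := fun j => (t (nj j) * RtoC (wt kappa (nj j) y) * e (IZR (nj j) * x0))%C).
 set (g := fun j => / (sqrt y * KB kappa 0 (vj j))).
 assert (Z2S : forall (F : Z -> C) l, Csum F (zrange (m + 1) l) = Csum (fun j => F (nj j)) (seq 0 l)).
 { intros F l. unfold zrange. rewrite Csum_map. side. } rewrite Z2S.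
 rewrite (Csum_ext _ (fun j => (b j * RtoC (g j))%C)).
 2: { intros j Hj. apply in_seq in Hj. unfold b, g, wt. fold (vj j). note (KBl (vj j) (Rvj j !!)).
  replace (t (nj j) * RtoC (sqrt y * KB kappa 0 (vj j)) * e (IZR (nj j) * x0) * RtoC (/ (sqrt y * KB kappa 0 (vj j))))%C with (t (nj j) * e (IZR (nj j) * x0) * RtoC ((sqrt y * KB kappa 0 (vj j)) * / (sqrt y * KB kappa 0 (vj j))))%C by (rewrite RtoC_mult; ring).
  rewrite Rinv_r by side. ring. }
 assert (Gb : forall j, (j < len)%nat -> Rabs (g j) <= / sqrt y * / c1).
 { intros j Hj. note (KBl (vj j) (Rvj j Hj)). unfold g. rewrite Rabs_inv, Rabs_pos_eq by side. rewrite <- Rinv_mult.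
  side. }
 assert (Gd : forall j, (S j < len)%nat -> Rabs (g (S j) - g j) <= / sqrt y * (2 * v0 * K1 / c1 ^ 2) / N).
 { intros j Hj. note (KBl (vj j) (Rvj j !!)) as L1. note (KBl (vj (S j)) (Rvj (S j) Hj)) as L2.
  assert (Dv : vj (S j) - vj j = 2 * v0 / N) by (rewrite !Evj, S_INR; field; lra).
  assert (D : Rabs (KB kappa 0 (vj (S j)) - KB kappa 0 (vj j)) <= K1 * (2 * v0 / N)).
  { rewrite <- Dv. apply KBd; [apply Rvj; lia|]. have : 0 < 2 * v0 / N. lra. } set (k1 := KB kappa 0 (vj (S j))) in *.
  set (k0 := KB kappa 0 (vj j)) in *. unfold g. fold k1 k0.
  replace (/ (sqrt y * k1) - / (sqrt y * k0)) with (- (k1 - k0) * (/ sqrt y * / (k1 * k0))) by side.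
  rewrite Rabs_mult, Rabs_Ropp. rewrite (Rabs_pos_eq (/ sqrt y * / (k1 * k0))). 2: { side. }
  via (K1 * (2 * v0 / N) * (/ sqrt y * / c1 ^ 2)).
  - apply Rmult_le_compat; [side| |side|].
   + side.
   + mul_l. apply Rinv_le_contravar; [side|]. side.
  - side. }
 note (abel_bound b g E (/ sqrt y * / c1) (/ sqrt y * (2 * v0 * K1 / c1 ^ 2) / N) len HE) as AB.
 eapply Rle_trans; [apply AB; [side|apply Rdiv_le_0_compat; side| |side|side]|].
 - intros j Hj. rewrite <- (Z2S (fun n => t n * RtoC (wt kappa n y) * e (IZR n * x0))%C). side.
 - assert (Ey : / sqrt y = Q * sqrt N).
  { unfold y, Q. rewrite <- sqrt_inv. rewrite <- sqrt_mult_alt by side. f_equal. side. } rewrite Ey.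
  assert (Hl : INR len <= N). { have : 0 <= IZR m. lra. } assert (HsN : 0 <= sqrt N) by apply sqrt_pos.
  via (E * (Q * sqrt N * / c1 + N * (Q * sqrt N * (2 * v0 * K1 / c1 ^ 2) / N))).
  + side.
  + replace (E * (Q * sqrt N * / c1 + N * (Q * sqrt N * (2 * v0 * K1 / c1 ^ 2) / N))) with (Q * (/ c1 + 2 * v0 * K1 / c1 ^ 2) * (E * sqrt N)) by side.
   side.
Qed.

Definition psum (t : Z -> C) (M : nat) (x : R) : C := Csum (fun n => t n * e (IZR n * x))%C (zrange 1 M).

Lemma psum_split t (m len : nat) x :
  psum t (m + len) x = (psum t m x + Csum (fun n => t n * e (IZR n * x))%C (zrange (Z.of_nat m + 1) len))%C.
Proof.
 unfold psum. induction len as [|len IH].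
 - rewrite Nat.add_0_r. simpl. ring.
 - rewrite Nat.add_succ_r, !Csum_zrange_S, IH.
  replace (1 + Z.of_nat (m + len))%Z with (Z.of_nat m + 1 + Z.of_nat len)%Z by lia. ring.
Qed.

Lemma psum_trivial t M x : Cmod (psum t M x) <= Rsum (fun n => Cmod (t n)) (zrange 1 M).
Proof. upto Cmod_Csum. apply Rsum_le. intros n _. rewrite Cmod_mult, Cmod_e. lra. Qed.

Lemma psum_shift t M x (i : Z) : psum t M (x + IZR i) = psum t M x.
Proof. apply Csum_ext. intros n _. f_equal. rewrite Rmult_plus_distr_l, <- mult_IZR. apply e_add_Z. Qed.

Lemma Rsum_zrange_mono (f : Z -> R) (M M' : nat) : (forall n, 0 <= f n) -> (M <= M')%nat -> Rsum f (zrange 1 M) <= Rsum f (zrange 1 M').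
Proof.
 intros Hf H. apply Rsum_incl; [| |side].
 - apply Injective_map_NoDup; [intros u v; lia|apply seq_NoDup].
 - intros z Hz. apply in_zrange_iff in Hz. apply in_zrange. lia.
Qed.

(* The blocks [(M / 2, M]] sum to a geometric series. *)
Lemma dyadic_psum (t : Z -> C) (x A C0 c M0 : R) : 0 < c -> 0 <= A -> 0 <= C0 -> 1 <= M0 ->
  (forall M, INR M <= M0 -> Cmod (psum t M x) <= A) ->
  (forall M m len : nat, M0 <= INR M -> m = (M / 2)%nat -> (m + len)%nat = M ->
    Cmod (Csum (fun n => t n * e (IZR n * x))%C (zrange (Z.of_nat m + 1) len)) <= C0 * Rpower (INR M) c) ->
  forall M, (1 <= M)%nat -> Cmod (psum t M x) <= (A + C0 / (1 - Rpower 2 (- c))) * Rpower (INR M) c.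
Proof.
 intros Hc HA HC HM0 Hsmall Hblock. assert (P2 : 0 < Rpower 2 (- c) < 1).
 { split; [side|]. rewrite <- (Rpower_O 2) by lra. apply Rpower_lt; lra. } set (B := A + C0 / (1 - Rpower 2 (- c))).
 have HB : 0 <= C0 / (1 - Rpower 2 (- c)). assert (HBC : B * Rpower 2 (- c) + C0 <= B).
 { have E : C0 / (1 - Rpower 2 (- c)) * (1 - Rpower 2 (- c)) = C0. side. }
 apply (well_founded_induction lt_wf (fun M => (1 <= M)%nat -> Cmod (psum t M x) <= B * Rpower (INR M) c)).
 intros M IH HM. assert (HM1 : 1 <= INR M) by (replace 1 with (INR 1) by reflexivity; apply le_INR; lia).
 have RM : 1 <= Rpower (INR M) c. destruct (Rle_lt_dec M0 (INR M)) as [H|H].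
 2: { eapply Rle_trans; [apply Hsmall; lra|]. side. } set (m := (M / 2)%nat). note (Nat.div_mod M 2 !!) as DM.
 fold m in DM. have EM : (m + (M - m))%nat = M. rewrite <- EM at 1. rewrite psum_split. upto Cmod_triangle.
 note (Hblock M m (M - m)%nat H eq_refl EM) as Hb.
 assert (Hs : Cmod (psum t m x) <= B * Rpower 2 (- c) * Rpower (INR M) c).
 { destruct (Nat.eq_dec m 0) as [E0|E0].
  - rewrite E0. unfold psum. simpl. rewrite Cmod_0. side.
  - eapply Rle_trans; [apply IH; lia|]. rewrite Rmult_assoc. mul_l. rewrite <- Rpower_inv_base by lra.
   rewrite Rpower_mult_distr by lra. apply Rpower_base_le; [side| |lra].
   assert (2 * INR m <= INR M) by (replace 2 with (INR 2) by side; rewrite <- mult_INR; apply le_INR; lia). lra. }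
 side.
Qed.

Section ThmW.
Variables (kappa : R) (psi : C -> C) (t : Z -> C).
Hypothesis FF : form_facts psi t (wt kappa) (dwt kappa).

Lemma reduce_mod (k h : Z) M : (1 <= k)%Z -> psum t M (IZR h / IZR k) = psum t M (IZR (h mod k) / IZR k).
Proof.
 intros Hk. rewrite <- (psum_shift t M (IZR (h mod k) / IZR k) (h / k)). f_equal. note (Z.div_mod h k !!) as D.
 rewrite D at 1. rewrite plus_IZR, mult_IZR. side.
Qed.

(** Blocks with M below M0 are covered by a constant that does not depend on h and k; h is first
    reduced mod k, as [block_bound] asks for 0 <= h < k. *)
Lemma psum_from_blocks C0 a c M0 : 0 < c -> 0 <= a -> 0 < C0 -> 1 <= M0 ->
  (forall (h k : Z) (M m len : nat), (0 <= h < k)%Z -> Z.gcd h k = 1%Z -> M0 <= INR M -> INR M <= 2 * INR m + 1 -> (m + len)%nat = M ->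
    INR m + INR len = INR M ->
    Cmod (Csum (fun n => t n * e (IZR n * (IZR h / IZR k)))%C (zrange (Z.of_nat m + 1) len)) <= C0 * (Rpower (IZR k) a * Rpower (INR M) c)) ->
  exists B, 0 < B /\ forall (h k : Z) (M : nat), (1 <= k)%Z -> Z.gcd h k = 1%Z -> (1 <= M)%nat ->
    Cmod (psum t M (IZR h / IZR k)) <= B * (Rpower (IZR k) a * Rpower (INR M) c).
Proof.
 intros Hc Ha HC HM0 Hb. set (A0 := Rsum (fun n => Cmod (t n)) (zrange 1 (Z.to_nat (up M0)))).
 assert (HA0 : 0 <= A0) by (apply Rsum_nonneg; intros; apply Cmod_ge_0). assert (P2 : 0 < Rpower 2 (- c) < 1).
 { split; [side|]. rewrite <- (Rpower_O 2) by lra. apply Rpower_lt; lra. } exists (A0 + 1 + C0 / (1 - Rpower 2 (- c))).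
 have Hq : 0 <= C0 / (1 - Rpower 2 (- c)). split; [lra|]. intros h k M Hk Hg HM. rewrite reduce_mod by assumption.
 have Hk1 : 1 <= IZR k.
 assert (Hg2 : Z.gcd (h mod k) k = 1%Z) by (rewrite Z.gcd_mod by lia; rewrite Z.gcd_comm; assumption).
 note (Z.mod_pos_bound h k !!) as Hh. have Hkk : 1 <= Rpower (IZR k) a.
 eapply Rle_trans; [apply (dyadic_psum t _ A0 (C0 * Rpower (IZR k) a) c M0); try assumption; [side| |]|].
 - intros M' HM'. upto psum_trivial. apply Rsum_zrange_mono; [side|]. destruct (archimed M0) as [U1 U2]. apply INR_le.
  rewrite (INR_IZR_INZ (Z.to_nat (up M0))), Z2Nat.id; [lra|]. apply le_IZR. lra.
 - intros M' m len HM' Em El. rewrite Rmult_assoc. apply Hb; try assumption.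
  + note (Nat.div_mod M' 2 !!). note (Nat.mod_upper_bound M' 2 !!).
   replace (2 * INR m + 1) with (INR (2 * m + 1)) by (rewrite plus_INR, mult_INR; simpl; ring). side.
  + rewrite <- plus_INR, El. reflexivity.
 - rewrite <- Rmult_assoc. mul_r.
  replace (C0 * Rpower (IZR k) a / (1 - Rpower 2 (- c))) with (C0 / (1 - Rpower 2 (- c)) * Rpower (IZR k) a) by (field; lra).
  nra.
Qed.

(** [unweight] restores a factor sqrt N, and y of size 1/N turns y^(1/8) into N^(-1/8); 1/2 - 1/8 =
    3/8. The logarithm goes into the small exponents. *)
Lemma theorem_W eps : 0 < eps -> exists B, 0 < B /\ forall (h k : Z) (M : nat), (1 <= k)%Z -> Z.gcd h k = 1%Z -> (1 <= M)%nat ->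
  Cmod (psum t M (IZR h / IZR k)) <= B * (Rpower (IZR k) (1 / 4 + eps) * Rpower (INR M) (3 / 8 + eps)).
Proof.
 intros Heps. destruct (unweight kappa t) as (v0 & C0 & Hv0 & HC0 & UW). set (d := eps / 2).
 assert (HP1 : 1 < PI) by (note PI2_3_2; lra). set (b1 := v0 / (2 * PI)). set (b2 := 3 / 2 * v0 / PI).
 have Hb1 : 0 < b1.
 destruct (block_bound psi t (wt kappa) (dwt kappa) FF d b1 b2 ltac:(unfold d; lra) Hb1) as (B1 & HB1 & BB).
 set (Y := Rpower (v0 / PI) (1 / 8 - d)). set (C1 := C0 * (B1 * Y * (Rpower 65 d / d))). have Hd : 0 < d.
 have HC1 : 0 < C1. apply (psum_from_blocks C1 _ _ v0); [lra|lra|assumption|assumption|].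
 intros h k M m len Hh Hg HM HmN El ElN. set (x := IZR h / IZR k). set (N := INR M) in *. have Hk1 : 1 <= IZR k.
 have HN : 1 <= N. set (y := v0 / (PI * N)). have HPN : 0 < PI * N. have Hy0 : 0 < y. assert (Hy1 : y <= 1).
 { cancel_r (PI * N). unfold y, Rdiv. rewrite Rmult_assoc, Rinv_l by lra. nra. }
 set (E := B1 * (Rpower (IZR k) (1 / 4) * Rpower y (1 / 8 - d)) * ln (1 + 64 * IZR k ^ 2 * N)).
 have Hk2 : 1 <= IZR k ^ 2. have PkN : 1 <= IZR k ^ 2 * N. assert (HE : 0 <= E).
 { apply Rmult_le_pos; [side|]. rewrite <- ln_1. left. apply ln_increasing; lra. }
 eapply Rle_trans; [apply (UW (Z.of_nat m) len N x E); try lia; try assumption|].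
 - rewrite <- INR_IZR_INZ. lra.
 - rewrite <- INR_IZR_INZ. lra.
 - intros l Hl. have Hll : INR l <= INR len.
  apply BB; try lia; try assumption; try (split; assumption); rewrite <- ?INR_IZR_INZ; try lra.
  + via (N / 2 * y); [right; unfold b1, y; field; lra|]. side.
  + via (3 / 2 * N * y); [side|]. right. unfold b2, y. side.
 - assert (Ey : Rpower y (1 / 8 - d) = Y * Rpower N (- (1 / 8 - d))).
  { unfold Y. rewrite <- Rpower_inv_base by lra. rewrite Rpower_mult_distr; [|side|side]. f_equal. side. }
  assert (HL : ln (1 + 64 * IZR k ^ 2 * N) <= Rpower 65 d / d * (Rpower (IZR k) eps * Rpower N d)).
  { via (ln (65 * (IZR k ^ 2 * N))).
   - destruct (Rle_lt_or_eq_dec (1 + 64 * IZR k ^ 2 * N) (65 * (IZR k ^ 2 * N)) !!) as [Hl|Hl]; [left; apply ln_increasing; lra|right; f_equal; assumption].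
   - eapply Rle_trans; [apply (ln_le_Rpower _ d); lra|]. rewrite <- Rpower_mult_distr by lra.
    rewrite <- Rpower_mult_distr by lra. rewrite <- Rpower_pow by lra. rewrite Rpower_mult.
    replace (INR 2 * d) with eps by (unfold d; simpl; field). side. }
  assert (Hsq : sqrt N = Rpower N (/ 2)) by (rewrite Rpower_sqrt by lra; reflexivity).
  via (C0 * (B1 * (Rpower (IZR k) (1 / 4) * (Y * Rpower N (- (1 / 8 - d)))) * (Rpower 65 d / d * (Rpower (IZR k) eps * Rpower N d))) * Rpower N (/ 2)).
  + rewrite Hsq. mul_r. mul_l. unfold E. rewrite Ey. side.
  + right. unfold C1. replace (3 / 8 + eps) with (- (1 / 8 - d) + (d + / 2)) by side. rewrite !Rpower_plus. ring.
Qed.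
End ThmW.

(** * Arcs up to length 1, and periodicity *)

Section LongArc.
Variables (psi : C -> C) (t : Z -> C) (w dw : Z -> R -> R).
Hypothesis FF : form_facts psi t w dw.

Lemma near_cusp_half : exists B, 0 < B /\ forall (h k a : Z) (y u : R),
  (1 <= k)%Z -> Z.divide k (a * h + 1) -> 0 < y -> 0 <= u <= 8 * y ->
  Cmod (psi (IZR h / IZR k + u, y)) <= B * (IZR k * sqrt y).
Proof.
 destruct (ff_decay _ _ _ _ FF (1 / 2) !!) as (B & HB & Dec). exists (B * Rpower 65 (1 / 2)). split; [side|].
 intros h k a y u Hk [m Hm] Hy Hu. have Hk1 : 1 <= IZR k.
 note (ff_mobius _ _ _ _ FF a (- m) k (- h) (IZR h / IZR k + u) y !! !! Hy) as M.
 replace (IZR h / IZR k + u + IZR (- h) / IZR k) with u in M by (rewrite opp_IZR; field; lra). rewrite M.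
 have P2 : 0 < IZR k ^ 2 * (u ^ 2 + y ^ 2). have Pk : 0 < IZR k ^ 2.
 eapply Rle_trans; [apply Dec; apply Rdiv_lt_0_compat; assumption|]. rewrite Rmult_assoc. mul_l.
 via (Rpower (/ (65 * (IZR k ^ 2 * y))) (- (1 / 2))).
 - apply Rpower_anti; [side| |lra].
  replace (/ (65 * (IZR k ^ 2 * y))) with (y / (IZR k ^ 2 * (65 * y ^ 2))) by side. mul_l.
  apply Rinv_le_contravar; [side|]. mul_l. side.
 - rewrite Rpower_inv_base by nra. replace (- - (1 / 2)) with (1 / 2) by ring. have : 0 < IZR k ^ 2 * y.
  rewrite <- Rpower_mult_distr by lra. rewrite <- Rpower_mult_distr by lra. rewrite <- Rpower_pow by lra.
  rewrite Rpower_mult. replace (INR 2 * (1 / 2)) with 1 by (simpl; field). rewrite Rpower_1 by lra.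
  replace (1 / 2) with (/ 2) by field. rewrite (Rpower_sqrt y) by assumption. lra.
Qed.

(** No condition links x to k here, since [regime_one] holds on all scales above y. The y under the
    root covers x < 8 y, where [near_cusp_half] gives k sqrt y. *)
Lemma long_arc_bound eps : 0 < eps -> exists B, 0 < B /\
  forall (h k : Z) (y mu x : R),
  (1 <= k)%Z -> Z.gcd h k = 1%Z -> 0 < y <= 1 -> 0 <= x <= 1 ->
  Cmod (cint (fun u => psi ((IZR h / IZR k + u)%R, y) * e (mu * u))%C 0 x) <=
    B * (Rpower (IZR k) (1 + 2 * eps) * Rpower y (- eps)) * (x * sqrt (x + y)).
Proof.
 intros Heps. destruct (regime_one FF eps Heps) as (B1 & HB1 & D). destruct near_cusp_half as (B2 & HB2 & Nc).
 set (B1' := B1 * Rpower 5 eps). have HB1' : 0 < B1'. exists (B1' + B2). split; [lra|]. intros h k y mu x Hk Hg Hy.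
 destruct al_exists as (al & Hal & _). note (Hal h k Hk Hg) as Hdiv. have Hk1 : 1 <= IZR k.
 set (P := Rpower (IZR k) (1 + 2 * eps) * Rpower y (- eps)). have Rk : 1 <= Rpower (IZR k) (2 * eps).
 assert (Rpy : 1 <= Rpower y (- eps)).
 { via (Rpower 1 (- eps)); [rewrite Rpower_1_base; lra|]. apply Rpower_anti; lra. }
 assert (EP : P = IZR k * (Rpower (IZR k) (2 * eps) * Rpower y (- eps))).
 { unfold P. rewrite Rpower_plus, Rpower_1 by lra. ring. } assert (HPk : IZR k <= P).
 { have : 1 <= Rpower (IZR k) (2 * eps) * Rpower y (- eps). nra. }
 set (F := fun u => (psi ((IZR h / IZR k + u)%R, y) * e (mu * u))%C).
 assert (CF : forall u, ccont F u) by (intros; apply (psi_line_cont psi t w dw FF); lra).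
 assert (Ind : forall n x, x <= 8 * y * 2 ^ n -> 0 <= x <= 1 -> Cmod (cint F 0 x) <= (B1' + B2) * P * (x * sqrt (x + y))).
 { clear x. intros n. induction n as [|n IH]; intros x Hxn Hx; note (sqrt_pos (x + y)) as Sp.
  - via ((x - 0) * (B2 * (IZR k * sqrt y))).
   + eapply cint_bound; [lra| |apply cint_ok; side]. intros u Hu. unfold F.
    rewrite Cmod_mult, Cmod_e, Rmult_1_r. apply (Nc h k (al h k)); trivial; lra.
   + via (B2 * P * (x * sqrt (x + y))).
    * replace ((x - 0) * (B2 * (IZR k * sqrt y))) with (B2 * IZR k * (x * sqrt y)) by ring. side.
    * side.
  - destruct (Rle_lt_dec x (8 * y)) as [H8|H8].
   + apply IH; [|side]. have : 1 <= 2 ^ n. nra.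
   + rewrite (cint_chasles F 0 (x / 2) x); [|lra|lra|side]. upto Cmod_triangle.
    note (IH (x / 2) ltac:(simpl in Hxn; lra) !!) as I1.
    note (D h k (al h k) y mu (x / 2) (x / 2) x Hk Hdiv !! !! !! !! !!) as I2. fold F in I2.
    assert (E2 : Rpower (y / (5 * IZR k ^ 2 * (x / 2) ^ 2)) (- eps) <= Rpower 5 eps * (Rpower (IZR k) (2 * eps) * Rpower y (- eps))).
    { have Pk2 : 0 < IZR k ^ 2. via (Rpower (/ 5 * (/ IZR k ^ 2 * y)) (- eps)).
     - apply Rpower_anti; [|replace (/ 5 * (/ IZR k ^ 2 * y)) with (y / (5 * IZR k ^ 2)) by side|lra].
      + side.
      + mul_l. apply Rinv_le_contravar.
       * side.
       * rewrite <- (Rmult_1_r (5 * IZR k ^ 2)) at 2. mul_l. side.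
     - have I0 : 0 < / IZR k ^ 2. rewrite <- Rpower_mult_distr by side. rewrite <- Rpower_mult_distr by lra.
      rewrite !Rpower_inv_base by lra. replace (- - eps) with eps by ring. rewrite <- Rpower_pow by lra.
      rewrite Rpower_mult. replace (INR 2 * eps) with (2 * eps) by side. lra. }
    assert (I3 : Cmod (cint F (x / 2) x) <= B1' * P * (x / 2 * sqrt (x + y))).
    { upto I2.
     via (B1 * (IZR k * (x / 2 * sqrt (x + y))) * (Rpower 5 eps * (Rpower (IZR k) (2 * eps) * Rpower y (- eps)))).
     - side.
     - side. }
    have I4 : (B1' + B2) * P * (x / 2 * sqrt (x / 2 + y)) <= (B1' + B2) * P * (x / 2 * sqrt (x + y)).
    have I5 : 0 <= B2 * P * (x / 2 * sqrt (x + y)). lra. }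
 intros Hx. destruct (dyadic_count (8 * y) x !!) as (n & Hn & _). apply (Ind n); side.
Qed.

Lemma long_arc_bound_side eps : 0 < eps -> exists B, 0 < B /\
  forall (h k : Z) (y mu x s : R),
  (1 <= k)%Z -> Z.gcd h k = 1%Z -> 0 < y <= 1 -> 0 <= x <= 1 -> s = 1 \/ s = -1 ->
  Cmod (cint (fun u => psi ((IZR h / IZR k + s * u)%R, y) * e (mu * u))%C 0 x) <=
    B * (Rpower (IZR k) (1 + 2 * eps) * Rpower y (- eps)) * (x * sqrt (x + y)).
Proof.
 intros Heps. destruct (long_arc_bound eps Heps) as (B & HB & H). exists B. split; [side|].
 intros h k y mu x s Hk Hg Hy Hx [Hs|Hs].
 - rewrite (cint_ext _ (fun u => psi ((IZR h / IZR k + u)%R, y) * e (mu * u))%C); [side|]. intros u.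
  rewrite Hs, Rmult_1_l. side.
 - destruct (ff_parity _ _ _ _ FF) as (sg & Hsg & Par).
  specialize (H (- h)%Z k y mu x Hk ltac:(rewrite Z.gcd_opp_l; assumption) Hy Hx).
  assert (I : is_cint (fun u => psi ((IZR h / IZR k + s * u)%R, y) * e (mu * u))%C 0 x (sg * cint (fun u => psi ((IZR (- h) / IZR k + u)%R, y) * e (mu * u))%C 0 x)%C).
  { eapply is_cint_ext_le; [lra| |apply is_cint_scal; apply cint_ok; [lra|intros; apply (psi_line_cont psi t w dw FF); lra]].
   intros u Hu. simpl. rewrite Cmult_assoc. rewrite <- Par by lra. f_equal. f_equal. f_equal. rewrite opp_IZR, Hs. side. }
  rewrite (cint_eq _ _ _ _ I), Cmod_mult, Hsg. lra.
Qed.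

(** [ff_mobius] concerns maps with c <> 0, so the translation is read off the Fourier expansion. *)
Lemma psi_period x y : 0 < y -> psi (x + 1, y) = psi (x, y).
Proof.
 intros Hy. destruct (ff_fourier _ _ _ _ FF y Hy) as (B & HB & Ff).
 assert (E : forall N, Csum (fun n => t n * w n y * e (IZR n * (x + 1)))%C (zs N) = Csum (fun n => t n * w n y * e (IZR n * x))%C (zs N)).
 { intros N. apply Csum_ext. intros n _. f_equal. rewrite Rmult_plus_distr_l, Rmult_1_r. apply e_add_Z. }
 assert (Bd : forall N : nat, Cmod (psi ((x + 1)%R, y) - psi (x, y))%C <= 2 * B / INR (S N)).
 { intros N. note (Ff (x + 1) y N (Rle_refl y)) as F1. note (Ff x y N (Rle_refl y)) as F2. rewrite E in F1.
  set (Sm := Csum (fun n => t n * w n y * e (IZR n * x))%C (zs N)) in *.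
  replace (psi ((x + 1)%R, y) - psi (x, y))%C with ((psi ((x + 1)%R, y) - Sm) - (psi (x, y) - Sm))%C by ring.
  upto Cmod_triangle. rewrite Cmod_opp. side. }
 assert (Z0 : Cmod (psi ((x + 1)%R, y) - psi (x, y))%C <= 0).
 { apply Rnot_lt_le. intros Hp.
  destruct (archimed_cor1 (Cmod (psi ((x + 1)%R, y) - psi (x, y))%C / (2 * B)) ltac:(apply Rdiv_lt_0_compat; lra)) as (n & Hn & Hn0).
  specialize (Bd n). have Pn : 0 < INR n. have : / INR (S n) <= / INR n.
  set (c := Cmod (psi ((x + 1)%R, y) - psi (x, y))%C) in *. assert (2 * B * / INR n < c).
  { replace c with (2 * B * (c / (2 * B))) by side. side. } side. }
 note (Cmod_ge_0 (psi ((x + 1)%R, y) - psi (x, y))%C).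
 assert (E0 : (psi ((x + 1)%R, y) - psi (x, y) = 0)%C) by (apply Cmod_eq_0; lra).
 replace (psi (x + 1, y)) with ((psi ((x + 1)%R, y) - psi (x, y)) + psi (x, y))%C by ring. rewrite E0. ring.
Qed.

Lemma period_integral (F : R -> C) a : (forall u, ccont F u) -> (forall u, F (u + 1) = F u) -> 0 <= a <= 1 ->
  cint F 0 1 = cint F (a - 1 / 2) (a + 1 / 2).
Proof.
 intros CF Per Ha. assert (P1 : forall u v, u <= v -> cint F (u + 1) (v + 1) = cint F u v).
 { intros u v Huv. rewrite cint_shift by side. apply cint_ext. side. } destruct (Rle_lt_dec a (1 / 2)) as [H|H].
 - rewrite (cint_chasles F (a - 1 / 2) 0 (a + 1 / 2)) by side. rewrite <- (P1 (a - 1 / 2) 0) by lra.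
  rewrite (cint_chasles F 0 (a + 1 / 2) 1) by side. replace (a - 1 / 2 + 1) with (a + 1 / 2) by field.
  replace (0 + 1) with 1 by ring. ring.
 - rewrite (cint_chasles F (a - 1 / 2) 1 (a + 1 / 2)) by side. rewrite (cint_chasles F 0 (a - 1 / 2) 1) by side.
  replace (cint F 1 (a + 1 / 2)) with (cint F 0 (a - 1 / 2)); [ring|]. rewrite <- P1 by lra. f_equal; field.
Qed.
End LongArc.

(** * Averaging over shifts *)

(** A sum of H consecutive translates of the frequency window: up to a phase the product of two
    Dirichlet kernels, of lengths l and H, hence the square of the sine in [ddker_closed]. *)
Definition ddker (m : Z) (l H : nat) (z : R) : C := Csum (fun j => dker (m + Z.of_nat j) l z) (seq 0 H).

Lemma ddker_closed m l H z :
  (ddker m l H z * ((RtoC (2 * sin (PI * z)) * Ci) * (RtoC (2 * sin (PI * z)) * Ci)) =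
   (e (- (IZR m * z)) - e (- ((IZR m + INR H) * z))) - (e (- ((IZR m + INR l) * z)) - e (- ((IZR m + INR l + INR H) * z))))%C.
Proof.
 set (S := (RtoC (2 * sin (PI * z)) * Ci)%C).
 assert (G : forall (a : Z), (Csum (fun j => e (- ((IZR (a + Z.of_nat j) + 1 / 2) * z))) (seq 0 H) * S = e (- (IZR a * z)) - e (- ((IZR a + INR H) * z)))%C).
 { intros a. note (dker_closed a H z) as K. fold S in K.
  assert (E : Csum (fun j => e (- ((IZR (a + Z.of_nat j) + 1 / 2) * z))) (seq 0 H) = (e (z / 2) * dker a H z)%C).
  { unfold dker, zrange. rewrite Csum_map, <- Csum_scal. apply Csum_ext. intros j _. rewrite <- e_plus. f_equal.
   rewrite !plus_IZR. side. }
  rewrite E, <- Cmult_assoc, K. unfold Cminus. rewrite Cmult_plus_distr_l. rewrite <- e_plus.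
  replace (z / 2 + - ((IZR a + 1 / 2) * z)) with (- (IZR a * z)) by field.
  replace (e (z / 2) * - e (- ((IZR a + INR H + 1 / 2) * z)))%C with (- (e (z / 2) * e (- ((IZR a + INR H + 1 / 2) * z))))%C by ring.
  rewrite <- e_plus. replace (z / 2 + - ((IZR a + INR H + 1 / 2) * z)) with (- ((IZR a + INR H) * z)) by field. side. }
 note (G m) as G1. note (G (m + Z.of_nat l)%Z) as G2. rewrite plus_IZR, <- INR_IZR_INZ in G2. rewrite <- G1, <- G2.
 unfold ddker. rewrite Cmult_assoc. transitivity ((Csum (fun j => dker (m + Z.of_nat j) l z * S)%C (seq 0 H)) * S)%C.
 { f_equal. rewrite Cmult_comm, <- Csum_scal. apply Csum_ext. side. }
 assert (E : Csum (fun j => dker (m + Z.of_nat j) l z * S)%C (seq 0 H) = (Csum (fun j => e (- ((IZR (m + Z.of_nat j) + 1 / 2) * z))) (seq 0 H) - Csum (fun j => e (- ((IZR (m + Z.of_nat l + Z.of_nat j) + 1 / 2) * z))) (seq 0 H))%C).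
 { rewrite <- Csum_minus. apply Csum_ext. intros j _. note (dker_closed (m + Z.of_nat j) l z) as K. fold S in K.
  rewrite K. f_equal. f_equal. f_equal. f_equal. rewrite !plus_IZR, <- !INR_IZR_INZ. ring. }
 rewrite E. ring.
Qed.

Section Average.
Variables (f : R -> C) (s P eta : R).
Hypotheses (Cf : forall u, ccont f u) (Hs : s = 1 \/ s = -1) (HP : 0 <= P) (Heta : 0 < eta)
 (Hf : forall mu x, eta <= x <= 1 / 2 -> Cmod (cint (fun u => (f u * e (mu * u))%C) 0 x) <= P * (x * sqrt x)).

Lemma su_abs u : 0 <= u -> Rabs (0 + s * u) = u.
Proof. intros Hu. rewrite Rplus_0_l. apply sign_abs_mult; side. Qed.

(** Against the arc bound u^(3/2) the derivative 1/u^2 of the cosecant leaves the integral of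
    u^(-1/2), which converges at 0: no logarithm, and a gain sqrt b from shortness. *)
Lemma kernel_half m len b : eta <= b -> b <= 1 / 2 -> INR len * eta <= 1 ->
  Cmod (cint (fun u => (f u * dker m len (0 + s * u))%C) 0 b) <= 11 * P * sqrt b.
Proof.
 intros Hb Hb2 Hlen. assert (Cd : forall u, ccont (fun u => (f u * dker m len (0 + s * u))%C) u).
 { intros u. apply ccont_mult; [side|]. apply ccont_Csum. side. } rewrite (cint_chasles _ 0 eta b) by side.
 have S1 : sqrt eta <= sqrt b. note (sqrt_pos eta) as S0.
 assert (Part1 : Cmod (cint (fun u => (f u * dker m len (0 + s * u))%C) 0 eta) <= P * sqrt eta).
 { assert (I : is_cint (fun u => (f u * dker m len (0 + s * u))%C) 0 eta (Csum (fun n => cint (fm f s (IZR n)) 0 eta) (zrange (m + 1) len))).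
  { eapply is_cint_ext_le; [lra| |apply is_cint_Csum; intros n _; apply cint_ok; [lra|intros; apply fm_cont; exact Cf]].
   intros u Hu. unfold dker. rewrite <- Csum_scal. apply Csum_ext. intros n _. unfold fm. do 2 f_equal. ring. }
  rewrite (cint_eq _ _ _ _ I). upto Cmod_Csum. via (Rsum (fun _ => P * (eta * sqrt eta)) (zrange (m + 1) len)).
  - apply Rsum_le. intros n Hn. apply Hf. lra.
  - rewrite Rsum_const, length_zrange. have : 0 <= P * sqrt eta. nra. }
 assert (Part2 : Cmod (cint (fun u => (f u * dker m len (0 + s * u))%C) eta b) <= 2 * (P * sqrt b) + 8 * P * (sqrt b - sqrt eta)).
 { apply (kernel_split f 0 s m len Cf Hs eta b); [lra|side| |].
  { intros u Hu. apply (cosec_bounds 0 s u u); [lra|side|]. rewrite su_abs by lra. lra. } intros v Hv.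
  apply (parts_bound (fm f s v) (fun u => / sin (PI * (0 + s * u))) (fun u => - (PI * s * cos (PI * (0 + s * u)) / sin (PI * (0 + s * u)) ^ 2)) (fun u => 4 * P * / sqrt u) eta b).
  - lra.
  - side.
  - apply fm_cont. side.
  - intros u Hu. apply cosec_derive; [|side]. apply (cosec_bounds 0 s u u); [lra|side|]. rewrite su_abs by lra. lra.
  - intros u Hu. destruct (cosec_bounds 0 s u u !! Hs ltac:(rewrite su_abs by lra; lra)) as (_ & _ & B2).
   note (sqrt_sqrt u !!) as Su. via (4 / u ^ 2 * (P * (u * sqrt u))).
   + apply Rmult_le_compat; [side|side|side|]. apply Hf; lra.
   + right. replace (u ^ 2) with (u * (sqrt u * sqrt u)) by side. side.
  - assert (K : is_RInt (fun u => 4 * P * / sqrt u) eta b (8 * P * sqrt b - 8 * P * sqrt eta)).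
   { apply (is_RInt_derive (fun u => 8 * P * sqrt u) (fun u => 4 * P * / sqrt u)).
    - intros u. minmax. intros Hu. auto_derive; [lra|]. side.
    - intros u. minmax. side. }
   replace (8 * P * (sqrt b - sqrt eta)) with (8 * P * sqrt b - 8 * P * sqrt eta) by ring. side.
  - assert (Pt : forall u, eta <= u <= b -> Rabs (/ sin (PI * (0 + s * u))) * Cmod (cint (fm f s v) 0 u) <= P * sqrt b).
   { intros u Hu. destruct (cosec_bounds 0 s u u !! Hs ltac:(rewrite su_abs by lra; lra)) as (_ & B1 & _).
    via (/ u * (P * (u * sqrt u))).
    - apply Rmult_le_compat; [side|side|side|]. apply Hf; lra.
    - replace (/ u * (P * (u * sqrt u))) with (P * sqrt u) by side. side. }
   note (Pt b !!). note (Pt eta !!). lra. }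
 upto Cmod_triangle. side.
Qed.

Let A2 u := / sin (PI * (0 + s * u)) ^ 2.
Let dA2 u := - (2 * PI * s * cos (PI * (0 + s * u)) / sin (PI * (0 + s * u)) ^ 3).

Lemma A2_facts u : 0 < u <= 1 / 2 ->
  sin (PI * (0 + s * u)) <> 0 /\ (is_derive A2 u (dA2 u) /\ continuous dA2 u) /\ Rabs (A2 u) <= / u ^ 2 /\ Rabs (dA2 u) <= 8 / u ^ 3.
Proof.
 intros Hu. assert (Hz : Rabs (0 + s * u) <= 5 / 8) by (rewrite su_abs by lra; lra). note (sin_PI_abs _ Hz) as HS.
 rewrite su_abs in HS by lra. set (S := sin (PI * (0 + s * u))) in *.
 assert (Hn : S <> 0) by (intros E; rewrite E, Rabs_R0 in HS; lra). split; [side|]. split; [split|split].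
 - unfold A2, dA2. auto_derive; [fold S; rewrite Rmult_1_r; apply Rmult_integral_contrapositive_currified; assumption|].
  side.
 - apply (ex_derive_continuous dA2). unfold dA2. auto_derive. fold S. rewrite Rmult_1_r.
  repeat apply Rmult_integral_contrapositive_currified; assumption.
 - unfold A2. fold S. rewrite Rabs_inv, <- RPow_abs. side.
 - unfold dA2. fold S. rewrite Rabs_Ropp. unfold Rdiv. rewrite Rabs_mult, Rabs_inv, <- RPow_abs, !Rabs_mult.
  note (sign_abs s Hs) as E. note PI_RGT_0. rewrite (Rabs_pos_eq PI), (Rabs_pos_eq 2) by lra.
  assert (Rabs (cos (PI * (0 + s * u))) <= 1) by (apply Rabs_le; apply COS_bound). apply Rmult_le_compat.
  + side.
  + side.
  + note PI_4. side.
  + side.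
Qed.

(** With the squared cosecant the integrand is u^(-3) u^(3/2), now dominated by the lower end a
    instead of u = 1/2. *)
Lemma kernel_square m l H a : eta <= a -> a <= 1 / 2 ->
  Cmod (cint (fun u => (f u * ddker m l H (0 + s * u))%C) a (1 / 2)) <= 19 * P / sqrt a.
Proof.
 intros Ha Ha2.
 assert (One : forall v, Cmod (cint (fun u => (RtoC (A2 u) * fm f s v u)%C) a (1 / 2)) <= 19 * P / sqrt a).
 { intros v. via (3 * P / sqrt a + (16 * P * / sqrt a - 16 * P * / sqrt (1 / 2))).
  - apply (parts_bound (fm f s v) A2 dA2 (fun u => 8 * P * / (u * sqrt u)) a (1 / 2)).
   + lra.
   + side.
   + apply fm_cont; exact Cf.
   + intros u Hu. apply A2_facts. lra.
   + intros u Hu. destruct (A2_facts u !!) as (_ & _ & _ & B2). note (sqrt_sqrt u !!) as Su.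
    via (8 / u ^ 3 * (P * (u * sqrt u))).
    * apply Rmult_le_compat; [side|side|side|]. apply Hf; lra.
    * right. replace (u ^ 3) with (u * u * (sqrt u * sqrt u)) by side. side.
   + assert (K : is_RInt (fun u => 8 * P * / (u * sqrt u)) a (1 / 2) (- (16 * P) * / sqrt (1 / 2) - - (16 * P) * / sqrt a)).
    { apply (is_RInt_derive (fun u => - (16 * P) * / sqrt u) (fun u => 8 * P * / (u * sqrt u))).
     - intros u. minmax. intros Hu. note (sqrt_sqrt u !!) as Su. auto_derive; [side|].
      replace (u * sqrt u) with (sqrt u * sqrt u * sqrt u) by side. side.
     - intros u. minmax. side. }
    replace (16 * P * / sqrt a - 16 * P * / sqrt (1 / 2)) with (- (16 * P) * / sqrt (1 / 2) - - (16 * P) * / sqrt a) by ring.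
    side.
   + assert (Pt : forall u, a <= u <= 1 / 2 -> Rabs (A2 u) * Cmod (cint (fm f s v) 0 u) <= P / sqrt a).
    { intros u Hu. destruct (A2_facts u !!) as (_ & _ & B1 & _). note (sqrt_sqrt u !!) as Su.
     via (/ u ^ 2 * (P * (u * sqrt u))).
     - apply Rmult_le_compat; [side|side|side|]. apply Hf; lra.
     - replace (/ u ^ 2 * (P * (u * sqrt u))) with (P * / sqrt u).
      + mul_l. side.
      + replace (u ^ 2) with (u * (sqrt u * sqrt u)) by side. side. }
    note (Pt (1 / 2) !!). note (Pt a !!). have : 0 <= P / sqrt a. side.
  - have : 0 < / sqrt (1 / 2). side. }
 set (I1 := cint (fun u => (RtoC (A2 u) * fm f s (IZR m) u)%C) a (1 / 2)).
 set (I2 := cint (fun u => (RtoC (A2 u) * fm f s (IZR m + INR H) u)%C) a (1 / 2)).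
 set (I3 := cint (fun u => (RtoC (A2 u) * fm f s (IZR m + INR l) u)%C) a (1 / 2)).
 set (I4 := cint (fun u => (RtoC (A2 u) * fm f s (IZR m + INR l + INR H) u)%C) a (1 / 2)).
 assert (CA : forall v, is_cint (fun u => (RtoC (A2 u) * fm f s v u)%C) a (1 / 2) (cint (fun u => (RtoC (A2 u) * fm f s v u)%C) a (1 / 2))).
 { intros v. apply cint_ok; [side|]. intros u Hu.
  apply ccont_mult; [apply ccont_R; eapply derive_cont; apply A2_facts; lra|apply fm_cont; exact Cf]. }
 assert (I : is_cint (fun u => (f u * ddker m l H (0 + s * u))%C) a (1 / 2) (RtoC (- (1 / 4)) * ((I1 - I2) - (I3 - I4)))%C).
 { eapply is_cint_ext_le; [side| |apply is_cint_scal; apply is_cint_minus; apply is_cint_minus; apply CA]. intros u Hu.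
  destruct (A2_facts u !!) as (Hn & _). note (ddker_closed m l H (0 + s * u)) as K. unfold A2.
  set (S := sin (PI * (0 + s * u))) in *.
  assert (ED : ddker m l H (0 + s * u) = (RtoC (- (1 / 4)) * RtoC (/ S ^ 2) * ((e (- (IZR m * (0 + s * u))) - e (- ((IZR m + INR H) * (0 + s * u)))) - (e (- ((IZR m + INR l) * (0 + s * u))) - e (- ((IZR m + INR l + INR H) * (0 + s * u))))))%C).
  { rewrite <- K. assert (E3 : (RtoC (2 * S) * Ci * (RtoC (2 * S) * Ci) = RtoC (- (4 * S ^ 2)))%C).
   { unfold Ci, Cmult, RtoC; simpl. f_equal; ring. } rewrite E3.
   transitivity (ddker m l H (0 + s * u) * (RtoC (- (1 / 4)) * RtoC (/ S ^ 2) * RtoC (- (4 * S ^ 2))))%C; [|ring].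
   rewrite <- !RtoC_mult. replace (- (1 / 4) * / S ^ 2 * - (4 * S ^ 2)) with 1 by side. ring. }
  rewrite ED. unfold fm. replace (- (IZR m * (0 + s * u))) with (- IZR m * s * u) by ring.
  replace (- ((IZR m + INR H) * (0 + s * u))) with (- (IZR m + INR H) * s * u) by ring.
  replace (- ((IZR m + INR l) * (0 + s * u))) with (- (IZR m + INR l) * s * u) by ring.
  replace (- ((IZR m + INR l + INR H) * (0 + s * u))) with (- (IZR m + INR l + INR H) * s * u) by ring. ring. }
 rewrite (cint_eq _ _ _ _ I). rewrite Cmod_mult, Cmod_R, Rabs_Ropp, (Rabs_pos_eq (1 / 4)) by lra.
 assert (T : Cmod ((I1 - I2) - (I3 - I4))%C <= Cmod I1 + Cmod I2 + (Cmod I3 + Cmod I4)).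
 { upto Cmod_triangle. rewrite Cmod_opp. apply Rplus_le_compat; (upto Cmod_triangle); rewrite Cmod_opp; lra. }
 note (One (IZR m)). note (One (IZR m + INR H)). note (One (IZR m + INR l)). note (One (IZR m + INR l + INR H)).
 fold I1 in H0. fold I2 in H1. fold I3 in H2. fold I4 in H3. lra.
Qed.

(** The range is cut at 1/H. Below, H separate kernels give H P / sqrt H; above, [kernel_square]
    gives P sqrt H. *)
Lemma kernel_average m l H : INR l * eta <= 1 -> (2 <= H)%nat -> INR H * eta <= 1 ->
  Cmod (cint (fun u => (f u * ddker m l H (0 + s * u))%C) 0 (1 / 2)) <= 30 * P * sqrt (INR H).
Proof.
 intros Hl H2 HHe. assert (HH : 2 <= INR H) by (replace 2 with (INR 2) by side; apply le_INR; assumption).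
 set (b := / INR H). assert (Hb2 : b <= 1 / 2). { replace (1 / 2) with (/ 2) by field. side. } assert (Heb : eta <= b).
 { unfold b. cancel_r (INR H). rewrite Rinv_l by lra. lra. }
 assert (Cd : forall j u, ccont (fun u => (f u * dker (m + Z.of_nat j) l (0 + s * u))%C) u).
 { intros j u. apply ccont_mult; [side|]. apply ccont_Csum. side. }
 assert (CD : forall u, ccont (fun u => (f u * ddker m l H (0 + s * u))%C) u).
 { intros u. apply ccont_ext with (fun u => Csum (fun j => (f u * dker (m + Z.of_nat j) l (0 + s * u))%C) (seq 0 H)).
  - intros v. unfold ddker. rewrite <- Csum_scal. side.
  - apply ccont_Csum. side. }
 rewrite (cint_chasles _ 0 b (1 / 2)) by side. assert (Sb : sqrt b = / sqrt (INR H)) by (unfold b; apply sqrt_inv).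
 note (sqrt_sqrt (INR H) !!) as SS.
 assert (P1 : Cmod (cint (fun u => (f u * ddker m l H (0 + s * u))%C) 0 b) <= 11 * P * sqrt (INR H)).
 { assert (I : is_cint (fun u => (f u * ddker m l H (0 + s * u))%C) 0 b (Csum (fun j => cint (fun u => (f u * dker (m + Z.of_nat j) l (0 + s * u))%C) 0 b) (seq 0 H))).
  { eapply is_cint_ext_le; [lra| |apply is_cint_Csum; intros j _; apply cint_ok; side]. intros u Hu.
   unfold ddker. rewrite <- Csum_scal. side. }
  rewrite (cint_eq _ _ _ _ I). upto Cmod_Csum. via (Rsum (fun _ => 11 * P * sqrt b) (seq 0 H)).
  - apply Rsum_le. intros j _. apply kernel_half; assumption.
  - rewrite Rsum_const, length_seq, Sb. right. rewrite <- SS at 1. side. }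
 assert (P2 : Cmod (cint (fun u => (f u * ddker m l H (0 + s * u))%C) b (1 / 2)) <= 19 * P * sqrt (INR H)).
 { eapply Rle_trans; [apply kernel_square; assumption|]. rewrite Sb. side. } upto Cmod_triangle. lra.
Qed.
End Average.

Lemma Csum_zrange_add (f : Z -> C) lo a b :
  Csum f (zrange lo (a + b)) = (Csum f (zrange lo a) + Csum f (zrange (lo + Z.of_nat a) b))%C.
Proof.
 induction b as [|b IH].
 - rewrite Nat.add_0_r. simpl. ring.
 - rewrite Nat.add_succ_r, !Csum_zrange_S, IH, Nat2Z.inj_add, Z.add_assoc. ring.
Qed.

(** Shifting the window by j changes the sum by j terms at each end. *)
Lemma shift_average (f : Z -> C) lo l H G : 0 <= G ->
  (forall n, (lo <= n < lo + Z.of_nat l + Z.of_nat H)%Z -> Cmod (f n) <= G) ->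
  INR H * Cmod (Csum f (zrange lo l)) <=
  Cmod (Csum (fun j => Csum f (zrange (lo + Z.of_nat j) l)) (seq 0 H)) + INR H * (2 * INR H * G).
Proof.
 intros HG Hf. set (T := fun j => Csum f (zrange (lo + Z.of_nat j) l)). set (T0 := Csum f (zrange lo l)).
 assert (Hs : forall a j, (lo <= a)%Z -> (a + Z.of_nat j <= lo + Z.of_nat l + Z.of_nat H)%Z -> Cmod (Csum f (zrange a j)) <= INR j * G).
 { intros a j Ha Hj. upto Cmod_Csum. rewrite <- length_zrange at 2. rewrite <- Rsum_const. apply Rsum_le. intros n Hn.
  apply in_zrange_iff in Hn. apply Hf. lia. }
 assert (D : forall j, In j (seq 0 H) -> Cmod (T j - T0)%C <= 2 * INR H * G).
 { intros j Hj. apply in_seq in Hj.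
  assert (E : (T j - T0 = Csum f (zrange (lo + Z.of_nat l) j) - Csum f (zrange lo j))%C).
  { note (Csum_zrange_add f lo l j) as E1. note (Csum_zrange_add f lo j l) as E2. rewrite Nat.add_comm, E1 in E2.
   fold (T j) in E2. fold T0 in E2. transitivity (Csum f (zrange lo j) + T j - T0 - Csum f (zrange lo j))%C; [ring|].
   rewrite <- E2. ring. }
  rewrite E. upto Cmod_triangle. rewrite Cmod_opp. note (Hs (lo + Z.of_nat l)%Z j !! !!). note (Hs lo j !! !!).
  have : INR j <= INR H. side. }
 assert (E : (RtoC (INR H) * T0 = Csum T (seq 0 H) - Csum (fun j => T j - T0)%C (seq 0 H))%C).
 { rewrite <- Csum_minus. transitivity (Csum (fun _ : nat => (T0 * RtoC 1)%C) (seq 0 H)).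
  - rewrite Csum_scal, Csum_R, Rsum_const, length_seq, Rmult_1_r. ring.
  - apply Csum_ext. side. }
 rewrite <- (Rabs_pos_eq (INR H)) at 1 by apply pos_INR. rewrite <- Cmod_R, <- Cmod_mult, E. upto Cmod_triangle.
 rewrite Cmod_opp. apply Rplus_le_compat_l. upto Cmod_Csum. rewrite <- (length_seq H 0) at 2. rewrite <- Rsum_const.
 apply Rsum_le. side.
Qed.

Lemma ddker_period m l H z i : ddker m l H (z - IZR i) = ddker m l H z.
Proof. apply Csum_ext. intros j _. apply dker_period. Qed.

Lemma ccont_ddker m l H x0 u : ccont (fun x => ddker m l H (x - x0)) u.
Proof. apply ccont_Csum. intros j _. apply ccont_Csum. side. Qed.

Section ThmV.
Variables (kappa theta : R) (psi : C -> C) (t : Z -> C).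
Hypotheses (FF : form_facts psi t (wt kappa) (dwt kappa)) (Htheta : 0 <= theta) (Hcoeff : coeff_exponent t theta).

(** The first term is [kernel_average] divided by H. The second comes from the terms gained or lost
    by the shifts, where |t n| << N^(theta + d) and the weight is << N^(-1/2). *)
Lemma averaged_block d v0 : 0 < d -> 1 <= v0 -> exists B, 0 < B /\ forall (h k m : Z) (l H : nat) (N : R),
  (0 <= h < k)%Z -> Z.gcd h k = 1%Z -> (0 <= m)%Z -> v0 <= N -> N / 2 <= IZR m + 1 ->
  IZR m + INR l + INR H <= 2 * N -> INR l <= N -> (2 <= H)%nat -> INR H <= N ->
  Cmod (Csum (fun n => t n * wt kappa n (v0 / (PI * N)) * e (IZR n * (IZR h / IZR k)))%C (zrange (m + 1) l)) <=
  B * (Rpower (IZR k) (1 + 2 * d) * Rpower N d / sqrt (INR H) + INR H * Rpower N (theta + d - / 2)).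
Proof.
 intros Hd Hv0. note PI_RGT_0 as HP. assert (HP1 : 1 < PI) by (note PI2_3_2; lra). note PI_4 as HP4.
 destruct (long_arc_bound_side psi t (wt kappa) (dwt kappa) FF d Hd) as (B1 & HB1 & LA).
 destruct (ff_wbound _ _ _ _ FF 1 !!) as (Bw & HBw & WB). destruct (Hcoeff d Hd) as (Bc0 & HBc0).
 set (Bc := Rmax Bc0 0). assert (HBc : 0 <= Bc) by apply Rmax_r.
 assert (CB : forall n, (1 <= n)%Z -> Cmod (t n) <= Bc * Rpower (IZR n) (theta + d)).
 { intros n Hn. eapply Rle_trans; [apply HBc0; assumption|]. apply Rmult_le_compat_r; [side|apply Rmax_l]. }
 set (K1 := 60 * (B1 * Rpower (v0 / PI) (- d) * sqrt (1 + v0))).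
 set (K2 := 2 * (Bc * Rpower 2 (theta + d) * (Bw * Rpower (v0 / PI) (/ 2) * 8))). have HK1 : 0 <= K1.
 have HK2 : 0 <= K2. exists (K1 + K2 + 1). split; [lra|]. intros h k m l H N Hh Hg Hm HN HNm Hsum Hl HH2 HHN.
 have HN1 : 1 <= N. have Hk1 : 1 <= IZR k. set (y := v0 / (PI * N)). have HPN : 0 < PI * N. have Hy0 : 0 < y.
 assert (Hy1 : y <= 1). { cancel_r (PI * N). unfold y, Rdiv. rewrite Rmult_assoc, Rinv_l by lra. nra. }
 assert (Ey : forall a, Rpower y a = Rpower (v0 / PI) a * Rpower N (- a)).
 { intros a. rewrite <- Rpower_inv_base by lra. rewrite Rpower_mult_distr; [|side|side]. f_equal. side. }
 assert (HHr : 2 <= INR H) by (replace 2 with (INR 2) by side; apply le_INR; assumption). have SH : 0 < sqrt (INR H).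
 note (sqrt_sqrt (INR H) !!) as SS. set (x0 := IZR h / IZR k). assert (Hx0 : 0 <= x0 <= 1).
 { destruct Hh as [Hh1 Hh2]. apply IZR_le in Hh1. apply IZR_lt in Hh2. side. }
 set (P := B1 * (Rpower (IZR k) (1 + 2 * d) * Rpower y (- d)) * sqrt (1 + v0)). have HPp : 0 <= P.
 set (f := fun n => (t n * wt kappa n y * e (IZR n * x0))%C).
 set (G := Bc * Rpower (2 * N) (theta + d) * (Bw * sqrt y * 8)). have HG : 0 <= G.
 assert (Hf : forall n, (m + 1 <= n < m + 1 + Z.of_nat l + Z.of_nat H)%Z -> Cmod (f n) <= G).
 { intros n Hn. assert (N1 : IZR m + 1 <= IZR n) by (rewrite <- plus_IZR; apply IZR_le; lia).
  assert (N2 : IZR n <= 2 * N). { via (IZR m + INR l + INR H); [|side]. rewrite !INR_IZR_INZ, <- !plus_IZR. side. }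
  unfold f. rewrite !Cmod_mult, Cmod_e, Rmult_1_r, Cmod_R. apply Rmult_le_compat; [side|side| |].
  - eapply Rle_trans; [apply CB; lia|]. side.
  - destruct (WB n y !! Hy0) as [W1 _]. upto W1. mul_l.
   rewrite Rpower_Ropp, Rpower_1 by (apply Rmult_lt_0_compat; [apply Rabs_pos_lt; lra|side]).
   rewrite Rabs_pos_eq by lra. assert (Q1 : / 8 <= IZR n * y).
   { via (N / 2 * y); [|side]. replace (N / 2 * y) with (v0 / 2 * / PI) by (unfold y; field; lra).
    via (1 / 2 * / 4); [lra|]. side. }
   rewrite <- Rinv_inv. side. }
 note (shift_average f (m + 1) l H G HG Hf) as SA. set (J := cint (fun x => (psi (x, y) * ddker m l H (x - x0))%C) 0 1).
 assert (EJ : Csum (fun j => Csum f (zrange (m + 1 + Z.of_nat j) l)) (seq 0 H) = J).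
 { symmetry. apply cint_eq. eapply is_cint_ext_le; [lra| |apply is_cint_Csum].
  - intros x _. unfold ddker. rewrite <- Csum_scal. side.
  - intros j _. replace (m + 1 + Z.of_nat j)%Z with (m + Z.of_nat j + 1)%Z by lia. unfold f.
   rewrite (block_integral psi t (wt kappa) (dwt kappa) FF) by side. apply cint_ok; [lra|]. intros x _.
   apply (block_cont psi t (wt kappa) (dwt kappa) FF). side. }
 set (F := fun x => (psi (x, y) * ddker m l H (x - x0))%C). assert (CF : forall u, ccont F u).
 { intros u. apply ccont_mult; [|apply ccont_ddker]. eapply ff_cont; side. } assert (PF : forall u, F (u + 1) = F u).
 { intros u. unfold F. rewrite (psi_period psi t _ _ FF) by assumption. f_equal.
  rewrite <- (ddker_period m l H (u + 1 - x0) 1). f_equal. ring. }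
 assert (Side : forall s, s = 1 \/ s = -1 -> Cmod (cint (fun u => F (x0 + s * u)) 0 (1 / 2)) <= 30 * P * sqrt (INR H)).
 { intros s Hs. rewrite (cint_ext _ (fun u => (psi ((x0 + s * u)%R, y) * ddker m l H (0 + s * u))%C)).
  2:{ intros u. unfold F. do 2 f_equal. ring. } apply (kernel_average (fun u => psi ((x0 + s * u)%R, y)) s P (/ N)).
  - intros u. apply (ff_cont _ _ _ _ FF (fun u => x0 + s * u) (fun _ => y)); [|side|side]. side.
  - side.
  - side.
  - side.
  (* From x >= 1/N it follows that y <= v0 x, so sqrt (x + y) is a constant times sqrt x. *)
  - intros mu x Hx. have : 0 < / N. eapply Rle_trans; [apply LA; try assumption; try lia; side|]. unfold P.
   rewrite (Rmult_assoc (B1 * _) (sqrt (1 + v0))). mul_l.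
   replace (sqrt (1 + v0) * (x * sqrt x)) with (x * (sqrt (1 + v0) * sqrt x)) by ring. mul_l.
   rewrite <- sqrt_mult by lra. apply sqrt_le_1_alt. assert (y <= v0 * / N). { mul_l. apply Rinv_le_contravar; nra. }
   have : v0 * / N <= v0 * x. lra.
  - cancel_r N. rewrite Rmult_assoc, Rinv_l by lra. lra.
  - side.
  - cancel_r N. rewrite Rmult_assoc, Rinv_l by lra. lra. }
 assert (HJ : Cmod J <= 60 * P * sqrt (INR H)).
 { unfold J. fold F. rewrite (period_integral F x0 CF PF Hx0), (cint_chasles F (x0 - 1 / 2) x0 (x0 + 1 / 2)) by side.
  destruct (flip_integral F x0 (1 / 2) !! CF) as [F1 F2]. rewrite F1, F2. upto Cmod_triangle.
  note (Side 1 (or_introl eq_refl)). note (Side (-1) (or_intror eq_refl)). lra. }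
 rewrite EJ in SA. assert (M1 : Cmod (Csum f (zrange (m + 1) l)) <= 60 * P / sqrt (INR H) + 2 * INR H * G).
 { apply Rmult_le_reg_l with (INR H); [lra|]. upto SA. rewrite Rmult_plus_distr_l. apply Rplus_le_compat_r. upto HJ.
  right. rewrite <- SS at 2. side. }
 assert (E1 : 60 * P / sqrt (INR H) = K1 * (Rpower (IZR k) (1 + 2 * d) * Rpower N d / sqrt (INR H))).
 { unfold P, K1. rewrite Ey, Ropp_involutive. side. }
 assert (E2 : 2 * INR H * G = K2 * (INR H * Rpower N (theta + d - / 2))).
 { unfold G, K2. rewrite <- Rpower_mult_distr by lra. rewrite <- Rpower_sqrt by assumption. rewrite Ey. unfold Rminus.
  rewrite (Rpower_plus (theta + d)). ring. }
 assert (0 <= Rpower (IZR k) (1 + 2 * d) * Rpower N d / sqrt (INR H)). { apply Rdiv_le_0_compat; [|side]. side. }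
 have : 0 <= INR H * Rpower N (theta + d - / 2). side.
Qed.
End ThmV.

Lemma Rpower_exp_le x a b : 1 <= x -> a <= b -> Rpower x a <= Rpower x b.
Proof. side. Qed.

Section ThmV.
Variables (kappa theta : R) (psi : C -> C) (t : Z -> C).
Hypotheses (FF : form_facts psi t (wt kappa) (dwt kappa)) (Htheta : 0 <= theta) (Hcoeff : coeff_exponent t theta).

(** For theta >= 1/8 one has 3/8 <= 1/3 + theta/3, and [theorem_W] is already stronger. Otherwise
    averaging is used for small k only. *)
Lemma theorem_V eps : 0 < eps -> exists B, 0 < B /\ forall (h k : Z) (M : nat), (1 <= k)%Z -> Z.gcd h k = 1%Z -> (1 <= M)%nat ->
  Cmod (psum t M (IZR h / IZR k)) <= B * (Rpower (IZR k) (2 / 3 + eps) * Rpower (INR M) (1 / 3 + theta / 3 + eps)).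
Proof.
 intros Heps. destruct (theorem_W kappa psi t FF eps Heps) as (BW & HBW & TW).
 destruct (Rle_or_lt (1 / 8) theta) as [Ht|Ht].
 { exists BW. split; [side|]. intros h k M Hk Hg HM. eapply Rle_trans; [apply TW; assumption|]. have : 1 <= IZR k.
  assert (1 <= INR M) by (apply (le_INR 1); assumption). side. }
 destruct (unweight kappa t) as (v0 & C0 & Hv0 & HC0 & UW). set (d := eps / 2). have Hd : 0 < d.
 destruct (averaged_block kappa theta psi t FF Htheta Hcoeff d v0 Hd Hv0) as (BV & HBV & AB). set (M0 := v0 + 10).
 set (C1 := 2 * BW + C0 * (3 * BV)). have HC1 : 0 < C1. set (c := 1 / 3 + theta / 3 + eps).
 apply (psum_from_blocks t C1 _ c M0); [unfold c; lra|lra|assumption|unfold M0; lra|].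
 intros h k M m len Hh Hg HM HmN El ElN. set (x := IZR h / IZR k). set (N := INR M) in *. unfold M0 in HM.
 have Hk1 : 1 <= IZR k. set (kk := Rpower (IZR k) (2 / 3 + eps)).
 assert (HM10 : (10 <= M)%nat) by (apply INR_le; fold N; replace (INR 10) with 10 by (simpl; ring); lra).
 assert (Hm1 : (1 <= m)%nat) by (destruct m; [simpl in HmN; lra|lia]). note (pos_INR len) as Pl.
 (* For k >= N^(1/10) one has N^(1/24) <= k^(5/12), so k^(1/4) N^(3/8) <= k^(2/3) N^(1/3) and
    [theorem_W] suffices. The remaining k are small enough for 2 H0 <= N. *)
 destruct (Rle_or_lt (Rpower N (1 / 10)) (IZR k)) as [Hbig|Hsmall].
 - assert (E : Csum (fun n => t n * e (IZR n * x))%C (zrange (Z.of_nat m + 1) len) = (psum t M x - psum t m x)%C).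
  { rewrite <- El, psum_split. ring. } rewrite E. upto Cmod_triangle. rewrite Cmod_opp.
  assert (One : forall j, (1 <= j)%nat -> INR j <= N -> Cmod (psum t j x) <= BW * (kk * Rpower N c)).
  { intros j Hj HjN. eapply Rle_trans; [apply TW; try assumption; lia|]. mul_l.
   assert (1 <= INR j) by (apply (le_INR 1); assumption). via (Rpower (IZR k) (1 / 4 + eps) * Rpower N (3 / 8 + eps)).
   { side. } via (Rpower (IZR k) (1 / 4 + eps) * (Rpower (Rpower N (1 / 10)) (5 / 12) * Rpower N c)).
   { mul_l. rewrite Rpower_mult, <- Rpower_plus. side. } rewrite <- Rmult_assoc. mul_r. unfold kk.
   replace (2 / 3 + eps) with (1 / 4 + eps + 5 / 12) by field. rewrite (Rpower_plus (1 / 4 + eps)). side. }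
  note (One M !! ltac:(unfold N; lra)). note (One m Hm1 !!). have : 0 <= C0 * (3 * BV) * (kk * Rpower N c). unfold C1.
  lra.
 (* This is the solution of k / sqrt H = H N^(theta - 1/2), which balances the two terms of
    [averaged_block]. *)
 - set (HH0 := Rpower (IZR k) (2 / 3) * Rpower N (1 / 3 - 2 * theta / 3)). have H01 : 1 <= HH0.
  assert (HH0N : 2 * HH0 <= N).
  { assert (HH0 <= Rpower N (2 / 5)).
   { replace (2 / 5) with (1 / 10 * (2 / 3) + 1 / 3) by field. rewrite Rpower_plus, <- Rpower_mult. side. }
   assert (2 <= Rpower N (/ 2)).
   { rewrite Rpower_sqrt by lra. replace 2 with (sqrt (2 * 2)) by (apply sqrt_square; lra). side. }
   have : Rpower N (/ 2) <= Rpower N (3 / 5).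
   assert (E : Rpower N (3 / 5) * Rpower N (2 / 5) = N) by (rewrite <- Rpower_plus; replace (3 / 5 + 2 / 5) with 1 by field; apply Rpower_1; lra).
   side. }
  destruct (archimed HH0) as [U1 U2].
  assert (Hup : (2 <= up HH0)%Z) by (assert (1 < up HH0)%Z by (apply lt_IZR; lra); lia). set (H := Z.to_nat (up HH0)).
  assert (HHi : INR H = IZR (up HH0)) by (unfold H; rewrite INR_IZR_INZ, Z2Nat.id by lia; reflexivity).
  set (E := BV * (Rpower (IZR k) (1 + 2 * d) * Rpower N d / sqrt (INR H) + INR H * Rpower N (theta + d - / 2))).
  have HE : 0 <= E.
  eapply Rle_trans; [apply (UW (Z.of_nat m) len N x E); try lia; try assumption; rewrite <- ?INR_IZR_INZ; try lra|].
  + intros l Hl. have : INR l <= INR len. apply AB; try lia; try assumption; rewrite <- ?INR_IZR_INZ; lra.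
  + assert (T1 : Rpower (IZR k) (1 + 2 * d) * Rpower N d / sqrt (INR H) * sqrt N <= kk * Rpower N c).
   { via (Rpower (IZR k) (1 + 2 * d) * Rpower N d * Rpower HH0 (- / 2) * Rpower N (/ 2)).
    - rewrite Rpower_sqrt by lra. mul_r. mul_l. rewrite Rpower_Ropp, Rpower_sqrt by lra. side.
    - unfold HH0. rewrite <- Rpower_mult_distr by apply Rpower_pos. rewrite !Rpower_mult.
     via (Rpower (IZR k) (1 + 2 * d + 2 / 3 * - / 2) * Rpower N (d + (1 / 3 - 2 * theta / 3) * - / 2 + / 2)).
     + right. rewrite !Rpower_plus. ring.
     + apply Rmult_le_compat; try (left; apply Rpower_pos); apply Rpower_exp_le; unfold c, d; lra. }
   assert (T2 : INR H * Rpower N (theta + d - / 2) * sqrt N <= 2 * (kk * Rpower N c)).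
   { via (2 * HH0 * Rpower N (theta + d - / 2) * Rpower N (/ 2)).
    - rewrite Rpower_sqrt by lra. side.
    - unfold HH0. via (2 * (Rpower (IZR k) (2 / 3) * Rpower N (1 / 3 - 2 * theta / 3 + (theta + d - / 2) + / 2))).
     + right. rewrite !(Rpower_plus _ _ N). ring.
     + mul_l. apply Rmult_le_compat; try (left; apply Rpower_pos); apply Rpower_exp_le; unfold c, d; lra. }
   via (C0 * BV * (3 * (kk * Rpower N c))).
   * rewrite Rmult_assoc, (Rmult_assoc C0). mul_l. side.
   * have : 0 <= BW * (kk * Rpower N c). unfold C1. lra.
Qed.
End ThmV.

(** * Comparison of exponents *)

Lemma twisted_sum_psum t M h k : twisted_sum t M h k = psum t (Z.to_nat (Int_part M)) (IZR h / IZR k).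
Proof.
 unfold twisted_sum, psum. induction (Z.to_nat (Int_part M)) as [|n IH].
 - side.
 - rewrite Csum_zrange_S, <- IH, (sum_n_Sm (G := C_AbelianMonoid)) by lia.
  replace (1 + Z.of_nat n)%Z with (Z.of_nat (S n)) by lia. rewrite INR_IZR_INZ. unfold Rdiv. rewrite Rmult_assoc. side.
Qed.

Lemma floor_nat M : 1 <= M -> (1 <= Z.to_nat (Int_part M))%nat /\ INR (Z.to_nat (Int_part M)) <= M.
Proof.
 intros HM. destruct (base_Int_part M) as [I1 I2]. assert (0 < Int_part M)%Z by (apply lt_IZR; lra). split; [lia|].
 rewrite INR_IZR_INZ, Z2Nat.id by lia. side.
Qed.

Lemma twisted_sum_bound t B a b h k : 0 <= B -> 0 <= b ->
  (forall M : nat, (1 <= M)%nat -> Cmod (psum t M (IZR h / IZR k)) <= B * (Rpower (IZR k) a * Rpower (INR M) b)) ->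
  forall M, 1 <= M -> Cmod (twisted_sum t M h k) <= B * (Rpower (IZR k) a * Rpower M b).
Proof.
 intros HB Hb HP M HM. destruct (floor_nat M HM) as [I1 I2]. rewrite twisted_sum_psum.
 eapply Rle_trans; [apply HP; assumption|]. mul_l. mul_l. apply Rpower_base_le; side.
Qed.

Lemma Rpower_absorb k A M a b c : 0 < k -> 0 < A -> 1 <= M -> 0 <= b -> a * b <= c -> k <= A * Rpower M a ->
  Rpower k b <= Rpower A b * Rpower M c.
Proof.
 intros Hk HA HM Hb Hc Hle. eapply Rle_trans; [apply Rpower_base_le; [side|exact Hle|side]|].
 rewrite <- Rpower_mult_distr by side. rewrite Rpower_mult. side.
Qed.

Theorem theorem4 (kappa theta : R) (psi : C -> C) (t : Z -> C)
  (Hpsi : maass_cusp_form kappa psi)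
  (Hparity : even_form psi \/ odd_form psi)
  (Hfourier : fourier_expansion kappa psi t)
  (Htheta : 0 <= theta)
  (Hcoeff : coeff_exponent t theta) :
  (forall delta eps A : R, 0 < delta < 1 / 2 -> 0 < eps -> 0 < A ->
    exists B : R, forall (M : R) (h k : Z),
      1 <= M -> (0 < k)%Z -> Z.gcd h k = 1%Z ->
      IZR k <= A * Rpower M (1 / 2 - delta) ->
      Cmod (twisted_sum t M h k)
        <= B * (Rpower (IZR k) (2 / 3) * Rpower M (1 / 3 + theta / 3 + eps)))
  /\
  (theta <> 2 / 3 ->
   forall eps A1 A2 : R, 0 < eps -> 0 < A1 -> 0 < A2 ->
    exists B : R, forall (M : R) (h k : Z),
      1 <= M -> (0 < k)%Z -> Z.gcd h k = 1%Z ->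
      A1 * Rpower M (3 / (5 + 6 * theta) - 1 / 2 + theta) <= IZR k ->
      IZR k <= A2 * Rpower M (5 / 18 + theta / 3) ->
      Cmod (twisted_sum t M h k)
        <= B * (Rpower (IZR k) ((1 - 6 * theta) / (4 - 6 * theta))
                * Rpower M (3 / (8 - 12 * theta) + eps)))
  /\
  (forall eps A1 A2 : R, 0 < eps -> 0 < A1 -> 0 < A2 ->
    exists B : R, forall (M : R) (h k : Z),
      1 <= M -> (0 < k)%Z -> Z.gcd h k = 1%Z ->
      A1 * Rpower M (5 / 18 + theta / 3) <= IZR k ->
      IZR k <= A2 * Rpower M (1 / 2 - eps) ->
      Cmod (twisted_sum t M h k)
        <= B * (Rpower (IZR k) (2 / 3) * Rpower M (7 / 27 + theta / 9 + eps))).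
Proof.
 note (form_facts_intro kappa theta psi t Hpsi Hparity Hfourier Htheta Hcoeff) as FF.
 assert (TW : forall eps, 0 < eps -> exists B, 0 < B /\ forall M h k, 1 <= M -> (0 < k)%Z -> Z.gcd h k = 1%Z -> Cmod (twisted_sum t M h k) <= B * (Rpower (IZR k) (1 / 4 + eps) * Rpower M (3 / 8 + eps))).
 { intros eps Heps. destruct (theorem_W kappa psi t FF eps Heps) as (B & HB & TB). exists B. split; [side|].
  intros M h k HM Hk Hg. apply twisted_sum_bound; try lra. intros n Hn. apply TB; try assumption. lia. }
 repeat apply conj.
 - intros delta eps A Hdelta Heps HA.
  destruct (theorem_V kappa theta psi t FF Htheta Hcoeff (eps / 2) !!) as (B & HB & TB).
  exists (B * Rpower A (eps / 2)). intros M h k HM Hk Hg HkM. have : 0 < IZR k.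
  eapply Rle_trans; [apply (twisted_sum_bound t B (2 / 3 + eps / 2) (1 / 3 + theta / 3 + eps / 2)); try lra; intros n Hn; apply TB; try assumption; lia|].
  rewrite Rmult_assoc. mul_l. rewrite Rpower_plus.
  replace (1 / 3 + theta / 3 + eps) with (eps / 2 + (1 / 3 + theta / 3 + eps / 2)) by field.
  rewrite (Rpower_plus (eps / 2) _ M). set (R1 := Rpower M (1 / 3 + theta / 3 + eps / 2)).
  via (Rpower (IZR k) (2 / 3) * (Rpower A (eps / 2) * Rpower M (eps / 2)) * R1); [|side]. mul_r. mul_l.
  apply (Rpower_absorb _ A M (1 / 2 - delta)); try assumption; nra.
 - intros Hne eps A1 A2 Heps HA1 HA2. destruct (Rle_or_lt theta (2 / 3)) as [Hlt|Hgt].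
  (* The exponent g satisfies 1/4 = (1 - 6 theta)/(4 - 6 theta) + g and 3/(8 - 12 theta) = 3/8 +
     g/2. So k^g <= M^(g/2) up to a constant is enough, and 5/18 + theta/3 <= 1/2. *)
  + destruct (TW (eps / 2) !!) as (B & HB & TB). set (g := 9 * theta / (8 - 12 * theta)). have Hg0 : 0 <= g.
   exists (B * Rpower A2 (g + eps / 2)). intros M h k HM Hk Hg _ HkM. have : 0 < IZR k.
   eapply Rle_trans; [apply TB; assumption|]. rewrite Rmult_assoc. mul_l.
   replace (1 / 4 + eps / 2) with ((1 - 6 * theta) / (4 - 6 * theta) + (g + eps / 2)) by side. rewrite Rpower_plus.
   replace (3 / (8 - 12 * theta) + eps) with ((g / 2 + eps / 2) + (3 / 8 + eps / 2)) by side.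
   rewrite (Rpower_plus (g / 2 + eps / 2) _ M). set (R1 := Rpower M (3 / 8 + eps / 2)).
   set (R2 := Rpower (IZR k) ((1 - 6 * theta) / (4 - 6 * theta))).
   via (R2 * (Rpower A2 (g + eps / 2) * Rpower M (g / 2 + eps / 2)) * R1); [|side]. mul_r. mul_l.
   apply (Rpower_absorb _ A2 M (5 / 18 + theta / 3)); try assumption; nra.
  (* For theta > 2/3 the lower end of the range of k is a higher power of M than the upper end, so M
     is bounded by [Mx] and the trivial bound will do. The exponent b of M is negative here, hence
     the factor Mx^(- b) in the constant. *)
  + set (a := (3 / (5 + 6 * theta) - 1 / 2 + theta) - (5 / 18 + theta / 3)). assert (Ha : 0 < a).
   { replace a with (4 * (3 * theta - 2) * (3 * theta + 1) / (9 * (5 + 6 * theta))) by side. side. }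
   set (Mx := Rpower (A2 / A1) (/ a)). set (A0 := Rsum (fun n => Cmod (t n)) (zrange 1 (Z.to_nat (up Mx)))).
   assert (HA0 : 0 <= A0) by (apply Rsum_nonneg; intros; apply Cmod_ge_0). set (b := 3 / (8 - 12 * theta)).
   assert (Hb : b < 0). { unfold b, Rdiv. assert (/ (8 - 12 * theta) < 0) by (apply Rinv_lt_0_compat; lra). lra. }
   exists (A0 * Rpower Mx (- b)). intros M h k HM Hk Hg Hk1 Hk2. assert (HMx : M <= Mx).
   { assert (E : Rpower M a <= A2 / A1).
    { unfold a. unfold Rminus at 1. rewrite Rpower_plus, Rpower_Ropp. cancel_r (A1 * Rpower M (5 / 18 + theta / 3)).
     via (A1 * Rpower M (3 / (5 + 6 * theta) - 1 / 2 + theta)); [side|]. upto Hk1. upto Hk2. side. }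
    rewrite <- (Rpower_1 M) by lra. replace 1 with (a * / a) by side. rewrite <- Rpower_mult.
    apply Rpower_base_le; side. }
   assert (T0 : Cmod (twisted_sum t M h k) <= A0).
   { destruct (floor_nat M HM) as [I1 I2]. rewrite twisted_sum_psum. upto psum_trivial. apply Rsum_zrange_mono; [side|].
    destruct (archimed Mx) as [U1 U2]. apply INR_le. rewrite (INR_IZR_INZ (Z.to_nat (up Mx))), Z2Nat.id; [lra|].
    apply le_IZR. lra. }
   upto T0. rewrite <- Rmult_1_r at 1. rewrite Rmult_assoc. mul_l.
   assert (G1 : 1 <= Rpower (IZR k) ((1 - 6 * theta) / (4 - 6 * theta))).
   { apply Rpower_ge_1; [side|].
    replace ((1 - 6 * theta) / (4 - 6 * theta)) with ((6 * theta - 1) / (6 * theta - 4)) by side. side. }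
   assert (G2 : 1 <= Rpower Mx (- b) * Rpower M (b + eps)).
   { via (Rpower M (- b) * Rpower M (b + eps)).
    - rewrite <- Rpower_plus. side.
    - side. }
   side.
 - intros eps A1 A2 Heps HA1 HA2. destruct (TW (eps / 2) !!) as (B & HB & TB).
  exists (B * (Rpower A2 (eps / 2) * Rpower (/ A1) (5 / 12))). intros M h k HM Hk Hg Hk1 Hk2. have Kp : 0 < IZR k.
  eapply Rle_trans; [apply TB; assumption|]. rewrite Rmult_assoc. mul_l.
  assert (T1 : Rpower (IZR k) (eps / 2) <= Rpower A2 (eps / 2) * Rpower M (eps / 2)).
  { apply (Rpower_absorb _ A2 M (1 / 2 - eps)); try assumption; nra. }
  (* A power k^(5/12) = k^(2/3 - 1/4) is available to lower the power of M: (5/18 + theta/3) * 5/12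
     = 25/216 + 5 theta/36, and 3/8 - 25/216 = 7/27. *)
  assert (T2 : Rpower M (25 / 216 + 5 * theta / 36) <= Rpower (/ A1) (5 / 12) * Rpower (IZR k) (5 / 12)).
  { rewrite Rpower_mult_distr; [|side|side].
   replace (25 / 216 + 5 * theta / 36) with ((5 / 18 + theta / 3) * (5 / 12)) by field. rewrite <- Rpower_mult.
   apply Rpower_base_le; [side| |lra]. apply Rmult_le_reg_l with A1; [side|].
   rewrite <- Rmult_assoc, Rinv_r, Rmult_1_l by lra. side. }
  via (Rpower (IZR k) (1 / 4) * Rpower (IZR k) (eps / 2) * (Rpower M (25 / 216 + 5 * theta / 36) * Rpower M (7 / 27 + theta / 9 + eps / 2))).
  + rewrite Rpower_plus. mul_l. rewrite <- Rpower_plus. side.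
  + via (Rpower (IZR k) (1 / 4) * (Rpower A2 (eps / 2) * Rpower M (eps / 2)) * ((Rpower (/ A1) (5 / 12) * Rpower (IZR k) (5 / 12)) * Rpower M (7 / 27 + theta / 9 + eps / 2))).
   * side.
   * right. replace (2 / 3) with (1 / 4 + 5 / 12) by field.
    replace (7 / 27 + theta / 9 + eps) with (eps / 2 + (7 / 27 + theta / 9 + eps / 2)) by field. rewrite !Rpower_plus.
    ring.
Qed.
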